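(* Let $(u_t,v_t)$ be a solution of the symbiotic branching model on $\mathbb{Z}^d$ with parameters $\kappa>0$, $\varrho\in[-1,1]$, transition rates $(a(i,j))_{i,j\in\mathbb{Z}^d}$, and homogeneous initial conditions $u_0=v_0\equiv1$. Then, for any $k\in\mathbb{Z}^d$ and $t\ge0$, $$\mathbb{E}[u(t,k)v(t,k)]=\mathbb{E}[e^{\kappa\varrho L_t}],$$ $$\mathbb{E}[u(t,k)^2]=\mathbb{E}[v(t,k)^2]=\begin{cases}1+\kappa\,\mathbb{E}[L_t]&:\varrho=0,\\ 1-\frac1\varrho+\frac1\varrho\,\mathbb{E}[e^{\kappa\varrho L_t}]&:\varrho\ne0,\end{cases}$$ where $L_t$ denotes the local time in $0$ of the symmetrization $(\bar X_t)$ started in $0$.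
   Context: Symbiotic branching model: fix $d\ge 1$, $\kappa>0$, $\varrho\in[-1,1]$ and rates $(a(i,j))_{i,j\in\mathbb{Z}^d}$ with $0\le a(i,j)<\infty$, $\sum_{j}a(i,j)=1$ for all $i$, and $a(i,j)=a(0,j-i)$. Fix a positive summable function $\omega$ on $\mathbb{Z}^d$ with $\sum_i\omega(i)a(i,j)\le K\omega(j)$ for all $j$ and some finite $K$, and let $E=\{f:\mathbb{Z}^d\to\mathbb{R}_{\ge0}\mid\sum_j f(j)\omega(j)<\infty\}$ (the choice of $\omega$ is immaterial). A solution is a weak solution with almost surely continuous paths in $E\times E$ of $$du(t,i)=\sum_{j}a(i,j)(u(t,j)-u(t,i))\,dt+\sqrt{\kappa u(t,i)v(t,i)}\,dW^1_t(i),$$ $$dv(t,i)=\sum_{j}a(i,j)(v(t,j)-v(t,i))\,dt+\sqrt{\kappa u(t,i)v(t,i)}\,dW^2_t(i),$$ for $i\in\mathbb{Z}^d$, where $W^1(i),W^2(i)$, $i\in\mathbb{Z}^d$, are standard Brownian motions with $\langle W^n(i),W^m(j)\rangle_t=\varrho t$ if $i=j,\ n\ne m$; $=t$ if $i=j,\ n=m$; $=0$ otherwise. Symmetrization: $\bar X_t=X^1_t-X^2_t$, where $X^1,X^2$ are independent continuous-time Markov processes on $\mathbb{Z}^d$ with transition rates $(a(i,j))$. Its local time in $0$ is $L_t=\int_0^t\mathbf 1_{\{\bar X_s=0\}}\,ds$. *)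

(* Defs.v *)
From HB Require Import structures.
From mathcomp Require Import all_boot all_order all_algebra.
From mathcomp Require Import all_classical all_reals all_analysis.

Set Implicit Arguments.
Unset Strict Implicit.
Unset Printing Implicit Defensive.

Import Order.TTheory GRing.Theory Num.Theory.
Import numFieldNormedType.Exports.

Local Open Scope classical_set_scope.
Local Open Scope ring_scope.

(* Time is the half-line [0, +oo[ of R; processes are functions on all of R  *)
(* and no condition is ever imposed on them at negative times.               *)

Section Stochastics.
Context {dT : measure_display} {T : measurableType dT} {R : realType}.
Variable P : probability T R.

Definition indep_families (G H : set (set T)) : Prop :=
  forall A B, G A -> H B -> P (A `&` B) = (P A * P B)%E.

Definition is_filtration (F : R -> set (set T)) : Prop :=
  [/\ (forall t, 0 <= t -> sigma_algebra setT (F t)),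
      (forall t, 0 <= t -> F t `<=` measurable) &
      (forall s t, 0 <= s -> s <= t -> F s `<=` F t)].

Definition measurable_wrt (G : set (set T)) (X : T -> R) : Prop :=
  forall B, measurable B -> G (X @^-1` B).

Definition adapted (F : R -> set (set T)) (X : R -> T -> R) : Prop :=
  forall t, 0 <= t -> measurable_wrt (F t) (X t).

Record is_martingale (F : R -> set (set T)) (M : R -> T -> R) : Prop := {
  martingale_adapted : adapted F M;
  martingale_integrable :
    forall t, 0 <= t -> P.-integrable setT (EFin \o M t);
  martingale_condexp : forall s t A, 0 <= s -> s <= t -> F s A ->
    (\int[P]_(w in A) (M t w)%:E = \int[P]_(w in A) (M s w)%:E)%E
}.

(* <M, N> = V for square-integrable continuous martingales M, N with M N = 0 *)
(* at time 0 and a deterministic V that is continuous, of bounded variation  *)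
(* and zero at time 0: V is the compensator of M N.                          *)
Definition has_bracket (F : R -> set (set T)) (M N : R -> T -> R)
    (V : R -> R) : Prop :=
  is_martingale F (fun t w => M t w * N t w - V t).

Record is_brownian (F : R -> set (set T)) (W : R -> T -> R) : Prop := {
  brownian_adapted : adapted F W;
  brownian_start : {ae P, forall w, W 0 w = 0};
  brownian_indep : forall s t, 0 <= s -> s < t ->
    indep_families (F s)
      [set (fun w => W t w - W s w) @^-1` B | B in measurable];
  brownian_normal : forall s t, 0 <= s -> s < t ->
    forall B : set R, measurable B ->
      P ((fun w => W t w - W s w) @^-1` B) =
      normal_prob 0 (Num.sqrt (t - s)) B;
  brownian_continuous :
    {ae P, forall w, {within [set t | 0 <= t], continuous (W ^~ w)}}
}.

(* Convergence to 0 in probability of [0, +oo]-valued maps. The exceptional  *)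
(* events are covered by measurable ones, so that the definition also makes  *)
(* sense for maps that are measurable only up to a null set.                 *)
Definition cvg0_in_prob (D : nat -> T -> \bar R) : Prop :=
  forall e delta : R, 0 < e -> 0 < delta ->
    \forall n \near \oo, exists B : set T,
      [/\ measurable B, (P B <= delta%:E)%E &
          forall w, ~ B w -> (D n w < e%:E)%E].

(* The elementary process with value step_coef k on ]t_k, t_(k+1)], where    *)
(* t_0 = 0 and t_1 < t_2 < ... are the elements of step_pts.                 *)
Record step_process := StepProcess {
  step_pts : seq R;
  step_coef : nat -> T -> R
}.

Definition step_time (S : step_process) (k : nat) : R :=
  nth 0 (0 :: step_pts S) k.

Definition step_val (S : step_process) (s : R) (w : T) : R :=
  \sum_(k < size (step_pts S))
    step_coef S k w * (step_time S k < s <= step_time S k.+1)%R%:R.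

Definition step_integral (S : step_process) (W : R -> T -> R) (w : T) : R :=
  \sum_(k < size (step_pts S))
    step_coef S k w * (W (step_time S k.+1) w - W (step_time S k) w).

Definition step_admissible (F : R -> set (set T)) (t : R)
    (S : step_process) : Prop :=
  itv_partition 0 t (step_pts S) /\
  forall k, (k < size (step_pts S))%N ->
    measurable_wrt (F (step_time S k)) (step_coef S k) /\
    exists C : R, forall w, `|step_coef S k w| <= C.

(* I = \int_0^t H dW (Ito), almost surely: I is the limit in probability of  *)
(* the elementary integrals of bounded adapted step processes S_n such that  *)
(* \int_0^t (S_n - H)^2 ds tends to 0 in probability.                        *)
Definition is_ito_integral (F : R -> set (set T)) (W H : R -> T -> R)
    (t : R) (I : T -> R) : Prop :=
  exists S : nat -> step_process,
    [/\ (forall n, step_admissible F t (S n)),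
        cvg0_in_prob (fun n w =>
          \int[lebesgue_measure]_(s in `[0%R, t])
            ((step_val (S n) s w - H s w) ^+ 2)%:E)%E &
        cvg0_in_prob (fun n w => `|step_integral (S n) W w - I w|%:E)].

End Stochastics.

Notation lattice d := 'rV[int]_d.

Section Rates.
Context {R : realType} {d : nat}.

Record is_rates (a : lattice d -> lattice d -> R) : Prop := {
  rates_ge0 : forall i j, 0 <= a i j;
  rates_sum1 : forall i, (\esum_(j in [set: lattice d]) (a i j)%:E)%E = 1%E;
  rates_shift : forall i j, a i j = a 0 (j - i)
}.

Record is_weight (a : lattice d -> lattice d -> R) (om : lattice d -> R) :
    Prop := {
  weight_gt0 : forall i, 0 < om i;
  weight_summable : (\esum_(i in [set: lattice d]) (om i)%:E < +oo)%E;
  weight_rates : exists K : R, forall j,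
    (\esum_(i in [set: lattice d]) (om i * a i j)%:E <= (K * om j)%:E)%E
}.

Definition in_E (om f : lattice d -> R) : Prop :=
  (forall j, 0 <= f j) /\
  (\esum_(j in [set: lattice d]) (f j * om j)%:E < +oo)%E.

(* E carries the weighted l^1 distance \sum_j |f j - g j| om j.              *)
Definition E_path (om : lattice d -> R) (x : R -> lattice d -> R) : Prop :=
  (forall t, 0 <= t -> in_E om (x t)) /\
  forall t, 0 <= t ->
    ((\esum_(j in [set: lattice d]) (`|x s j - x t j| * om j)%:E)%E
       @[s --> within [set s | 0 <= s] (nbhs t)] --> 0%E).

(* Sum of an absolutely summable family of reals (esum is meant for families *)
(* of nonnegative terms).                                                    *)
Definition abs_sum (f : lattice d -> R) : R :=
  fine (\esum_(j in [set: lattice d]) (Num.max (f j) 0)%:E) -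
  fine (\esum_(j in [set: lattice d]) (Num.max (- f j) 0)%:E).

Definition drift (a : lattice d -> lattice d -> R) (f : lattice d -> R)
    (i : lattice d) : R :=
  abs_sum (fun j => a i j * (f j - f i)).

End Rates.

Section SymbioticBranching.
Context {dT : measure_display} {T : measurableType dT} {R : realType}.
Variables (P : probability T R) (F : R -> set (set T)).
Context {d : nat}.
Variables (a : lattice d -> lattice d -> R) (om : lattice d -> R).
Variables (kappa rho : R).
(* W 0 and W 1 are the noises W^1 and W^2 driving u and v. *)
Variables (W : 'I_2 -> lattice d -> R -> T -> R).
Variables (u v : R -> lattice d -> T -> R).

Definition noise_cov (n m : 'I_2) (i j : lattice d) : R :=
  if i == j then (if n == m then 1 else rho) else 0.

Definition solves_component (n : 'I_2) (x : R -> lattice d -> T -> R) : Prop :=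
  forall i t, 0 <= t ->
    is_ito_integral P F (W n i)
      (fun s w => Num.sqrt (kappa * u s i w * v s i w)) t
      (fun w => x t i w - x 0 i w -
         \int[lebesgue_measure]_(s in `[0, t]) drift a (x s ^~ w) i).

Record is_sbm_solution : Prop := {
  sbm_filtration : is_filtration F;
  sbm_brownian : forall n i, is_brownian P F (W n i);
  sbm_bracket : forall n m i j,
    has_bracket P F (W n i) (W m j) (fun t => noise_cov n m i j * t);
  sbm_adapted_u : forall i, adapted F (u ^~ i);
  sbm_adapted_v : forall i, adapted F (v ^~ i);
  sbm_paths : {ae P, forall w,
    E_path om (fun t i => u t i w) /\ E_path om (fun t i => v t i w)};
  sbm_eq_u : solves_component 0 u;
  sbm_eq_v : solves_component 1 v
}.

End SymbioticBranching.

Section MarkovChains.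
Context {R : realType} {d : nat}.

(* Conservative transition semigroup whose Q-matrix is a - id: jumps i -> j  *)
(* occur at rate a i j, and a "jump" i -> i, allowed by a i i > 0, is void.  *)
Record is_transition_function (a : lattice d -> lattice d -> R)
    (p : R -> lattice d -> lattice d -> R) : Prop := {
  trans_ge0 : forall t i j, 0 <= t -> 0 <= p t i j;
  trans_sum1 : forall t i, 0 <= t ->
    (\esum_(j in [set: lattice d]) (p t i j)%:E)%E = 1%E;
  trans_start : forall i j, p 0 i j = (i == j)%:R;
  trans_semigroup : forall s t i j, 0 <= s -> 0 <= t ->
    ((p (s + t) i j)%:E =
     \esum_(k in [set: lattice d]) (p s i k * p t k j)%:E)%E;
  trans_rates : forall i j,
    (p h i j - (i == j)%:R) / h @[h --> 0^'+] --> a i j - (i == j)%:R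
}.

Context {dT : measure_display} {T : measurableType dT}.
Variable P : probability T R.

Definition sigma_of_process (I : set R) (X : R -> T -> lattice d) :
    set (set T) :=
  <<s [set A | exists t i, [/\ 0 <= t, I t & A = [set w | X t w = i]]] >>.

Record is_markov_chain (a : lattice d -> lattice d -> R)
    (X : R -> T -> lattice d) : Prop := {
  markov_measurable : forall t i, 0 <= t -> measurable [set w | X t w = i];
  markov_right_continuous : forall w t, 0 <= t ->
    \forall s \near t^'+, X s w = X t w;
  markov_property : exists2 p, is_transition_function a p &
    forall s t i j A, 0 <= s -> 0 <= t ->
      sigma_of_process [set r | r <= s] X A ->
      P (A `&` [set w | X s w = i] `&` [set w | X (s + t) w = j]) =
      (P (A `&` [set w | X s w = i]) * (p t i j)%:E)%E
}.

Definition indep_processes (X Y : R -> T -> lattice d) : Prop :=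
  indep_families P (sigma_of_process setT X) (sigma_of_process setT Y).

Definition symmetrization (X Y : R -> T -> lattice d) (t : R) (w : T) :
    lattice d :=
  X t w - Y t w.

Definition local_time0 (X : R -> T -> lattice d) (t : R) (w : T) : R :=
  \int[lebesgue_measure]_(s in `[0, t]) (X s w == 0)%:R.

End MarkovChains.

(* Main.v *)
(* Second moments m(s, i, j) of the solution satisfy a closed linear system: the
   drift contributes the generator of a pair of independent walks, and the
   covariation of the noise contributes a multiple of E[u(s,i) v(s,i)] on the
   diagonal i = j. An a priori L^2 bound, by localization and Gronwall, makes the
   stochastic integrals square-integrable martingales with the Ito covariance.
   The Feynman-Kac expectations of the pair of chains, with L the time spent on
   the diagonal, satisfy the same system. Multiplied by e^(cs) with c large, the
   system has a nonnegative kernel; applying it n times to either candidate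
   gives functions y_n with y_n' = y_(n+1), the same y_n(0), and y_n = O(C^n),
   which determines y_0. For u^2 and v^2 the answer is affine in the mixed
   moment when rho <> 0, and linear in the local time when rho = 0. *)

Require Import Defs.
From HB Require Import structures.
From mathcomp Require Import all_boot all_order all_algebra.
From mathcomp Require Import all_classical all_reals all_analysis.
From mathcomp Require Import measurable_realfun lra ring.

Set Implicit Arguments.
Unset Strict Implicit.
Unset Printing Implicit Defensive.

Import Order.TTheory GRing.Theory Num.Theory.
Import numFieldNormedType.Exports.

Local Open Scope classical_set_scope.
Local Open Scope ring_scope.

(** * Integrals and measurability *)

(** The Ito integral is given only as a limit in probability along unnamed step processes.
    Lenglart's inequality shows that every step sequence converging to the integrand in that sense
    has the same limit; left-endpoint sums of a truncated integrand may thus be used, and a Fatou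
    argument turns their isometry into L^2 bounds. The lossy constants only enter Gronwall's
    inequality or multiply a quantity tending to 0. Truncation uses the event that the weighted norm
    has stayed below [N], whose indicator is adapted and left continuous. In place of Ito's formula,
    finite variation parts are multiplied pathwise and martingale increments are orthogonal to the
    past.

    On the chain side only the rates at time 0 are known. The semigroup law turns them into lower
    bounds for the transition probabilities, and applying these to [C - phi] as well as to [phi]
    gives a two-sided expansion. Moments are summable against a weight, whereas the chain is tested
    on bounded functions; nonnegativity of the kernel makes its iterates meaningful in both
    settings, so that the two can be compared. *)

Section RealIntegrable.
Context {d : measure_display} {T : measurableType d} {R : realType}.
Variables (mu : {measure set T -> \bar R}) (D : set T).
Hypothesis mD : measurable D.
Implicit Types (f g : T -> R) (k : R).

Lemma rintegrableD f g : mu.-integrable D (EFin \o f) -> mu.-integrable D (EFin \o g) ->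
  mu.-integrable D (EFin \o (fun x => f x + g x)).
Proof. by move=> hf hg; apply: eq_integrable (integrableD mD hf hg). Qed.

Lemma rintegrableB f g : mu.-integrable D (EFin \o f) -> mu.-integrable D (EFin \o g) ->
  mu.-integrable D (EFin \o (fun x => f x - g x)).
Proof. by move=> hf hg; apply: eq_integrable (integrableB mD hf hg). Qed.

Lemma rintegrableZl k f : mu.-integrable D (EFin \o f) ->
  mu.-integrable D (EFin \o (fun x => k * f x)).
Proof. by move=> hf; apply: eq_integrable (integrableZl mD k hf). Qed.

Lemma rintegrableZr k f : mu.-integrable D (EFin \o f) ->
  mu.-integrable D (EFin \o (fun x => f x * k)).
Proof. by move=> hf; apply: eq_integrable (integrableZr mD k hf). Qed.

End RealIntegrable.

Section TimeIntegrals.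
Variable R : realType.
Local Notation leb := (@lebesgue_measure R).
Implicit Types (f g : R -> R) (c s r t M : R).

Lemma measurable_oc s r : measurable (`]s, r]%classic : set (measurableTypeR R)).
Proof. exact: measurable_itv. Qed.

Lemma lebesgue_itv_oc s r : s <= r -> leb `]s, r] = (r - s)%:E.
Proof.
rewrite lebesgue_measure_itv/= lte_fin le_eqVlt => /predU1P[->|sr].
  by rewrite ltxx subrr.
by rewrite sr EFinB.
Qed.

Lemma lebesgue_itv_oc_lty s r : (leb `]s, r] < +oo)%E.
Proof. by rewrite lebesgue_measure_itv/=; case: ifPn => // _; rewrite -EFinB ltry. Qed.

Lemma Rintegral_cst_oc c s r : s <= r ->
  \int[leb]_(x in `]s, r]) c = c * (r - s).
Proof. by move=> sr; rewrite Rintegral_cst//= (lebesgue_itv_oc sr). Qed.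

Lemma bounded_integrable_oc f s r M : measurable_fun `]s, r] f ->
  (forall x, s < x <= r -> `|f x| <= M) -> leb.-integrable `]s, r] (EFin \o f).
Proof.
move=> mf fM; apply: measurable_bounded_integrable => //.
  exact: lebesgue_itv_oc_lty.
exists M; split; first exact: num_real.
move=> y My x /=; rewrite in_itv/= => sxr.
exact: le_trans (fM _ sxr) (ltW My).
Qed.

Lemma le_normr_Rintegral_oc f s r M : s <= r -> measurable_fun `]s, r] f ->
  (forall x, s < x <= r -> `|f x| <= M) ->
  `|\int[leb]_(x in `]s, r]) f x| <= M * (r - s).
Proof.
move=> sr mf fM; have intf := bounded_integrable_oc mf fM.
apply: le_trans (le_normr_Rintegral _ intf) _ => //.
rewrite -[leRHS](_ : \int[leb]_(x in `]s, r]) M = _); last first.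
  by rewrite Rintegral_cst//= (lebesgue_itv_oc sr).
apply: le_Rintegral => //.
- exact: integrable_norm.
by apply: (bounded_integrable_oc (M := `|M|)) => // x _; rewrite lexx.
Qed.

Lemma Rintegral_cat f a b c : a <= b -> b <= c ->
  leb.-integrable `]a, c] (EFin \o f) ->
  \int[leb]_(x in `]a, c]) f x =
  \int[leb]_(x in `]a, b]) f x + \int[leb]_(x in `]b, c]) f x.
Proof.
move=> ab bc intf.
have := @Rintegral_itvB R f (BRight a) (BRight c) b intf.
by rewrite !bnd_simp => /(_ ab bc) <-; rewrite addrC subrK.
Qed.

Lemma Rintegral_oc_set0 f a : \int[leb]_(x in `]a, a]) f x = 0.
Proof. by rewrite set_itv_ge ?bnd_simp ?ltxx// Rintegral_set0. Qed.

Lemma measurable_fun_expRM (b : R) (D : set R) :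
  measurable_fun D (fun x => expR (b * x)).
Proof. by apply: measurable_funTS; apply: measurableT_comp => //; exact: measurable_expR. Qed.

Lemma Rintegral_expR (b s : R) : 0 <= s ->
  expR (b * s) = 1 + \int[leb]_(x in `]0, s]) (b * expR (b * x)).
Proof.
rewrite le_eqVlt => /predU1P[<-|s0]; first by rewrite Rintegral_oc_set0 addr0 mulr0 expR0.
pose F (x : R) := expR (b * x).
have dF (x : R) : is_derive x 1 F (b * expR (b * x)).
  rewrite /F; apply: is_derive_eq.
  by rewrite /GRing.scale/= mulr1 mulrC.
have cF : continuous F.
  by move=> x; apply: differentiable_continuous; apply/derivable1_diffP.
have ce' : {within `[0, s], continuous (fun x : R => b * expR (b * x))}.
  by apply: continuous_subspaceT => x; apply: cvgM; [exact: cvg_cst|exact: cF].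
have dF' : derivable_oo_LRcontinuous F 0 s.
  split=> [x _||]; [by have [] := dF x | |].
    by apply: cvg_at_right_filter; exact: cF.
  by apply: cvg_at_left_filter; exact: cF.
have e1 : {in `]0, s[, derive1 F =1 (fun x => b * expR (b * x))}.
  by move=> x _; rewrite derive1E; apply: derive_val.
have e := continuous_FTC2 s0 ce' dF' e1.
rewrite /Rintegral integral_itv_obnd_cbnd; last first.
  by apply/measurable_EFinP; apply: measurable_funM => //; exact: measurable_fun_expRM.
by rewrite e/= /F mulr0 expR0 addrCA subrr addr0.
Qed.

Lemma Rintegral_expR_le b s : 0 < b -> 0 <= s ->
  \int[leb]_(x in `]0, s]) expR (b * x) <= expR (b * s) / b.
Proof.
move=> b0 s0; rewrite ler_pdivlMr// mulrC -RintegralZl//.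
  by rewrite (Rintegral_expR b s0) lerDr.
apply: (bounded_integrable_oc (M := expR (b * s))); first exact: measurable_fun_expRM.
move=> x /andP[_ xs]; rewrite ger0_norm ?expR_ge0// ler_expR ler_pM2l//.
Qed.

Lemma le0_geometric_half (x K : R) : (forall n, x <= K * 2^-1 ^+ n) -> x <= 0.
Proof.
move=> xK; have h : `|2^-1 : R| < 1 by rewrite ger0_norm ?invf_lt1 ?ltr1n.
have c := @cvg_geometric R K _ h.
rewrite -(cvg_lim _ c)//; apply: limr_ge; first by apply: cvgP c.
by apply: nearW => n; exact: xK.
Qed.

Lemma le0_invn (x K : R) : (forall n : nat, x <= K / n.+1%:R) -> x <= 0.
Proof.
move=> xK; rewrite leNgt; apply/negP => x0.
have K0 : 0 <= K by have := xK 0; rewrite divr1; apply: le_trans; exact: ltW.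
pose n := Num.truncn (K / x).
have Kn : K / x < n.+1%:R by apply: truncnS_gt.
have := xK n; rewrite ler_pdivlMr// mulrC -ler_pdivlMr// leNgt.
by rewrite Kn.
Qed.

(** In the sup norm weighted by [expR (- b * s)] with [b = 2 * C], one integration divides by at
    least [b]. Passing from [n] to [n.+1] costs a factor [C], so each round gains 1/2 and the
    iteration drives the bound to 0. *)
Lemma iterated_integral_eq0 (T M C : R) (D : nat -> R -> R) :
  0 <= T -> 0 < C ->
  (forall n, measurable_fun `]0, T] (D n)) ->
  (forall n s, 0 <= s <= T -> `|D n s| <= M * C ^+ n) ->
  (forall n s, 0 <= s <= T -> D n s = \int[leb]_(x in `]0, s]) D n.+1 x) ->
  D 0 T = 0.
Proof.
move=> T0 C0 mD DM Dint.
have M0 : 0 <= M.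
  by have := DM 0 0; rewrite lexx T0 => /(_ isT); rewrite expr0 mulr1; exact: le_trans.
pose b := 2 * C.
have b0 : 0 < b by rewrite mulr_gt0.
have key m : forall n s, 0 <= s <= T ->
    `|D n s| <= M * C ^+ n * 2^-1 ^+ m * expR (b * s).
  elim: m => [n s /andP[s0 sT]|m IH n s /andP[s0 sT]].
    rewrite expr0 mulr1 (le_trans (DM _ _ _)) ?s0 ?sT// ler_peMr//.
      by rewrite mulr_ge0// exprn_ge0// ltW.
    by rewrite -expR0 ler_expR mulr_ge0// ltW.
  have sub : `]0, s] `<=` `]0, T].
    by move=> x /=; rewrite !in_itv/= => /andP[-> /le_trans->].
  have iD : leb.-integrable `]0, s] (EFin \o D n.+1).
    apply: (bounded_integrable_oc (M := M * C ^+ n.+1)).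
      exact: measurable_funS (mD _).
    move=> x /andP[x0 xs]; apply: DM.
    by rewrite (ltW x0) (le_trans xs sT).
  rewrite Dint ?s0//; apply: le_trans (le_normr_Rintegral _ iD) _ => //.
  pose K := M * C ^+ n.+1 * 2^-1 ^+ m.
  apply: (@le_trans _ _ (\int[leb]_(x in `]0, s]) (K * expR (b * x)))).
    apply: le_Rintegral => //.
    - exact: integrable_norm.
    - apply: (bounded_integrable_oc (M := `|K| * expR (b * s))).
        by apply: measurable_funM => //; exact: measurable_fun_expRM.
      move=> x /andP[x0 xs]; rewrite normrM ler_wpM2l//.
      by rewrite ger0_norm ?expR_ge0// ler_expR ler_pM2l.
    - move=> x /=; rewrite in_itv/= => /andP[x0 xs]; apply: IH.
      by rewrite (ltW x0) (le_trans xs sT).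
  rewrite RintegralZl//; last first.
    apply: (bounded_integrable_oc (M := expR (b * s))).
      exact: measurable_fun_expRM.
    move=> x /andP[x0 xs].
    by rewrite ger0_norm ?expR_ge0// ler_expR ler_pM2l.
  have K0 : 0 <= K by rewrite /K !mulr_ge0 ?exprn_ge0// ltW.
  apply: (le_trans (ler_wpM2l K0 (Rintegral_expR_le b0 s0))).
  rewrite /K /b exprS (exprS 2^-1 m) le_eqVlt; apply/orP; left; apply/eqP.
  by field; rewrite gt_eqF.
apply/eqP; rewrite -normr_le0.
apply: (@le0_geometric_half _ (M * expR (b * T))) => n.
have := key n 0 T; rewrite T0 lexx => /(_ isT); rewrite expr0 mulr1.
by rewrite mulrAC.
Qed.

(** The same exponential weight with [b = 2 * C2]: inserting a bound [K * expR (b * s)] into the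
    inequality returns [(C1 + K / 2) * expR (b * s)], and the fixed point of this map is [2 * C1].
    The a priori bound [M] starts the iteration. *)
Lemma gronwall (T M C1 C2 : R) (phi : R -> R) :
  0 <= T -> 0 <= C1 -> 0 < C2 -> measurable_fun `]0, T] phi ->
  (forall s, 0 <= s <= T -> 0 <= phi s <= M) ->
  (forall s, 0 <= s <= T ->
    phi s <= C1 + C2 * \int[leb]_(x in `]0, s]) phi x) ->
  forall s, 0 <= s <= T -> phi s <= 2 * C1 * expR (2 * C2 * s).
Proof.
move=> T0 C10 C20 mphi phiM phile.
have M0 : 0 <= M.
  by have := phiM 0; rewrite lexx T0 => /(_ isT)/andP[]; exact: le_trans.
pose b := 2 * C2.
have b0 : 0 < b by rewrite mulr_gt0.
have key n : forall s, 0 <= s <= T ->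
    phi s <= (2 * C1 + M * 2^-1 ^+ n) * expR (b * s).
  elim: n => [s /andP[s0 sT]|n IH s /andP[s0 sT]].
    rewrite expr0 mulr1; have := phiM s; rewrite s0 sT => /(_ isT)/andP[_].
    move=> /le_trans; apply; rewrite -[leLHS]mulr1 ler_pM//.
      by rewrite lerDr mulr_ge0.
    by rewrite -expR0 ler_expR mulr_ge0// ltW.
  have sub : `]0, s] `<=` `]0, T].
    by move=> x /=; rewrite !in_itv/= => /andP[-> /le_trans->].
  rewrite (le_trans (phile _ _)) ?s0//.
  pose K := 2 * C1 + M * 2^-1 ^+ n.
  have K0 : 0 <= K by rewrite /K addr_ge0 ?mulr_ge0 ?exprn_ge0.
  have : \int[leb]_(x in `]0, s]) phi x <= \int[leb]_(x in `]0, s]) (K * expR (b * x)).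
    apply: le_Rintegral => //.
    - apply: (bounded_integrable_oc (M := M)); first exact: measurable_funS mphi.
      move=> x /andP[x0 xs]; have := phiM x; rewrite (ltW x0) (le_trans xs sT) => /(_ isT)/andP[p0 pM].
      by rewrite ger0_norm.
    - apply: (bounded_integrable_oc (M := `|K| * expR (b * s))).
        by apply: measurable_funM => //; exact: measurable_fun_expRM.
      move=> x /andP[x0 xs]; rewrite normrM ler_wpM2l//.
      by rewrite ger0_norm ?expR_ge0// ler_expR ler_pM2l.
    - move=> x /=; rewrite in_itv/= => /andP[x0 xs]; apply: IH.
      by rewrite (ltW x0) (le_trans xs sT).
  rewrite RintegralZl//; last first.
    apply: (bounded_integrable_oc (M := expR (b * s))).
      exact: measurable_fun_expRM.
    move=> x /andP[x0 xs].
    by rewrite ger0_norm ?expR_ge0// ler_expR ler_pM2l.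
  move=> /(fun h => le_trans h (ler_wpM2l K0 (Rintegral_expR_le b0 s0))).
  move=> /(ler_wpM2l (ltW C20)) h.
  have E1 : 1 <= expR (b * s) by rewrite -expR0 ler_expR mulr_ge0// ltW.
  have -> : (2 * C1 + M * 2^-1 ^+ n.+1) * expR (b * s) =
      C1 * expR (b * s) + C2 * (K * (expR (b * s) / b)).
    by rewrite /K /b exprS; field; rewrite gt_eqF.
  by rewrite lerD// ler_peMr.
move=> s sT; rewrite -subr_le0.
apply: (@le0_geometric_half _ (M * expR (b * s))) => n.
by rewrite lerBlDl -/b (mulrAC M) -mulrDl; exact: key.
Qed.

(** Over [n] steps of length [T / n] the errors add up to [C * T ^+ 2 / n], which vanishes as [n]
    grows. *)
Lemma Rintegral_of_quadratic_error (T C : R) (Z z : R -> R) :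
  0 <= T -> leb.-integrable `]0, T] (EFin \o z) ->
  (forall s r, 0 <= s -> s <= r -> r <= T -> r - s <= 1 ->
    `|Z r - Z s - \int[leb]_(x in `]s, r]) z x| <= C * (r - s) ^+ 2) ->
  Z T = Z 0 + \int[leb]_(x in `]0, T]) z x.
Proof.
move=> T0 iz HZ.
have C0 n : T <= n.+1%:R ->
    `|Z T - Z 0 - \int[leb]_(x in `]0, T]) z x| <= C * T ^+ 2 / n.+1%:R.
  move=> Tn; pose h := T / n.+1%:R.
  have h0 : 0 <= h by rewrite divr_ge0.
  have nh : n.+1%:R * h = T by rewrite mulrCA mulfV ?mulr1// pnatr_eq0.
  have key k : (k <= n.+1)%N ->
     `|Z (k%:R * h) - Z 0 - \int[leb]_(x in `]0, k%:R * h]) z x| <= k%:R * (C * h ^+ 2).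
    elim: k => [_|k IH kn].
      by rewrite !mul0r subrr Rintegral_oc_set0 subrr normr0.
    have kh0 : 0 <= k%:R * h by rewrite mulr_ge0.
    have kh : k%:R * h <= k.+1%:R * h by rewrite ler_wpM2r// ler_nat.
    have khT : k.+1%:R * h <= T by rewrite -nh ler_wpM2r// ler_nat.
    have iz' : leb.-integrable `]0, k.+1%:R * h] (EFin \o z).
      apply: integrableS iz => // x /=; rewrite !in_itv/= => /andP[-> /le_trans->//].
    rewrite (Rintegral_cat kh0 kh iz').
    have e : k.+1%:R * h - k%:R * h = h by rewrite -mulrBl -natrB// subSnn mul1r.
    have := HZ _ _ kh0 kh khT; rewrite e => /(_ _)/wrap[].
      by rewrite ler_pdivrMr ?mul1r.
    move=> H; apply: (le_trans _ (_ : k%:R * (C * h ^+ 2) + C * h ^+ 2 <= _)).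
      apply: le_trans (lerD (IH (ltnW kn)) H).
      rewrite (le_trans _ (ler_normD _ _))// le_eqVlt; apply/orP; left; apply/eqP.
      by congr `|_|; ring.
    by rewrite -natr1 mulrDl mul1r.
  have := key n.+1 (leqnn _); rewrite nh => /le_trans; apply.
  rewrite /h le_eqVlt; apply/orP; left; apply/eqP.
  have : n.+1%:R != 0 :> R by rewrite pnatr_eq0.
  by move: (n.+1%:R : R) => N N0; field.
apply/eqP; rewrite -subr_eq0 opprD addrA -normr_le0.
(* The error bound is available for steps of length at most 1, so the number of steps is taken as a
   multiple of some [N > T]. *)
pose N := (Num.truncn T).+1.
apply: (@le0_invn _ (C * T ^+ 2 / N%:R)) => n.
pose m := (N * n.+1).-1.
have em : m.+1 = (N * n.+1)%N by rewrite /m prednK// muln_gt0.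
have Tm : T <= m.+1%:R.
  rewrite em natrM; apply: (@le_trans _ _ N%:R); first exact/ltW/truncnS_gt.
  by rewrite ler_peMr// ler1n.
by have := C0 m Tm; rewrite em natrM invfM mulrA.
Qed.

(** The factors are primitives of bounded measurable functions, so the product rule is obtained from
    increments: on each step the increment of [X * Y] and the integral of [al * Y + X * be] differ
    to second order only, because [X] and [Y] are [K]-Lipschitz. *)
Lemma Rintegral_product (T K : R) (X Y al be : R -> R) : 0 <= T ->
  measurable_fun `]0, T] al -> measurable_fun `]0, T] be ->
  measurable_fun `]0, T] X -> measurable_fun `]0, T] Y ->
  (forall s, 0 <= s <= T -> `|al s| <= K) ->
  (forall s, 0 <= s <= T -> `|be s| <= K) ->
  (forall s, 0 <= s <= T -> X s = X 0 + \int[leb]_(x in `]0, s]) al x) ->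
  (forall s, 0 <= s <= T -> Y s = Y 0 + \int[leb]_(x in `]0, s]) be x) ->
  X T * Y T = X 0 * Y 0 + \int[leb]_(s in `]0, T]) (al s * Y s + X s * be s).
Proof.
move=> T0 ma mb mX mY aK bK HX HY.
have K0 : 0 <= K by have := aK 0; rewrite lexx T0 => /(_ isT); exact: le_trans.
have ml (g : R -> R) s : s <= T -> measurable_fun `]0, T] g -> measurable_fun `]0, s] g.
  move=> sT; apply: measurable_funS => // x /=.
  by rewrite !in_itv/= => /andP[-> /le_trans->].
have incr (Z g : R -> R) : measurable_fun `]0, T] g ->
    (forall s, 0 <= s <= T -> `|g s| <= K) ->
    (forall s, 0 <= s <= T -> Z s = Z 0 + \int[leb]_(x in `]0, s]) g x) ->
    forall s r, 0 <= s -> s <= r -> r <= T ->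
    Z r - Z s = \int[leb]_(x in `]s, r]) g x /\ `|Z r - Z s| <= K * (r - s).
  move=> mg gK HZ s r s0 sr rT.
  have e : Z r - Z s = \int[leb]_(x in `]s, r]) g x.
    rewrite (HZ r) ?(HZ s) ?(le_trans s0 sr) ?rT ?s0 ?(le_trans sr rT)//.
    rewrite (Rintegral_cat s0 sr); first by ring.
    apply: (bounded_integrable_oc (M := K)); first exact: ml mg.
    by move=> x /andP[x0 xr]; apply: gK; rewrite (ltW x0) (le_trans xr).
  split=> //; rewrite e; apply: le_normr_Rintegral_oc => //.
    apply: measurable_funS mg => // x /=; rewrite !in_itv/= => /andP[sx xr].
    by rewrite (le_lt_trans s0 sx) (le_trans xr).
  move=> x /andP[sx xr]; apply: gK.
  by rewrite (le_trans s0 (ltW sx)) (le_trans xr).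
have incX := incr _ _ ma aK HX; have incY := incr _ _ mb bK HY.
have bd (Z : R -> R) : (forall s r, 0 <= s -> s <= r -> r <= T ->
     `|Z r - Z s| <= K * (r - s)) -> forall s, 0 <= s <= T -> `|Z s| <= `|Z 0| + K * T.
  move=> h s /andP[s0 sT]; rewrite -lerBlDl.
  apply: (@le_trans _ _ (K * (s - 0))); last by rewrite subr0 ler_wpM2l.
  by apply: le_trans (h _ _ (lexx 0) s0 sT); exact: lerB_dist.
have bX := bd _ (fun s r h1 h2 h3 => (incX s r h1 h2 h3).2).
have bY := bd _ (fun s r h1 h2 h3 => (incY s r h1 h2 h3).2).
pose M := K * (`|X 0| + K * T) + K * (`|Y 0| + K * T).
have mz : measurable_fun `]0, T] (fun s => al s * Y s + X s * be s).
  by apply: measurable_funD; apply: measurable_funM.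
have bz x : 0 <= x <= T -> `|al x * Y x + X x * be x| <= M.
  move=> xT; rewrite (le_trans (ler_normD _ _))// !normrM /M addrC lerD//.
    by rewrite mulrC ler_pM// ?aK ?bX// bK.
  by rewrite ler_pM// ?aK ?bY.
apply: (@Rintegral_of_quadratic_error T (2 * K ^+ 2) (fun s => X s * Y s)) => //.
  apply: (bounded_integrable_oc (M := M)) => // x /andP[x0 xT].
  by apply: bz; rewrite ltW.
move=> s r s0 sr rT _.
have sub : `]s, r] `<=` `]0, T].
  move=> x /=; rewrite !in_itv/= => /andP[sx xr].
  by rewrite (le_lt_trans s0 sx) (le_trans xr).
have inT x : s < x <= r -> 0 <= x <= T.
  by move=> /andP[sx xr]; rewrite (le_trans s0 (ltW sx)) (le_trans xr).
have ia : leb.-integrable `]s, r] (EFin \o al).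
  apply: (bounded_integrable_oc (M := K)); first exact: measurable_funS ma.
  by move=> x /inT; exact: aK.
have ib : leb.-integrable `]s, r] (EFin \o be).
  apply: (bounded_integrable_oc (M := K)); first exact: measurable_funS mb.
  by move=> x /inT; exact: bK.
have iz : leb.-integrable `]s, r] (EFin \o (fun s => al s * Y s + X s * be s)).
  apply: (bounded_integrable_oc (M := M)); first exact: measurable_funS mz.
  by move=> x /inT; exact: bz.
have -> : X r * Y r - X s * Y s = (X r - X s) * Y r + X s * (Y r - Y s) by ring.
rewrite (incX s r s0 sr rT).1 (incY s r s0 sr rT).1.
have iaY := rintegrableZr (measurable_oc s r) (Y r) ia.
have iXb := rintegrableZl (measurable_oc s r) (X s) ib.
rewrite -RintegralZr// -RintegralZl// -RintegralD// -RintegralB//; last first.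
  by apply: eq_integrable (integrableD _ iaY iXb) => //.
have -> : 2 * K ^+ 2 * (r - s) ^+ 2 = (2 * K ^+ 2 * (r - s)) * (r - s) by ring.
apply: le_normr_Rintegral_oc => //.
  apply: measurable_funB; last exact: measurable_funS mz.
  apply: measurable_funD; first apply: measurable_funM => //.
    exact: measurable_funS ma.
  apply: measurable_funM => //; exact: measurable_funS mb.
move=> x sxr; have /andP[sx xr] := sxr.
have x0 := le_trans s0 (ltW sx); have xT := le_trans xr rT.
have -> : al x * Y r + X s * be x - (al x * Y x + X x * be x) =
  al x * (Y r - Y x) - (X x - X s) * be x by ring.
have -> : 2 * K ^+ 2 * (r - s) = K * (K * (r - s)) + (K * (r - s)) * K by ring.
rewrite (le_trans (ler_normB _ _))// !normrM lerD// ler_pM//.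
- by apply: aK; rewrite x0.
- rewrite (le_trans (incY x r x0 xr rT).2)// ler_wpM2l// lerD2l lerN2; exact: ltW.
- rewrite (le_trans (incX s x s0 (ltW sx) xT).2)// ler_wpM2l// lerD2r//.
- by apply: bK; rewrite x0.
Qed.

(** A fundamental theorem of calculus from one-sided difference estimates. The estimate on [z] makes
    it continuous, hence integrable, and replacing [z s] by the values of [z] along the step costs
    another [C * (r - s) ^+ 2]. *)
Lemma Rintegral_of_derivative_error (T C : R) (Z z : R -> R) : 0 <= T ->
  (forall s r, 0 <= s -> s <= r -> r <= T -> r - s <= 1 ->
    `|Z r - Z s - (r - s) * z s| <= C * (r - s) ^+ 2) ->
  (forall s r, 0 <= s -> s <= r -> r <= T -> r - s <= 1 ->
    `|z r - z s| <= C * (r - s)) ->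
  leb.-integrable `]0, T] (EFin \o z) /\
  Z T = Z 0 + \int[leb]_(x in `]0, T]) z x.
Proof.
move=> T0 HZ Hz.
have C0 : T = 0 \/ 0 <= C.
  have [T0'|] := eqVneq T 0; [by left|move=> Tn0; right].
  have Tp : 0 < T by rewrite lt_neqAle eq_sym Tn0.
  pose e := Num.min T 1.
  have e0 : 0 < e by rewrite lt_min Tp ltr01.
  have := Hz 0 e (lexx 0) (ltW e0); rewrite subr0 !ge_min !lexx/= orbT.
  by move=> /(_ isT isT)/(le_trans (normr_ge0 _)); rewrite pmulr_lge0.
have [T00|Tn0] := eqVneq T 0.
  rewrite T00 Rintegral_oc_set0 addr0 set_itv_ge ?bnd_simp ?ltxx//.
  by split=> //; exact: integrable_set0.
have {}C0 : 0 <= C by case: C0 => // /eqP; rewrite (negbTE Tn0).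
have cz : {within `[0, T], continuous z}.
  apply/subspace_continuousP => x /=; rewrite in_itv/= => /andP[x0 xT].
  apply/cvgrPdist_lt => e e0; near=> y => /=.
  have : y \in `[0, T] by near: y; apply: withinT.
  rewrite in_itv/= => /andP[y0 yT].
  have xy : `|x - y| < Num.min 1 (e / (C + 1)).
    near: y; apply: cvg_within; apply: nbhsx_ballx.
    by rewrite lt_min ltr01 divr_gt0// ltr_wpDl.
  have [xy1 xye] : `|x - y| <= 1 /\ `|x - y| < e / (C + 1).
    by move: xy; rewrite lt_min => /andP[/ltW].
  have h : `|z x - z y| <= C * `|x - y|.
    have [le_xy|/ltW le_yx] := leP x y.
      rewrite distrC (distrC x) (ger0_norm (x := y - x)) ?subr_ge0//.
      by apply: Hz => //; move: xy1; rewrite distrC ger0_norm// subr_ge0.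
    rewrite (ger0_norm (x := x - y)) ?subr_ge0//.
    by apply: Hz => //; move: xy1; rewrite ger0_norm// subr_ge0.
  apply: (le_lt_trans h); apply: (@le_lt_trans _ _ ((C + 1) * `|x - y|)).
    by rewrite ler_wpM2r// lerDl.
  by rewrite mulrC -ltr_pdivlMr// ltr_wpDl.
have iz : leb.-integrable `]0, T] (EFin \o z).
  apply: (@integrableS _ _ _ leb `[0, T]%classic) => //.
    by move=> x /=; rewrite !in_itv/= => /andP[/ltW-> ->].
  by apply: continuous_compact_integrable => //; exact: segment_compact.
split=> //; apply: (@Rintegral_of_quadratic_error T (2 * C)) => //.
move=> s r s0 sr rT rs1.
have izs : leb.-integrable `]s, r] (EFin \o z).
  apply: integrableS iz => // x /=; rewrite !in_itv/= => /andP[sx xr].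
  by rewrite (le_lt_trans s0 sx) (le_trans xr).
have mzs : measurable_fun `]s, r] z by apply/measurable_EFinP; exact: measurable_int izs.
have -> : Z r - Z s - \int[leb]_(x in `]s, r]) z x =
   (Z r - Z s - (r - s) * z s) - \int[leb]_(x in `]s, r]) (z x - z s).
  rewrite RintegralB//; last first.
    by apply: (bounded_integrable_oc (M := `|z s|)) => // x _; rewrite lexx.
  by rewrite (Rintegral_cst_oc _ sr); ring.
rewrite (le_trans (ler_normB _ _))// (_ : 2 * C * _ = C * (r - s) ^+ 2 + (C * (r - s)) * (r - s)); last by ring.
apply: lerD; first exact: HZ.
apply: le_normr_Rintegral_oc => //; first by apply: measurable_funB.
move=> x /andP[sx xr]; apply: (@le_trans _ _ (C * (x - s))).
  apply: Hz => //; [exact: ltW|exact: le_trans rT|].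
  by rewrite (le_trans _ rs1)// lerD2r.
by rewrite ler_wpM2l// lerD2r.
Unshelve. all: by end_near.
Qed.

End TimeIntegrals.

(** * Products with factors measurable for a sub-sigma-algebra *)

Section SubSigmaAlgebra.
Context {d : measure_display} {T : measurableType d} {R : realType}.
Variable P : probability T R.
Variable G : set (set T).
Hypothesis sG : sigma_algebra setT G.
Hypothesis Gm : G `<=` measurable.

Lemma g_sigma_algebraTypeE : (@measurable _ (g_sigma_algebraType G)) = G.
Proof. exact: measurable_g_measurableTypeE. Qed.

Lemma measurable_g_sigma_algebraType (A : set T) :
  @measurable _ (g_sigma_algebraType G) A -> G A.
Proof. by rewrite measurable_g_measurableTypeE. Qed.

Lemma measurable_wrtP (X : T -> R) :
  measurable_wrt G X <-> measurable_fun setT (X : g_sigma_algebraType G -> R).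
Proof.
split=> [h _ B mB|h B mB].
  by rewrite setTI; move: (h B mB); rewrite -[in X in X -> _]g_sigma_algebraTypeE.
by rewrite -g_sigma_algebraTypeE -[X @^-1` B]setTI; exact: h.
Qed.

Lemma measurable_wrt_fun (X : T -> R) : measurable_wrt G X -> measurable_fun setT X.
Proof. by move=> h _ B mB; rewrite setTI; apply: Gm; exact: h. Qed.

Import HBNNSimple.

(** First stage of taking out what is known: a simple [Z] is a finite combination of indicators of
    events of [G], and [X] integrates to 0 over each of them. *)
Lemma integral_nnsfun_mul_eq0 (X : T -> R) (Z : {nnsfun (g_sigma_algebraType G) >-> R}) :
  P.-integrable setT (EFin \o X) ->
  (forall A, G A -> (\int[P]_(w in A) (X w)%:E = 0)%E) ->
  (\int[P]_w (Z w * X w)%:E = 0)%E.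
Proof.
move=> iX X0.
have GA y : G (Z @^-1` [set y]).
  by apply: measurable_g_sigma_algebraType; rewrite -[_ @^-1` _]setTI; exact: measurable_funP.
have mA y : d.-measurable (Z @^-1` [set y]) by exact: Gm.
under eq_integral.
  move=> w _; rewrite (fimfunE Z w) fsbig_finite//= mulr_suml -sumEFin.
  over.
rewrite /= integral_sum//=; last first.
  move=> y; under eq_fun do rewrite -mulrA EFinM.
  apply: integrableZl => //.
  have := (integrable_mkcond (mu := P) (EFin \o X) (mA y)).1 (integrableS measurableT (mA y) (@subsetT _ _) iX).
  apply: eq_integrable => // w _; rewrite /= restrict_EFin/= patchE indicE.
  by case: ifPn => _; rewrite ?mul1r ?mul0r.
rewrite big1// => y _; under eq_integral do rewrite -mulrA EFinM.
have e : (\int[P]_w (\1_(Z @^-1` [set y]) w * X w)%:E = 0)%E.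
  rewrite -[RHS](X0 _ (GA y)) [RHS]integral_mkcond; apply: eq_integral => w _.
  by rewrite patchE indicE; case: ifPn => _; rewrite ?mul1r ?mul0r.
rewrite integralZl ?e ?mule0//.
have := (integrable_mkcond (mu := P) (EFin \o X) (mA y)).1 (integrableS measurableT (mA y) (@subsetT _ _) iX).
apply: eq_integrable => // w _; rewrite /= restrict_EFin/= patchE indicE.
by case: ifPn => _; rewrite ?mul1r ?mul0r.
Qed.

(** The simple approximations of [Z] lie below [Z], so the absolute value of [Z * X] dominates and
    the simple case passes to the limit. *)
Lemma integral_ge0_mul_eq0 (X Z : T -> R) :
  P.-integrable setT (EFin \o X) ->
  (forall A, G A -> (\int[P]_(w in A) (X w)%:E = 0)%E) ->
  measurable_wrt G Z -> (forall w, 0 <= Z w) ->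
  P.-integrable setT (EFin \o (fun w => Z w * X w)) ->
  (\int[P]_w (Z w * X w)%:E = 0)%E.
Proof.
move=> iX X0 /measurable_wrtP mZ Z0 iZX.
have mZe : measurable_fun setT (EFin \o Z : g_sigma_algebraType G -> \bar R).
  exact/measurable_EFinP.
pose Zn := nnsfun_approx (@measurableT _ (g_sigma_algebraType G)) mZe.
have Ze0 w : setT w -> (0 <= (EFin \o Z) w)%E by rewrite lee_fin.
have c : (\int[P]_w (Zn n w * X w)%:E)%E @[n --> \oo] --> (\int[P]_w (Z w * X w)%:E)%E.
  apply: (@dominated_cvg _ _ _ P setT measurableT (fun n w => (Zn n w * X w)%:E)
           _ (fun w => `|Z w * X w|%:E)) => //.
  - move=> n; apply/measurable_EFinP; apply: measurable_funM.
      apply: measurable_wrt_fun; apply/measurable_wrtP.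
      exact: measurable_funP.
    by apply/measurable_EFinP; exact: measurable_int iX.
  - move=> w _; have := cvg_nnsfun_approx measurableT mZe Ze0 (I : setT w).
    rewrite /comp => h.
    have {}h : Zn n w @[n --> \oo] --> Z w by move: h => /fine_cvg.
    apply: cvg_EFin; first exact: nearW.
    rewrite /comp/=; apply: cvgM => //; exact: cvg_cst.
  - apply: eq_integrable (integrable_abse iZX) => //.
  - move=> n w _ /=; rewrite lee_fin !normrM ler_wpM2r//.
    rewrite ger0_norm ?ger0_norm ?Z0//.
    by have := @le_approx _ _ _ setT _ n w Ze0 I; rewrite nnsfun_approxE lee_fin.
have := cvg_lim _ c; move=> <- //.
under eq_fun do rewrite integral_nnsfun_mul_eq0//.
exact: lim_cst.
Qed.

(** This is E[Z X] = 0 when E[X | G] = 0, the conditional expectation being expressed through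
    integrals over events of [G]. [Z] may be unbounded as long as the product is integrable, because
    its positive and negative parts are both dominated by |Z|. *)
Lemma integral_mul_eq0 (X Z : T -> R) :
  P.-integrable setT (EFin \o X) ->
  (forall A, G A -> (\int[P]_(w in A) (X w)%:E = 0)%E) ->
  measurable_wrt G Z ->
  P.-integrable setT (EFin \o (fun w => Z w * X w)) ->
  (\int[P]_w (Z w * X w)%:E = 0)%E.
Proof.
move=> iX X0 mZ iZX.
have mXT : measurable_fun setT X by apply/measurable_EFinP; exact: measurable_int iX.
have part (Z' : T -> R) : measurable_wrt G Z' -> (forall w, 0 <= Z' w <= `|Z w|) ->
    P.-integrable setT (EFin \o (fun w => Z' w * X w)) /\
    (\int[P]_w (Z' w * X w)%:E = 0)%E.
  move=> mZ' Z'Z.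
  have i' : P.-integrable setT (EFin \o (fun w => Z' w * X w)).
    apply: le_integrable iZX => //.
      apply/measurable_EFinP; apply: measurable_funM => //.
      exact: measurable_wrt_fun.
    move=> w _ /=; rewrite lee_fin !normrM ler_wpM2r//.
    by have /andP[z0 z1] := Z'Z w; rewrite ger0_norm.
  split=> //; apply: integral_ge0_mul_eq0 => // w.
  by have /andP[] := Z'Z w.
have [ip ep] : P.-integrable setT (EFin \o (fun w => (Z^\+)%R w * X w)) /\
    (\int[P]_w ((Z^\+)%R w * X w)%:E = 0)%E.
  apply: part.
    by move/measurable_wrtP: mZ => mZ; apply/measurable_wrtP; exact: measurable_funrpos.
  move=> w; rewrite /funrpos le_max lexx orbT/= ge_max ler_norm.
  exact: normr_ge0.
have [im em] : P.-integrable setT (EFin \o (fun w => (Z^\-)%R w * X w)) /\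
    (\int[P]_w ((Z^\-)%R w * X w)%:E = 0)%E.
  apply: part.
    by move/measurable_wrtP: mZ => mZ; apply/measurable_wrtP; exact: measurable_funrneg.
  move=> w; rewrite /funrneg le_max lexx orbT/= ge_max normr_ge0 andbT.
  by rewrite -normrN ler_norm.
under eq_integral.
  move=> w _.
  have -> : Z w * X w = (Z^\+)%R w * X w - (Z^\-)%R w * X w.
    by rewrite -mulrBl; congr (_ * _); rewrite -[in LHS](funrposBneg Z).
  over.
under eq_integral do rewrite EFinB.
by rewrite integralB//= ep em sube0.
Qed.

End SubSigmaAlgebra.

(** * Square-integrable functions and their inner products *)

Section SquareIntegrable.
Context {d : measure_display} {T : measurableType d} {R : realType}.
Variable mu : {measure set T -> \bar R}.
Variable D : set T.
Hypothesis mD : measurable D.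
Implicit Types f g : T -> R.

Definition sqint f := measurable_fun D f /\
  mu.-integrable D (EFin \o (fun x => f x ^+ 2)).

Lemma sqint_mul f g : sqint f -> sqint g ->
  mu.-integrable D (EFin \o (fun x => f x * g x)).
Proof.
move=> [mf ff] [mg gg]; apply: le_integrable (integrableD mD ff gg) => //.
  by apply/measurable_EFinP; exact: measurable_funM.
move=> x _ /=; rewrite lee_fin.
rewrite [leRHS]ger0_norm ?addr_ge0 ?sqr_ge0// normrM.
rewrite -(real_normK (num_real (f x))) -(real_normK (num_real (g x))).
have := sqr_ge0 (`|f x| - `|g x|); nra.
Qed.

Lemma sqintZ c f : sqint f -> sqint (fun x => c * f x).
Proof.
move=> [mf ff]; split.
  by apply: measurable_funM => //; exact: measurable_cst.
apply: eq_integrable (integrableZl mD (c ^+ 2) ff) => // x _ /=.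
by congr (_%:E); rewrite exprMn.
Qed.

Lemma sqintD f g : sqint f -> sqint g -> sqint (fun x => f x + g x).
Proof.
move=> sf sg; have [mf ff] := sf; have [mg gg] := sg; split.
  exact: measurable_funD.
have fg := sqint_mul sf sg.
apply: eq_integrable (integrableD mD (integrableD mD ff gg) (integrableZl mD 2 fg)) => // x _ /=.
by congr (_%:E); ring.
Qed.

Lemma sqintB f g : sqint f -> sqint g -> sqint (fun x => f x - g x).
Proof.
move=> sf sg; have := sqintD sf (sqintZ (-1) sg).
by under [X in sqint X]funext do rewrite mulN1r.
Qed.

Lemma le_sqint f g : measurable_fun D f -> (forall x, D x -> `|f x| <= `|g x|) ->
  sqint g -> sqint f.
Proof.
move=> mf fg [mg gg]; split=> //; apply: le_integrable gg => //.
  by apply/measurable_EFinP; exact: measurable_funX.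
move=> x Dx /=; rewrite lee_fin !normrX ler_pXn2r// ?nnegrE//.
exact: fg.
Qed.

Lemma sqint_sum (I : Type) (s : seq I) (F : I -> T -> R) :
  (forall i, sqint (F i)) -> sqint (fun x => \sum_(i <- s) F i x).
Proof.
move=> sF; elim: s => [|i s IH].
  under [X in sqint X]funext do rewrite big_nil.
  split; first exact: measurable_cst.
  under [X in _.-integrable _ (EFin \o X)]funext do rewrite expr0n/=.
  exact: integrable0.
under [X in sqint X]funext do rewrite big_cons.
exact: sqintD.
Qed.

(** Young's inequality in the role of Cauchy-Schwarz: the free parameter [eta] allows either side to
    be made small, as needed for the cross terms in [cvg_Rintegral_mul]. *)
Lemma Rintegral_mul_le f g eta : sqint f -> sqint g -> 0 < eta ->
  `|\int[mu]_(x in D) (f x * g x)| <=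
  eta * \int[mu]_(x in D) (f x ^+ 2) + eta^-1 * \int[mu]_(x in D) (g x ^+ 2).
Proof.
move=> sf sg e0; have fg := sqint_mul sf sg; have [_ ff] := sf; have [_ gg] := sg.
apply: le_trans (le_normr_Rintegral mD fg) _.
rewrite -!RintegralZl// -RintegralD//; try exact: rintegrableZl.
apply: le_Rintegral => //.
- exact: integrable_norm.
- by apply: rintegrableD => //; exact: rintegrableZl.
move=> x _; rewrite normrM.
rewrite -(real_normK (num_real (f x))) -(real_normK (num_real (g x))).
have := sqr_ge0 (eta * `|f x| - `|g x|); set A := `|f x|; set B := `|g x| => h.
have A0 : 0 <= A by exact: normr_ge0.
have B0 : 0 <= B by exact: normr_ge0.
rewrite -(ler_pM2l e0) mulrDr (mulrA eta eta^-1) mulfV ?mul1r ?gt_eqF//.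
nra.
Qed.

Lemma Rintegral_sqrD_le f g : sqint f -> sqint g ->
  \int[mu]_(x in D) ((f x + g x) ^+ 2) <=
  2 * \int[mu]_(x in D) (f x ^+ 2) + 2 * \int[mu]_(x in D) (g x ^+ 2).
Proof.
move=> sf sg; have [_ ff] := sf; have [_ gg] := sg; have [_ fg] := sqintD sf sg.
rewrite -!RintegralZl// -RintegralD//; try exact: rintegrableZl.
apply: le_Rintegral => //; first by apply: rintegrableD => //; exact: rintegrableZl.
move=> x _; have := sqr_ge0 (f x - g x); nra.
Qed.

(** The difference of the products expands into one product of two small factors and two cross
    terms; on the latter Young's inequality is used with [eta] so small that
    [eta * (A + B) < e / 2]. *)
Lemma cvg_Rintegral_mul (fn gn : nat -> T -> R) f g :
  (forall n, sqint (fn n)) -> (forall n, sqint (gn n)) -> sqint f -> sqint g ->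
  \int[mu]_(x in D) ((fn n x - f x) ^+ 2) @[n --> \oo] --> (0 : R) ->
  \int[mu]_(x in D) ((gn n x - g x) ^+ 2) @[n --> \oo] --> (0 : R) ->
  \int[mu]_(x in D) (fn n x * gn n x) @[n --> \oo] --> \int[mu]_(x in D) (f x * g x).
Proof.
move=> sfn sgn sf sg cf cg.
pose xn n := \int[mu]_(x in D) ((fn n x - f x) ^+ 2).
pose yn n := \int[mu]_(x in D) ((gn n x - g x) ^+ 2).
pose A := \int[mu]_(x in D) (f x ^+ 2); pose B := \int[mu]_(x in D) (g x ^+ 2).
have A0 : 0 <= A by apply: Rintegral_ge0 => x _; exact: sqr_ge0.
have B0 : 0 <= B by apply: Rintegral_ge0 => x _; exact: sqr_ge0.
have bound n eta : 0 < eta ->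
   `|\int[mu]_(x in D) (f x * g x) - \int[mu]_(x in D) (fn n x * gn n x)| <=
   (1 + eta^-1) * xn n + (1 + eta^-1) * yn n + eta * (A + B).
  move=> e0.
  have s1 := sqintB (sfn n) sf; have s2 := sqintB (sgn n) sg.
  have -> : \int[mu]_(x in D) (f x * g x) - \int[mu]_(x in D) (fn n x * gn n x) =
    - (\int[mu]_(x in D) ((fn n x - f x) * (gn n x - g x)) +
       (\int[mu]_(x in D) ((fn n x - f x) * g x) +
       \int[mu]_(x in D) ((gn n x - g x) * f x))).
    rewrite -RintegralB; [|by []|exact: sqint_mul|exact: sqint_mul].
    rewrite -RintegralD; [|by []|exact: sqint_mul|exact: sqint_mul].
    rewrite -RintegralD; [|by []|exact: sqint_mul|]; last first.
      by apply: rintegrableD => //; exact: sqint_mul.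
    rewrite -[RHS]mulN1r -RintegralZl//; last first.
      by do 2?apply: rintegrableD => //; exact: sqint_mul.
    by apply: eq_Rintegral => x _; ring.
  rewrite normrN.
  have h1 := Rintegral_mul_le s1 s2 ltr01.
  have e0' : 0 < eta^-1 by rewrite invr_gt0.
  have h2 := Rintegral_mul_le s1 sg e0'.
  have h3 := Rintegral_mul_le s2 sf e0'.
  rewrite invr1 !mul1r -/(xn n) -/(yn n) in h1.
  rewrite invrK -/(xn n) -/B in h2; rewrite invrK -/(yn n) -/A in h3.
  rewrite (le_trans (ler_normD _ _))//.
  rewrite (le_trans (lerD h1 (le_trans (ler_normD _ _) (lerD h2 h3))))//.
  by rewrite le_eqVlt; apply/orP; left; apply/eqP; ring.
apply/cvgrPdist_lt => e e0.
pose eta := e / (2 * (A + B + 1)).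
have ab : 0 < A + B + 1 by rewrite ltr_wpDl ?addr_ge0.
have eta0 : 0 < eta by rewrite divr_gt0// mulr_gt0.
have hAB : eta * (A + B) < e / 2.
  rewrite /eta invfM mulrA mulrAC -[ltRHS]mulr1 -mulrA ltr_pM2l ?divr_gt0//.
  by rewrite ltr_pdivrMr ?mul1r// ltrDl.
have c0 : (1 + eta^-1) * xn n + (1 + eta^-1) * yn n @[n --> \oo] --> (0 : R).
  rewrite -[X in _ --> X](_ : (1 + eta^-1) * 0 + (1 + eta^-1) * 0 = 0); last by ring.
  by apply: cvgD; apply: cvgM => //; exact: cvg_cst.
have e20 : 0 < e / 2 by rewrite divr_gt0.
near=> n; apply: (le_lt_trans (bound n _ eta0)).
rewrite [ltRHS]splitr ltrD// (le_lt_trans (ler_norm _))// -normrN -sub0r.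
by near: n; move/cvgrPdist_lt : c0 => /(_ _ e20).
Unshelve. all: by end_near.
Qed.

End SquareIntegrable.

(** * Sums over countable types: finite exhaustion, measurability, exchange *)

Section CountableSums.
Context {R : realType} {I : countType}.
Local Open Scope ereal_scope.
Implicit Types f g : I -> \bar R.

(** The elements whose code is below [n], in a duplicate-free list: an exhaustion of the countable
    type that makes [esum] a monotone limit of finite sums. Codes that decode to nothing are
    skipped. *)
Definition sites n : seq I := pmap pickle_inv (iota 0 n).

Lemma uniq_sites n : uniq (sites n).
Proof. by apply: (pmap_uniq pickle_invK); exact: iota_uniq. Qed.

Lemma esum_nneseries f : (forall i, 0 <= f i) ->
  \esum_(i in [set: I]) f i = \sum_(n <oo) oapp f 0 (pickle_inv n).
Proof.
move=> f0; pose g n := oapp f 0 (pickle_inv n : option I).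
have g0 n : 0 <= g n by rewrite /g; case: (pickle_inv n).
rewrite (_ : \sum_(n <oo) _ = \esum_(n in [set: nat]) g n); last exact: nneseries_esumT.
transitivity (\esum_(n in range (pickle : I -> nat)) g n).
  rewrite esum_image; last by apply: in2W; exact: pcan_inj pickleK_inv.
  by apply: eq_esum => i _; rewrite /g pickleK_inv.
rewrite esum_mkcond; apply: eq_esum => n _; case: ifPn => //.
rewrite notin_setE /g; case e : (pickle_inv n) => [i|]//= h; exfalso; apply: h.
by exists i => //; have /= := @pickle_invK I n; rewrite /oapp e.
Qed.

Lemma sum_sites f n : \sum_(i <- sites n) f i = \sum_(0 <= k < n) oapp f 0 (pickle_inv k : option I).
Proof.
rewrite /sites /index_iota subn0; elim: (iota 0 n) => [|k s IH]; first by rewrite !big_nil.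
by rewrite big_cons -IH /=; case: (pickle_inv k) => [i|]//=; rewrite ?big_cons// add0e.
Qed.

Lemma cvg_sum_sites f : (forall i, 0 <= f i) ->
  \sum_(i <- sites n) f i @[n --> \oo] --> \esum_(i in [set: I]) f i.
Proof.
move=> f0; rewrite esum_nneseries//; under eq_fun do rewrite sum_sites.
apply: is_cvg_nneseries => n _ _; by case: (pickle_inv n).
Qed.

Lemma sum_sites_le_esum f n : (forall i, 0 <= f i) ->
  \sum_(i <- sites n) f i <= \esum_(i in [set: I]) f i.
Proof.
move=> f0; rewrite esum_nneseries// sum_sites.
by apply: nneseries_lim_ge => k _ _; case: (pickle_inv k).
Qed.

Lemma nondecreasing_sum_sites f : (forall i, 0 <= f i) ->
  nondecreasing_seq (fun n => \sum_(i <- sites n) f i).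
Proof.
move=> f0 m n mn; rewrite !sum_sites.
by apply: ereal_nondecreasing_series => // k _ _; case: (pickle_inv k).
Qed.

Lemma esumZl (k : R) f : (0 <= k)%R -> (forall i, 0 <= f i) ->
  \esum_(i in [set: I]) (k%:E * f i) = k%:E * \esum_(i in [set: I]) f i.
Proof.
move=> k0 f0; rewrite !esum_nneseries//; last by move=> i; rewrite mule_ge0.
rewrite -nneseriesZl//; last by move=> i _; case: (pickle_inv i).
by apply: eq_eseriesr => n _; case: (pickle_inv n) => //=; rewrite mule0.
Qed.

Lemma esumZr (k : R) f : (0 <= k)%R -> (forall i, 0 <= f i) ->
  \esum_(i in [set: I]) (f i * k%:E) = (\esum_(i in [set: I]) f i) * k%:E.
Proof.
move=> k0 f0; rewrite muleC -esumZl//.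
by apply: eq_esum => i _; rewrite muleC.
Qed.

Lemma le_esum_term f j : (forall i, 0 <= f i) -> f j <= \esum_(i in [set: I]) f i.
Proof.
move=> f0; rewrite -{1}(esum_set1 (f0 j)) [leLHS]esum_mkcond.
by apply: le_esum => i _; case: ifPn.
Qed.

Lemma esum_delta f j : (forall i, 0 <= f i) ->
  \esum_(i in [set: I]) ((i == j)%:R%:E * f i) = f j.
Proof.
move=> f0; rewrite -[RHS](esum_set1 (f0 j)) [RHS]esum_mkcond.
apply: eq_esum => i _; rewrite (_ : (i \in [set j]) = (i == j)).
  by case: ifPn => _; rewrite ?mul1e ?mul0e.
by apply/idP/eqP; rewrite inE.
Qed.

Section integrals.
Context {d : measure_display} {T : measurableType d}.
Variables (mu : {measure set T -> \bar R}) (D : set T).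
Hypothesis mD : measurable D.
Variable F : I -> T -> \bar R.
Hypothesis F0 : forall i x, D x -> 0 <= F i x.
Hypothesis mF : forall i, measurable_fun D (F i).

Lemma measurable_fun_esum :
  measurable_fun D (fun x => \esum_(i in [set: I]) F i x).
Proof.
apply: (@eq_measurable_fun _ _ _ _ _
  (fun x => \sum_(n <oo) oapp (F ^~ x) 0 (pickle_inv n : option I))).
  by move=> x; rewrite inE => Dx; rewrite esum_nneseries// => i; exact: F0.
have : measurable_fun D (fun x => \big[+%E/0]_(0 <= n <oo | n \in xpredT) oapp (F ^~ x) 0 (pickle_inv n : option I)).
  apply: ge0_emeasurable_sum => [k x Dx _|k _].
    by case: (pickle_inv k) => //= i; exact: F0.
  by case: (pickle_inv k) => [i|]/=; [exact: mF|exact: measurable_cst].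
by [].
Qed.

Lemma ge0_integral_esum :
  \int[mu]_(x in D) (\esum_(i in [set: I]) F i x) =
  \esum_(i in [set: I]) \int[mu]_(x in D) F i x.
Proof.
have E x : x \in D -> \esum_(i in [set: I]) F i x =
    \sum_(n <oo) oapp (F ^~ x) 0 (pickle_inv n : option I).
  by rewrite inE => Dx; rewrite esum_nneseries// => i; exact: F0.
under eq_integral do rewrite E//.
rewrite integral_nneseries//; last 2 first.
- by move=> n; case: (pickle_inv n) => [i|]/=; [exact: mF|exact: measurable_cst].
- by move=> n x Dx; case: (pickle_inv n) => [i|]//=; exact: F0.
rewrite [RHS]esum_nneseries//; last by move=> i; apply: integral_ge0 => x; exact: F0.
apply: eq_eseriesr => n _; case: (pickle_inv n) => //=; exact: integral0.
Qed.

End integrals.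

End CountableSums.

Section SumExchange.
Context {R : realType} {I J : countType}.
Local Open Scope ereal_scope.

Lemma esum_exchange (F : I -> J -> \bar R) : (forall i j, 0 <= F i j) ->
  \esum_(i in [set: I]) \esum_(j in [set: J]) F i j =
  \esum_(j in [set: J]) \esum_(i in [set: I]) F i j.
Proof.
move=> F0; rewrite !esum_esum//.
rewrite (reindex_esum ([set: J] `*`` (fun=> [set: I])) _ (fun x => (x.2, x.1)))//.
split=> //=; first by move=> [i j] [i' j'] _ _ /= [-> ->].
by move=> [i j] _; exists (j, i).
Qed.

Lemma esum_pair (F : I * J -> \bar R) : (forall x, 0 <= F x) ->
  \esum_(x in [set: I * J]) F x =
  \esum_(i in [set: I]) \esum_(j in [set: J]) F (i, j).
Proof.
move=> F0; rewrite esum_esum//.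
rewrite (_ : [set: I] `*`` (fun=> [set: J]) = setT); last by apply/seteqP; split.
by apply: eq_esum => -[].
Qed.

End SumExchange.

(** * Grids, step functions and joint measurability *)

Section JointMeasurability.
Context {d : measure_display} {T : measurableType d} {R : realType}.
Implicit Types (X : R -> T -> R) (tau : nat -> R).

(** The cell of [s] ends at the least index whose point is at or beyond [s]. Monotonicity is not
    strict, so points may repeat: the corresponding cells are empty and contribute 0. *)
Lemma sum_step (tau : nat -> R) n (c : nat -> R) s :
  {homo tau : i j / (i <= j)%N >-> i <= j} -> tau 0%N < s <= tau n ->
  exists2 k, (k < n)%N & tau k < s <= tau k.+1 /\
    \sum_(i < n) c i * (tau i < s <= tau i.+1)%R%:R = c k.
Proof.
move=> tauM /andP[s0 sn].
have ex : exists k, s <= tau k by exists n.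
pose k := ex_minn ex; have [sk kmin] : s <= tau k /\ forall j, s <= tau j -> (k <= j)%N.
  by rewrite /k; case: ex_minnP.
have kn : (k <= n)%N by exact: kmin.
have k0 : (0 < k)%N.
  by rewrite lt0n; apply/eqP => k0; move: sk; rewrite k0 leNgt s0.
have kk : k.-1.+1 = k by rewrite prednK.
have tk : tau k.-1 < s.
  by rewrite ltNge; apply/negP => /kmin; rewrite -ltnS kk ltnn.
exists k.-1; first by rewrite kk.
split; first by rewrite kk tk.
have lt : (k.-1 < n)%N by rewrite kk.
rewrite (bigD1 (Ordinal lt))//= kk tk sk mulr1 big1 ?addr0// => i /eqP ik.
have [ik'|ki'|e] := ltngtP i k.-1.
- have : tau i.+1 <= tau k.-1 by apply: tauM.
  by move=> /le_lt_trans/(_ tk); rewrite ltNge => /negbTE ->; rewrite andbF mulr0.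
- have : tau k <= tau i by apply: tauM; rewrite -kk.
  by move=> /(le_trans sk); rewrite leNgt => /negbTE ->; rewrite mulr0.
- by exfalso; apply: ik; exact: val_inj.
Qed.

(* m+1 equal steps from 0 to s followed by m+1 equal steps from s to t. *)
Definition grid2 (s t : R) (m k : nat) : R :=
  (minn k m.+1)%:R * (s / m.+1%:R) + (k - m.+1)%N%:R * ((t - s) / m.+1%:R).

Section Grid2.
Variables (s t : R) (m : nat).
Hypotheses (s0 : 0 <= s) (st : s <= t).

Let ts0 : 0 <= (t - s) / m.+1%:R. Proof. by rewrite divr_ge0// subr_ge0. Qed.

Lemma grid2_homo : {homo grid2 s t m : i j / (i <= j)%N >-> i <= j}.
Proof.
move=> i j ij; rewrite /grid2; apply: lerD; apply: ler_wpM2r.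
- exact: divr_ge0.
- by rewrite ler_nat leq_min geq_minr andbT (leq_trans (geq_minl _ _)).
- exact: ts0.
- by rewrite ler_nat leq_sub2r.
Qed.

Lemma grid20 : grid2 s t m 0 = 0.
Proof. by rewrite /grid2 min0n sub0n !mul0r addr0. Qed.

Lemma grid2_mid : grid2 s t m m.+1 = s.
Proof. by rewrite /grid2 minnn subnn mul0r addr0 mulrCA mulfV ?mulr1// pnatr_eq0. Qed.

Lemma grid2_last : grid2 s t m (m.+1 + m.+1) = t.
Proof.
rewrite /grid2 (minn_idPr _) ?leq_addr// addKn -mulrDr addrC -mulrDl subrK.
by rewrite mulrCA mulfV ?mulr1// pnatr_eq0.
Qed.

Lemma grid2_ge0 k : 0 <= grid2 s t m k.
Proof. by rewrite -grid20 grid2_homo. Qed.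

Lemma grid2_le k : (k <= m.+1 + m.+1)%N -> grid2 s t m k <= t.
Proof. by move=> h; rewrite -[leRHS]grid2_last grid2_homo. Qed.

Lemma grid2_mesh k : grid2 s t m k.+1 - grid2 s t m k <= t / m.+1%:R.
Proof.
rewrite /grid2; have [km|mk] := ltnP k m.+1.
  rewrite (minn_idPl km).
  have -> : (k.+1 - m.+1 = 0)%N by apply/eqP; rewrite subn_eq0.
  have -> : (k - m.+1 = 0)%N by apply/eqP; rewrite subn_eq0 ltnW.
  rewrite !mul0r !addr0 -mulrBl -natrB// subSnn mul1r.
  by rewrite ler_wpM2r// invr_ge0.
rewrite (minn_idPr (leqW mk)) subSn//.
rewrite opprD addrACA subrr add0r -mulrBl -natrB// subSnn mul1r.
by rewrite ler_wpM2r ?invr_ge0// lerBlDr lerDl.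
Qed.

End Grid2.

(** Only nonnegative test times are compared with [s], since processes are unconstrained at negative
    times. *)
Definition left_cont (x : R -> R) (s : R) := forall e : R, 0 < e ->
  exists2 dl : R, 0 < dl & forall r, 0 <= r -> s - dl < r -> r < s -> `|x r - x s| < e.

Definition right_cont (x : R -> R) (s : R) := forall e : R, 0 < e ->
  exists2 dl : R, 0 < dl & forall r, s <= r -> r < s + dl -> `|x r - x s| < e.

Lemma near_invn_lt (t dl : R) : 0 <= t -> 0 < dl -> \forall m \near \oo, t / m.+1%:R < dl.
Proof.
move=> t0 d0; exists (Num.truncn (t / dl)) => // m /= hm.
rewrite ltr_pdivrMr// mulrC -ltr_pdivrMr//; apply: lt_le_trans (truncnS_gt _) _.
by rewrite ler_nat ltnS.
Qed.

Section StepLimit.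
Variables (t : R) (tau : nat -> nat -> R) (n : nat -> nat).
Hypotheses (t0 : 0 <= t).
Hypothesis tauM : forall m, {homo tau m : i j / (i <= j)%N >-> i <= j}.
Hypothesis tau0 : forall m, tau m 0 = 0.
Hypothesis taun : forall m, tau m (n m) = t.
Hypothesis mesh : forall m k, tau m k.+1 - tau m k <= t / m.+1%:R.

Lemma cvg_sum_step_left (x : R -> R) s : 0 < s <= t -> left_cont x s ->
  \sum_(i < n m) x (tau m i) * (tau m i < s <= tau m i.+1)%R%:R @[m --> \oo] --> x s.
Proof.
move=> s0t xs; apply/cvgrPdist_lt => e e0; have [dl d0 xd] := xs _ e0.
near=> m.
have mdl : t / m.+1%:R < dl by near: m; exact: near_invn_lt.
have := @sum_step (tau m) (n m) (fun k => x (tau m k)) s (@tauM m).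
rewrite tau0 taun => /(_ s0t)[k _ [/andP[k1 k2] ->]].
have mk := le_lt_trans (mesh m k) mdl.
rewrite distrC xd//; first by rewrite -(tau0 m); exact: tauM.
by rewrite ltrBlDr -ltrBlDl (le_lt_trans _ mk)// lerD2r.
Unshelve. all: by end_near.
Qed.

Lemma cvg_sum_step_right (x : R -> R) s : 0 < s <= t -> right_cont x s ->
  \sum_(i < n m) x (tau m i.+1) * (tau m i < s <= tau m i.+1)%R%:R @[m --> \oo] --> x s.
Proof.
move=> s0t xs; apply/cvgrPdist_lt => e e0; have [dl d0 xd] := xs _ e0.
near=> m.
have mdl : t / m.+1%:R < dl by near: m; exact: near_invn_lt.
have := @sum_step (tau m) (n m) (fun k => x (tau m k.+1)) s (@tauM m).
rewrite tau0 taun => /(_ s0t)[k _ [/andP[k1 k2] ->]].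
have mk := le_lt_trans (mesh m k) mdl.
by rewrite distrC xd// -ltrBlDl (le_lt_trans _ mk)// lerD2l lerN2 ltW.
Unshelve. all: by end_near.
Qed.

End StepLimit.

Lemma measurable_sum_step (tau : nat -> R) n (c : nat -> T -> R) (D : set (R * T)) :
  (forall k, (k < n)%N -> measurable_fun setT (c k)) ->
  measurable_fun D (fun z : R * T =>
    \sum_(i < n) c i z.2 * (tau i < z.1 <= tau i.+1)%R%:R).
Proof.
move=> mc; apply: measurable_funTS; apply: measurable_sum => i.
apply: measurable_funM.
  by apply: measurableT_comp; [exact: mc|exact: measurable_snd].
have -> : (fun z : R * T => (tau i < z.1 <= tau i.+1)%R%:R) =
    (\1_(`]tau i, tau i.+1] : set R) : R -> R) \o fst.
  apply/funext => z /=; rewrite indicE; congr (_%:R).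
  by rewrite mem_setE in_itv.
by apply: measurableT_comp; [exact: measurable_indic|exact: measurable_fst].
Qed.

(** A left continuous process is the limit of the step processes that read it at left endpoints, and
    these are finite sums of a random variable times an indicator in time. *)
Lemma measurable_left_cont X t : 0 <= t ->
  (forall s, 0 <= s <= t -> measurable_fun setT (X s)) ->
  (forall w s, 0 < s <= t -> left_cont (X ^~ w) s) ->
  measurable_fun (`]0, t] `*` setT) (fun z : R * T => X z.1 z.2).
Proof.
move=> t0 mX cX.
pose h m (z : R * T) := \sum_(i < m.+1 + m.+1) X (grid2 t t m i) z.2 *
   (grid2 t t m i < z.1 <= grid2 t t m i.+1)%R%:R.
apply: (@measurable_fun_cvg _ _ _ _ h).
  move=> m; apply: (@measurable_sum_step _ _ (fun i => X (grid2 t t m i))) => k km.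
  by apply: mX; rewrite grid2_ge0//= grid2_le// ltnW.
move=> [s w] [/=]; rewrite in_itv/= => s0t _.
exact: (@cvg_sum_step_left t (grid2 t t) (fun m => m.+1 + m.+1)%N t0
  (fun m => @grid2_homo t t m t0 (lexx t)) (grid20 t t) (grid2_last t t)
  (fun m k => grid2_mesh m t0 (lexx t) k) (X ^~ w) s s0t (cX w s s0t)).
Qed.

Lemma measurable_right_cont X t : 0 <= t ->
  (forall s, 0 <= s <= t -> measurable_fun setT (X s)) ->
  (forall w s, 0 < s <= t -> right_cont (X ^~ w) s) ->
  measurable_fun (`]0, t] `*` setT) (fun z : R * T => X z.1 z.2).
Proof.
move=> t0 mX cX.
pose h m (z : R * T) := \sum_(i < m.+1 + m.+1) X (grid2 t t m i.+1) z.2 *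
   (grid2 t t m i < z.1 <= grid2 t t m i.+1)%R%:R.
apply: (@measurable_fun_cvg _ _ _ _ h).
  move=> m; apply: (@measurable_sum_step _ _ (fun i => X (grid2 t t m i.+1))) => k km.
  by apply: mX; rewrite grid2_ge0//= grid2_le.
move=> [s w] [/=]; rewrite in_itv/= => s0t _.
exact: (@cvg_sum_step_right t (grid2 t t) (fun m => m.+1 + m.+1)%N t0
  (fun m => @grid2_homo t t m t0 (lexx t)) (grid20 t t) (grid2_last t t)
  (fun m k => grid2_mesh m t0 (lexx t) k) (X ^~ w) s s0t (cX w s s0t)).
Qed.

Lemma measurable_section (D : set R) (f : R * T -> R) w : measurable D ->
  measurable_fun (D `*` setT) f -> measurable_fun D (fun s => f (s, w)).
Proof.
move=> mD mf; apply: (@measurable_comp _ _ _ _ _ _ (D `*` setT) f D (fun s => (s, w))) => //.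
- exact: measurableX.
- by move=> _ [s Ds <-].
- by apply: measurable_funTS; exact: pair2_measurable.
Qed.

End JointMeasurability.

Lemma Rintegral_sum {d : measure_display} {T : measurableType d} {R : realType}
    (mu : {measure set T -> \bar R}) (D : set T) (I : Type) (s : seq I)
    (f : I -> T -> R) : measurable D ->
  (forall i, mu.-integrable D (EFin \o f i)) ->
  mu.-integrable D (EFin \o (fun x => \sum_(i <- s) f i x)) /\
  \int[mu]_(x in D) (\sum_(i <- s) f i x) = \sum_(i <- s) \int[mu]_(x in D) f i x.
Proof.
move=> mD fi; elim: s => [|i s [IH1 IH2]].
  under [X in _.-integrable _ (EFin \o X)]funext do rewrite big_nil.
  split; first exact: integrable0.
  rewrite big_nil; under eq_Rintegral do rewrite big_nil.
  by rewrite /Rintegral integral0.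
under [X in _.-integrable _ (EFin \o X)]funext do rewrite big_cons.
split; first exact: rintegrableD.
rewrite big_cons -IH2 -RintegralD//; apply: eq_Rintegral => x _.
by rewrite big_cons.
Qed.

Section StepIntegral.
Variable R : realType.
Local Notation leb := (@lebesgue_measure R).

Lemma bool_norm_le1 (c : bool) : `|c%:R : R| <= 1.
Proof. by case: c; rewrite ?normr1 ?normr0. Qed.

Lemma measurable_step_fun (tau c : nat -> R) n (D : set R) :
  measurable_fun D (fun s => \sum_(i < n) c i * (tau i < s <= tau i.+1)%R%:R).
Proof.
apply: measurable_funTS; apply: measurable_sum => i.
apply: measurable_funM; first exact: measurable_cst.
have -> : (fun s : R => (tau i < s <= tau i.+1)%R%:R) =
    (\1_(`]tau i, tau i.+1] : set R) : R -> R).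
  apply/funext => s /=; rewrite indicE; congr (_%:R).
  by rewrite mem_setE in_itv.
exact: measurable_indic.
Qed.

Lemma Rintegral_step_fun (tau c : nat -> R) n r :
  {homo tau : i j / (i <= j)%N >-> i <= j} -> 0 <= tau 0 -> tau n <= r ->
  \int[leb]_(s in `]0, r]) (\sum_(i < n) c i * (tau i < s <= tau i.+1)%R%:R) =
  \sum_(i < n) c i * (tau i.+1 - tau i).
Proof.
move=> tauM tau0 taun.
have ii (i : nat) : leb.-integrable `]0, r] (EFin \o (fun s => c i * (tau i < s <= tau i.+1)%R%:R)).
  apply: (bounded_integrable_oc (M := `|c i|)).
    have := @measurable_step_fun (fun k => tau (i + k)%N) (fun=> c i) 1 `]0, r]%classic.
    apply: eq_measurable_fun => s _ /=.
    by rewrite big_ord_recl big_ord0 addr0/= addn0 addn1.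
  by move=> x _; rewrite normrM ler_piMr// bool_norm_le1.
have [_ ->] := @Rintegral_sum _ _ _ leb `]0, r]%classic _ (index_enum 'I_n)
  (fun i s => c i * (tau i < s <= tau i.+1)%R%:R) (measurable_itv _) (fun i => ii i).
apply: eq_bigr => i _.
have g0 : 0 <= tau i by rewrite (le_trans tau0)// tauM.
have g01 : tau i <= tau i.+1 by apply: tauM.
have g1 : tau i.+1 <= r by rewrite (le_trans _ taun)// tauM//; exact: ltn_ord.
rewrite (Rintegral_cat g0 (le_trans g01 g1)); last exact: ii.
rewrite (Rintegral_cat g01 g1); last first.
  apply: integrableS (ii i) => //; apply: subset_itvr.
  by rewrite bnd_simp.
have z (D : set R) (f : R -> R) : (forall s, D s -> f s = 0) -> \int[leb]_(s in D) f s = 0.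
  by move=> f0; rewrite /Rintegral integral0_eq// => x Dx; rewrite f0.
rewrite z ?add0r; last first.
  by move=> s /=; rewrite in_itv/= => /andP[_ s1]; rewrite ltNge s1 mulr0.
rewrite [X in _ + X]z ?addr0; last first.
  by move=> s /=; rewrite in_itv/= => /andP[s1 _]; rewrite (leNgt s) s1 andbF mulr0.
rewrite -(Rintegral_cst_oc (c i) g01); apply: eq_Rintegral => s.
by rewrite inE/= in_itv/= => ->; rewrite mulr1.
Qed.

End StepIntegral.

Lemma Rintegral_dominated_cvg {d : measure_display} {T : measurableType d} {R : realType}
    (mu : {measure set T -> \bar R}) (D : set T) (f_ : nat -> T -> R) (f g : T -> R) :
  measurable D -> (forall n, measurable_fun D (f_ n)) ->
  (forall x, D x -> f_ n x @[n --> \oo] --> f x) ->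
  mu.-integrable D (EFin \o g) -> (forall n x, D x -> `|f_ n x| <= g x) ->
  mu.-integrable D (EFin \o f) /\
  \int[mu]_(x in D) f_ n x @[n --> \oo] --> \int[mu]_(x in D) f x.
Proof.
move=> mD mf ff ig fg.
have mfe n : measurable_fun D (EFin \o f_ n) by exact/measurable_EFinP.
have ffe x : D x -> (EFin \o f_ n) x @[n --> \oo] --> (EFin \o f) x.
  by move=> Dx; apply: cvg_EFin; [exact: nearW|exact: ff].
have fge n x : D x -> (`|(EFin \o f_ n) x| <= (EFin \o g) x)%E.
  by move=> Dx; rewrite /= lee_fin fg.
have iF : mu.-integrable D (EFin \o f).
  apply: le_integrable ig => //.
    by apply/measurable_EFinP; apply: (measurable_fun_cvg mf ff).
  move=> x Dx /=; rewrite lee_fin (le_trans _ (ler_norm _))//.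
  rewrite -(cvg_lim (@Rhausdorff R) (cvg_norm (ff _ Dx))).
  by apply: limr_le; [apply: cvgP (cvg_norm (ff _ Dx))|apply: nearW => n; exact: fg].
split=> //; apply: fine_cvg; rewrite -[X in _ --> X]/((fine _)%:E) fineK; last exact: integrable_fin_num.
exact: (dominated_cvg mD mfe ffe _ ig fge).
Qed.

Section FubiniStrip.
Context {d : measure_display} {T : measurableType d} {R : realType}.
Variable P : probability T R.
Local Notation leb := (@lebesgue_measure R).
Local Open Scope ereal_scope.
Variable D : set R.
Hypothesis mD : measurable D.
Implicit Types f : R * T -> \bar R.

Let mDT : measurable (D `*` [set: T]). Proof. exact: measurableX. Qed.

Let restrictE f s w : (f \_ (D `*` setT)) (s, w) = ((fun s => f (s, w)) \_ D) s.
Proof. by rewrite !patchE; congr (if _ then _ else _); rewrite in_setX in_setT andbT. Qed.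

(** Extending [f] by 0 off the strip reduces this to Tonelli's theorem on the whole product. *)
Lemma tonelli_strip f : measurable_fun (D `*` setT) f ->
  (forall z, (D `*` setT) z -> 0 <= f z) ->
  \int[leb]_(s in D) \int[P]_w f (s, w) = \int[P]_w \int[leb]_(s in D) f (s, w).
Proof.
move=> mf f0.
have f0' z : 0 <= (f \_ (D `*` setT)) z.
  by rewrite patchE; case: ifPn => //; rewrite inE => /f0.
have mf' : measurable_fun setT (f \_ (D `*` setT)).
  by apply/(measurable_restrictT _ mDT).
have := @fubini_tonelli _ _ _ _ _ leb P _ mf' f0'.
under [X in _ = X -> _]eq_integral do under eq_integral do rewrite restrictE.
under [X in _ = X -> _]eq_integral do rewrite -integral_mkcond.
move=> <-; rewrite integral_mkcond; apply: eq_integral => s _.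
rewrite patchE; case: ifPn => sD.
  by apply: eq_integral => w _; rewrite restrictE patchE sD.
by rewrite integral0_eq// => w _; rewrite restrictE patchE (negbTE sD).
Qed.

Lemma measurable_tonelli_strip f : measurable_fun (D `*` setT) f ->
  (forall z, (D `*` setT) z -> 0 <= f z) ->
  measurable_fun D (fun s => \int[P]_w f (s, w)).
Proof.
move=> mf f0.
have f0' z : 0 <= (f \_ (D `*` setT)) z.
  by rewrite patchE; case: ifPn => //; rewrite inE => /f0.
have mf' : measurable_fun setT (f \_ (D `*` setT)).
  by apply/(measurable_restrictT _ mDT).
have := @measurable_fun_fubini_tonelli_F _ _ _ _ _ P _ mf' f0'.
move=> /(measurable_funS measurableT (@subsetT _ D)); apply: eq_measurable_fun.
move=> s sD; apply: eq_integral => w _; rewrite restrictE patchE.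
by rewrite sD.
Qed.

Lemma measurable_tonelli_strip2 f : measurable_fun (D `*` setT) f ->
  (forall z, (D `*` setT) z -> 0 <= f z) ->
  measurable_fun setT (fun w => \int[leb]_(s in D) f (s, w)).
Proof.
move=> mf f0.
have f0' z : 0 <= (f \_ (D `*` setT)) z.
  by rewrite patchE; case: ifPn => //; rewrite inE => /f0.
have mf' : measurable_fun setT (f \_ (D `*` setT)).
  by apply/(measurable_restrictT _ mDT).
have := @measurable_fun_fubini_tonelli_G _ _ _ _ _ leb _ mf' f0'.
apply: eq_measurable_fun => w _; rewrite [RHS]integral_mkcond.
by apply: eq_integral => s _; rewrite restrictE.
Qed.

End FubiniStrip.

(** * Continuous-time chains and the Feynman-Kac weight *)

Section TransitionFunctions.
Context {R : realType} {d : nat}.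
Local Notation I := (lattice d).
Variables (a : I -> I -> R) (p : R -> I -> I -> R).
Hypotheses (ha : is_rates a) (hp : is_transition_function a p).

Lemma rates_le1 i j : a i j <= 1.
Proof.
rewrite -lee_fin -(rates_sum1 ha i).
by apply: (@le_esum_term _ _ (fun j => (a i j)%:E)) => k; rewrite lee_fin; exact: rates_ge0.
Qed.

Lemma trans_semigroup_ge s t i j k : 0 <= s -> 0 <= t ->
  p s i k * p t k j <= p (s + t) i j.
Proof.
move=> s0 t0; rewrite -lee_fin (trans_semigroup hp)//.
apply: (@le_esum_term _ _ (fun k => (p s i k * p t k j)%:E)) => l.
by rewrite lee_fin mulr_ge0// (trans_ge0 hp).
Qed.

Lemma trans_semigroup_ge2 s t i j k l : 0 <= s -> 0 <= t -> k != l ->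
  p s i k * p t k j + p s i l * p t l j <= p (s + t) i j.
Proof.
move=> s0 t0 kl; rewrite -lee_fin (trans_semigroup hp)//.
have pos m : (0 <= (p s i m * p t m j)%:E)%E.
  by rewrite lee_fin mulr_ge0// (trans_ge0 hp).
rewrite (esumID [set k])// setTI esum_set1// EFinD leeD2l//.
rewrite -(@esum_set1 _ _ l (fun m => (p s i m * p t m j)%:E))//.
rewrite [leLHS]esum_mkcond [leRHS]esum_mkcond; apply: le_esum => m _.
case: ifPn => [|_]; last by case: ifPn.
rewrite inE => /= ->; rewrite ifT// inE; split=> //= lk.
by rewrite lk eqxx in kl.
Qed.

Lemma trans_rates_near i j e : 0 < e -> exists2 h0, 0 < h0 &
  forall h, 0 < h -> h < h0 -> `|p h i j - (i == j)%:R - h * (a i j - (i == j)%:R)| <= h * e.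
Proof.
move=> e0; have c : (p h i j - (i == j)%:R) / h @[h --> 0^'+] --> a i j - (i == j)%:R by exact: trans_rates.
move/cvgrPdist_le : c => /(_ _ e0).
move=> [h0 /= h00 H]; exists h0 => // h hp0 hh0.
have := H h; rewrite /= sub0r normrN gtr0_norm// => /(_ hh0 hp0).
rewrite -(ler_pM2l hp0) -[X in X * `|_|](gtr0_norm hp0) -normrM distrC.
by rewrite mulrBr mulrCA mulfV ?gt_eqF// mulr1.
Qed.

(** By the semigroup law [p t i i] is at least the [m]-th power of [p h i i] for [h = t / m], and
    [p h i i >= 1 - h * q], so a Bernoulli-type induction applies. Here [q] exceeds the exit rate
    [1 - a i i] by a slack [e], which is then sent to 0. *)
Lemma trans_diag_ge t i : 0 <= t -> 1 - t * (1 - a i i) <= p t i i.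
Proof.
rewrite le_eqVlt => /predU1P[<-|t0].
  by rewrite mul0r subr0 (trans_start hp) eqxx.
rewrite -subr_le0; apply: (@le0_invn _ _ t) => n.
pose e : R := n.+1%:R^-1.
have e0 : 0 < e by rewrite invr_gt0.
have [h0 h00 H] := trans_rates_near i i e0.
have q0 : 0 <= 1 - a i i by rewrite subr_ge0 rates_le1.
pose q := 1 - a i i + e; have qp : 0 < q by rewrite ltr_wpDl.
pose m := (Num.truncn (t / h0)).+1.
pose h := t / m%:R.
have m0 : 0 < m%:R :> R by rewrite ltr0n.
have hp0 : 0 < h by rewrite divr_gt0.
have hh0 : h < h0.
  by rewrite ltr_pdivrMr// mulrC -ltr_pdivrMr// truncnS_gt.
have ph : 1 - h * q <= p h i i.
  have := H h hp0 hh0; rewrite eqxx/= mulr1n ler_norml => /andP[H1 _].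
  by move: H1; rewrite /q; nra.
have key k : 1 - k%:R * (h * q) <= p (k%:R * h) i i.
  elim: k => [|k IH]; first by rewrite !mul0r subr0 (trans_start hp) eqxx.
  have kh : 0 <= k%:R * h by rewrite mulr_ge0// ltW.
  rewrite -natr1 !mulrDl !mul1r.
  apply: le_trans (trans_semigroup_ge i i i kh (ltW hp0)).
  have P1 := trans_ge0 hp i i kh; have P2 := trans_ge0 hp i i (ltW hp0).
  have X0 : 0 <= k%:R * (h * q) by rewrite !mulr_ge0// ltW.
  have Y0 : 0 <= h * q by rewrite mulr_ge0 ?ltW.
  move: IH ph X0 Y0 P1 P2.
  move: (p (k%:R * h) i i) (p h i i) (k%:R * (h * q)) (h * q) => A B x y IH ph x0 y0 A0 B0.
  (* If [x] or [y] exceeds 1 the left side is nonpositive; otherwise (1 - x)(1 - y) >= 1 - x - y. *)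
  have [y1|y1] := leP y 1; have [x1|x1] := leP x 1; nra.
have mh : m%:R * h = t by rewrite /h mulrCA mulfV ?gt_eqF// mulr1.
have := key m; rewrite mulrA mh /q -/e.
by move: (p t i i) => P1; nra.
Qed.

(** On a grid of step [h], only trajectories that sit in [i], jump once to [j] and stay there are
    counted. There are [m] possible times for the jump, each contributing about [h * a i j]; waiting
    before and after is paid for by the factor [1 - t]. *)
Lemma trans_offdiag_ge t i j : i != j -> 0 <= t <= 1 ->
  (1 - t) * (t * a i j) <= p t i j.
Proof.
move=> ij /andP[]; rewrite le_eqVlt => /predU1P[<- _|t0 t1].
  by rewrite mul0r mulr0 (trans_start hp) (negbTE ij).
rewrite -subr_le0; apply: (@le0_invn _ _ ((1 - t) * t)) => n.
pose e : R := n.+1%:R^-1.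
have e0 : 0 < e by rewrite invr_gt0.
have [h0 h00 H] := trans_rates_near i j e0.
pose m := (Num.truncn (t / h0)).+1.
pose h := t / m%:R.
have m0 : 0 < m%:R :> R by rewrite ltr0n.
have hp0 : 0 < h by rewrite divr_gt0.
have mh : m%:R * h = t by rewrite /h mulrCA mulfV ?gt_eqF// mulr1.
have hh0 : h < h0.
  by rewrite ltr_pdivrMr// mulrC -ltr_pdivrMr// truncnS_gt.
have ph : h * (a i j - e) <= p h i j.
  have := H h hp0 hh0; rewrite (negbTE ij)/= mulr0n ler_norml => /andP[H1 _].
  by move: H1; nra.
have dg s l : 0 <= s -> 1 - s <= p s l l.
  move=> s0; apply: le_trans (trans_diag_ge l s0).
  have := rates_ge0 ha l l; have := s0; nra.
have key k : (k <= m)%N -> k%:R * p h i j * (1 - k%:R * h) <= p (k%:R * h) i j.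
  elim: k => [_|k IH km]; first by rewrite !mul0r (trans_start hp) (negbTE ij).
  have kh : 0 <= k%:R * h by rewrite mulr_ge0// ltW.
  have kh1 : k%:R * h <= 1.
    by rewrite (le_trans _ t1)// -mh ler_wpM2r ?(ltW hp0)// ler_nat ltnW.
  have h1 : h <= 1.
    rewrite (le_trans _ t1)// -mh ler_peMl ?(ltW hp0)// ler1n.
    exact: leq_ltn_trans km.
  rewrite -natr1 !mulrDl !mul1r.
  apply: le_trans (trans_semigroup_ge2 i j kh (ltW hp0) ij).
  have P1 := trans_ge0 hp i j (ltW hp0); have P2 := trans_ge0 hp i j kh.
  have D1 := dg _ i kh; have D2 := dg _ j (ltW hp0).
  have {}IH := IH (ltnW km).
  have A1 : (1 - k%:R * h) * p h i j <= p (k%:R * h) i i * p h i j by rewrite ler_wpM2r.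
  have A2 : p (k%:R * h) i j * (1 - h) <= p (k%:R * h) i j * p h j j by rewrite ler_wpM2l.
  have A3 : k%:R * p h i j * (1 - k%:R * h) * (1 - h) <= p (k%:R * h) i j * (1 - h).
    by rewrite ler_wpM2r// subr_ge0.
  apply: le_trans (lerD A1 (le_trans A3 A2)).
  rewrite -subr_ge0.
  rewrite (_ : _ - _ = p h i j * (h + (k%:R * h) ^+ 2)); last by ring.
  by rewrite mulr_ge0// addr_ge0 ?sqr_ge0// ltW.
have := key m (leqnn _); rewrite mh => k1.
have k2 : (1 - t) * (t * (a i j - e)) <= p t i j.
  apply: le_trans k1; rewrite mulrC ler_wpM2r ?subr_ge0//.
  by rewrite -mh -mulrA ler_wpM2l.
by move: k2; rewrite -/e; nra.
Qed.

(** A lower bound, yet sharp to first order: summed over [j] it gives [1 - t ^+ 2], while the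
    probabilities sum to 1, so the total excess over the bound is at most [t ^+ 2]. [jump_expansion]
    exploits this. *)
Lemma trans_ge t i j : 0 <= t <= 1 ->
  (1 - t) * ((i == j)%:R + t * a i j) <= p t i j.
Proof.
move=> t01; have /andP[t0 t1] := t01.
have [<-|ij] := eqVneq i j; last by rewrite add0r trans_offdiag_ge.
apply: le_trans (trans_diag_ge i t0); rewrite mulr1n.
have := rates_ge0 ha i i; have : 0 <= t ^+ 2 by rewrite sqr_ge0.
nra.
Qed.

End TransitionFunctions.

Section ExpectationBounds.
Context {d : measure_display} {T : measurableType d} {R : realType}.
Variable P : probability T R.
Implicit Types (X Y : T -> R).

Lemma bounded_integrable X M : measurable_fun setT X ->
  (forall w, `|X w| <= M) -> P.-integrable setT (EFin \o X).
Proof.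
move=> mX XM; apply: measurable_bounded_integrable => //.
  by have /= -> := @probability_setT _ _ _ P; rewrite ltry.
exists M; split; first exact: num_real.
by move=> y My w _ /=; exact: le_trans (XM _) (ltW My).
Qed.

Lemma Rintegral_prob_cst (c : R) : \int[P]_w c = c.
Proof. by rewrite Rintegral_cst//; have /= -> := @probability_setT _ _ _ P; rewrite mulr1. Qed.

Lemma le_normr_Rintegral_prob X M : measurable_fun setT X ->
  (forall w, `|X w| <= M) -> `|\int[P]_w X w| <= M.
Proof.
move=> mX XM; have iX := bounded_integrable mX XM.
apply: le_trans (le_normr_Rintegral _ iX) _ => //.
rewrite -[leRHS](Rintegral_prob_cst); apply: le_Rintegral => //.
- exact: integrable_norm.
- by apply: (@bounded_integrable _ `|M|).
Qed.

Lemma EFin_Rintegral X : P.-integrable setT (EFin \o X) ->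
  (\int[P]_w X w)%:E = (\int[P]_w (X w)%:E)%E.
Proof. by move=> iX; rewrite fineK//; exact: integrable_fin_num. Qed.

End ExpectationBounds.

(** * Short-time expansions for a jump process on a countable set *)

Section JumpProcess.
Context {R : realType} {S : countType}.
Context {d : measure_display} {T : measurableType d}.
Variable P : probability T R.
Variables (X : R -> T -> S) (G : R -> set (set T)).
Variables (A : S -> S -> R) (q : R -> S -> S -> R).
Local Notation leb := (@lebesgue_measure R).

Hypothesis sG : forall r, 0 <= r -> sigma_algebra setT (G r).
Hypothesis Gm : forall r, 0 <= r -> G r `<=` measurable.
Hypothesis GM : forall r s, 0 <= r -> r <= s -> G r `<=` G s.
Hypothesis XG : forall r x, 0 <= r -> G r [set w | X r w = x].
Hypothesis Xrc : forall w r, 0 <= r -> exists2 dl : R, 0 < dl &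
  forall s, r <= s -> s < r + dl -> X s w = X r w.
Hypothesis A0 : forall x y, 0 <= A x y.
Hypothesis Amass : forall x, (\esum_(y in [set: S]) (A x y)%:E = (2 : R)%:E)%E.
Hypothesis q_ge : forall h x y, 0 <= h <= 1 ->
  (1 - h) ^+ 2 * ((x == y)%:R + h * A x y) <= q h x y.
Hypothesis markov : forall r h x y (Z : T -> R) M, 0 <= r -> 0 <= h ->
  measurable_wrt (G r) Z -> (forall w, 0 <= Z w <= M) ->
  (\int[P]_w (Z w * ((X r w == x)%:R * (X (r + h) w == y)%:R))%:E =
   (q h x y)%:E * \int[P]_w (Z w * (X r w == x)%:R)%:E)%E.

(** The jump part of the generator. The term [- 2 * phi] is kept apart, 2 being the common mass of
    the rows of [A], so that this operator preserves nonnegativity and is a plain [esum]. *)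
Definition gen_op (phi : S -> R) (x : S) : R :=
  fine (\esum_(y in [set: S]) (A x y * phi y)%:E).

Section gen_op.
Variables (phi : S -> R) (C : R).
Hypothesis phiC : forall x, 0 <= phi x <= C.

Let phi0 x : 0 <= phi x. Proof. by have /andP[] := phiC x. Qed.

Lemma EFin_gen_op x : (gen_op phi x)%:E = (\esum_(y in [set: S]) (A x y * phi y)%:E)%E.
Proof.
rewrite fineK// ge0_fin_numE; last first.
  by apply: esum_ge0 => y _; rewrite lee_fin mulr_ge0.
apply: (@le_lt_trans _ _ (\esum_(y in [set: S]) ((A x y)%:E * C%:E))%E).
  apply: le_esum => y _; rewrite -EFinM lee_fin ler_wpM2l//.
  by have /andP[] := phiC y.
rewrite esumZr ?Amass ?ltry//; first by have /andP[] := phiC x; exact: le_trans.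
by move=> y; rewrite lee_fin.
Qed.

Lemma gen_op_ge0 x : 0 <= gen_op phi x.
Proof. by rewrite -lee_fin EFin_gen_op; apply: esum_ge0 => y _; rewrite lee_fin mulr_ge0. Qed.

(** Exchanging [phi] for [C - phi] turns lower bounds into upper bounds. *)
Lemma gen_op_compl x : gen_op phi x + gen_op (fun y => C - phi y) x = 2 * C.
Proof.
have C0 : 0 <= C by have /andP[] := phiC x; exact: le_trans.
have p2 y : 0 <= C - phi y by have /andP[_] := phiC y; rewrite subr_ge0.
have f2 : (\esum_(y in [set: S]) (A x y * phi y)%:E + \esum_(y in [set: S]) (A x y * (C - phi y))%:E = (2 * C)%:E)%E.
  rewrite -esumD; last 2 first.
  - by move=> y _; rewrite lee_fin mulr_ge0.
  - by move=> y _; rewrite lee_fin mulr_ge0.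
  rewrite EFinM -(Amass x) -esumZr//; last by move=> y; rewrite lee_fin.
  by apply: eq_esum => y _; rewrite -EFinD -EFinM; congr (_%:E); ring.
rewrite /gen_op -fineD ?f2//.
  by rewrite -EFin_gen_op.
rewrite ge0_fin_numE; last by apply: esum_ge0 => y _; rewrite lee_fin mulr_ge0.
apply: le_lt_trans (ltry (2 * C)); rewrite -f2 leeDr//.
by apply: esum_ge0 => y _; rewrite lee_fin mulr_ge0.
Qed.

End gen_op.

Lemma gen_op_le phi C x : (forall x, 0 <= phi x <= C) -> 0 <= gen_op phi x <= 2 * C.
Proof.
move=> phiC; rewrite (gen_op_ge0 phiC)/= -(gen_op_compl phiC x) lerDl.
apply: (@gen_op_ge0 _ C) => y; have /andP[p0 p1] := phiC y.
by rewrite subr_ge0 p1 lerBlDr lerDl.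
Qed.

Lemma countable_fun_wrt r (phi : S -> R) : 0 <= r ->
  measurable_wrt (G r) (fun w => phi (X r w)).
Proof.
move=> r0 B mB; have [G0 GC GU] := sG r0.
rewrite (_ : _ @^-1` B = \bigcup_n oapp (fun x => if phi x \in B then [set w | X r w = x] else set0) set0 (pickle_inv n : option S)).
  apply: GU => n; case: (pickle_inv n) => [x|]//=; case: ifPn => // _.
  exact: XG.
apply/seteqP; split=> [w /= Bw|w [n _]].
  exists (pickle (X r w)) => //; rewrite pickleK_inv/= ifT//.
  by rewrite inE.
case: (pickle_inv n) => [x|]//=; case: ifPn => //.
by rewrite inE/= => Bx ->.
Qed.

Lemma measurable_countable_fun r (phi : S -> R) : 0 <= r ->
  measurable_fun setT (fun w => phi (X r w)).
Proof. by move=> r0; apply: (measurable_wrt_fun (Gm r0)); exact: countable_fun_wrt. Qed.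

Lemma measurable_wrt_mono r s (Z : T -> R) : 0 <= r -> r <= s ->
  measurable_wrt (G r) Z -> measurable_wrt (G s) Z.
Proof. by move=> r0 rs mZ B mB; apply: GM (mZ B mB). Qed.

Lemma state_decomposition r (F : T -> R) : 0 <= r -> measurable_fun setT F ->
  (forall w, 0 <= F w) ->
  (\int[P]_w (F w)%:E = \esum_(x in [set: S]) \int[P]_w (F w * (X r w == x)%:R)%:E)%E.
Proof.
move=> r0 mF F0; rewrite -ge0_integral_esum//; last 2 first.
- by move=> x w _; rewrite lee_fin mulr_ge0.
- move=> x; apply/measurable_EFinP; apply: measurable_funM => //.
  by have := @measurable_countable_fun r (fun y => (y == x)%:R) r0.
apply: eq_integral => w _.
rewrite -(@esum_delta _ _ (fun x => (F w)%:E) (X r w))//; last by move=> _; rewrite lee_fin.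
by apply: eq_esum => x _; rewrite muleC EFinM eq_sym.
Qed.

Section lower_bound.
Variables (r h M C : R) (Z : T -> R) (phi : S -> R).
Hypotheses (r0 : 0 <= r) (h01 : 0 <= h <= 1) (mZ : measurable_wrt (G r) Z).
Hypotheses (ZM : forall w, 0 <= Z w <= M) (phiC : forall x, 0 <= phi x <= C).

Let h0 : 0 <= h. Proof. by have /andP[] := h01. Qed.
Let Z0 w : 0 <= Z w. Proof. by have /andP[] := ZM w. Qed.
Let phi0 x : 0 <= phi x. Proof. by have /andP[] := phiC x. Qed.
Let mZT : measurable_fun setT Z.
Proof. by apply: (measurable_wrt_fun (Gm r0)); exact: mZ. Qed.
Let rh0 : 0 <= r + h. Proof. exact: addr_ge0. Qed.

Let mind s (x : S) : 0 <= s -> measurable_fun setT (fun w => (X s w == x)%:R : R).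
Proof. by move=> s0; have := @measurable_countable_fun s (fun y => (y == x)%:R) s0. Qed.

(** Summing the Markov property over the states at both times leaves [q h x y], which is bounded
    below by [q_ge]; the diagonal part of that bound yields [phi] and the rest yields
    [h * gen_op phi]. *)
Lemma jump_lower_bound :
  (((1 - h) ^+ 2)%:E * \int[P]_w (Z w * (phi (X r w) + h * gen_op phi (X r w)))%:E
  <= \int[P]_w (Z w * phi (X (r + h) w))%:E)%E.
Proof.
pose mx x := (\int[P]_w (Z w * (X r w == x)%:R)%:E)%E.
have mx0 x : (0 <= mx x)%E by apply: integral_ge0 => w _; rewrite lee_fin mulr_ge0.
have mpf : measurable_fun setT (fun w => Z w * phi (X (r + h) w)).
  by apply: measurable_funM => //; exact: measurable_countable_fun.
have E1 : (\int[P]_w (Z w * phi (X (r + h) w))%:E =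
  \esum_(x in [set: S]) \esum_(y in [set: S]) ((phi y * q h x y)%:E * mx x))%E.
  rewrite (state_decomposition r0 mpf); last by move=> w; rewrite mulr_ge0.
  apply: eq_esum => x _.
  rewrite (state_decomposition rh0); last 2 first.
  - by apply: measurable_funM => //; exact: mind.
  - by move=> w; rewrite !mulr_ge0.
  apply: eq_esum => y _.
  rewrite EFinM -muleA -(markov _ _ r0 h0 mZ ZM) -ge0_integralZl_EFin//; last 2 first.
  - by move=> w _; rewrite lee_fin !mulr_ge0.
  - apply/measurable_EFinP; apply: measurable_funM => //.
    by apply: measurable_funM => //; exact: mind.
  apply: eq_integral => w _; rewrite -EFinM; congr (_%:E).
  by have [<-|] := eqVneq (X (r + h) w) y; rewrite ?mulr1 ?mulr0//; ring.
have mg : measurable_fun setT (fun w => phi (X r w) + h * gen_op phi (X r w)).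
  by have := @measurable_countable_fun r (fun y => phi y + h * gen_op phi y) r0.
have g0 x : 0 <= phi x + h * gen_op phi x.
  by rewrite addr_ge0// mulr_ge0// (gen_op_ge0 phiC).
have E2 : (\int[P]_w (Z w * (phi (X r w) + h * gen_op phi (X r w)))%:E =
  \esum_(x in [set: S]) ((phi x + h * gen_op phi x)%:E * mx x))%E.
  rewrite (state_decomposition r0); last 2 first.
  - exact: measurable_funM.
  - by move=> w; rewrite mulr_ge0.
  apply: eq_esum => x _; rewrite -ge0_integralZl_EFin//; last 2 first.
  - by move=> w _; rewrite lee_fin mulr_ge0.
  - by apply/measurable_EFinP; apply: measurable_funM => //; exact: mind.
  apply: eq_integral => w _; rewrite -EFinM; congr (_%:E).
  by have [<-|] := eqVneq (X r w) x; rewrite ?mulr1 ?mulr0//; ring.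
rewrite E1 E2 -esumZl ?sqr_ge0//; last first.
  by move=> x; rewrite mule_ge0// lee_fin.
apply: le_esum => x _; rewrite muleA.
have mxf : mx x \is a fin_num.
  apply: integrable_fin_num => //.
  apply: (@bounded_integrable _ _ _ _ _ M).
    by apply: measurable_funM => //; exact: mind.
  move=> w; have /andP[z0 z1] := ZM w; rewrite ger0_norm ?mulr_ge0//.
  by case: (X r w == x); rewrite ?mulr1 ?mulr0//; exact: le_trans z1.
rewrite -(fineK mxf); set m := fine (mx x).
have m0 : 0 <= m by rewrite fine_ge0.
have q0 y : 0 <= q h x y.
  apply: le_trans (q_ge x y h01).
  by rewrite mulr_ge0 ?sqr_ge0// addr_ge0// mulr_ge0.
rewrite esumZr//; last by move=> y; rewrite lee_fin mulr_ge0.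
rewrite lee_wpmul2r ?lee_fin//.
rewrite EFinD (EFinM h) (EFin_gen_op phiC) -(@esum_delta _ _ (fun y => (phi y)%:E) x)//.
rewrite -[(_ * \esum_(_ in _) _)%E]esumZl//; last by move=> y; rewrite lee_fin mulr_ge0.
rewrite -esumD; last 2 first.
- by move=> y _; rewrite -EFinM lee_fin mulr_ge0.
- by move=> y _; rewrite -EFinM lee_fin !mulr_ge0.
rewrite -esumZl ?sqr_ge0//; last first.
  by move=> y; rewrite -!EFinM -EFinD lee_fin addr_ge0// !mulr_ge0.
apply: le_esum => y _; rewrite /= lee_fin.
rewrite (mulrC (phi y)) (_ : _ * _ = ((1 - h) ^+ 2 * ((x == y)%:R + h * A x y)) * phi y).
  by rewrite ler_wpM2r// q_ge.
by rewrite (eq_sym y x); ring.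
Qed.

End lower_bound.

(** Staying put has probability at least [(1 - h) ^+ 2 >= 1 - 2 * h], by the diagonal case of [q_ge]
    summed over the states at time [r]. *)
Lemma jump_prob r h : 0 <= r -> 0 <= h <= 1 ->
  \int[P]_w (X (r + h) w != X r w)%:R <= 2 * h.
Proof.
move=> r0 h01; have /andP[h0 h1] := h01; have rh0 : 0 <= r + h by rewrite addr_ge0.
have mind s (x : S) : 0 <= s -> measurable_fun setT (fun w => (X s w == x)%:R : R).
  by move=> s0; have := @measurable_countable_fun s (fun y => (y == x)%:R) s0.
have meq : measurable_fun setT (fun w => (X (r + h) w == X r w)%:R : R).
  have : measurable_fun setT (fun w => fine (\esum_(x in [set: S]) ((X r w == x)%:R * (X (r + h) w == x)%:R : R)%:E)).
    apply: measurableT_comp => //; apply: measurable_fun_esum => [x w _|x].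
      by rewrite lee_fin mulr_ge0.
    by apply/measurable_EFinP; apply: measurable_funM; exact: mind.
  apply: eq_measurable_fun => w _; rewrite -[RHS]/(fine (_%:E)).
  rewrite -(@esum_delta _ _ (fun x => ((X (r + h) w == x)%:R)%:E) (X r w)); last by move=> x; rewrite lee_fin.
  by congr fine; apply: eq_esum => x _; rewrite EFinM eq_sym.
have ieq : P.-integrable setT (EFin \o (fun w => (X (r + h) w == X r w)%:R : R)).
  apply: (@bounded_integrable _ _ _ _ _ 1) => // w.
  by case: eqP; rewrite ?normr1 ?normr0.
have lb : (1 - h) ^+ 2 <= \int[P]_w (X (r + h) w == X r w)%:R.
  rewrite -lee_fin EFin_Rintegral//.
  have one : measurable_wrt (G r) (fun=> 1 : R).
    exact: (countable_fun_wrt (fun=> 1) r0).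
  have bd (w : T) : 0 <= (1 : R) <= 1 by rewrite ler01 lexx.
  rewrite (state_decomposition r0 meq); last by [].
  have e1 : (\int[P]_w (1 : R)%:E = 1)%E.
    by rewrite -EFin_Rintegral ?Rintegral_prob_cst//; apply: (@bounded_integrable _ _ _ _ _ 1) => // w; rewrite normr1.
  have := state_decomposition r0 (measurable_cst (1 : R)) (fun w => @ler01 R).
  rewrite e1 => e2; rewrite -[leLHS]mule1 e2 -esumZl ?sqr_ge0//; last first.
    by move=> x; apply: integral_ge0 => w _; rewrite lee_fin mulr_ge0.
  apply: le_esum => x _.
  have -> : (\int[P]_w ((X (r + h) w == X r w)%:R * (X r w == x)%:R)%:E =
    \int[P]_w (1 * ((X r w == x)%:R * (X (r + h) w == x)%:R))%:E)%E.
    apply: eq_integral => w _; congr (_%:E); rewrite mul1r.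
    by have [->|] := eqVneq (X r w) x; rewrite ?mul0r ?mulr0 ?mulr1 ?mul1r.
  rewrite (markov x x r0 h0 one bd) lee_wpmul2r//.
    by apply: integral_ge0 => w _; rewrite lee_fin mulr_ge0.
  rewrite lee_fin; apply: le_trans (q_ge x x h01).
  by rewrite eqxx ler_peMr ?sqr_ge0// lerDl mulr_ge0.
rewrite (_ : \int[P]_w _ = 1 - \int[P]_w (X (r + h) w == X r w)%:R).
  have := sqr_ge0 h; move: lb; nra.
rewrite -[X in X - _](Rintegral_prob_cst P 1) -RintegralB//; last first.
  by apply: (@bounded_integrable _ _ _ _ _ 1) => // w; rewrite normr1.
by apply: eq_Rintegral => w _; case: eqP; rewrite ?subrr ?subr0.
Qed.

(** One direction is [jump_lower_bound]; the other is the same bound for [C - phi], since both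
    integrals are affine in [phi] and agree on constants. *)
Lemma jump_expansion r h M C (Z : T -> R) (phi : S -> R) :
  0 <= r -> 0 <= h <= 1 -> measurable_wrt (G r) Z -> (forall w, 0 <= Z w <= M) ->
  (forall x, 0 <= phi x <= C) ->
  `|\int[P]_w (Z w * phi (X (r + h) w)) -
    \int[P]_w (Z w * (phi (X r w) + h * (gen_op phi (X r w) - 2 * phi (X r w))))| <=
  7 * C * M * h ^+ 2.
Proof.
move=> r0 h01 mZ ZM phiC; have /andP[h0 h1] := h01.
have rh0 : 0 <= r + h by rewrite addr_ge0.
have mZT : measurable_fun setT Z by apply: (measurable_wrt_fun (Gm r0)).
have M0 : 0 <= M by have /andP[z0 z1] := ZM point; exact: le_trans z1.
have C0 : 0 <= C by have /andP[p0 p1] := phiC (X r point); exact: le_trans p1.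
have int s (f : S -> R) K : 0 <= s -> (forall x, `|f x| <= K) ->
    P.-integrable setT (EFin \o (fun w => Z w * f (X s w))).
  move=> s0 fK; apply: (@bounded_integrable _ _ _ _ _ (M * K)).
    by apply: measurable_funM => //; exact: measurable_countable_fun.
  move=> w; have /andP[z0 z1] := ZM w; rewrite normrM ler_pM//.
  by rewrite ger0_norm.
have low (f : S -> R) : (forall x, 0 <= f x <= C) ->
  \int[P]_w (Z w * (f (X r w) + h * (gen_op f (X r w) - 2 * f (X r w)))) -
  7 * C * M * h ^+ 2 <= \int[P]_w (Z w * f (X (r + h) w)).
  move=> fC.
  have f0 x : 0 <= f x by have /andP[] := fC x.
  have f1 x : f x <= C by have /andP[] := fC x.
  have g0 x : 0 <= gen_op f x by have /andP[] := gen_op_le x fC.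
  have g1 x : gen_op f x <= 2 * C by have /andP[] := gen_op_le x fC.
  have := jump_lower_bound r0 h01 mZ ZM fC.
  have i1 := @int r (fun x => f x + h * gen_op f x) (C + h * (2 * C)) r0.
  have {}i1 := i1 (fun x => _); rewrite -EFin_Rintegral; last first.
    apply: i1 => x; rewrite ger0_norm ?addr_ge0 ?mulr_ge0// lerD//.
    by rewrite ler_wpM2l.
  rewrite -EFin_Rintegral; last first.
    by apply: (@int _ f C) => // x; rewrite ger0_norm.
  rewrite -EFinM lee_fin; apply: le_trans.
  rewrite -RintegralZl//; last first.
    apply: i1 => x; rewrite ger0_norm ?addr_ge0 ?mulr_ge0// lerD//.
    by rewrite ler_wpM2l.
  have -> : 7 * C * M * h ^+ 2 = \int[P]_w (7 * C * M * h ^+ 2) by rewrite Rintegral_prob_cst.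
  have ic (K : R) : P.-integrable setT (EFin \o (fun w : T => K)).
    by apply: (@bounded_integrable _ _ _ _ _ `|K|).
  have i2 : P.-integrable setT (EFin \o (fun w => Z w * (f (X r w) + h * (gen_op f (X r w) - 2 * f (X r w))))).
    apply: (@int r (fun x => f x + h * (gen_op f x - 2 * f x)) (C + h * (2 * C + 2 * C))) => // x.
    apply: le_trans (ler_normD _ _) _; apply: lerD; first by rewrite ger0_norm.
    rewrite normrM ger0_norm//.
    rewrite ler_wpM2l//; apply: le_trans (ler_normB _ _) _.
    by rewrite !ger0_norm ?mulr_ge0// lerD// ler_wpM2l.
  rewrite -RintegralB//; apply: le_Rintegral => //.
  - by apply: eq_integrable (integrableB _ i2 (ic (7 * C * M * h ^+ 2))).
  - have i3 : P.-integrable setT (EFin \o (fun w => Z w * (f (X r w) + h * gen_op f (X r w)))).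
      apply: i1 => x; rewrite ger0_norm ?addr_ge0 ?mulr_ge0// lerD//.
      by rewrite ler_wpM2l.
    by apply: eq_integrable (integrableZl _ ((1 - h) ^+ 2) i3).
  move=> w _; have /andP[z0 z1] := ZM w.
  have := f0 (X r w); have := f1 (X r w); have := g0 (X r w); have := g1 (X r w).
  move: (f (X r w)) (gen_op f (X r w)) (Z w) z0 z1 => F1 F2 z z0 z1 F2C F20 F1C F10.
  (* Multiplying out [(1 - h) ^+ 2] leaves a second-order deficit of at most [2 * F2 <= 4 * C] times
     [z]; the constant 7 leaves room. *)
  rewrite -subr_ge0 (_ : _ - _ = h ^+ 2 * (7 * C * M - z * (2 * F2 - F1 - h * F2))); last by ring.
  apply: mulr_ge0; first exact: sqr_ge0.
  rewrite subr_ge0 (_ : 7 * C * M = M * (7 * C)); last by ring.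
  have hF : 0 <= h * F2 by exact: mulr_ge0.
  apply: (@le_trans _ _ (z * (7 * C))); first by rewrite ler_wpM2l//; lra.
  by rewrite ler_wpM2r// mulr_ge0.
have ifi : P.-integrable setT (EFin \o (fun w => Z w * phi (X (r + h) w))).
  by apply: (@int _ phi C) => // x; have /andP[p0 p1] := phiC x; rewrite ger0_norm.
have ig : P.-integrable setT (EFin \o (fun w => Z w * (phi (X r w) + h * (gen_op phi (X r w) - 2 * phi (X r w))))).
  apply: (@int r (fun x => phi x + h * (gen_op phi x - 2 * phi x)) (C + h * (2 * C + 2 * C))) => // x.
  have /andP[p0 p1] := phiC x; have /andP[g0 g1] := gen_op_le x phiC.
  apply: le_trans (ler_normD _ _) _; apply: lerD; first by rewrite ger0_norm.
    rewrite normrM ger0_norm//.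
  rewrite ler_wpM2l//; apply: le_trans (ler_normB _ _) _.
  by rewrite !ger0_norm ?mulr_ge0// lerD// ler_wpM2l.
have iC : P.-integrable setT (EFin \o (fun w => Z w * C)).
  by apply: (@int r (fun=> C) C) => // x; rewrite ger0_norm.
have phiC' x : 0 <= C - phi x <= C.
  by have /andP[p0 p1] := phiC x; rewrite subr_ge0 p1 lerBlDr lerDl.
have H1 := low _ phiC; have H2 := low _ phiC'.
have e1 : \int[P]_w (Z w * (C - phi (X (r + h) w))) =
  \int[P]_w (Z w * C) - \int[P]_w (Z w * phi (X (r + h) w)).
  by rewrite -RintegralB//; apply: eq_Rintegral => w _; rewrite mulrBr.
have e2 : \int[P]_w (Z w * (C - phi (X r w) + h * (gen_op (fun x => C - phi x) (X r w) - 2 * (C - phi (X r w))))) =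
  \int[P]_w (Z w * C) - \int[P]_w (Z w * (phi (X r w) + h * (gen_op phi (X r w) - 2 * phi (X r w)))).
  rewrite -RintegralB//; apply: eq_Rintegral => w _.
  have -> : gen_op (fun x => C - phi x) (X r w) = 2 * C - gen_op phi (X r w).
    by rewrite -(gen_op_compl phiC (X r w)) [in RHS]addrC addKr.
  by ring.
rewrite e1 e2 in H2; rewrite ler_norml; apply/andP; split; lra.
Qed.

Section LocalTime.
Variable b : S -> bool.

(** The half-open interval lets occupation times be concatenated at an intermediate time. *)
Definition occup (r : R) (w : T) : R := \int[leb]_(s in `]0, r]) (b (X s w))%:R.

Lemma right_cont_fun (f : S -> R) w r : 0 <= r -> right_cont (fun s => f (X s w)) r.
Proof.
move=> r0 e e0; have [dl d0 H] := Xrc w r0; exists dl => // s rs sd.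
by rewrite H// subrr normr0.
Qed.

Lemma measurable_path (f : S -> R) (r : R) w : 0 <= r ->
  measurable_fun `]0, r] (fun s => f (X s w)).
Proof.
move=> r0.
have := @measurable_right_cont _ _ R (fun s w => f (X s w)) r r0.
have h1 s : 0 <= s <= r -> measurable_fun setT (fun w => f (X s w)).
  by move=> /andP[s0 _]; exact: measurable_countable_fun.
have h2 w' s : 0 < s <= r -> right_cont (fun s => f (X s w')) s.
  by move=> /andP[s0 _]; apply: right_cont_fun; exact: ltW.
by move=> /(_ h1 h2)/(measurable_section w (measurable_itv _)).
Qed.

Lemma occup_integrable s r w : 0 <= s -> 0 <= r ->
  leb.-integrable `]s, r] (EFin \o (fun x => (b (X x w))%:R : R)).
Proof.
move=> s0 r0; apply: (bounded_integrable_oc (M := 1)); last by move=> x _; exact: bool_norm_le1.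
apply: measurable_funS (measurable_path (fun x => (b x)%:R) w r0) => //.
by move=> x /=; rewrite !in_itv/= => /andP[sx ->]; rewrite (le_lt_trans s0).
Qed.

Lemma occupD r h w : 0 <= r -> 0 <= h ->
  occup (r + h) w = occup r w + \int[leb]_(s in `]r, r + h]) (b (X s w))%:R.
Proof.
move=> r0 h0; rewrite /occup (Rintegral_cat r0) ?lerDl//.
exact: occup_integrable (addr_ge0 r0 h0).
Qed.

Lemma occup_incr r h w : 0 <= r -> 0 <= h ->
  0 <= \int[leb]_(s in `]r, r + h]) (b (X s w))%:R <= h.
Proof.
move=> r0 h0; apply/andP; split; first exact: Rintegral_ge0.
rewrite -[leRHS](_ : \int[leb]_(s in `]r, r + h]) (1 : R) = _); last first.
  by rewrite (Rintegral_cst_oc 1) ?lerDl// mul1r addrC addKr.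
apply: le_Rintegral => //.
- exact: occup_integrable (addr_ge0 r0 h0).
- by apply: (bounded_integrable_oc (M := 1)) => // x _; rewrite normr1.
- by move=> x _; case: b.
Qed.

Lemma occup0 w : occup 0 w = 0.
Proof. exact: Rintegral_oc_set0. Qed.

Lemma occup_bound r w : 0 <= r -> 0 <= occup r w <= r.
Proof.
by move=> r0; have := @occup_incr 0 r w (lexx _) r0; rewrite add0r.
Qed.

(** Riemann sums with right endpoints converge to the occupation time along right continuous paths,
    and their grid points all lie in [[0, r]], so each sum is measurable for [G r]. *)
Lemma measurable_wrt_occup r : 0 <= r -> measurable_wrt (G r) (occup r).
Proof.
move=> r0; apply/(measurable_wrtP (sG r0)).
pose tau := grid2 r r.
pose F m w := \sum_(i < m.+1 + m.+1) (b (X (tau m i.+1) w))%:R * (tau m i.+1 - tau m i).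
have g2 m k : (k <= m.+1 + m.+1)%N -> tau m k <= r by move=> h; exact: grid2_le.
have tM m : {homo tau m : i j / (i <= j)%N >-> i <= j} by exact: grid2_homo.
apply: (@measurable_fun_cvg _ (g_sigma_algebraType (G r)) R setT F).
  move=> m; apply: measurable_sum => i; apply: measurable_funM; last exact: measurable_cst.
  apply/(measurable_wrtP (sG r0)).
  have g1 : 0 <= tau m i.+1 by exact: grid2_ge0.
  apply: (measurable_wrt_mono g1 (g2 m i.+1 (ltn_ord i))).
  exact: (countable_fun_wrt (fun x => (b x)%:R)).
move=> w _.
pose st m s := \sum_(i < m.+1 + m.+1) (b (X (tau m i.+1) w))%:R * (tau m i < s <= tau m i.+1)%R%:R : R.
rewrite (_ : (fun m => F m w) = (fun m => \int[leb]_(s in `]0, r]) st m s)); last first.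
  apply/funext => m; rewrite (@Rintegral_step_fun _ (tau m) (fun k => (b (X (tau m k.+1) w))%:R))//.
  - by rewrite /tau grid20.
  - by rewrite /tau grid2_last.
have [] // := @Rintegral_dominated_cvg _ _ _ leb `]0, r]%classic st (fun s => (b (X s w))%:R) (fun=> 1).
- by move=> m; exact: (@measurable_step_fun _ (tau m) (fun k => (b (X (tau m k.+1) w))%:R)).
- move=> s /=; rewrite in_itv/= => sr; have /andP[s0 _] := sr.
  exact: (@cvg_sum_step_right _ r tau (fun m => m.+1 + m.+1)%N r0 tM (grid20 r r) (grid2_last r r)
    (fun m k => grid2_mesh m r0 (lexx r) k) _ s sr (right_cont_fun (fun x => (b x)%:R) w (ltW s0))).
- by apply: (bounded_integrable_oc (M := 1)) => // x _; rewrite normr1.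
- move=> m s /=; rewrite in_itv/= => sr.
  have := @sum_step _ (tau m) (m.+1 + m.+1)%N (fun k => (b (X (tau m k.+1) w))%:R) s (tM m).
  rewrite {1}/tau grid20 {1}/tau grid2_last => /(_ sr)[k _ [_ e]].
  by rewrite /st e bool_norm_le1.
Qed.

Lemma measurable_occup r : 0 <= r -> measurable_fun setT (occup r).
Proof. by move=> r0; apply: (measurable_wrt_fun (Gm r0)); exact: measurable_wrt_occup. Qed.

Lemma jump_measurable_neq r s : 0 <= r -> 0 <= s ->
  measurable_fun setT (fun w => (X s w != X r w)%:R : R).
Proof.
move=> r0 s0.
have mind s' (x : S) : 0 <= s' -> measurable_fun setT (fun w => (X s' w == x)%:R : R).
  by move=> s'0; have := @measurable_countable_fun s' (fun y => (y == x)%:R) s'0.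
have : measurable_fun setT (fun w => 1 - fine (\esum_(x in [set: S]) ((X r w == x)%:R * (X s w == x)%:R : R)%:E)).
  apply: measurable_funB => //.
  apply: measurableT_comp => //; apply: measurable_fun_esum => [x w _|x].
    by rewrite lee_fin mulr_ge0.
  by apply/measurable_EFinP; apply: measurable_funM; exact: mind.
apply: eq_measurable_fun => w _.
rewrite (_ : (\esum_(x in _) _)%E = ((X s w == X r w)%:R)%:E); last first.
  rewrite -(@esum_delta _ _ (fun x => ((X s w == x)%:R)%:E) (X r w)); last by move=> x; rewrite lee_fin.
  by apply: eq_esum => x _; rewrite EFinM eq_sym.
by case: eqP; rewrite /= ?subrr ?subr0.
Qed.

(* The integrand is at most the time spent away from X_r during ]r, r+h]. *)
Lemma occup_increment r h : 0 <= r -> 0 <= h <= 1 ->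
  \int[P]_w `|occup (r + h) w - occup r w - h * (b (X r w))%:R| <= 2 * h ^+ 2.
Proof.
move=> r0 h01; have /andP[h0 h1] := h01; have rh0 : 0 <= r + h by rewrite addr_ge0.
have mb : measurable_fun setT (fun w => (b (X r w))%:R : R).
  exact: (@measurable_countable_fun r (fun x => (b x)%:R)).
pose N (z : R * T) : R := (X z.1 z.2 != X r z.2)%:R.
have sub : `]r, r + h] `<=` `]0, r + h].
  by move=> x /=; rewrite !in_itv/= => /andP[rx ->]; rewrite (le_lt_trans r0).
have mN : measurable_fun (`]r, r + h] `*` setT) N.
  apply: (@measurable_funS _ _ _ _ (`]0, r + h] `*` setT)).
  - exact: measurableX.
  - by move=> [x w] [/= /sub].
  apply: (@measurable_right_cont _ _ R (fun s w => (X s w != X r w)%:R) (r + h) rh0).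
    by move=> s /andP[s0 _]; exact: jump_measurable_neq.
  move=> w s /andP[s0 _] e e0; have [dl d0 H] := Xrc w (ltW s0); exists dl => // s' ss' s'd.
  by rewrite H// subrr normr0.
have pt w : `|occup (r + h) w - occup r w - h * (b (X r w))%:R| <=
    \int[leb]_(s in `]r, r + h]) N (s, w).
  rewrite occupD// [X in X - _ - _]addrC addrK.
  have hr : h * (b (X r w))%:R = \int[leb]_(s in `]r, r + h]) (b (X r w))%:R.
    by rewrite Rintegral_cst_oc ?lerDl// mulrC (addrC r) addrK.
  have i1 := occup_integrable w r0 rh0.
  have i2 : leb.-integrable `]r, r + h] (EFin \o (fun=> (b (X r w))%:R : R)).
    by apply: (bounded_integrable_oc (M := 1)) => // x _; exact: bool_norm_le1.
  have i3 := rintegrableB (measurable_oc r (r + h)) i1 i2.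
  rewrite hr -RintegralB//; apply: le_trans (le_normr_Rintegral _ i3) _ => //.
  apply: le_Rintegral => //.
  - exact: integrable_norm.
  - apply: (bounded_integrable_oc (M := 1)); last by move=> x _; exact: bool_norm_le1.
    exact: (measurable_section w (measurable_itv _) mN).
  move=> s _; rewrite /N/=; have [->|_] := eqVneq (X s w) (X r w).
    by rewrite subrr normr0.
  by case: (b (X s w)); case: (b (X r w)); rewrite ?subrr ?subr0 ?sub0r ?normr0 ?normrN ?normr1.
have iL : P.-integrable setT (EFin \o (fun w => `|occup (r + h) w - occup r w - h * (b (X r w))%:R|)).
  apply: (@bounded_integrable _ _ _ _ _ (2 * h)).
    apply: measurableT_comp => //; apply: measurable_funB; last exact: measurable_funM.
    by apply: measurable_funB; exact: measurable_occup.
  move=> w; rewrite normr_id occupD// [X in X - _ - _]addrC addrK.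
  have /andP[oc0 oc1] := occup_incr w r0 h0.
  rewrite (le_trans (ler_normB _ _))// (ger0_norm oc0) normrM (ger0_norm h0).
  by rewrite mulr_natl mulr2n lerD// ler_piMr// bool_norm_le1.
rewrite -lee_fin EFin_Rintegral//.
have mN' : measurable_fun (`]r, r + h] `*` setT) (EFin \o N) by exact/measurable_EFinP.
have N0 z : (`]r, r + h] `*` [set: T]) z -> (0 <= (EFin \o N) z)%E by rewrite lee_fin.
have step1 : (\int[P]_w `|occup (r + h) w - occup r w - h * (b (X r w))%:R|%:E <=
    \int[P]_w \int[leb]_(s in `]r, (r + h)%R]) (EFin \o N) (s, w))%E.
  apply: ge0_le_integral => //.
  - by have /integrableP[] := iL.
  - exact: (measurable_tonelli_strip2 (measurable_itv _) mN' N0).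
  move=> w _; apply: (@le_trans _ _ (\int[leb]_(s in `]r, r + h]) N (s, w))%:E).
    by rewrite lee_fin.
  rewrite fineK//; apply: integrable_fin_num => //.
  apply: (bounded_integrable_oc (M := 1)); last by move=> x _; exact: bool_norm_le1.
  exact: (measurable_section w (measurable_itv _) mN).
apply: (le_trans step1).
(* After the exchange the integrand in time is P(X_s <> X_r) <= 2 (s - r), which is at most
   [2 * h]. *)
rewrite -(tonelli_strip P (measurable_itv _) mN' N0).
have step2 : (\int[leb]_(s in `]r, (r + h)%R]) (2 * h)%:E <= (2 * h ^+ 2)%:E)%E.
  rewrite integral_cst//= lebesgue_itv_oc ?lerDl// -EFinM lee_fin.
  by rewrite addrC addKr expr2 mulrA.
apply: le_trans step2; apply: ge0_le_integral => //.
- by move=> s _; apply: integral_ge0 => w _; rewrite lee_fin.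
- exact: (measurable_tonelli_strip P (measurable_itv _) mN' N0).
move=> s /=; rewrite in_itv/= => /andP[rs srh].
have s0 : 0 <= s by rewrite (le_trans r0)// ltW.
rewrite -[leLHS]EFin_Rintegral; last first.
  apply: (@bounded_integrable _ _ _ _ _ 1); first exact: jump_measurable_neq.
  by move=> w; exact: bool_norm_le1.
rewrite lee_fin; apply: (@le_trans _ _ (2 * (s - r))).
  have := @jump_prob r (s - r) r0; rewrite (addrC r (s - r)) subrK; apply.
  by rewrite subr_ge0 (ltW rs)/= (le_trans _ h1)// lerBlDr addrC.
by rewrite ler_wpM2l// lerBlDl.
Qed.

Section FeynmanKac.
Variables (lam c : R).
Hypothesis c2 : 2 + `|lam| <= c.

(** The Feynman-Kac weight for the potential [lam * b], with an extra growth rate [c]. Since [c] is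
    at least 2 + |lam|, the generator [fk_op] of the weighted process preserves nonnegativity. *)
Definition fk_weight r w : R := expR (lam * occup r w + c * r).

Definition fk_op (phi : S -> R) (x : S) : R :=
  gen_op phi x + (lam * (b x)%:R + (c - 2)) * phi x.

Lemma fk_op_ge0 phi C x : (forall x, 0 <= phi x <= C) ->
  0 <= fk_op phi x <= 2 * C + (`|lam| + c) * C.
Proof.
move=> phiC; have /andP[p0 p1] := phiC x; have /andP[g0 g1] := gen_op_le x phiC.
have l0 : 0 <= `|lam| by [].
have la : - `|lam| <= lam <= `|lam| by rewrite -ler_norml.
have C0 : 0 <= C by exact: le_trans p1.
have k0 : 0 <= lam * (b x)%:R + (c - 2).
  by have := c2; case: (b x); rewrite ?mulr1n ?mulr0n; move: la => /andP[]; lra.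
have k1 : lam * (b x)%:R + (c - 2) <= `|lam| + c.
  by case: (b x); rewrite ?mulr1n ?mulr0n; move: la => /andP[]; lra.
apply/andP; split; first by rewrite addr_ge0// mulr_ge0.
rewrite /fk_op lerD//; exact: ler_pM.
Qed.

Let c0 : 0 <= c. Proof. by apply: le_trans c2; rewrite addr_ge0. Qed.

Lemma fk_weight_bound T0 r w : 0 <= r <= T0 ->
  0 <= fk_weight r w <= expR ((`|lam| + c) * T0).
Proof.
move=> /andP[r0 rT]; rewrite expR_ge0/= ler_expR mulrDl.
have /andP[oc0 oc1] := occup_bound w r0.
rewrite lerD//; last by rewrite ler_wpM2l.
apply: le_trans (ler_norm _) _; rewrite normrM (ger0_norm oc0).
by rewrite ler_wpM2l// (le_trans oc1).
Qed.

Lemma measurable_wrt_fk_weight r : 0 <= r -> measurable_wrt (G r) (fk_weight r).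
Proof.
move=> r0; apply/(measurable_wrtP (sG r0)).
have /(measurable_wrtP (sG r0)) mo := measurable_wrt_occup r0.
apply: measurableT_comp; first exact: measurable_expR.
by apply: measurable_funD => //; apply: measurable_funM.
Qed.

(** The bounds [1 + x <= expR x] and [1 - x <= expR (- x)] combine to 0 <= e^x - 1 - x <= x (e^x -
    1), and the last product is at most x^2 e^|x| for either sign of [x]. *)
Lemma expR_second_order (x : R) : `|expR x - 1 - x| <= x ^+ 2 * expR `|x|.
Proof.
have h1 : 1 + x <= expR x := expR_ge1Dx x.
have h2 : 1 - x <= expR (- x) := expR_ge1Dx (- x).
have E : expR x * expR (- x) = 1 by rewrite expRxMexpNx_1.
have e0 : 0 < expR x := expR_gt0 x.
have h3 : expR x - 1 <= x * expR x.
  by have := ler_wpM2l (ltW e0) h2; rewrite E; nra.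
have hx : expR x <= expR `|x| by rewrite ler_expR ler_norm.
have ha1 : 1 <= expR `|x| by rewrite -expR0 ler_expR.
rewrite ger0_norm; last by lra.
apply: (@le_trans _ _ (x * (expR x - 1))); first by nra.
have [x0|x0] := leP 0 x.
  by have := sqr_ge0 x; nra.
have : x <= expR x - 1 by lra.
have := sqr_ge0 x; nra.
Qed.

Lemma fk_pointwise (M C K h y xi bx f f' g dn : R) : 0 <= y <= M -> 0 <= f' <= C -> 0 <= f <= C ->
  0 <= h <= 1 -> `|xi| <= K * h -> 0 <= K -> `|lam| + c <= K -> 0 <= bx <= 1 ->
  `|f' - f| <= C * dn ->
  `|y * (expR xi * f') - y * f - h * (y * (g + (lam * bx + (c - 2)) * f)) -
    (y * f' - y * (f + h * (g - 2 * f)))| <=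
  M * C * (K ^+ 2 * expR K * h ^+ 2) + M * C * `|xi - h * (lam * bx + c)| + M * (K * h * (C * dn)).
Proof.
move=> /andP[y0 yM] /andP[f'0 f'C] /andP[f0 fC] /andP[h0 h1] xiK K0 lK /andP[b0 b1] ff.
have -> : y * (expR xi * f') - y * f - h * (y * (g + (lam * bx + (c - 2)) * f)) -
    (y * f' - y * (f + h * (g - 2 * f))) =
  y * f' * (expR xi - 1 - xi) + y * f' * (xi - h * (lam * bx + c)) +
  y * (h * (lam * bx + c) * (f' - f)) by ring.
have M0 : 0 <= M by exact: le_trans yM.
have C0 : 0 <= C by exact: le_trans fC.
have yf : `|y * f'| <= M * C by rewrite normrM !ger0_norm// ler_pM.
apply: le_trans (ler_normD _ _) _; apply: lerD.
  apply: le_trans (ler_normD _ _) _; apply: lerD; rewrite normrM ler_pM//.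
  apply: le_trans (expR_second_order _) _; rewrite -[X in X <= _]mulrC.
  rewrite -[leRHS]mulrA -[leRHS]mulrCA ler_pM ?expR_ge0 ?sqr_ge0//.
    rewrite ler_expR (le_trans xiK)// ler_piMr//.
  rewrite -exprMn -(real_normK (num_real xi)) ler_pXn2r ?nnegrE// mulr_ge0//.
rewrite normrM ler_pM ?(ger0_norm y0)// normrM ler_pM// normrM (ger0_norm h0) mulrC ler_wpM2r//.
apply: le_trans (ler_normD _ _) _; apply: le_trans lK.
rewrite (ger0_norm c0) lerD2r normrM ler_piMr// ger0_norm//.
Qed.

Lemma fk_derivative_error T0 C phi : 0 <= T0 -> (forall x, 0 <= phi x <= C) ->
  exists2 K : R, 0 <= K & forall r h, 0 <= r -> 0 <= h <= 1 -> r + h <= T0 ->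
  `|\int[P]_w (fk_weight (r + h) w * phi (X (r + h) w)) -
    \int[P]_w (fk_weight r w * phi (X r w)) -
    h * \int[P]_w (fk_weight r w * fk_op phi (X r w))| <= K * h ^+ 2.
Proof.
move=> T00 phiC.
have C0 : 0 <= C by have /andP[p0 p1] := phiC (X 0 point); exact: le_trans p1.
pose M := expR ((`|lam| + c) * T0); have M0 : 0 <= M by exact: expR_ge0.
pose K := `|lam| + c; have K0 : 0 <= K by rewrite addr_ge0.
(* The summands bound, in order, the Taylor remainder, the occupation error through
   [occup_increment], the jump term through [jump_prob], and the error of [jump_expansion]. *)
pose Kt := M * C * (K ^+ 2 * expR K) + M * C * (`|lam| * 2) + M * (K * (C * 2)) + 7 * C * M.
have Kt0 : 0 <= Kt by rewrite /Kt !addr_ge0// !mulr_ge0// ?expR_ge0.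
exists Kt => // r h r0 h01 rhT; have /andP[h0 h1] := h01.
have rh0 : 0 <= r + h by rewrite addr_ge0.
have rT : 0 <= r <= T0 by rewrite r0 (le_trans _ rhT)// lerDl.
have rhT' : 0 <= r + h <= T0 by rewrite rh0.
have bw w := fk_weight_bound w rT; have bw' w := fk_weight_bound w rhT'.
have mw := measurable_wrt_fk_weight r0.
have int s (f : S -> R) B : 0 <= s <= T0 -> (forall x, `|f x| <= B) ->
    P.-integrable setT (EFin \o (fun w => fk_weight s w * f (X s w))).
  move=> sT fB; have /andP[s0 _] := sT.
  apply: (@bounded_integrable _ _ _ _ _ (M * B)).
    apply: measurable_funM; last exact: measurable_countable_fun.
    by apply: (measurable_wrt_fun (Gm s0)); exact: measurable_wrt_fk_weight.
  move=> w; have /andP[z0 z1] := fk_weight_bound w sT; rewrite normrM ler_pM//.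
  by rewrite ger0_norm.
have exp := jump_expansion r0 h01 mw bw phiC.
pose Q w := fk_weight (r + h) w * phi (X (r + h) w) - fk_weight r w * phi (X r w) -
  h * (fk_weight r w * fk_op phi (X r w)).
pose Q' w := fk_weight r w * phi (X (r + h) w) -
  fk_weight r w * (phi (X r w) + h * (gen_op phi (X r w) - 2 * phi (X r w))).
have nphi x : `|phi x| <= C by have /andP[p0 p1] := phiC x; rewrite ger0_norm.
have i1 : P.-integrable setT (EFin \o (fun w => fk_weight (r + h) w * phi (X (r + h) w))).
  exact: int nphi.
have i2 : P.-integrable setT (EFin \o (fun w => fk_weight r w * phi (X r w))).
  exact: int nphi.
have i3 : P.-integrable setT (EFin \o (fun w => fk_weight r w * fk_op phi (X r w))).
  apply: (int r (fk_op phi) (2 * C + (`|lam| + c) * C)) => // x.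
  by have /andP[q0 q1] := fk_op_ge0 x phiC; rewrite ger0_norm.
have mX := measurable_countable_fun phi rh0.
have mwT : measurable_fun setT (fk_weight r) by apply: (measurable_wrt_fun (Gm r0)).
have i4 : P.-integrable setT (EFin \o (fun w => fk_weight r w * phi (X (r + h) w))).
  apply: (@bounded_integrable _ _ _ _ _ (M * C)); first exact: measurable_funM.
  by move=> w; have /andP[z0 z1] := bw w; rewrite normrM ler_pM// ger0_norm.
have i5 : P.-integrable setT (EFin \o (fun w => fk_weight r w * (phi (X r w) + h * (gen_op phi (X r w) - 2 * phi (X r w))))).
  apply: (int r (fun x => phi x + h * (gen_op phi x - 2 * phi x)) (C + h * (2 * C + 2 * C))) => // x.
  have /andP[g0 g1] := gen_op_le x phiC.
  apply: le_trans (ler_normD _ _) _; apply: lerD => //.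
  rewrite normrM ger0_norm// ler_wpM2l//; apply: le_trans (ler_normB _ _) _.
  rewrite ger0_norm// lerD// normrM ger0_norm// ler_wpM2l//.
have i6 := rintegrableZl measurableT h i3.
have iQ := rintegrableB measurableT (rintegrableB measurableT i1 i2) i6.
have iQ' := rintegrableB measurableT i4 i5.
have i12 := rintegrableB measurableT i1 i2.
have eQ : \int[P]_w (fk_weight (r + h) w * phi (X (r + h) w)) -
    \int[P]_w (fk_weight r w * phi (X r w)) -
    h * \int[P]_w (fk_weight r w * fk_op phi (X r w)) = \int[P]_w Q w.
  by rewrite -RintegralZl// -RintegralB// -RintegralB.
have eQ' : \int[P]_w (fk_weight r w * phi (X (r + h) w)) -
    \int[P]_w (fk_weight r w * (phi (X r w) + h * (gen_op phi (X r w) - 2 * phi (X r w)))) = \int[P]_w Q' w.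
  by rewrite -RintegralB.
rewrite eQ (_ : \int[P]_w Q w = \int[P]_w (Q w - Q' w) + \int[P]_w Q' w); last first.
  by rewrite (@RintegralB _ _ _ P setT Q Q')// subrK.
rewrite eQ' in exp.
rewrite /Kt mulrDl; apply: le_trans (ler_normD _ _) _; apply: lerD => //.
have iQQ := rintegrableB measurableT iQ iQ'.
apply: le_trans (le_normr_Rintegral _ iQQ) _ => //.
pose dn w : R := (X (r + h) w != X r w)%:R.
pose dl w := `|occup (r + h) w - occup r w - h * (b (X r w))%:R|.
have idn : P.-integrable setT (EFin \o dn).
  apply: (@bounded_integrable _ _ _ _ _ 1); first exact: jump_measurable_neq.
  by move=> w; exact: bool_norm_le1.
have mb : measurable_fun setT (fun w => (b (X r w))%:R : R).
  exact: (@measurable_countable_fun r (fun x => (b x)%:R)).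
have occ w : 0 <= occup (r + h) w - occup r w <= h.
  by rewrite occupD// [X in X - _]addrC addrK; exact: occup_incr.
have idl : P.-integrable setT (EFin \o dl).
  apply: (@bounded_integrable _ _ _ _ _ (2 * h)).
    apply: measurableT_comp => //; apply: measurable_funB; last exact: measurable_funM.
    by apply: measurable_funB; exact: measurable_occup.
  move=> w; rewrite normr_id; have /andP[oc0 oc1] := occ w.
  rewrite (le_trans (ler_normB _ _))// (ger0_norm oc0) normrM (ger0_norm h0).
  by rewrite mulr_natl mulr2n lerD// ler_piMr// bool_norm_le1.
have idn' : P.-integrable setT (EFin \o (fun w => M * (K * h * (C * dn w)))).
  by apply: eq_integrable (integrableZl _ (M * (K * h * C)) idn) => // w _; rewrite /= !mulrA.
have idl' : P.-integrable setT (EFin \o (fun w => M * C * (`|lam| * dl w))).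
  by apply: eq_integrable (integrableZl _ (M * C * `|lam|) idl) => // w _; rewrite /= !mulrA.
have ic (k : R) : P.-integrable setT (EFin \o (fun w : T => k)).
  by apply: (@bounded_integrable _ _ _ _ _ `|k|).
pose k1 := M * C * (K ^+ 2 * expR K * h ^+ 2).
have ib := rintegrableD measurableT (rintegrableD measurableT (ic k1) idl') idn'.
apply: (@le_trans _ _ (\int[P]_w (k1 + M * C * (`|lam| * dl w) + M * (K * h * (C * dn w))))).
  apply: le_Rintegral => //; first exact: integrable_norm.
  move=> w _; pose xi := lam * (occup (r + h) w - occup r w) + c * h.
  have -> : Q w - Q' w = fk_weight r w * (expR xi * phi (X (r + h) w)) - fk_weight r w * phi (X r w) -
     h * (fk_weight r w * (gen_op phi (X r w) + (lam * (b (X r w))%:R + (c - 2)) * phi (X r w))) -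
    (fk_weight r w * phi (X (r + h) w) - fk_weight r w * (phi (X r w) + h * (gen_op phi (X r w) - 2 * phi (X r w)))).
    rewrite /Q /Q' /fk_op (_ : fk_weight (r + h) w = fk_weight r w * expR xi) ?mulrA//.
    by rewrite /fk_weight -expRD; congr expR; rewrite /xi; ring.
  have -> : `|lam| * dl w = `|xi - h * (lam * (b (X r w))%:R + c)|.
    by rewrite /dl -normrM; congr `|_|; rewrite /xi; ring.
  have /andP[oc0 oc1] := occ w.
  apply: fk_pointwise => //.
  - rewrite /xi /K mulrDl; apply: le_trans (ler_normD _ _) _; apply: lerD.
      by rewrite normrM ler_wpM2l// ger0_norm.
    by rewrite ger0_norm// mulr_ge0.
  - by case: (b _); rewrite ?mulr0n ?mulr1n ?ler01 ?lexx.
  - rewrite /dn; have [->|_] := eqVneq (X (r + h) w) (X r w).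
      by rewrite subrr normr0 mulr0.
    have /andP[p0 p1] := phiC (X (r + h) w); have /andP[p2 p3] := phiC (X r w).
    rewrite mulr1 ler_norml lerBlDr lerBrDr; apply/andP; split.
      by rewrite (le_trans _ p0)// addrC subr_le0.
    by rewrite (le_trans p1)// lerDl.
have iadd := rintegrableD measurableT (ic k1) idl'.
rewrite RintegralD// RintegralD// Rintegral_prob_cst.
have -> : \int[P]_w (M * C * (`|lam| * dl w)) = M * C * `|lam| * \int[P]_w dl w.
  by rewrite -RintegralZl//; apply: eq_Rintegral => w _; rewrite !mulrA.
have -> : \int[P]_w (M * (K * h * (C * dn w))) = M * (K * h * C) * \int[P]_w dn w.
  by rewrite -RintegralZl//; apply: eq_Rintegral => w _; rewrite !mulrA.
have Dl := occup_increment r0 h01; have Dn := jump_prob r0 h01.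
rewrite [leRHS]mulrDl [X in _ <= X + _]mulrDl; apply: lerD; first apply: lerD.
- by rewrite /k1 !mulrA.
- rewrite (_ : M * C * (`|lam| * 2) * h ^+ 2 = M * C * `|lam| * (2 * h ^+ 2)); last by ring.
  by rewrite ler_wpM2l// !mulr_ge0.
- rewrite (_ : M * (K * (C * 2)) * h ^+ 2 = M * (K * h * C) * (2 * h)); last by ring.
  by rewrite ler_wpM2l// !mulr_ge0.
Qed.

(** The first-order expansion is integrated by [Rintegral_of_derivative_error]. The required
    Lipschitz bound on the derivative comes from the same expansion for [fk_op phi], which is again
    nonnegative and bounded. *)
Lemma fk_equation T0 C phi : 0 <= T0 -> (forall x, 0 <= phi x <= C) ->
  leb.-integrable `]0, T0] (EFin \o (fun s => \int[P]_w (fk_weight s w * fk_op phi (X s w)))) /\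
  \int[P]_w (fk_weight T0 w * phi (X T0 w)) =
  \int[P]_w phi (X 0 w) +
  \int[leb]_(s in `]0, T0]) \int[P]_w (fk_weight s w * fk_op phi (X s w)).
Proof.
move=> T00 phiC.
have C0 : 0 <= C by have /andP[p0 p1] := phiC (X 0 point); exact: le_trans p1.
pose C1 := 2 * C + (`|lam| + c) * C.
have phi1 x : 0 <= fk_op phi x <= C1 by exact: fk_op_ge0.
have [K K0 HK] := fk_derivative_error T00 phiC.
have [K' K'0 HK'] := fk_derivative_error T00 phi1.
pose C2 := 2 * C1 + (`|lam| + c) * C1.
have phi2 x : 0 <= fk_op (fk_op phi) x <= C2 by exact: fk_op_ge0.
pose M := expR ((`|lam| + c) * T0); have M0 : 0 <= M by exact: expR_ge0.
have C20 : 0 <= C2 by have /andP[p0 p1] := phi2 (X 0 point); exact: le_trans p1.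
pose Z r := \int[P]_w (fk_weight r w * phi (X r w)).
pose z r := \int[P]_w (fk_weight r w * fk_op phi (X r w)).
have zb r : 0 <= r <= T0 -> `|\int[P]_w (fk_weight r w * fk_op (fk_op phi) (X r w))| <= M * C2.
  move=> rT; have /andP[r0 _] := rT.
  apply: le_normr_Rintegral_prob.
    apply: measurable_funM; last exact: measurable_countable_fun.
    by apply: (measurable_wrt_fun (Gm r0)); exact: measurable_wrt_fk_weight.
  move=> w; have /andP[z0 z1] := fk_weight_bound w rT; rewrite normrM ler_pM//.
    by rewrite ger0_norm.
  by have /andP[p0 p1] := phi2 (X r w); rewrite ger0_norm.
have [] := @Rintegral_of_derivative_error R T0 (K + (K' + M * C2)) Z z T00.
- move=> s r s0 sr rT rs1.
  have h01 : 0 <= r - s <= 1 by rewrite subr_ge0 sr.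
  have := HK s (r - s) s0 h01; rewrite addrC subrK => /(_ rT); rewrite -/(Z _) -/(Z _) -/(z _).
  move=> /le_trans; apply; rewrite ler_wpM2r ?sqr_ge0// lerDl addr_ge0// mulr_ge0//.
- move=> s r s0 sr rT rs1.
  have h01 : 0 <= r - s <= 1 by rewrite subr_ge0 sr.
  have := HK' s (r - s) s0 h01; rewrite addrC subrK => /(_ rT); rewrite -/(z _) -/(z _) => h.
  have sT : 0 <= s <= T0 by rewrite s0 (le_trans sr).
  rewrite -[z r - z s](subrK ((r - s) * \int[P]_w (fk_weight s w * fk_op (fk_op phi) (X s w)))).
  have rs0 : 0 <= r - s by have /andP[] := h01.
  apply: le_trans (ler_normD _ _) _.
  rewrite [leRHS]mulrDl; apply: ler_wpDl; first by rewrite mulr_ge0.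
  rewrite [leRHS]mulrDl; apply: lerD.
    apply: (le_trans h); rewrite ler_wpM2l// expr2 ler_piMr//.
  by rewrite normrM (ger0_norm rs0) mulrC ler_wpM2r// zb.
move=> iz eZ; split=> //; rewrite -/(Z T0) eZ; congr (_ + _).
apply: eq_Rintegral => w _.
by rewrite /fk_weight occup0 !mulr0 addr0 expR0 mul1r.
Qed.

End FeynmanKac.

End LocalTime.
End JumpProcess.

(** * The pair of independent chains *)

Section PairKernel.
Context {R : realType} {d : nat}.
Local Notation I := (lattice d).
Variable a : I -> I -> R.
Hypothesis ha : is_rates a.

(** The two walks do not move at the same time. Void jumps [a i i] are kept, so each walk
    contributes mass 1 to every row. *)
Definition pair_rate (x y : I * I) : R :=
  a x.1 y.1 * (x.2 == y.2)%:R + (x.1 == y.1)%:R * a x.2 y.2.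

Lemma pair_rate_ge0 x y : 0 <= pair_rate x y.
Proof. by rewrite addr_ge0// mulr_ge0// (rates_ge0 ha). Qed.

Lemma esum_pair_rate (f : I * I -> \bar R) x : (forall y, 0 <= f y)%E ->
  (\esum_(y in [set: I * I]) ((pair_rate x y)%:E * f y) =
   \esum_(k in [set: I]) ((a x.1 k)%:E * f (k, x.2)) +
   \esum_(l in [set: I]) ((a x.2 l)%:E * f (x.1, l)))%E.
Proof.
move=> f0; have a0 i j : (0 <= (a i j)%:E)%E by rewrite lee_fin (rates_ge0 ha).
have b0 (b : bool) : (0 <= (b%:R : R)%:E)%E by rewrite lee_fin.
rewrite (eq_esum (b := fun y => ((a x.1 y.1)%:E * ((x.2 == y.2)%:R%:E * f y) +
    (x.1 == y.1)%:R%:E * ((a x.2 y.2)%:E * f y))%E)); last first.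
  move=> y _; rewrite /pair_rate EFinD ge0_muleDl ?EFinM ?muleA//.
    by rewrite mule_ge0.
  by rewrite mule_ge0.
rewrite esumD; [|by move=> y _; rewrite !mule_ge0|by move=> y _; rewrite !mule_ge0].
congr (_ + _)%E; rewrite esum_pair; try by move=> y; rewrite !mule_ge0.
- apply: eq_esum => k _ /=; rewrite esumZl ?(rates_ge0 ha)//; last first.
    by move=> j; rewrite mule_ge0.
  congr (_ * _)%E; rewrite -(@esum_delta _ _ (fun j => f (k, j)) x.2)//.
  by apply: eq_esum => j _; rewrite eq_sym.
- rewrite esum_exchange; last by move=> i j; rewrite !mule_ge0.
  apply: eq_esum => l _ /=.
  rewrite -(@esum_delta _ _ (fun i => ((a x.2 l)%:E * f (i, l))%E) x.1); last by move=> i; rewrite mule_ge0.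
  by apply: eq_esum => j _; rewrite eq_sym.
Qed.

Lemma pair_rate_mass x : (\esum_(y in [set: I * I]) (pair_rate x y)%:E = (2 : R)%:E)%E.
Proof.
rewrite (eq_esum (b := fun y => ((pair_rate x y)%:E * (fun=> 1) y)%E)); last by move=> y _; rewrite mule1.
rewrite esum_pair_rate; last by move=> y; rewrite lee01.
rewrite -(eq_esum (a := fun k => (a x.1 k)%:E)); last by move=> k _; rewrite mule1.
rewrite -[X in (_ + X)%E](eq_esum (a := fun k => (a x.2 k)%:E)); last by move=> k _; rewrite mule1.
by rewrite !(rates_sum1 ha).
Qed.

End PairKernel.

Section PairChain.
Context {R : realType} {d : nat}.
Local Notation I := (lattice d).
Variable a : I -> I -> R.
Hypothesis ha : is_rates a.
Context {dT : measure_display} {T : measurableType dT}.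
Variable P : probability T R.
Variables X1 X2 : R -> T -> I.
Hypotheses (hX1 : is_markov_chain P a X1) (hX2 : is_markov_chain P a X2).
Hypothesis hX12 : indep_processes P X1 X2.

Definition pair_chain (r : R) (w : T) : I * I := (X1 r w, X2 r w).

Implicit Types (J : set R) (X : R -> T -> I) (r s t : R).

Let past r (X : R -> T -> I) := sigma_of_process [set s | s <= r] X.

(** A system closed under intersection that generates the joint past; on it independence factors the
    probability into the Markov properties of the two chains. *)
Definition pair_gen (r : R) : set (set T) :=
  [set B | exists B1 B2, [/\ past r X1 B1, past r X2 B2 & B = B1 `&` B2]].

Definition pair_past (r : R) : set (set T) := <<s pair_gen r >>.

Let past_sigma J X : sigma_algebra setT (sigma_of_process J X).
Proof. exact: smallest_sigma_algebra. Qed.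

Let sub_meas J X (hX : is_markov_chain P a X) : sigma_of_process J X `<=` measurable.
Proof.
apply: smallest_sub; first exact: sigma_algebra_measurable.
by move=> _ [t [i [t0 _ ->]]]; exact: (markov_measurable hX).
Qed.

Let past_sub J J' X : J `<=` J' -> sigma_of_process J X `<=` sigma_of_process J' X.
Proof.
move=> JJ; apply: smallest_sub; first exact: past_sigma.
move=> B [t [i [t0 /JJ tJ ->]]]; apply: sub_sigma_algebra.
by exists t, i.
Qed.

Let past_event J X t i : 0 <= t -> J t -> sigma_of_process J X [set w | X t w = i].
Proof. by move=> t0 Jt; apply: sub_sigma_algebra; exists t, i. Qed.

Let sigI (C : set (set T)) : sigma_algebra setT C -> setI_closed C.
Proof.
move=> sC A B CA CB; have [C0 CC CU] := sC.
have CT (D : set T) : C D -> C (~` D) by move=> /CC; rewrite setTD.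
rewrite -[A `&` B]setCK setCI; apply: (CT _).
rewrite (_ : ~` A `|` ~` B = \bigcup_n (fun n => if n == 0%N then ~` A else ~` B) n); last first.
  apply/seteqP; split=> [w [wA|wB]|w [n _]/=].
  - by exists 0%N.
  - by exists 1%N.
  - by case: ifP; [left|right].
by apply: CU => n; case: ifP => _; exact: CT.
Qed.

Lemma pair_past_sigma r : 0 <= r -> sigma_algebra setT (pair_past r).
Proof. by move=> _; exact: smallest_sigma_algebra. Qed.

Lemma pair_gen_measurable r : pair_gen r `<=` measurable.
Proof. by move=> _ [B1 [B2 [h1 h2 ->]]]; apply: measurableI; [exact: sub_meas hX1 _ h1|exact: sub_meas hX2 _ h2]. Qed.

Lemma pair_past_measurable r : 0 <= r -> pair_past r `<=` measurable.
Proof.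
move=> _; apply: smallest_sub; first exact: sigma_algebra_measurable.
exact: pair_gen_measurable.
Qed.

Lemma pair_past_mono r s : 0 <= r -> r <= s -> pair_past r `<=` pair_past s.
Proof.
move=> r0 rs; apply: smallest_sub; first exact: smallest_sigma_algebra.
have sub : [set t | t <= r] `<=` [set t | t <= s] by move=> t /le_trans; exact.
move=> _ [B1 [B2 [h1 h2 ->]]]; apply: sub_sigma_algebra; exists B1, B2.
by split=> //; apply: past_sub sub _ _.
Qed.

Lemma pair_past_event r x : 0 <= r -> pair_past r [set w | pair_chain r w = x].
Proof.
move=> r0; apply: sub_sigma_algebra.
exists [set w | X1 r w = x.1], [set w | X2 r w = x.2]; split.
- by apply: past_event => //=.
- by apply: past_event => //=.
- by apply/seteqP; split=> w /=; rewrite /pair_chain; case: x => i j /=; [case=> -> ->|case=> -> ->].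
Qed.

Lemma pair_chain_rc w r : 0 <= r -> exists2 dl : R, 0 < dl &
  forall s, r <= s -> s < r + dl -> pair_chain s w = pair_chain r w.
Proof.
move=> r0.
have one X (hX : is_markov_chain P a X) : exists2 dl : R, 0 < dl &
    forall s, r <= s -> s < r + dl -> X s w = X r w.
  have [e /= e0 H] := markov_right_continuous hX w r0; exists e => // s.
  rewrite le_eqVlt => /predU1P[<-//|rs] sr; apply: H => //=.
  by rewrite ltr0_norm ?subr_lt0// opprB ltrBlDl.
have [d1 d10 H1] := one _ hX1; have [d2 d20 H2] := one _ hX2.
exists (Num.min d1 d2); first by rewrite lt_min d10.
move=> s rs; rewrite -ltrBlDl lt_min => /andP[s1 s2]; rewrite /pair_chain H1 ?H2//.
  by rewrite -ltrBlDl.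
by rewrite -ltrBlDl.
Qed.

Section with_transitions.
Variables p1 p2 : R -> I -> I -> R.
Hypotheses (hp1 : is_transition_function a p1) (hp2 : is_transition_function a p2).
Hypothesis mk1 : forall s t i j A, 0 <= s -> 0 <= t -> past s X1 A ->
  (P (A `&` [set w | X1 s w = i] `&` [set w | X1 (s + t) w = j]) =
   P (A `&` [set w | X1 s w = i]) * (p1 t i j)%:E)%E.
Hypothesis mk2 : forall s t i j A, 0 <= s -> 0 <= t -> past s X2 A ->
  (P (A `&` [set w | X2 s w = i] `&` [set w | X2 (s + t) w = j]) =
   P (A `&` [set w | X2 s w = i]) * (p2 t i j)%:E)%E.

Definition pair_trans h (x y : I * I) : R := p1 h x.1 y.1 * p2 h x.2 y.2.

(** The product of the two lower bounds contains a further term, h^2 times a product of rates, which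
    is dropped. Each chain brings its own transition function, and both obey the same bound. *)
Lemma pair_trans_ge h x y : 0 <= h <= 1 ->
  (1 - h) ^+ 2 * ((x == y)%:R + h * pair_rate a x y) <= pair_trans h x y.
Proof.
move=> h01; have /andP[h0 h1] := h01.
have t1 := trans_ge ha hp1 x.1 y.1 h01; have t2 := trans_ge ha hp2 x.2 y.2 h01.
have a1 := rates_ge0 ha x.1 y.1; have a2 := rates_ge0 ha x.2 y.2.
have h1' : 0 <= 1 - h by rewrite subr_ge0.
apply: le_trans (ler_pM _ _ t1 t2); try by rewrite mulr_ge0// addr_ge0// mulr_ge0.
rewrite mulrACA -expr2 ler_wpM2l ?sqr_ge0// /pair_rate.
have -> : (x == y)%:R = (x.1 == y.1)%:R * (x.2 == y.2)%:R :> R.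
  by rewrite -pair_eqE /pair_eq; case: (x.1 == y.1); rewrite ?mul1r ?mul0r.
rewrite -subr_ge0.
rewrite (_ : _ - _ = h ^+ 2 * (a x.1 y.1 * a x.2 y.2)); last by ring.
by rewrite mulr_ge0 ?sqr_ge0// mulr_ge0.
Qed.

Let E r x := [set w | pair_chain r w = x].

Let EE r x : E r x = [set w | X1 r w = x.1] `&` [set w | X2 r w = x.2].
Proof. by apply/seteqP; split=> w; rewrite /E/= /pair_chain; case: x => i j /=; [case=> -> ->|case=> -> ->]. Qed.

Let mE r x : 0 <= r -> measurable (E r x).
Proof. by move=> r0; apply: (pair_past_measurable r0); exact: pair_past_event. Qed.

Lemma pair_markov_gen r h x y A : 0 <= r -> 0 <= h -> pair_gen r A ->
  (P (A `&` (E r x `&` E (r + h) y)) = (pair_trans h x y)%:E * P (A `&` E r x))%E.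
Proof.
move=> r0 h0 [B1 [B2 [b1 b2 ->]]].
have rh0 : 0 <= r + h by rewrite addr_ge0.
have full s X : sigma_of_process [set t | t <= s] X `<=` sigma_of_process setT X by exact: past_sub.
have ev s X i : 0 <= s -> sigma_of_process setT X [set w | X s w = i] by move=> s0; exact: past_event.
have sI J X := sigI (past_sigma J X).
rewrite !EE.
rewrite (_ : B1 `&` B2 `&` (_ `&` _) =
  (B1 `&` [set w | X1 r w = x.1] `&` [set w | X1 (r + h) w = y.1]) `&`
  (B2 `&` [set w | X2 r w = x.2] `&` [set w | X2 (r + h) w = y.2])); last first.
  by apply/seteqP; split=> w /=; tauto.
rewrite hX12; last 2 first.
- by apply: (sI setT X1); [apply: (sI setT X1); [exact: (full r X1 _ b1)|exact: ev]|exact: ev].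
- by apply: (sI setT X2); [apply: (sI setT X2); [exact: (full r X2 _ b2)|exact: ev]|exact: ev].
rewrite mk1// mk2//.
rewrite (_ : B1 `&` B2 `&` (_ `&` _) = (B1 `&` [set w | X1 r w = x.1]) `&`
  (B2 `&` [set w | X2 r w = x.2])); last by apply/seteqP; split=> w /=; tauto.
rewrite [X in _ = (_ * X)%E]hX12; last 2 first.
- by apply: (sI setT X1); [exact: (full r X1 _ b1)|exact: ev].
- by apply: (sI setT X2); [exact: (full r X2 _ b2)|exact: ev].
by rewrite /pair_trans EFinM muleACA muleC.
Qed.

(** Both sides are finite measures in [A] that agree on [pair_gen r], a system closed under
    intersection and containing the whole space; hence they agree on the sigma-algebra it
    generates. *)
Lemma pair_markov_set r h x y A : 0 <= r -> 0 <= h -> pair_past r A ->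
  (P (A `&` (E r x `&` E (r + h) y)) = (pair_trans h x y)%:E * P (A `&` E r x))%E.
Proof.
move=> r0 h0 rA; have rh0 : 0 <= r + h by rewrite addr_ge0.
have q0 : 0 <= pair_trans h x y by rewrite mulr_ge0// ?(trans_ge0 hp1) ?(trans_ge0 hp2).
have mD : measurable (E r x `&` E (r + h) y) by apply: measurableI; exact: mE.
pose m1 : {measure set T -> \bar R} := mrestr P mD.
pose m2 : {measure set T -> \bar R} := mscale (NngNum q0) (mrestr P (mE x r0)).
have e A' : pair_gen r A' -> m1 A' = m2 A'.
  by move=> gA; rewrite /m1 /m2 /mscale/= /mrestr; exact: pair_markov_gen.
have gT : pair_gen r setT.
  exists setT, setT; rewrite setIT; split=> //; have [s0 sC _] := past_sigma [set s | s <= r] X1; have [t0 tC _] := past_sigma [set s | s <= r] X2.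
    by rewrite -[setT](setD0 setT); exact: sC.
  by rewrite -[setT](setD0 setT); exact: tC.
have gI : setI_closed (pair_gen r).
  move=> _ _ [B1 [B2 [b1 b2 ->]]] [C1 [C2 [c1 c2 ->]]].
  exists (B1 `&` C1), (B2 `&` C2); split; [exact: (sigI (past_sigma _ _) b1 c1)|exact: (sigI (past_sigma _ _) b2 c2)|].
  by rewrite setIACA.
have fin (k : nat) : (m1 ((fun=> setT) k : set T) < +oo)%E.
  rewrite /m1 /= /mrestr; apply: le_lt_trans (ltry 1).
  by apply: probability_le1; rewrite setTI.
have := @g_sigma_algebra_measure_unique _ R T (pair_gen r) (@pair_gen_measurable r)
  (fun=> setT) (fun=> gT) _ m1 m2 gI e fin A rA.
rewrite /m1 /m2 /mscale/= /mrestr; apply.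
by rewrite bigcup_const//; exists 0%N.
Qed.

(** By [pair_markov_set] the variable [f1 - qq * f2] integrates to 0 over every past event, so it is
    orthogonal to [Z] by [integral_mul_eq0]. *)
Lemma pair_markov r h x y (Z : T -> R) M : 0 <= r -> 0 <= h ->
  measurable_wrt (pair_past r) Z -> (forall w, 0 <= Z w <= M) ->
  (\int[P]_w (Z w * ((pair_chain r w == x)%:R * (pair_chain (r + h) w == y)%:R))%:E =
   (pair_trans h x y)%:E * \int[P]_w (Z w * (pair_chain r w == x)%:R)%:E)%E.
Proof.
move=> r0 h0 mZ ZM; have rh0 : 0 <= r + h by rewrite addr_ge0.
have ind s z w : 0 <= s -> (pair_chain s w == z)%:R = \1_(E s z) w :> R.
  move=> s0; rewrite indicE (_ : (w \in E s z) = (pair_chain s w == z))//.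
  by apply/idP/eqP => [/set_mem//|sz]; exact: mem_set.
have mi s z : 0 <= s -> measurable_fun setT (fun w => (pair_chain s w == z)%:R : R).
  move=> s0; rewrite (_ : (fun _ => _) = \1_(E s z)); first by exact/measurable_indic/mE.
  by apply/funext => w; exact: ind.
pose qq := pair_trans h x y.
pose f1 w : R := (pair_chain r w == x)%:R * (pair_chain (r + h) w == y)%:R.
pose f2 w : R := (pair_chain r w == x)%:R.
have m1 : measurable_fun setT f1 by apply: measurable_funM; exact: mi.
have m2 : measurable_fun setT f2 by exact: mi.
have f1b w : `|f1 w| <= 1.
  by rewrite normrM -[leRHS]mulr1 ler_pM// bool_norm_le1.
have f2b w : `|f2 w| <= 1 by exact: bool_norm_le1.
have i1 : P.-integrable setT (EFin \o f1) by exact: bounded_integrable f1b.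
have i2 : P.-integrable setT (EFin \o f2) by exact: bounded_integrable f2b.
have mZT : measurable_fun setT Z by apply: (measurable_wrt_fun (pair_past_measurable r0)).
have ZMn w : `|Z w| <= M by have /andP[z0 z1] := ZM w; rewrite ger0_norm.
have iZ (f : T -> R) : measurable_fun setT f -> (forall w, `|f w| <= 1) ->
    P.-integrable setT (EFin \o (fun w => Z w * f w)).
  move=> mf fb; apply: (@bounded_integrable _ _ _ _ _ (M * 1)).
    exact: measurable_funM.
  by move=> w; rewrite normrM ler_pM.
have key := @integral_mul_eq0 _ T R P (pair_past r) (pair_past_sigma r0) (pair_past_measurable r0)
  (fun w => f1 w - qq * f2 w) Z.
have iqf := rintegrableZl measurableT qq i2.
have {}key := key ltac:(by apply: eq_integrable (integrableB measurableT i1 iqf)).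
have A0 A : pair_past r A -> (\int[P]_(w in A) (f1 w - qq * f2 w)%:E = 0)%E.
  move=> rA; have mA := pair_past_measurable r0 rA.
  rewrite (_ : (\int[P]_(w in A) (f1 w - qq * f2 w)%:E =
    \int[P]_(w in A) ((EFin \o f1) w - qq%:E * (EFin \o f2) w))%E); last first.
    by apply: eq_integral => w _; rewrite EFinB -EFinM.
  have S1 : (\int[P]_(w in A) (f1 w)%:E = P (A `&` (E r x `&` E (r + h) y)))%E.
    rewrite setIC -integral_indic//; last by apply: measurableI; exact: mE.
    apply: eq_integral => w _; congr (_%:E).
    by rewrite /f1 !ind// indicI.
  have S2 : (\int[P]_(w in A) (f2 w)%:E = P (A `&` E r x))%E.
    rewrite setIC -integral_indic//; last exact: mE.
    by apply: eq_integral => w _; congr (_%:E); rewrite /f2 ind.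
  have i1A : P.-integrable A (EFin \o f1) by exact: integrableS i1.
  have i2A : P.-integrable A (EFin \o f2) by exact: integrableS i2.
  rewrite integralB//; last exact: integrableZl.
  rewrite integralZl// S1 S2 pair_markov_set// subee//.
  by rewrite fin_numM// fin_num_measure//; apply: measurableI => //; exact: mE.
have iZ1 := iZ _ m1 f1b; have iZ2 := iZ _ m2 f2b.
have eZ w : Z w * (f1 w - qq * f2 w) = Z w * f1 w - qq * (Z w * f2 w) by ring.
have iqZ : P.-integrable setT (fun w => qq%:E * (EFin \o (fun w => Z w * f2 w)%R) w)%E.
  by apply: (@integrableZl _ _ _ P setT measurableT qq _ iZ2).
have {key} : (\int[P]_w (Z w * (f1 w - qq * f2 w))%:E = 0)%E.
  apply: key A0 mZ _; apply: eq_integrable (integrableB measurableT iZ1 iqZ) => // w _.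
  by rewrite /= eZ EFinB EFinM.
rewrite (_ : (\int[P]_w (Z w * (f1 w - qq * f2 w))%:E = \int[P]_w
  ((EFin \o (fun w => Z w * f1 w)%R) w - qq%:E * (EFin \o (fun w => Z w * f2 w)%R) w))%E); last first.
  by apply: eq_integral => w _; rewrite /= eZ EFinB EFinM.
rewrite integralB// integralZl// => /eqP; rewrite sube_eq ?add0e; first by move/eqP.
- exact: integrable_fin_num.
- by rewrite fin_num_adde_defl// fin_numM// integrable_fin_num.
Qed.

End with_transitions.

Lemma pair_fk_equation (b : I * I -> bool) (lam c T0 C : R) (phi : I * I -> R) :
  2 + `|lam| <= c -> 0 <= T0 -> (forall x, 0 <= phi x <= C) ->
  (@lebesgue_measure R).-integrable `]0, T0] (EFin \o (fun s =>
    \int[P]_w (fk_weight pair_chain b lam c s w * fk_op (pair_rate a) b lam c phi (pair_chain s w)))) /\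
  \int[P]_w (fk_weight pair_chain b lam c T0 w * phi (pair_chain T0 w)) =
  \int[P]_w phi (pair_chain 0 w) +
  \int[lebesgue_measure]_(s in `]0, T0]) \int[P]_w
    (fk_weight pair_chain b lam c s w * fk_op (pair_rate a) b lam c phi (pair_chain s w)).
Proof.
have [p1 hp1 mk1] := markov_property hX1; have [p2 hp2 mk2] := markov_property hX2.
move=> lc T00 phiC.
apply: (@fk_equation R (I * I)%type _ T P pair_chain pair_past (pair_rate a) (pair_trans p1 p2)
  pair_past_sigma pair_past_measurable pair_past_mono pair_past_event pair_chain_rc
  (pair_rate_ge0 ha) (pair_rate_mass ha) _ _ b lam c lc T0 C phi T00 phiC).
- by move=> h x y h01; exact: pair_trans_ge.
- by move=> r h x y Z M r0 h0 mZ ZM; apply: (@pair_markov p1 p2 hp1 hp2 mk1 mk2 r h x y Z M).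
Qed.

End PairChain.

(** * Stochastic integrals *)

(** What the L^2 theory takes from the driving Brownian motions, stated through integrals over past
    events. In this form the properties pass to a filtration enlarged by null events, as is done
    with [completed]. *)
Record is_noise {R : realType} {d : measure_display} {T : measurableType d}
    (P : probability T R) (F : R -> set (set T)) (J : Type)
    (W : J -> R -> T -> R) (cov : J -> J -> R) : Prop := IsNoise {
  noise_sigma : forall t, 0 <= t -> sigma_algebra setT (F t);
  noise_measurable : forall t, 0 <= t -> F t `<=` measurable;
  noise_filtration : forall s t, 0 <= s -> s <= t -> F s `<=` F t;
  noise_adapted : forall j t, 0 <= t -> measurable_wrt (F t) (W j t);
  noise_sqint : forall j t, 0 <= t -> sqint P setT (W j t);
  noise_increment : forall j s t A, 0 <= s -> s <= t -> F s A ->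
    (\int[P]_(w in A) (W j t w - W j s w)%:E = 0)%E;
  noise_bracket : forall j k s t A, 0 <= s -> s <= t -> F s A ->
    (\int[P]_(w in A) (W j t w * W k t w - W j s w * W k s w - cov j k * (t - s))%:E = 0)%E
}.

Section Noise.
Context {R : realType} {d : measure_display} {T : measurableType d}.
Variable P : probability T R.
Variable F : R -> set (set T).
Variable J : Type.
Variables (W : J -> R -> T -> R) (cov : J -> J -> R).
Local Notation leb := (@lebesgue_measure R).
Local Notation sqintP := (sqint P setT).

Hypothesis hW : is_noise P F W cov.
Let sF := noise_sigma hW.
Let Fm := noise_measurable hW.
Let FM := noise_filtration hW.
Let Wad := noise_adapted hW.
Let W2 := noise_sqint hW.
Let Wmart := noise_increment hW.
Let Wbracket := noise_bracket hW.

Lemma adapted_mono s t (Z : T -> R) : 0 <= s -> s <= t ->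
  measurable_wrt (F s) Z -> measurable_wrt (F t) Z.
Proof. by move=> s0 st mZ B mB; apply: FM (mZ B mB). Qed.

Lemma adapted_measurable t (Z : T -> R) : 0 <= t -> measurable_wrt (F t) Z ->
  measurable_fun setT Z.
Proof. by move=> t0; apply: measurable_wrt_fun; exact: Fm. Qed.

Section adapted_closure.
Variable t : R.
Hypothesis t0 : 0 <= t.
Implicit Types f g : T -> R.

Lemma adaptedM f g : measurable_wrt (F t) f -> measurable_wrt (F t) g ->
  measurable_wrt (F t) (fun w => f w * g w).
Proof.
move=> /(measurable_wrtP (sF t0)) mf /(measurable_wrtP (sF t0)) mg.
by apply/(measurable_wrtP (sF t0)); exact: measurable_funM.
Qed.

Lemma adaptedD f g : measurable_wrt (F t) f -> measurable_wrt (F t) g ->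
  measurable_wrt (F t) (fun w => f w + g w).
Proof.
move=> /(measurable_wrtP (sF t0)) mf /(measurable_wrtP (sF t0)) mg.
by apply/(measurable_wrtP (sF t0)); exact: measurable_funD.
Qed.

Lemma adaptedB f g : measurable_wrt (F t) f -> measurable_wrt (F t) g ->
  measurable_wrt (F t) (fun w => f w - g w).
Proof.
move=> /(measurable_wrtP (sF t0)) mf /(measurable_wrtP (sF t0)) mg.
by apply/(measurable_wrtP (sF t0)); exact: measurable_funB.
Qed.

Lemma adapted_cst (c : R) : measurable_wrt (F t) (fun=> c).
Proof. by apply/(measurable_wrtP (sF t0)); exact: measurable_cst. Qed.

Lemma adapted_comp (h : R -> R) f : measurable_fun setT h ->
  measurable_wrt (F t) f -> measurable_wrt (F t) (fun w => h (f w)).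
Proof.
move=> mh /(measurable_wrtP (sF t0)) mf; apply/(measurable_wrtP (sF t0)).
exact: measurableT_comp.
Qed.

Lemma adapted_indic (A : set T) : F t A -> measurable_wrt (F t) (\1_A : T -> R).
Proof.
move=> FA; apply/(measurable_wrtP (sF t0)).
by apply: (@measurable_indic _ (g_sigma_algebraType (F t)) R setT A); rewrite g_sigma_algebraTypeE//; exact: sF.
Qed.

Lemma adapted_sum n (f : nat -> T -> R) :
  (forall k, (k < n)%N -> measurable_wrt (F t) (f k)) ->
  measurable_wrt (F t) (fun w => \sum_(k < n) f k w).
Proof.
move=> mf; apply/(measurable_wrtP (sF t0)); apply: measurable_sum => k.
by apply/(measurable_wrtP (sF t0)); apply: mf.
Qed.

End adapted_closure.

Lemma sqint_bounded (f : T -> R) C : measurable_fun setT f ->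
  (forall w, `|f w| <= C) -> sqintP f.
Proof.
move=> mf fC; split=> //; apply: (@bounded_integrable _ _ _ _ _ (C ^+ 2)).
  exact: measurable_funX.
by move=> w; rewrite normrX lerXn2r// nnegrE// (le_trans _ (fC w)).
Qed.

Lemma sqint_boundedM (f g : T -> R) C : measurable_fun setT f ->
  (forall w, `|f w| <= C) -> sqintP g -> sqintP (fun w => f w * g w).
Proof.
move=> mf fC sg; have C0 : 0 <= C by exact: le_trans (fC point).
apply: (@le_sqint _ _ _ _ _ _ _ (fun w => C * g w)) => //.
- by case: sg => mg _; exact: measurable_funM.
- by move=> w _; rewrite !normrM ler_wpM2r// (ger0_norm C0).
- exact: sqintZ.
Qed.

Lemma sqint_integrable (f : T -> R) : sqintP f -> P.-integrable setT (EFin \o f).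
Proof.
move=> sf; have s1 : sqintP (fun=> 1) by apply: (@sqint_bounded _ 1) => // w; rewrite normr1.
have := sqint_mul measurableT sf s1; apply: eq_integrable => // w _ /=.
by rewrite mulr1.
Qed.

Lemma noise_mart (Z : T -> R) j s t : 0 <= s -> s <= t ->
  measurable_wrt (F s) Z -> sqintP Z ->
  \int[P]_w (Z w * (W j t w - W j s w)) = 0.
Proof.
move=> s0 st mZ sZ; have t0 := le_trans s0 st.
have sD : sqintP (fun w => W j t w - W j s w) by apply: sqintB => //; exact: W2.
rewrite /Rintegral (@integral_mul_eq0 _ T R P (F s) (sF s0) (Fm s0) _ Z)//.
- exact: sqint_integrable.
- by move=> A FA; exact: Wmart.
- exact: sqint_mul.
Qed.

(** The product of increments is the increment of [W j * W k] minus [W j s] times the increment of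
    [W k], minus the symmetric term. The bracket evaluates the first; the other two vanish against
    past-measurable factors by [noise_mart]. *)
Lemma noise_covariance (Z : T -> R) C j k s t : 0 <= s -> s <= t ->
  measurable_wrt (F s) Z -> (forall w, `|Z w| <= C) ->
  \int[P]_w (Z w * ((W j t w - W j s w) * (W k t w - W k s w))) =
  cov j k * (t - s) * \int[P]_w Z w.
Proof.
move=> s0 st mZ ZC; have t0 := le_trans s0 st.
have mZT := adapted_measurable s0 mZ.
have iZ : P.-integrable setT (EFin \o Z) by exact: bounded_integrable ZC.
have iWW u : 0 <= u -> P.-integrable setT (EFin \o (fun w => W j u w * W k u w)).
  by move=> u0; apply: sqint_mul => //; exact: W2.
pose V := cov j k * (t - s).
pose X w := W j t w * W k t w - W j s w * W k s w - V.
have ic : P.-integrable setT (EFin \o (fun=> V : R)).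
  by apply: (@bounded_integrable _ _ _ _ _ `|V|).
have iWD := rintegrableB measurableT (iWW t t0) (iWW s s0).
have iX := rintegrableB measurableT iWD ic.
have iZb f : P.-integrable setT (EFin \o f) -> P.-integrable setT (EFin \o (fun w => Z w * f w)).
  move=> fi; have mf : measurable_fun setT f by apply/measurable_EFinP; exact: measurable_int fi.
  apply: le_integrable (integrableZl measurableT C fi) => //.
    by apply/measurable_EFinP; exact: measurable_funM.
  move=> w _ /=; rewrite lee_fin !normrM ler_wpM2r//.
  by rewrite (le_trans (ZC w))// ler_norm.
have e1 : \int[P]_w (Z w * X w) = 0.
  rewrite /Rintegral (@integral_mul_eq0 _ T R P (F s) (sF s0) (Fm s0) X Z)//.
  - by move=> A FA; exact: Wbracket.
  - exact: iZb.
have sZW l : sqintP (fun w => Z w * W l s w).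
  by apply: sqint_boundedM ZC _ => //; exact: W2.
have mZW l : measurable_wrt (F s) (fun w => Z w * W l s w).
  by apply: adaptedM => //; exact: Wad.
have e2 := noise_mart k s0 st (mZW j) (sZW j).
have e3 := noise_mart j s0 st (mZW k) (sZW k).
have sD l : sqintP (fun w => W l t w - W l s w) by apply: sqintB => //; exact: W2.
have i2 := sqint_mul measurableT (sZW j) (sD k).
have i3 := sqint_mul measurableT (sZW k) (sD j).
have iVZ := rintegrableZl measurableT V iZ.
rewrite -RintegralZl//.
rewrite -[RHS](addr0) -e1 -[RHS]subr0 -e2 -[RHS]subr0 -e3.
have i12 := rintegrableD measurableT iVZ (iZb _ iX).
have i123 := rintegrableB measurableT i12 i2.
rewrite -RintegralD//; last exact: iZb.
rewrite -RintegralB// -RintegralB//.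
by apply: eq_Rintegral => w _; rewrite /X /V; ring.
Qed.

Section step_integrals.
Variables (tau : nat -> R) (n : nat).
Hypothesis tauM : forall i k, (i <= k)%N -> (k <= n)%N -> tau i <= tau k.
Hypothesis tau0 : 0 <= tau 0.

Definition step_sum (c : nat -> T -> R) (j : J) (m : nat) (w : T) : R :=
  \sum_(k < m) c k w * (W j (tau k.+1) w - W j (tau k) w).

Definition step_coefs (c : nat -> T -> R) := forall k, (k < n)%N ->
  measurable_wrt (F (tau k)) (c k) /\ exists C : R, forall w, `|c k w| <= C.

Let tau_ge0 k : (k <= n)%N -> 0 <= tau k.
Proof. by move=> kn; rewrite (le_trans tau0)// tauM. Qed.

Lemma step_sumS c j m w :
  step_sum c j m.+1 w = step_sum c j m w + c m w * (W j (tau m.+1) w - W j (tau m) w).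
Proof. by rewrite /step_sum big_ord_recr. Qed.

Lemma step_sum_adapted c j m : step_coefs c -> (m <= n)%N ->
  measurable_wrt (F (tau m)) (step_sum c j m).
Proof.
move=> hc mn.
apply: (@adapted_sum (tau m) (tau_ge0 mn) m (fun k w => c k w * (W j (tau k.+1) w - W j (tau k) w))).
move=> k km; have kn : (k < n)%N := leq_trans km mn.
have [mc _] := hc k kn; have k0 := tau_ge0 (ltnW kn).
have k10 := tau_ge0 kn; have m0 := tau_ge0 mn.
have kk : tau k <= tau k.+1 by exact: tauM.
have km' : tau k.+1 <= tau m by exact: tauM.
apply: adaptedM => //; first exact: adapted_mono (le_trans kk km') mc.
apply: adaptedB => //; first exact: adapted_mono km' (Wad _ k10).
exact: adapted_mono (le_trans kk km') (Wad _ k0).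
Qed.

Lemma step_sum_sqint c j m : step_coefs c -> (m <= n)%N -> sqintP (step_sum c j m).
Proof.
move=> hc mn.
have sk k : (k < m)%N -> sqintP (fun w => c k w * (W j (tau k.+1) w - W j (tau k) w)).
  move=> km; have kn : (k < n)%N := leq_trans km mn.
  have [mc [C cC]] := hc k kn; have k0 := tau_ge0 (ltnW kn); have k10 := tau_ge0 kn.
  apply: (@sqint_boundedM _ _ C) => //; first exact: adapted_measurable mc.
  by apply: sqintB => //; exact: W2.
have := @sqint_sum _ _ _ P setT measurableT _ (index_enum 'I_m)
  (fun k w => c k w * (W j (tau k.+1) w - W j (tau k) w)) (fun k => sk k (ltn_ord k)).
by [].
Qed.

(** Induction on the number of steps: the product of the two new increments contributes the noise
    covariance over the last cell, while each mixed term pairs an increment with something known at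
    its start. *)
Lemma step_sum_isometry c c' j k m : step_coefs c -> step_coefs c' -> (m <= n)%N ->
  \int[P]_w (step_sum c j m w * step_sum c' k m w) =
  cov j k * \sum_(i < m) (\int[P]_w (c i w * c' i w)) * (tau i.+1 - tau i).
Proof.
move=> hc hc'; elim: m => [_|m IH mn].
  rewrite big_ord0 mulr0 -[RHS](Rintegral_prob_cst P).
  by apply: eq_Rintegral => w _; rewrite /step_sum !big_ord0 mulr0.
have {}IH := IH (ltnW mn).
have [mc [C cC]] := hc m mn; have [mc' [C' cC']] := hc' m mn.
have m0 := tau_ge0 (ltnW mn); have m10 := tau_ge0 mn.
have mm : tau m <= tau m.+1 by exact: tauM.
pose D l w := W l (tau m.+1) w - W l (tau m) w.
have sD l : sqintP (D l) by apply: sqintB => //; exact: W2.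
have s1 := step_sum_sqint j hc (ltnW mn); have s2 := step_sum_sqint k hc' (ltnW mn).
have a1 := step_sum_adapted j hc (ltnW mn); have a2 := step_sum_adapted k hc' (ltnW mn).
have scD : sqintP (fun w => c m w * D j w).
  by apply: sqint_boundedM cC _ => //; exact: adapted_measurable mc.
have sc'D : sqintP (fun w => c' m w * D k w).
  by apply: sqint_boundedM cC' _ => //; exact: adapted_measurable mc'.
have sS1 : sqintP (fun w => c' m w * step_sum c j m w).
  by apply: sqint_boundedM cC' _ => //; exact: adapted_measurable mc'.
have sS2 : sqintP (fun w => c m w * step_sum c' k m w).
  by apply: sqint_boundedM cC _ => //; exact: adapted_measurable mc.
have e2 : \int[P]_w (c' m w * step_sum c j m w * D k w) = 0.
  by apply: noise_mart => //; exact: adaptedM.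
have e3 : \int[P]_w (c m w * step_sum c' k m w * D j w) = 0.
  by apply: noise_mart => //; exact: adaptedM.
have ccb w : `|c m w * c' m w| <= C * C' by rewrite normrM ler_pM.
have e4 := noise_covariance j k m0 mm (adaptedM m0 mc mc') ccb.
have i1 := sqint_mul measurableT s1 s2.
have i2 := sqint_mul measurableT sS1 (sD k).
have i3 := sqint_mul measurableT sS2 (sD j).
have i4 : P.-integrable setT (EFin \o (fun w => c m w * c' m w * (D j w * D k w))).
  apply: eq_integrable (sqint_mul measurableT scD sc'D) => // w _ /=.
  by congr (_%:E); ring.
rewrite big_ord_recr/= mulrDr -IH.
have -> : cov j k * (\int[P]_w (c m w * c' m w) * (tau m.+1 - tau m)) =
  \int[P]_w (c m w * c' m w * (D j w * D k w)) by rewrite e4; ring.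
rewrite -[RHS]addr0 -e2 -[RHS]addr0 -e3.
have i14 := rintegrableD measurableT i1 i4.
have i142 := rintegrableD measurableT i14 i2.
rewrite -RintegralD// -RintegralD// -RintegralD//.
by apply: eq_Rintegral => w _; rewrite !step_sumS -/(D j w) -/(D k w); ring.
Qed.

Lemma step_sum_mart c j m p (Z : T -> R) : step_coefs c -> (m <= p <= n)%N ->
  measurable_wrt (F (tau m)) Z -> sqintP Z ->
  \int[P]_w (Z w * (step_sum c j p w - step_sum c j m w)) = 0.
Proof.
move=> hc /andP[mp pn] mZ sZ; elim: p mp pn => [|p IH].
  rewrite leqn0 => /eqP-> _; rewrite -[RHS](Rintegral_prob_cst P).
  by apply: eq_Rintegral => w _; rewrite subrr mulr0.
rewrite leq_eqVlt => /predU1P[<- _|]; last rewrite ltnS => mp pn.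
- rewrite -[RHS](Rintegral_prob_cst P).
  by apply: eq_Rintegral => w _; rewrite subrr mulr0.
have {}IH := IH mp (ltnW pn).
have [mc [C cC]] := hc p pn.
have p0 := tau_ge0 (ltnW pn); have p10 := tau_ge0 pn; have pp : tau p <= tau p.+1 by exact: tauM.
have mn : (m <= n)%N := leq_trans mp (ltnW pn).
have mZp : measurable_wrt (F (tau p)) Z by apply: adapted_mono mZ; [exact: tau_ge0|exact: tauM (ltnW pn)].
have mcZ : measurable_wrt (F (tau p)) (fun w => c p w * Z w) by exact: adaptedM.
have scZ : sqintP (fun w => c p w * Z w).
  by apply: sqint_boundedM cC _ => //; exact: adapted_measurable mc.
have e1 := noise_mart j p0 pp mcZ scZ.
have sD : sqintP (fun w => W j (tau p.+1) w - W j (tau p) w) by apply: sqintB => //; exact: W2.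
have sS : sqintP (fun w => step_sum c j p w - step_sum c j m w).
  by apply: sqintB => //; apply: step_sum_sqint => //; exact: ltnW.
rewrite -[RHS]addr0 -{1}IH -e1 -RintegralD//; last 2 first.
- exact: sqint_mul.
- exact: sqint_mul.
by apply: eq_Rintegral => w _; rewrite step_sumS; ring.
Qed.

End step_integrals.
End Noise.

(** Points may repeat and [tau] is unconstrained beyond index [n], so a sorted list with duplicates
    qualifies. *)
Definition partition_of {R : realType} (t : R) (tau : nat -> R) (n : nat) : Prop :=
  [/\ tau 0 = 0, tau n = t & forall i k, (i <= k)%N -> (k <= n)%N -> tau i <= tau k].

(** * Common refinements of partitions *)

Section Refinement.
Context {R : realType}.
Variables (t : R) (L : seq R).
Hypothesis L_sorted : sorted <=%R L.
Hypothesis L_bounds : forall x, x \in L -> 0 <= x <= t.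
Hypotheses (L0 : 0 \in L) (Lt : t \in L).

(** The default value [t] keeps the refined grid at [t] beyond the end of the list, which makes it
    monotone on all indices. *)
Definition refine_time (k : nat) : R := nth t L k.
Local Notation sg := refine_time.
Local Notation N := (size L).-1.

Let L_size : (0 < size L)%N. Proof. by case: L L0. Qed.

Let sg_mem k : sg k \in L.
Proof.
rewrite /sg; have [kL|kL] := ltnP k (size L); first exact: mem_nth.
by rewrite nth_default.
Qed.

Lemma refine_time_homo : {homo sg : i j / (i <= j)%N >-> i <= j}.
Proof.
move=> i j ij; have [jL|jL] := ltnP j (size L).
  by apply: (sorted_leq_nth le_trans le_refl) => //; rewrite inE ?(leq_ltn_trans ij).
by rewrite /sg [nth t L j]nth_default//; have /andP[] := L_bounds (sg_mem i).
Qed.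

Lemma refine_time0 : sg 0 = 0.
Proof.
apply/eqP; rewrite eq_le; have /andP[-> _] := L_bounds (sg_mem 0); rewrite andbT.
by rewrite -[leRHS](nth_index t L0) -/(sg _) refine_time_homo.
Qed.

Lemma refine_time_last : sg N = t.
Proof.
apply/eqP; rewrite eq_le; have /andP[_ ->] := L_bounds (sg_mem N); rewrite /=.
rewrite -[leLHS](nth_index t Lt) -/(sg _) refine_time_homo//.
by rewrite -ltnS prednK// index_mem.
Qed.

Lemma refine_time_cross x k : x \in L -> sg k < x -> sg k.+1 <= x.
Proof.
move=> xL; rewrite -(nth_index t xL) -/(sg _) => kx; apply: refine_time_homo.
by rewrite ltnNge; apply: contraTN kx => ?; rewrite -leNgt refine_time_homo.
Qed.

Section step.
Variables (tau : nat -> R) (n : nat).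
Hypothesis tauP : partition_of t tau n.
Hypothesis tauL : forall i, (i <= n)%N -> tau i \in L.

Let ind i s : R := (tau i < s <= tau i.+1)%R%:R.

(** A refined cell has no point of [L] in its interior, so the indicator of an original cell takes a
    single value on it, read off at the right endpoint. *)
Lemma refine_ind i k s : (i < n)%N -> sg k < s <= sg k.+1 -> ind i s = ind i (sg k.+1).
Proof.
move=> i_n /andP[s1 s2]; rewrite /ind; congr ((_ && _)%:R).
  apply/idP/idP => [/lt_le_trans|h]; first exact.
  rewrite (le_lt_trans _ s1)// leNgt; apply: contraTN h => h; rewrite -leNgt.
  exact: refine_time_cross (tauL (ltnW i_n)) h.
apply/idP/idP => [h|]; last exact: le_trans.
exact: refine_time_cross (tauL i_n) (lt_le_trans s1 h).
Qed.

Lemma refine_ind_before i k : (i < n)%N -> tau i < sg k.+1 -> tau i <= sg k.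
Proof.
move=> i_n h; rewrite leNgt; apply: contraTN h => h; rewrite -leNgt.
exact: refine_time_cross (tauL (ltnW i_n)) h.
Qed.

Lemma refine_increment (g : R -> R) i : (i < n)%N ->
  \sum_(k < N) ind i (sg k.+1) * (g (sg k.+1) - g (sg k)) = g (tau i.+1) - g (tau i).
Proof.
move=> i_n; have [tau0 taun tauM] := tauP.
have ti : tau i <= tau i.+1 by exact: tauM.
(* Clamping times to the original cell makes the sum telescope over the whole refined grid: cells
   outside contribute 0 and cells inside are unchanged. *)
pose cl x := Num.min (Num.max x (tau i)) (tau i.+1).
have cl_lo x : x <= tau i -> cl x = tau i by move=> h; rewrite /cl max_r// min_l.
have cl_hi x : tau i.+1 <= x -> cl x = tau i.+1.
  by move=> h; rewrite /cl max_l ?(le_trans ti)// min_r.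
have cl_mid x : tau i <= x <= tau i.+1 -> cl x = x.
  by move=> /andP[h1 h2]; rewrite /cl max_l// min_l.
have e k : ind i (sg k.+1) * (g (sg k.+1) - g (sg k)) = g (cl (sg k.+1)) - g (cl (sg k)).
  have kk : sg k <= sg k.+1 by exact: refine_time_homo.
  rewrite /ind; have [h1|h1] := ltP (tau i) (sg k.+1); last first.
    by rewrite mul0r !cl_lo ?subrr// (le_trans kk).
  have h1' := refine_ind_before i_n h1.
  have [h2|h2] := leP (sg k.+1) (tau i.+1).
    by rewrite mul1r !cl_mid// ?(ltW h1)//= h1'// (le_trans kk).
  rewrite mul0r !cl_hi ?subrr ?(ltW h2)//.
  rewrite leNgt; apply: contraTN h2 => h2; rewrite -leNgt.
  exact: refine_time_cross (tauL i_n) h2.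
under eq_bigr do rewrite e.
rewrite -(big_mkord xpredT (fun k => g (cl (sg k.+1)) - g (cl (sg k)))) telescope_sumr//.
rewrite refine_time_last refine_time0 cl_hi; last by rewrite -taun tauM.
by rewrite cl_lo// -tau0 tauM// ltnW.
Qed.

Variable c : nat -> R.
Let val s := \sum_(i < n) c i * ind i s.

Lemma refine_step_sum (g : R -> R) :
  \sum_(k < N) val (sg k.+1) * (g (sg k.+1) - g (sg k)) =
  \sum_(i < n) c i * (g (tau i.+1) - g (tau i)).
Proof.
under eq_bigr do rewrite /val mulr_suml.
rewrite exchange_big/=; apply: eq_bigr => i _.
rewrite -(refine_increment g (ltn_ord i)) mulr_sumr.
by apply: eq_bigr => k _; rewrite mulrA.
Qed.

Lemma refine_step_fun s : 0 < s <= t ->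
  \sum_(k < N) val (sg k.+1) * (sg k < s <= sg k.+1)%R%:R = val s.
Proof.
move=> st; have := @sum_step R sg N (fun k => val (sg k.+1)) s refine_time_homo.
rewrite refine_time0 refine_time_last => /(_ st)[k _ [ks ->]].
by apply: eq_bigr => i _; rewrite (refine_ind _ ks).
Qed.

End step.
End Refinement.

Section StepMerge.
Context {R : realType} {d : measure_display} {T : measurableType d}.
Variable P : probability T R.
Variable F : R -> set (set T).
Variable J : Type.
Variables (W : J -> R -> T -> R) (cov : J -> J -> R).
Hypothesis hW : is_noise P F W cov.

Definition step_fun (tau : nat -> R) (c : nat -> T -> R) (n : nat) (s : R) (w : T) : R :=
  \sum_(i < n) c i w * (tau i < s <= tau i.+1)%R%:R.

Lemma bounded_bigsum n (f : nat -> T -> R) :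
  (forall i, (i < n)%N -> exists C : R, forall w, `|f i w| <= C) ->
  exists C : R, forall w, `|\sum_(i < n) f i w| <= C.
Proof.
elim: n => [|n IH] h; first by exists 0 => w; rewrite big_ord0 normr0.
have [C hC] := IH (fun i i_n => h i (ltnW i_n)); have [C' hC'] := h n (ltnSn n).
exists (C + C') => w; rewrite big_ord_recr/= (le_trans (ler_normD _ _))//.
by rewrite lerD.
Qed.

Lemma step_coefsB tau n c c' : (forall k, (k < n)%N -> 0 <= tau k) ->
  step_coefs F tau n c -> step_coefs F tau n c' ->
  step_coefs F tau n (fun k w => c k w - c' k w).
Proof.
move=> tau0 hc hc' k kn; have [mc [C cC]] := hc k kn; have [mc' [C' cC']] := hc' k kn.
split; first by apply: (adaptedB hW (tau0 k kn) mc mc').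
by exists (C + C') => w; rewrite (le_trans (ler_normB _ _))// lerD.
Qed.

(** On a refined cell the coefficient is the difference of the two step functions at the right
    endpoint. It is nevertheless known at the left endpoint, because an original cell covering the
    right endpoint starts at or before the left one. *)
Lemma step_merge t tau1 n1 c1 tau2 n2 c2 : 0 <= t ->
  partition_of t tau1 n1 -> step_coefs F tau1 n1 c1 ->
  partition_of t tau2 n2 -> step_coefs F tau2 n2 c2 ->
  exists sg N c, [/\ partition_of t sg N /\ {homo sg : i j / (i <= j)%N >-> i <= j},
    step_coefs F sg N c,
    (forall j w, step_sum W sg c j N w = step_sum W tau1 c1 j n1 w - step_sum W tau2 c2 j n2 w) &
    (forall s w, 0 < s <= t -> step_fun sg c N s w = step_fun tau1 c1 n1 s w - step_fun tau2 c2 n2 s w)].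
Proof.
move=> t0 P1 hc1 P2 hc2.
have [t10 t1n t1M] := P1; have [t20 t2n t2M] := P2.
pose L := sort <=%R (map tau1 (iota 0 n1.+1) ++ map tau2 (iota 0 n2.+1)).
have L1 i : (i <= n1)%N -> tau1 i \in L.
  by move=> i_n; rewrite mem_sort mem_cat map_f ?mem_iota.
have L2 i : (i <= n2)%N -> tau2 i \in L.
  by move=> i_n; rewrite mem_sort mem_cat [X in _ || X]map_f ?orbT// mem_iota.
have Ls : sorted <=%R L by apply: sort_sorted; exact: le_total.
have Lb x : x \in L -> 0 <= x <= t.
  rewrite mem_sort mem_cat => /orP[] /mapP[i]; rewrite mem_iota/= add0n ltnS => i_n ->.
    by rewrite -{1}t10 -t1n !t1M.
  by rewrite -{1}t20 -t2n !t2M.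
have L0 : 0 \in L by rewrite -t10 L1.
have Lt : t \in L by rewrite -t1n L1.
pose sg := refine_time t L; pose N := (size L).-1.
pose c k w := step_fun tau1 c1 n1 (sg k.+1) w - step_fun tau2 c2 n2 (sg k.+1) w.
have sgM : {homo sg : i j / (i <= j)%N >-> i <= j} by exact: refine_time_homo.
have sgP : partition_of t sg N.
  by split; [exact: refine_time0|exact: refine_time_last|move=> i k ik _; exact: sgM].
have sg0 k : 0 <= sg k by have [<- _ _] := sgP; exact: sgM.
have one tau n c0 : partition_of t tau n -> step_coefs F tau n c0 ->
    (forall i, (i <= n)%N -> tau i \in L) ->
    step_coefs F sg N (fun k w => step_fun tau c0 n (sg k.+1) w).
  move=> [tt0 ttn ttM] hc tauL k kN.
  have mi i : (i < n)%N -> measurable_wrt (F (sg k))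
      (fun w => c0 i w * (tau i < sg k.+1 <= tau i.+1)%R%:R).
    move=> i_n; have ti0 : 0 <= tau i by rewrite -tt0 ttM// ltnW.
    have [mc _] := hc i i_n; have [/andP[h _]|_] := boolP (tau i < sg k.+1 <= tau i.+1); last first.
      rewrite (_ : (fun w => _) = fun=> 0); last by apply/funext => w; rewrite mulr0.
      exact: (adapted_cst hW (sg0 k) 0).
    rewrite (_ : (fun w => _) = c0 i); last by apply/funext => w; rewrite mulr1.
    apply: (adapted_mono hW ti0 _ mc).
    by apply: refine_ind_before i_n h.
  split; first exact: (@adapted_sum _ _ _ _ _ _ _ _ hW _ (sg0 k) n (fun i w => c0 i w * (tau i < sg k.+1 <= tau i.+1)%R%:R)).
  apply: (@bounded_bigsum n (fun i w => c0 i w * (tau i < sg k.+1 <= tau i.+1)%R%:R)) => i i_n.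
  have [_ [C cC]] := hc i i_n; exists C => w.
  by rewrite normrM (le_trans _ (cC w))// ler_piMr// bool_norm_le1.
have hc : step_coefs F sg N c.
  by apply: (@step_coefsB _ _ (fun k w => step_fun tau1 c1 n1 (sg k.+1) w)
    (fun k w => step_fun tau2 c2 n2 (sg k.+1) w)) => //; apply: one.
exists sg, N, c; split=> //.
- move=> j w; rewrite /step_sum.
  have e1 := refine_step_sum Ls Lb L0 Lt P1 L1 (fun i => c1 i w) (W j ^~ w).
  have e2 := refine_step_sum Ls Lb L0 Lt P2 L2 (fun i => c2 i w) (W j ^~ w).
  rewrite -e1 -e2 -sumrB; apply: eq_bigr => k _.
  by rewrite -mulrBl.
- move=> s w st.
  have e1 := refine_step_fun Ls Lb L0 Lt L1 (fun i => c1 i w) st.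
  have e2 := refine_step_fun Ls Lb L0 Lt L2 (fun i => c2 i w) st.
  rewrite [in RHS]/step_fun -e1 -e2 -sumrB; apply: eq_bigr => k _.
  by rewrite -mulrBl.
Qed.

End StepMerge.

Section MeasureLemmas.
Context {d : measure_display} {T : measurableType d} {R : realType}.
Variable mu : {measure set T -> \bar R}.
Local Open Scope ereal_scope.

Lemma integral_le_nondecreasing_limit (D : set T) (f_ : nat -> T -> \bar R) f c :
  measurable D -> (forall n, measurable_fun D (f_ n)) -> (forall n x, D x -> 0 <= f_ n x) ->
  (forall x, D x -> nondecreasing_seq (f_ ^~ x)) ->
  (forall x, D x -> f_ n x @[n --> \oo] --> f x) ->
  (forall n, \int[mu]_(x in D) f_ n x <= c) -> \int[mu]_(x in D) f x <= c.
Proof.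
move=> mD mf f0 fnd ff fc.
have cv := @cvg_monotone_convergence _ _ _ mu D mD _ mf f0 fnd.
have -> : \int[mu]_(x in D) f x = \int[mu]_(x in D) limn (f_^~ x).
  by apply: eq_integral => x /set_mem Dx; rewrite (cvg_lim _ (ff x Dx)).
rewrite -(cvg_lim (@ereal_hausdorff R) cv).
by apply: lime_le; [exact: cvgP cv|exact: nearW].
Qed.

Lemma markov_set (f : T -> \bar R) (e : R) : (0 < e)%R -> measurable_fun setT f ->
  (forall x, 0 <= f x) -> e%:E * mu [set x | e%:E <= f x] <= \int[mu]_x f x.
Proof.
move=> e0 mf f0; have mA : measurable [set x | e%:E <= f x].
  rewrite -[X in measurable X]setTI.
  by apply: measurable_lee => //; exact: measurable_cst.
rewrite -(@integral_cst _ _ _ mu _ mA).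
apply: le_trans (@ge0_subset_integral _ _ _ mu _ _ mA measurableT f mf (fun x _ => f0 x) (@subsetT _ _)).
apply: ge0_le_integral => //.
- by move=> x _; rewrite lee_fin ltW.
- exact: measurable_funTS.
Qed.

End MeasureLemmas.

(** * Convergence in probability on an event *)

Section InProbability.
Context {d : measure_display} {T : measurableType d} {R : realType}.
Variable P : probability T R.

(** The restriction to [G] accounts for truncated integrands, which agree with the given one only on
    an event. *)
Definition cvg0_on (G : set T) (D : nat -> T -> \bar R) : Prop :=
  forall e delta : R, 0 < e -> 0 < delta ->
    \forall n \near \oo, exists B : set T,
      [/\ measurable B, (P B <= delta%:E)%E &
          forall w, G w -> ~ B w -> (D n w < e%:E)%E].

Lemma cvg0_on_markov (G : set T) (D : nat -> T -> \bar R) :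
  (forall n, measurable_fun setT (D n)) -> (forall n w, 0 <= D n w)%E ->
  (\int[P]_w D n w)%E @[n --> \oo] --> 0%E -> cvg0_on G D.
Proof.
move=> mD D0 cD e delta e0 delta0.
have ed0 : 0 < e * delta by rewrite mulr_gt0.
have : \forall n \near \oo, (\int[P]_w D n w < (e * delta)%:E)%E.
  move/fine_cvgP: cD => [cf /cvgrPdist_lt/(_ _ ed0) cD].
  near=> n; have fn : (\int[P]_w D n w)%E \is a fin_num by near: n.
  rewrite -(fineK fn) lte_fin; have : `|0 - fine (\int[P]_w D n w)%E| < e * delta by near: n.
  by rewrite sub0r normrN; apply: le_lt_trans; exact: ler_norm.
move=> ev; near=> n.
exists [set w | (e%:E <= D n w)%E]; split.
- by rewrite -[X in measurable X]setTI; apply: measurable_lee => //; exact: measurable_cst.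
- rewrite -(@lee_pmul2l _ e%:E) ?lte_fin//.
  apply: (le_trans (markov_set P e0 (mD n) (D0 n))).
  by rewrite -EFinM ltW//; near: n.
- by move=> w _ /= /negP; rewrite -ltNge.
Unshelve. all: by end_near.
Qed.

(** [Y ^+ 2] is cut at level [M], so that an exceptional event [B] costs at most [M] times its
    probability, and off [B] the inequality Y^2 <= 2 Y_n^2 + 2 (Y_n - Y)^2 applies; hence the factor
    2. Then [M] tends to infinity by monotone convergence. *)
Lemma fatou_in_probability (G : set T) (Y : T -> R) (Y_ : nat -> T -> R) (c : R) :
  measurable G -> measurable_fun setT Y -> (forall n, measurable_fun setT (Y_ n)) -> 0 <= c ->
  (\forall n \near \oo, \int[P]_w ((Y_ n w) ^+ 2)%:E <= c%:E)%E ->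
  cvg0_on G (fun n w => `|Y_ n w - Y w|%:E) ->
  (\int[P]_(w in G) ((Y w) ^+ 2)%:E <= (2 * c)%:E)%E.
Proof.
move=> mG mY mY_ c0 Yc cv.
pose f_ (M : nat) w := Num.min (Y w ^+ 2) M%:R.
have mf M : measurable_fun setT (f_ M).
  by apply: measurable_minr; [exact: measurable_funX|exact: measurable_cst].
have f0 M w : 0 <= f_ M w by rewrite le_min sqr_ge0 ler0n.
apply: (@integral_le_nondecreasing_limit _ _ _ P G (fun M w => (f_ M w)%:E)) => //.
- by move=> M; apply/measurable_EFinP; exact: measurable_funTS.
- by move=> M w _; rewrite lee_fin.
- move=> w _ M M' MM; rewrite lee_fin /f_ le_min ge_min lexx/=.
  by rewrite ge_min ler_nat MM orbT.
- move=> w _; apply: cvg_near_cst; exists (Num.truncn (Y w ^+ 2)).+1 => // M /= hM.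
  rewrite /f_ min_l// ltW// (lt_le_trans (truncnS_gt _))// ler_nat//.
move=> M; apply/lee_addgt0Pr => eps eps0.
(* [e] and [delta] are such that the error off [B] and the cost of [B] are each at most
   [eps / 2]. *)
pose e := Num.sqrt (eps / 4); have e0 : 0 < e by rewrite sqrtr_gt0 divr_gt0.
have e2 : e ^+ 2 = eps / 4 by rewrite sqr_sqrtr// divr_ge0// ltW.
pose delta := eps / (2 * M.+1%:R); have delta0 : 0 < delta by rewrite divr_gt0// mulr_gt0.
have [n [nc [B [mB PB hB]]]] : exists n, (\int[P]_w ((Y_ n w) ^+ 2)%:E <= c%:E)%E /\
    exists B : set T, [/\ measurable B, (P B <= delta%:E)%E &
          forall w, G w -> ~ B w -> (`|Y_ n w - Y w|%:E < e%:E)%E].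
  have [n0 _ h0] := cv e delta e0 delta0; have [n1 _ h1] := Yc.
  exists (maxn n0 n1); split; first by apply: h1; rewrite /= leq_maxr.
  by apply: h0; rewrite /= leq_maxl.
pose g w := 2 * Y_ n w ^+ 2 + (2 * e ^+ 2 + M%:R * \1_B w).
have fg w : G w -> f_ M w <= g w.
  move=> Gw; rewrite /g indicE; have [wB|wB] := boolP (w \in B).
    rewrite mulr1 (@le_trans _ _ M%:R) ?ge_min ?lexx ?orbT//.
    by rewrite addrA lerDr addr_ge0// mulr_ge0 ?sqr_ge0.
  rewrite mulr0 addr0 /f_ ge_min; apply/orP; left.
  have : `|Y_ n w - Y w| < e by rewrite -lte_fin hB// => /mem_set; rewrite (negbTE wB).
  move=> /ltW he; have h2 : (Y_ n w - Y w) ^+ 2 <= e ^+ 2.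
    by rewrite -[leLHS]real_normK ?num_real// lerXn2r// nnegrE ltW.
  have -> : Y w ^+ 2 = 2 * Y_ n w ^+ 2 + 2 * (Y_ n w - Y w) ^+ 2 - (2 * Y_ n w - Y w) ^+ 2 by ring.
  by rewrite lerBlDr ler_wpDr ?sqr_ge0// lerD2l ler_wpM2l.
have mg1 : measurable_fun setT (fun w => 2 * Y_ n w ^+ 2).
  by apply: measurable_funM => //; exact: measurable_funX.
have mg2 : measurable_fun setT (fun w => 2 * e ^+ 2 + M%:R * \1_B w).
  by apply: measurable_funD => //; apply: measurable_funM.
have mg : measurable_fun setT g by exact: measurable_funD.
have g0 w : 0 <= 2 * e ^+ 2 + M%:R * \1_B w :> R.
  by rewrite addr_ge0// mulr_ge0// ?sqr_ge0// indicE.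
have g10 w : 0 <= 2 * Y_ n w ^+ 2 by rewrite mulr_ge0// sqr_ge0.
apply: (@le_trans _ _ (\int[P]_w (g w)%:E)%E).
  apply: (@le_trans _ _ (\int[P]_(w in G) (g w)%:E)%E).
    apply: ge0_le_integral => //.
    - by move=> w _; rewrite lee_fin.
    - by apply/measurable_EFinP; exact: measurable_funTS.
    - by apply/measurable_EFinP; exact: measurable_funTS.
  apply: ge0_subset_integral => //; first exact/measurable_EFinP.
  by move=> w _; rewrite lee_fin addr_ge0.
under eq_integral do rewrite /g EFinD.
rewrite ge0_integralD//; last 4 first.
- by move=> w _; rewrite lee_fin.
- exact/measurable_EFinP.
- by move=> w _; rewrite lee_fin.
- exact/measurable_EFinP.
under eq_integral do rewrite EFinM.
rewrite ge0_integralZl_EFin//; last 2 first.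
- by move=> w _; rewrite lee_fin sqr_ge0.
- by apply/measurable_EFinP; exact: measurable_funX.
rewrite EFinM leeD//; first by rewrite lee_pmul2l.
under eq_integral do rewrite EFinD.
rewrite ge0_integralD; [|exact: measurableT
  |by move=> w _; rewrite lee_fin mulr_ge0// sqr_ge0
  |exact: measurable_cst
  |by move=> w _; rewrite lee_fin mulr_ge0// indicE
  |by apply/measurable_EFinP; apply: measurable_funM].
have -> : (\int[P]__ (2 * e ^+ 2)%:E = (2 * e ^+ 2)%:E)%E.
  by rewrite integral_cst//; have /= -> := @probability_setT _ _ _ P; rewrite mule1.
under eq_integral do rewrite EFinM.
rewrite ge0_integralZl_EFin; [|exact: measurableT
  |by move=> w _; rewrite lee_fin indicE
  |exact/measurable_EFinP
  |exact: ler0n].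
rewrite integral_indic// setIT e2.
apply: (@le_trans _ _ ((2 * (eps / 4))%:E + M%:R%:E * delta%:E)%E).
  by rewrite leeD2l// lee_wpmul2l// lee_fin.
rewrite -EFinM -EFinD lee_fin /delta.
have -> : M%:R * (eps / (2 * M.+1%:R)) = (M%:R / M.+1%:R) * (eps / 2).
  by rewrite invfM; ring.
have : M%:R / M.+1%:R * (eps / 2) <= 1 * (eps / 2) :> R.
  apply: ler_wpM2r; first by rewrite divr_ge0// ltW.
  by rewrite ler_pdivrMr// mul1r ler_nat.
by move: (M%:R / _ * _) => x hx; lra.
Qed.

End InProbability.

(** * Elementary integrals: isometry and Lenglart's inequality *)

Section ItoLimit.
Context {R : realType} {d : measure_display} {T : measurableType d}.
Variable P : probability T R.
Variable F : R -> set (set T).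
Variable J : Type.
Variables (W : J -> R -> T -> R) (cov : J -> J -> R).
Hypothesis hW : is_noise P F W cov.
Hypothesis cov1 : forall j, cov j j = 1.
Local Notation leb := (@lebesgue_measure R).

(** The squared L^2 norm of an integrand over time and probability, kept in the extended reals
    because it is not known to be finite in advance. *)
Definition energy (t : R) (D : R -> T -> R) : \bar R :=
  (\int[P]_w \int[leb]_(s in `]0%R, t]) ((D s w) ^+ 2)%:E)%E.

Section one_partition.
Variables (t : R) (sg : nat -> R) (N : nat).
Hypothesis sgM : {homo sg : i j / (i <= j)%N >-> i <= j}.
Hypothesis sgP : partition_of t sg N.
Implicit Types (c : nat -> T -> R).

Let sg0 : 0 <= sg 0. Proof. by have [-> _ _] := sgP. Qed.
Let sgN : sg N <= t. Proof. by have [_ -> _] := sgP. Qed.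
Let sgMN i k : (i <= k)%N -> (k <= N)%N -> sg i <= sg k. Proof. by move=> + _; exact: sgM. Qed.

(** The cell containing [s] does not depend on the coefficients. Applied to squared coefficients
    this computes the square of a step function. *)
Lemma step_fun_eq c s w : 0 < s <= t ->
  exists2 k, (k < N)%N & forall c', step_fun sg c' N s w = c' k w.
Proof.
move=> st; have [sg00 sgNt _] := sgP.
have := @sum_step R sg N (fun k => c k w) s sgM; rewrite sg00 sgNt => /(_ st)[k kN [ks _]].
exists k => // c'; have := @sum_step R sg N (fun k => c' k w) s sgM.
rewrite sg00 sgNt => /(_ st)[k' k'N [/andP[k's1 k's2] e]].
rewrite /step_fun e; congr (c' _ w); case/andP: ks => ks1 ks2.
apply/eqP; rewrite eqn_leq; apply/andP; split; rewrite leqNgt; apply/negP => /sgM h.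
  by have := le_lt_trans (le_trans ks2 h) k's1; rewrite ltxx.
by have := le_lt_trans (le_trans k's2 h) ks1; rewrite ltxx.
Qed.

Lemma path_energy c w :
  (\int[leb]_(s in `]0%R, t]) ((step_fun sg c N s w) ^+ 2)%:E =
   (\sum_(k < N) c k w ^+ 2 * (sg k.+1 - sg k))%:E)%E.
Proof.
rewrite -(@Rintegral_step_fun _ sg (fun k => c k w ^+ 2) N t sgM sg0 sgN).
have e s : s \in `]0, t]%classic -> (step_fun sg c N s w) ^+ 2 =
    \sum_(i < N) c i w ^+ 2 * (sg i < s <= sg i.+1)%R%:R.
  rewrite inE/= in_itv/= => st; have [k _ ek] := step_fun_eq c w st.
  by rewrite ek; have := ek (fun k w => c k w ^+ 2); rewrite /step_fun => ->.
have ii : leb.-integrable `]0, t] (EFin \o (fun s => \sum_(i < N) c i w ^+ 2 * (sg i < s <= sg i.+1)%R%:R)).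
  apply: (bounded_integrable_oc (M := \sum_(i < N) c i w ^+ 2)).
    exact: (@measurable_step_fun _ sg (fun k => c k w ^+ 2) N).
  move=> s _; rewrite (le_trans (ler_norm_sum _ _ _))// ler_sum// => i _.
  by rewrite normrM ger0_norm ?sqr_ge0// ler_piMr ?sqr_ge0// bool_norm_le1.
rewrite /Rintegral fineK; last exact: integrable_fin_num.
by apply: eq_integral => s st; rewrite /= e.
Qed.

(** The case of equal noises and coefficients in [step_sum_isometry], with the sum over cells read
    as a time integral. *)
Lemma energy_step c j : step_coefs F sg N c ->
  (\int[P]_w ((step_sum W sg c j N w) ^+ 2)%:E)%E = energy t (step_fun sg c N).
Proof.
move=> hc.
have iso := step_sum_isometry hW sgMN sg0 j j hc hc (leqnn N).
have s2 := (step_sum_sqint hW sgMN sg0 j hc (leqnn N)).2.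
have e1 : (\int[P]_w ((step_sum W sg c j N w) ^+ 2)%:E)%E =
    (\int[P]_w (step_sum W sg c j N w * step_sum W sg c j N w))%:E.
  have -> : \int[P]_w (step_sum W sg c j N w * step_sum W sg c j N w) =
      \int[P]_w (step_sum W sg c j N w ^+ 2) by apply: eq_Rintegral => w _; rewrite expr2.
  by rewrite /Rintegral fineK//; exact: (integrable_fin_num measurableT s2).
rewrite e1 iso cov1 mul1r /energy.
under [in RHS]eq_integral do rewrite path_energy.
have ic i : (i < N)%N -> P.-integrable setT (EFin \o (fun w => c i w ^+ 2 * (sg i.+1 - sg i))).
  move=> iN; have [mc [C cC]] := hc i iN; have i0 : 0 <= sg i by rewrite (le_trans sg0)// sgM.
  have mcT := adapted_measurable hW i0 mc.
  apply: (@bounded_integrable _ _ _ _ _ (C ^+ 2 * (sg i.+1 - sg i))).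
    by apply: measurable_funM => //; exact: measurable_funX.
  move=> w; have h : 0 <= sg i.+1 - sg i by rewrite subr_ge0 sgM.
  rewrite normrM (ger0_norm h) ler_wpM2r// normrX lerXn2r// nnegrE//.
  exact: le_trans (cC w).
have [ii e2] := @Rintegral_sum _ _ _ P setT _ (index_enum 'I_N)
  (fun i w => c i w ^+ 2 * (sg i.+1 - sg i)) measurableT (fun i => ic i (ltn_ord i)).
rewrite -[RHS](@fineK _); last exact: (integrable_fin_num measurableT ii).
congr (_%:E); rewrite -[RHS]/(Rintegral _ _ _) e2; apply: eq_bigr => i _.
have iN := ltn_ord i; have [mc [C cC]] := hc i iN.
have i0 : 0 <= sg i by rewrite (le_trans sg0)// sgM.
have mcT := adapted_measurable hW i0 mc.
rewrite mulrC -RintegralZl//; last first.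
  apply: (@bounded_integrable _ _ _ _ _ (C ^+ 2)).
    exact: measurable_funM.
  move=> w; rewrite -expr2 normrX lerXn2r// nnegrE//.
  exact: le_trans (cC w).
by apply: eq_Rintegral => w _; rewrite expr2 mulrC.
Qed.

(* The coefficients are switched off as soon as the accumulated energy exceeds dl. *)
Lemma step_sum_lenglart c j (dl e : R) : step_coefs F sg N c -> 0 < e -> 0 <= dl ->
  exists B : set T, [/\ measurable B, (P B <= (dl / e ^+ 2)%:E)%E &
    forall w, ~ B w -> \sum_(k < N) c k w ^+ 2 * (sg k.+1 - sg k) <= dl ->
      `|step_sum W sg c j N w| < e].
Proof.
move=> hc e0 dl0.
pose V k w := \sum_(l < k) c l w ^+ 2 * (sg l.+1 - sg l).
have Vnd k k' w : (k <= k')%N -> V k w <= V k' w.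
  apply: (@homo_leq R (fun k => V k w) <=%R) k k' => [?|? ? ?|l]; [exact: lexx|exact: le_trans|].
  by rewrite /V big_ord_recr/= lerDl mulr_ge0 ?sqr_ge0// subr_ge0 sgM.
(* [V k.+1] includes the energy of [c k] itself, so the switch is already known at time [sg k], and
   the retained energy never exceeds [dl]. *)
pose b k w : R := (V k.+1 w <= dl)%R%:R.
pose c' k w := c k w * b k w.
have hc' : step_coefs F sg N c'.
  move=> k kN; have [mc [C cC]] := hc k kN; have k0 : 0 <= sg k by rewrite (le_trans sg0)// sgM.
  split; last by exists C => w; rewrite /c' normrM (le_trans _ (cC w))// ler_piMr// bool_norm_le1.
  apply: (adaptedM hW k0 mc).
  have mV : measurable_wrt (F (sg k)) (V k.+1).
    apply: (@adapted_sum _ _ _ _ _ _ _ _ hW _ k0 k.+1 (fun l w => c l w ^+ 2 * (sg l.+1 - sg l))) => l lk.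
    have lN : (l < N)%N by rewrite (leq_ltn_trans _ kN).
    have [mcl _] := hc l lN; have l0 : 0 <= sg l by rewrite (le_trans sg0)// sgM.
    have lk' : sg l <= sg k by exact: sgM.
    have mcl' := adapted_mono hW l0 lk' mcl.
    apply: (adaptedM hW k0) (adapted_cst hW k0 _).
    rewrite (_ : (fun w => _) = (fun w => c l w * c l w)).
      exact: (adaptedM hW k0 mcl' mcl').
    by apply/funext => w; rewrite expr2.
  apply: (adapted_comp hW k0 (h := fun x => (x <= dl)%R%:R)) mV.
  rewrite (_ : (fun _ => _) = (\1_(`]-oo, dl]) : R -> R)); first exact: measurable_indic.
  by apply/funext => x; rewrite indicE mem_setE in_itv.
have le_dl w : \sum_(k < N) c' k w ^+ 2 * (sg k.+1 - sg k) <= dl.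
  suff : \sum_(k < N) c' k w ^+ 2 * (sg k.+1 - sg k) <= Num.min dl (V N w).
    by rewrite le_min => /andP[].
  have : forall n, \sum_(k < n) c' k w ^+ 2 * (sg k.+1 - sg k) <= Num.min dl (V n w); last exact.
    elim=> [|n IH]; first by rewrite /V !big_ord0 le_min dl0 lexx.
    move: IH; rewrite le_min => /andP[IH1 IH2].
    rewrite big_ord_recr/= le_min.
    have sq : c' n w ^+ 2 * (sg n.+1 - sg n) <= c n w ^+ 2 * (sg n.+1 - sg n).
      rewrite ler_wpM2r ?subr_ge0 ?sgM// /c' exprMn ler_piMr ?sqr_ge0// /b.
      by rewrite expr_le1 ?ler0n ?lern1 ?leq_b1.
    have h2 : \sum_(i < n) c' i w ^+ 2 * (sg i.+1 - sg i) + c' n w ^+ 2 * (sg n.+1 - sg n) <= V n.+1 w.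
      by rewrite /V big_ord_recr/= lerD.
    rewrite h2 andbT; have [h|h] := boolP (V n.+1 w <= dl).
      exact: le_trans h.
    by rewrite /c' /b (negbTE h) mulr0 expr0n mul0r addr0.
have E2 := energy_step j hc'.
have le_E : (energy t (step_fun sg c' N) <= dl%:E)%E.
  rewrite /energy; under eq_integral do rewrite path_energy.
  apply: (@le_trans _ _ (\int[P]_w (dl%:E))%E).
    apply: ge0_le_integral => //.
    - move=> w _; rewrite lee_fin sumr_ge0// => k _.
      by rewrite mulr_ge0 ?sqr_ge0// subr_ge0 sgM.
    - apply/measurable_EFinP; apply: measurable_sum => k.
      apply: measurable_funM => //; apply: measurable_funX.
      have [mc _] := hc' k (ltn_ord k).
      have k0 : 0 <= sg k by rewrite (le_trans sg0)// sgM.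
      exact: (adapted_measurable hW k0 mc).
    - by move=> w _; rewrite lee_fin.
  by rewrite integral_cst//; have /= -> := @probability_setT _ _ _ P; rewrite mule1.
have s2 := step_sum_sqint hW sgMN sg0 j hc' (leqnn N).
have mf : measurable_fun setT (fun w => ((step_sum W sg c' j N w) ^+ 2)%:E).
  by apply/measurable_EFinP; apply: measurable_funX; case: s2.
exists [set w | ((e ^+ 2)%:E <= ((step_sum W sg c' j N w) ^+ 2)%:E)%E]; split.
- by rewrite -[X in measurable X]setTI; apply: measurable_lee => //; exact: measurable_cst.
- have e20 : 0 < e ^+ 2 by rewrite exprn_gt0.
  rewrite -(@lee_pmul2l _ (e ^+ 2)%:E) ?lte_fin//.
  apply: (le_trans (markov_set P e20 mf _)); first by move=> w; rewrite lee_fin sqr_ge0.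
  by rewrite E2 -EFinM mulrC divfK ?gt_eqF.
- move=> w /= /negP; rewrite -ltNge lte_fin => lt_e Vdl.
  have -> : step_sum W sg c j N w = step_sum W sg c' j N w.
    apply: eq_bigr => k _; congr (_ * _); rewrite /c' /b.
    by rewrite (le_trans (Vnd k.+1 N w _) Vdl) ?mulr1.
  by rewrite -(ltr_pXn2r (n := 2)) ?nnegrE ?normr_ge0 ?ltW// real_normK ?num_real.
Qed.

End one_partition.
End ItoLimit.

Section ItoEnergy.
Context {R : realType} {d : measure_display} {T : measurableType d}.
Variable P : probability T R.
Variable F : R -> set (set T).
Variable J : eqType.
Variables (W : J -> R -> T -> R) (cov : J -> J -> R).
Hypothesis hW : is_noise P F W cov.
Hypothesis cov1 : forall j, cov j j = 1.
Local Notation leb := (@lebesgue_measure R).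

Definition jointly_measurable (t : R) (D : R -> T -> R) : Prop :=
  measurable_fun (`]0, t] `*` [set: T]) (fun z : R * T => D z.1 z.2).

Lemma jointly_measurableB t D D' : jointly_measurable t D -> jointly_measurable t D' ->
  jointly_measurable t (fun s w => D s w - D' s w).
Proof. by move=> mD mD'; exact: measurable_funB. Qed.

Lemma jointly_measurable_section t D w : jointly_measurable t D ->
  measurable_fun `]0, t] (D ^~ w).
Proof.
move=> mD; exact: (@measurable_section _ _ _ `]0, t]%classic (fun z => D z.1 z.2) w (measurable_itv _) mD).
Qed.

Lemma jointly_measurable_step t tau n c : 0 <= tau 0 ->
  (forall i k, (i <= k)%N -> (k <= n)%N -> tau i <= tau k) ->
  step_coefs F tau n c -> jointly_measurable t (step_fun tau c n).
Proof.
move=> t0 tM hc; apply: measurable_sum_step => k kn; have [mc _] := hc k kn.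
have k0 : 0 <= tau k by rewrite (le_trans t0)// tM// ltnW.
exact: (adapted_measurable hW k0 mc).
Qed.

Let mI (t : R) : measurable (`]0, t] : set R). Proof. exact: measurable_itv. Qed.

Lemma measurable_path_energy t D : jointly_measurable t D ->
  measurable_fun setT (fun w => \int[leb]_(s in `]0%R, t]) ((D s w) ^+ 2)%:E)%E.
Proof.
move=> mD.
have := @measurable_tonelli_strip2 _ T R `]0%R, t]%classic (mI t) (fun z => ((D z.1 z.2) ^+ 2)%:E).
apply; last by move=> z _; rewrite lee_fin sqr_ge0.
by apply/measurable_EFinP; exact: measurable_funX.
Qed.

Lemma path_energy_triangle (p q t : R) (D D1 D2 : R -> R) :
  0 <= p -> 0 <= q ->
  measurable_fun `]0, t] D -> measurable_fun `]0, t] D1 -> measurable_fun `]0, t] D2 ->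
  (forall s, 0 < s <= t -> D s ^+ 2 <= p * D1 s ^+ 2 + q * D2 s ^+ 2) ->
  (\int[leb]_(s in `]0%R, t]) (D s ^+ 2)%:E <=
   p%:E * \int[leb]_(s in `]0%R, t]) (D1 s ^+ 2)%:E +
   q%:E * \int[leb]_(s in `]0%R, t]) (D2 s ^+ 2)%:E)%E.
Proof.
move=> p0 q0 mD mD1 mD2 h.
have sq (f : R -> R) : measurable_fun `]0, t] f ->
    measurable_fun (`]0, t] : set R) (fun s => (f s ^+ 2)%:E).
  by move=> mf; apply/measurable_EFinP; exact: measurable_funX.
have sq0 (f : R -> R) s : (0 <= (f s ^+ 2)%:E)%E by rewrite lee_fin sqr_ge0.
rewrite -!ge0_integralZl_EFin//; try exact: sq.
rewrite -ge0_integralD//.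
- apply: ge0_le_integral; [exact: mI|by move=> s _; exact: sq0|exact: sq
    |by apply: emeasurable_funD; apply: measurable_funeM; exact: sq|].
  by move=> s; rewrite /= in_itv/= => /h; rewrite -!EFinM -EFinD lee_fin.
- by move=> s _; rewrite mule_ge0.
- by apply: measurable_funeM; exact: sq.
- by move=> s _; rewrite mule_ge0.
- by apply: measurable_funeM; exact: sq.
Qed.

(** The weights stay free: 2 and 2 suffice for crude bounds, while 1 + eta and 1 + 1/eta yield
    convergence of energies. *)
Lemma energy_triangle (p q : R) t D D1 D2 : 0 <= p -> 0 <= q -> jointly_measurable t D ->
  jointly_measurable t D1 -> jointly_measurable t D2 ->
  (forall s w, 0 < s <= t -> D s w ^+ 2 <= p * D1 s w ^+ 2 + q * D2 s w ^+ 2) ->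
  (energy P t D <= p%:E * energy P t D1 + q%:E * energy P t D2)%E.
Proof.
move=> p0 q0 mD mD1 mD2 h; rewrite /energy.
have pe0 (f : R -> T -> R) w : (0 <= \int[leb]_(s in `]0%R, t]) (f s w ^+ 2)%:E)%E.
  by apply: integral_ge0 => s _; rewrite lee_fin sqr_ge0.
rewrite -!ge0_integralZl_EFin//; try exact: measurable_path_energy.
rewrite -ge0_integralD//.
- apply: ge0_le_integral; [exact: measurableT|by move=> w _; exact: pe0|exact: measurable_path_energy
    |by apply: emeasurable_funD; apply: measurable_funeM; exact: measurable_path_energy|].
  move=> w _; apply: path_energy_triangle => //; try exact: jointly_measurable_section.
  by move=> s st; exact: h.
- by move=> w _; rewrite mule_ge0.
- by apply: measurable_funeM; exact: measurable_path_energy.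
- by move=> w _; rewrite mule_ge0.
- by apply: measurable_funeM; exact: measurable_path_energy.
Qed.

Lemma sqrB_le (x y : R) : (x - y) ^+ 2 <= 2 * x ^+ 2 + 2 * y ^+ 2.
Proof.
rewrite -subr_ge0 (_ : _ - _ = (x + y) ^+ 2); last by ring.
exact: sqr_ge0.
Qed.

Lemma step_process_partition (S : @step_process _ T R) t : itv_partition 0 t (step_pts S) ->
  partition_of t (step_time S) (size (step_pts S)).
Proof.
move=> [pth /eqP lst]; split; first by [].
  by rewrite /step_time -last_nth.
move=> i k ik kn; rewrite /step_time; apply: (sorted_leq_nth le_trans le_refl) => //.
- by apply: sub_path pth => x y; exact: ltW.
- by rewrite inE ltnS (leq_trans ik).
Qed.

Section limit.
Variables (t : R) (j : J) (H : R -> T -> R) (I : T -> R) (G : set T).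
Variables (tau : nat -> nat -> R) (n : nat -> nat) (c : nat -> nat -> T -> R).
Hypothesis t0 : 0 <= t.
Hypothesis ito : is_ito_integral P F (W j) H t I.
Hypothesis mH : forall w, G w -> measurable_fun `]0, t] (H ^~ w).
Hypothesis tauP : forall m, partition_of t (tau m) (n m).
Hypothesis hc : forall m, step_coefs F (tau m) (n m) (c m).
Hypothesis cvH : cvg0_on P G (fun m w =>
  \int[leb]_(s in `]0%R, t]) ((step_fun (tau m) (c m) (n m) s w - H s w) ^+ 2)%:E)%E.

(* Both approximating sequences live on a common refinement, where Lenglart's
   inequality controls the difference of their elementary integrals. *)
Lemma ito_integral_limit :
  cvg0_on P G (fun m w => `|step_sum W (tau m) (c m) j (n m) w - I w|%:E).
Proof.
have [S [Sad Scv SI]] := ito.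
have SP m := step_process_partition (Sad m).1.
have hS m : step_coefs F (step_time (S m)) (size (step_pts (S m))) (step_coef (S m)).
  by move=> k kn; exact: (Sad m).2.
move=> e delta e0 delta0.
have e20 : 0 < (e / 2) ^+ 2 by rewrite exprn_gt0// divr_gt0.
have d40 : 0 < delta / 4 by rewrite divr_gt0.
(* With this choice Lenglart's bound [dl / (e / 2) ^+ 2] equals [delta / 4], as for the three other
   exceptional events, and two integrands within energy [dl / 4] of [H] differ by energy at most
   [dl]. *)
pose dl := (e / 2) ^+ 2 * (delta / 4).
have dl0 : 0 < dl by rewrite mulr_gt0.
have dl40 : 0 < dl / 4 by rewrite divr_gt0.
have ev1 := Scv _ _ dl40 d40; have ev2 := cvH dl40 d40.
have e2' : 0 < e / 2 by rewrite divr_gt0.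
have ev3 := SI _ _ e2' d40.
near=> m.
have [B1 [mB1 PB1 hB1]] : exists B : set T, [/\ measurable B, (P B <= (delta / 4)%:E)%E &
    forall w, ~ B w -> (\int[leb]_(s in `[0%R, t])
      ((step_val (S m) s w - H s w) ^+ 2)%:E < (dl / 4)%:E)%E] by near: m; exact: ev1.
have [B2 [mB2 PB2 hB2]] : exists B : set T, [/\ measurable B, (P B <= (delta / 4)%:E)%E &
    forall w, G w -> ~ B w -> (\int[leb]_(s in `]0%R, t])
      ((step_fun (tau m) (c m) (n m) s w - H s w) ^+ 2)%:E < (dl / 4)%:E)%E] by near: m; exact: ev2.
have [B3 [mB3 PB3 hB3]] : exists B : set T, [/\ measurable B, (P B <= (delta / 4)%:E)%E &
    forall w, ~ B w -> (`|step_integral (S m) (W j) w - I w|%:E < (e / 2)%:E)%E] by near: m; exact: ev3.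
have [sg [N [c' [[sgP sgM] hc' eS ef]]]] := step_merge hW t0 (tauP m) (@hc m) (SP m) (@hS m).
have [B4 [mB4 PB4 hB4]] := step_sum_lenglart hW cov1 sgM sgP j hc' e2' (ltW dl0).
exists (B1 `|` B2 `|` (B3 `|` B4)); split.
- by do !apply: measurableU.
- have {}PB4 : (P B4 <= (delta / 4)%:E)%E.
    by rewrite (le_trans PB4)// lee_fin /dl mulrAC divff ?gt_eqF// mul1r.
  apply: (le_trans (measureU2 _ _ _)); [exact: measurableU|exact: measurableU|].
  rewrite (_ : delta = (delta / 4 + delta / 4) + (delta / 4 + delta / 4)); last by field.
  rewrite [leRHS]EFinD; apply: leeD; apply: (le_trans (measureU2 _ _ _)) => //; rewrite EFinD; exact: leeD.
move=> w Gw nB.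
have nB1 : ~ B1 w by move=> h; apply: nB; left; left.
have nB2 : ~ B2 w by move=> h; apply: nB; left; right.
have nB3 : ~ B3 w by move=> h; apply: nB; right; left.
have nB4 : ~ B4 w by move=> h; apply: nB; right; right.
have mS s' : measurable_fun (`]0, t] : set R) (fun s => step_fun (step_time (S m)) (step_coef (S m)) s' s w).
  exact: (@measurable_step_fun _ (step_time (S m)) (fun k => step_coef (S m) k w)).
have mR : measurable_fun (`]0, t] : set R) (fun s => step_fun (tau m) (c m) (n m) s w).
  exact: (@measurable_step_fun _ (tau m) (fun k => c m k w)).
have mHw := mH Gw.
have {}hB1 := hB1 w nB1; have {}hB2 := hB2 w Gw nB2.
have V : \sum_(k < N) c' k w ^+ 2 * (sg k.+1 - sg k) <= dl.
  rewrite -lee_fin -(path_energy sgM sgP).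
  have mc' : measurable_fun (`]0, t] : set R) (fun s => step_fun sg c' N s w).
    exact: (@measurable_step_fun _ sg (fun k => c' k w)).
  apply: (le_trans (@path_energy_triangle 2 2 t (fun s => step_fun sg c' N s w)
    (fun s => step_fun (tau m) (c m) (n m) s w - H s w)
    (fun s => step_val (S m) s w - H s w) _ _ mc' _ _ _)) => //.
  - exact: measurable_funB.
  - by apply: measurable_funB => //; exact: mS.
  - move=> s st; rewrite ef//.
    rewrite (_ : step_fun _ _ _ _ _ - _ =
      (step_fun (tau m) (c m) (n m) s w - H s w) - (step_val (S m) s w - H s w)); last first.
      by rewrite opprB addrA subrK.
    exact: sqrB_le.
  have -> : dl%:E = (2%:E * (dl / 4)%:E + 2%:E * (dl / 4)%:E)%E.
    by rewrite -!EFinM -EFinD; congr (_%:E); field.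
  apply: leeD; rewrite lee_pmul2l ?lte_fin//; first exact: ltW.
  rewrite integral_itv_obnd_cbnd; first exact: ltW.
  apply/measurable_EFinP; apply: measurable_funX; apply: measurable_funB => //; exact: mS.
have := hB4 w nB4 V; rewrite eS => h4.
have := hB3 w nB3; rewrite lte_fin => h3; rewrite lte_fin.
rewrite (_ : _ - _ = (step_sum W (tau m) (c m) j (n m) w -
   step_integral (S m) (W j) w) + (step_integral (S m) (W j) w - I w)); last first.
  by rewrite addrA subrK.
rewrite (le_lt_trans (ler_normD _ _))// [ltRHS]splitr ltrD//.
Unshelve. all: by end_near.
Qed.

End limit.
End ItoEnergy.

(** * L^2 bounds for Ito integrals *)

Section ItoIsometry.
Context {R : realType} {d : measure_display} {T : measurableType d}.
Variable P : probability T R.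
Variable F : R -> set (set T).
Variable J : eqType.
Variables (W : J -> R -> T -> R) (cov : J -> J -> R).
Hypothesis hW : is_noise P F W cov.
Hypothesis cov1 : forall j, cov j j = 1.
Local Notation leb := (@lebesgue_measure R).

Lemma lee_twice (x y : \bar R) (r s : R) : (x <= r%:E -> y <= s%:E ->
  2%:E * x + 2%:E * y <= (2 * r + 2 * s)%:E)%E.
Proof.
move=> xr ys; rewrite [leRHS](_ : _ = 2%:E * r%:E + 2%:E * s%:E)%E; last first.
  by rewrite -!EFinM -EFinD.
by apply: leeD; apply: lee_wpmul2l; rewrite // lee_fin.
Qed.

Lemma energy_ge0 t D : (0 <= energy P t D)%E.
Proof.
apply: integral_ge0 => w _; apply: integral_ge0 => s _.
by rewrite lee_fin sqr_ge0.
Qed.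

Lemma eq_energy (t : R) D D' : (forall s w, 0 < s <= t -> D s w = D' s w) ->
  energy P t D = energy P t D'.
Proof.
move=> e; apply: eq_integral => w _; apply: eq_integral => s.
by rewrite inE/= in_itv/= => st; rewrite e.
Qed.

(** Distinct noises of the list are uncorrelated, so their elementary integrals are orthogonal and
    the squares add up. *)
Lemma step_combo_energy (t : R) (js : seq J) (wt : J -> R) sg N (c : J -> nat -> T -> R) :
  {homo sg : i j / (i <= j)%N >-> i <= j} -> partition_of t sg N ->
  uniq js -> {in js &, forall j k, j != k -> cov j k = 0} ->
  (forall j, step_coefs F sg N (c j)) ->
  (\int[P]_w ((\sum_(j <- js) wt j * step_sum W sg (c j) j N w) ^+ 2)%:E =
   \sum_(j <- js) ((wt j ^+ 2)%:E * energy P t (step_fun sg (c j) N)))%E.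
Proof.
move=> sgM sgP ujs orth hc.
have sg0 : 0 <= sg 0 by have [-> _ _] := sgP.
have sgMN i k : (i <= k)%N -> (k <= N)%N -> sg i <= sg k by move=> + _; exact: sgM.
have s2 j := step_sum_sqint hW sgMN sg0 j (hc j) (leqnn N).
pose S j w := step_sum W sg (c j) j N w.
have sY : forall l, sqint P setT (fun w => \sum_(j <- l) wt j * S j w).
  move=> l; apply: sqint_sum => // j; apply: sqintZ => //; exact: s2.
have fin2 f : sqint P setT f -> (\int[P]_w (f w ^+ 2)%:E)%E = (\int[P]_w (f w ^+ 2))%:E.
  by move=> [_ h]; rewrite /Rintegral fineK//; exact: (integrable_fin_num measurableT h).
rewrite fin2; last exact: sY.
rewrite (eq_bigr (fun j => (wt j ^+ 2 * \int[P]_w (S j w ^+ 2))%:E)); last first.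
  by move=> j _; rewrite -(energy_step hW cov1 sgM sgP j (hc j)) (fin2 (S j) (s2 j)) -EFinM.
rewrite sumEFin; congr (_%:E).
have iSS j k : P.-integrable setT (EFin \o (fun w => S j w * S k w)).
  by apply: sqint_mul => //; exact: s2.
elim: js ujs orth => [_ _|j js IH /= /andP[jjs ujs] orth].
  by rewrite big_nil -[RHS](Rintegral_prob_cst P); apply: eq_Rintegral => w _; rewrite big_nil expr0n.
have {}IH := IH ujs (sub_in2 (fun x xjs => mem_behead xjs) orth).
rewrite big_cons -IH.
have cross : \int[P]_w (S j w * \sum_(k <- js) wt k * S k w) = 0.
  rewrite (_ : \int[P]_w _ = \int[P]_w (\sum_(k <- js) wt k * (S j w * S k w))); last first.
    by apply: eq_Rintegral => w _; rewrite mulr_sumr; apply: eq_bigr => k _; rewrite mulrCA.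
  have iw k := rintegrableZl measurableT (wt k) (iSS j k).
  have [_ ->] := @Rintegral_sum _ _ _ P setT _ js (fun k w => wt k * (S j w * S k w)) measurableT iw.
  rewrite big_seq big1// => k kjs; rewrite RintegralZl// /S.
  rewrite (step_sum_isometry hW sgMN sg0 j k (hc j) (hc k) (leqnn N)) orth ?mul0r ?mulr0//.
  - by rewrite inE eqxx.
  - by rewrite inE kjs orbT.
  - by apply: contraNneq jjs => ->.
pose Y w := \sum_(k <- js) wt k * S k w.
have i1 := rintegrableZl measurableT (wt j ^+ 2) (s2 j).2.
have i2 : P.-integrable setT (EFin \o (fun w => S j w * Y w)) by apply: sqint_mul (s2 j) (sY js).
have i2' := rintegrableZl measurableT (2 * wt j) i2.
have i3 : P.-integrable setT (EFin \o (fun w => Y w ^+ 2)) by exact: (sY js).2.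
have i12 := rintegrableD measurableT i1 i2'.
rewrite -RintegralZl//; last exact: (s2 j).2.
rewrite (_ : \int[P]_w _ = \int[P]_w (wt j ^+ 2 * S j w ^+ 2 + 2 * wt j * (S j w * Y w) + Y w ^+ 2)); last first.
  by apply: eq_Rintegral => w _; rewrite big_cons /Y /S; ring.
by rewrite RintegralD// RintegralD// [in X in _ + X + _]RintegralZl// cross mulr0 addr0.
Qed.

Section limits.
Variables (t : R) (G : set T).
Variables (tau : nat -> nat -> R) (n : nat -> nat).
Hypothesis t0 : 0 <= t.
Hypothesis mG : measurable G.
Hypothesis tauM : forall m, {homo tau m : i j / (i <= j)%N >-> i <= j}.
Hypothesis tauP : forall m, partition_of t (tau m) (n m).

Let tau0 m : 0 <= tau m 0. Proof. by have [-> _ _] := tauP m. Qed.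
Let tauMN m i k : (i <= k)%N -> (k <= n m)%N -> tau m i <= tau m k.
Proof. by move=> + _; exact: tauM. Qed.

(** [K] is a jointly measurable substitute for [H] that agrees with it on [G]. Markov's inequality
    turns convergence in energy towards [K] into convergence in probability, which on [G] is
    convergence towards [H]. *)
Lemma ito_integral_limit_energy j (H K : R -> T -> R) (I : T -> R) (c : nat -> nat -> T -> R) :
  is_ito_integral P F (W j) H t I -> jointly_measurable t K ->
  (forall s w, G w -> 0 < s <= t -> K s w = H s w) ->
  (forall m, step_coefs F (tau m) (n m) (c m)) ->
  energy P t (fun s w => step_fun (tau m) (c m) (n m) s w - K s w) @[m --> \oo] --> 0%E ->
  cvg0_on P G (fun m w => `|step_sum W (tau m) (c m) j (n m) w - I w|%:E).
Proof.
move=> ito mK KH hc cv.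
apply: (ito_integral_limit hW cov1 t0 ito _ tauP hc).
  move=> w Gw; have := jointly_measurable_section w mK; apply: eq_measurable_fun => s.
  by rewrite inE/= in_itv/= => st; exact: KH.
have jm m : jointly_measurable t (fun s w => step_fun (tau m) (c m) (n m) s w - K s w).
  by apply: jointly_measurableB => //; exact: (jointly_measurable_step hW (tau0 m) (@tauMN m) (hc m)).
move=> e delta e0 delta0.
have h : cvg0_on P setT (fun m w => (\int[leb]_(s in `]0%R, t])
    ((step_fun (tau m) (c m) (n m) s w - K s w) ^+ 2)%:E)%E).
  apply: cvg0_on_markov => // [m|m w]; first exact: measurable_path_energy.
  by apply: integral_ge0 => s _; rewrite lee_fin sqr_ge0.
have := h e delta e0 delta0; apply: filterS => m [B [mB PB hB]].
exists B; split=> // w Gw nB; have := hB w Logic.I nB; apply: le_lt_trans.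
rewrite le_eqVlt; apply/orP; left; apply/eqP; apply: eq_integral => s.
by rewrite inE/= in_itv/= => st; rewrite KH.
Qed.

(** The constant 4 is a factor 2 from comparing the energy of the step integrand with that of [K j],
    times a factor 2 from [fatou_in_probability]. *)
Lemma ito_combo_le (js : seq J) (wt : J -> R) (H K : J -> R -> T -> R) (I : J -> T -> R)
    (c : nat -> J -> nat -> T -> R) (e : J -> R) :
  uniq js -> {in js &, forall j k, j != k -> cov j k = 0} ->
  (forall j, is_ito_integral P F (W j) (H j) t (I j)) ->
  (forall j, measurable_fun setT (I j)) ->
  (forall j, jointly_measurable t (K j)) ->
  (forall j s w, G w -> 0 < s <= t -> K j s w = H j s w) ->
  (forall m j, step_coefs F (tau m) (n m) (c m j)) ->
  (forall j, energy P t (fun s w => step_fun (tau m) (c m j) (n m) s w - K j s w) @[m --> \oo] --> 0%E) ->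
  (forall j, energy P t (K j) <= (e j)%:E)%E ->
  (\int[P]_(w in G) ((\sum_(j <- js) wt j * I j w) ^+ 2)%:E <=
   (4 * \sum_(j <- js) wt j ^+ 2 * e j)%:E)%E.
Proof.
move=> ujs orth ito mI mK KH hc cv Ke.
have e0 j : 0 <= e j by rewrite -lee_fin (le_trans (energy_ge0 t (K j))).
pose Y m w := \sum_(j <- js) wt j * step_sum W (tau m) (c m j) j (n m) w.
have mS m j : measurable_fun setT (step_sum W (tau m) (c m j) j (n m)).
  by case: (step_sum_sqint hW (@tauMN m) (tau0 m) j (hc m j) (leqnn _)).
have mY m : measurable_fun setT (Y m).
  by apply: measurable_sum => j; apply: measurable_funM.
have mYI : measurable_fun setT (fun w => \sum_(j <- js) wt j * I j w).
  by apply: measurable_sum => j; apply: measurable_funM.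
have cvY : cvg0_on P G (fun m w => `|Y m w - \sum_(j <- js) wt j * I j w|%:E).
  have one j : cvg0_on P G (fun m w => `|step_sum W (tau m) (c m j) j (n m) w - I j w|%:E).
    exact: (ito_integral_limit_energy (ito j) (mK j) (KH j) (fun m => hc m j) (cv j)).
  rewrite /Y; elim: {ujs orth Y mY mYI}js => [|j l IH].
    move=> x delta x0 delta0; apply: nearW => m; exists set0; split=> //.
      by rewrite measure0 lee_fin ltW.
    by move=> w _ _; rewrite !big_nil subrr normr0 lte_fin.
  move=> x delta x0 delta0.
  have x20 : 0 < x / 2 by rewrite divr_gt0.
  have d20 : 0 < delta / 2 by rewrite divr_gt0.
  have x30 : 0 < x / 2 / (`|wt j| + 1) by rewrite divr_gt0// ltr_wpDl.
  have ev1 := IH _ _ x20 d20; have ev2 := one j _ _ x30 d20.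
  near=> m.
  have [B1 [mB1 PB1 hB1]] : exists B : set T, [/\ measurable B, (P B <= (delta / 2)%:E)%E &
    forall w, G w -> ~ B w -> (`|\sum_(j <- l) wt j * step_sum W (tau m) (c m j) j (n m) w -
       \sum_(j <- l) wt j * I j w|%:E < (x / 2)%:E)%E] by near: m; exact: ev1.
  have [B2 [mB2 PB2 hB2]] : exists B : set T, [/\ measurable B, (P B <= (delta / 2)%:E)%E &
    forall w, G w -> ~ B w -> (`|step_sum W (tau m) (c m j) j (n m) w - I j w|%:E <
      (x / 2 / (`|wt j| + 1))%:E)%E] by near: m; exact: ev2.
  exists (B1 `|` B2); split; first exact: measurableU.
    rewrite (splitr delta) EFinD (le_trans (measureU2 _ _ _))//.
    exact: leeD.
  move=> w Gw nB.
  have h1 := hB1 w Gw (fun h => nB (or_introl h)).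
  have h2 := hB2 w Gw (fun h => nB (or_intror h)).
  move: h1 h2; rewrite !lte_fin => h1 h2.
  rewrite !big_cons [in X in `|X|]opprD addrACA -mulrBr (le_lt_trans (ler_normD _ _))//.
  rewrite (splitr x) ler_ltD//.
  rewrite normrM (@le_trans _ _ (`|wt j| * (x / 2 / (`|wt j| + 1))))//.
    by rewrite ler_wpM2l// ltW.
  rewrite mulrCA ler_piMr ?(ltW x20)// ler_pdivrMr ?ltr_wpDl// mul1r.
  by rewrite lerDl.
apply/lee_addgt0Pr => eta eta0.
pose s := \sum_(j <- js) wt j ^+ 2.
have s0 : 0 <= s by rewrite sumr_ge0// => j _; exact: sqr_ge0.
pose eps := eta / (4 * (s + 1)).
have eps0 : 0 < eps by rewrite divr_gt0// mulr_gt0// ltr_wpDl.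
have E1 : \forall m \near \oo, forall j, j \in js ->
    (energy P t (step_fun (tau m) (c m j) (n m)) <= (2 * e j + 2 * eps)%:E)%E.
  have ev j : \forall m \near \oo,
      (energy P t (step_fun (tau m) (c m j) (n m)) <= (2 * e j + 2 * eps)%:E)%E.
    have : \forall m \near \oo, (energy P t (fun s w => step_fun (tau m) (c m j) (n m) s w - K j s w)%R <= eps%:E)%E.
      have /fine_cvgP[cf /cvgrPdist_lt/(_ _ eps0) ce] := cv j.
      near=> m; have fn : energy P t (fun s w => step_fun (tau m) (c m j) (n m) s w - K j s w) \is a fin_num by near: m.
      rewrite -(fineK fn) lee_fin ltW//.
      have : `|0 - fine (energy P t (fun s w => step_fun (tau m) (c m j) (n m) s w - K j s w))| < eps by near: m.
      by rewrite sub0r normrN; apply: le_lt_trans; exact: ler_norm.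
    apply: filterS => m hm.
    have jmS := jointly_measurable_step (t := t) hW (tau0 m) (@tauMN m) (hc m j).
    apply: (le_trans (energy_triangle (p := 2) (q := 2) P (ler0n _ 2) (ler0n _ 2) jmS (mK j) (jointly_measurableB jmS (mK j)) _)).
      move=> r w _; rewrite -[X in X ^+ 2 <= _](subrK (K j r w)) addrC.
      by rewrite -{1}[step_fun _ _ _ _ _ - _]opprK (le_trans (sqrB_le _ _))// sqrrN.
    exact: lee_twice.
  elim: (js) => [|j l IH]; first by apply: nearW.
  near=> m => k; rewrite inE => /predU1P[->|kl]; first by near: m; exact: ev.
  by move: k kl; near: m; exact: IH.
have E2 : \forall m \near \oo, (\int[P]_w ((Y m w) ^+ 2)%:E <=
    (\sum_(j <- js) wt j ^+ 2 * (2 * e j + 2 * eps))%:E)%E.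
  move: E1; apply: filterS => m hm.
  rewrite (step_combo_energy wt (@tauM m) (tauP m) ujs orth (hc m)).
  rewrite -sumEFin big_seq [leRHS]big_seq; apply: lee_sum => j jjs.
  by rewrite [leRHS]EFinM lee_wpmul2l ?lee_fin ?sqr_ge0// hm.
have c0 : 0 <= \sum_(j <- js) wt j ^+ 2 * (2 * e j + 2 * eps).
  have eps00 := ltW eps0.
  by rewrite sumr_ge0// => j _; rewrite mulr_ge0 ?sqr_ge0// addr_ge0//; apply: mulr_ge0.
apply: (le_trans (fatou_in_probability mG mYI mY c0 E2 cvY)).
rewrite -EFinD lee_fin.
rewrite (_ : \sum_(j <- js) _ = 2 * (\sum_(j <- js) wt j ^+ 2 * e j) + 2 * eps * s); last first.
  rewrite /s !mulr_sumr -big_split/=; apply: eq_bigr => j _; ring.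
have : 4 * eps * s <= eta.
  have s1 : s + 1 != 0 by rewrite gt_eqF// ltr_wpDl.
  have -> : 4 * eps * s = eta * (s / (s + 1)) by rewrite /eps; move: (s) s1 => s' s1; field.
  by rewrite ler_piMr ?(ltW eta0)// ler_pdivrMr ?ltr_wpDl// mul1r lerDl.
move: (\sum_(j <- js) _ * _) => x hx.
rewrite mulrDr mulrA (_ : 2 * 2 = 4 :> R); last by ring.
by rewrite lerD2l// (le_trans _ hx)// !mulrA (_ : 2 * 2 = 4 :> R)//; ring.
Unshelve. all: by end_near.
Qed.

(** The same two losses as in [ito_combo_le]. The approximants are compared with a fixed step
    integrand on a common refinement, where their difference is again an elementary integral. *)
Lemma ito_approximation_le j (H K : R -> T -> R) (I : T -> R) (c : nat -> nat -> T -> R)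
    (tau' : nat -> R) (n' : nat) (c' : nat -> T -> R) (e : R) :
  is_ito_integral P F (W j) H t I -> measurable_fun setT I -> jointly_measurable t K ->
  (forall s w, G w -> 0 < s <= t -> K s w = H s w) ->
  (forall m, step_coefs F (tau m) (n m) (c m)) ->
  energy P t (fun s w => step_fun (tau m) (c m) (n m) s w - K s w) @[m --> \oo] --> 0%E ->
  {homo tau' : i j / (i <= j)%N >-> i <= j} -> partition_of t tau' n' -> step_coefs F tau' n' c' ->
  (energy P t (fun s w => step_fun tau' c' n' s w - K s w)%R <= e%:E)%E ->
  (\int[P]_(w in G) ((I w - step_sum W tau' c' j n' w) ^+ 2)%:E <= (4 * e)%:E)%E.
Proof.
move=> ito mI mK KH hc cv tau'M tau'P hc' Ke.
have e0 : 0 <= e by rewrite -lee_fin (le_trans (energy_ge0 t _) Ke).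
have tau'0 : 0 <= tau' 0 by have [-> _ _] := tau'P.
have tau'MN i k : (i <= k)%N -> (k <= n')%N -> tau' i <= tau' k by move=> + _; exact: tau'M.
have mS' : measurable_fun setT (step_sum W tau' c' j n').
  by case: (step_sum_sqint hW tau'MN tau'0 j hc' (leqnn _)).
have mS m : measurable_fun setT (step_sum W (tau m) (c m) j (n m)).
  by case: (step_sum_sqint hW (@tauMN m) (tau0 m) j (hc m) (leqnn _)).
have cvI := ito_integral_limit_energy ito mK KH hc cv.
pose Y m w := step_sum W (tau m) (c m) j (n m) w - step_sum W tau' c' j n' w.
have cvY : cvg0_on P G (fun m w => `|Y m w - (I w - step_sum W tau' c' j n' w)|%:E).
  move=> x delta x0 delta0; have := cvI x delta x0 delta0; apply: filterS => m [B [mB PB hB]].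
  by exists B; split=> // w Gw nB; rewrite /Y opprB addrA subrK; exact: hB.
apply/lee_addgt0Pr => eta eta0.
have eps0 : 0 < eta / 4 by rewrite divr_gt0.
have E2 : \forall m \near \oo, (\int[P]_w ((Y m w) ^+ 2)%:E <= (2 * (eta / 4) + 2 * e)%:E)%E.
  have : \forall m \near \oo, (energy P t (fun s w => step_fun (tau m) (c m) (n m) s w - K s w)%R <= (eta / 4)%:E)%E.
    have /fine_cvgP[cf /cvgrPdist_lt/(_ _ eps0) ce] := cv.
    near=> m; have fn : energy P t (fun s w => step_fun (tau m) (c m) (n m) s w - K s w) \is a fin_num by near: m.
    rewrite -(fineK fn) lee_fin ltW//.
    have : `|0 - fine (energy P t (fun s w => step_fun (tau m) (c m) (n m) s w - K s w))| < eta / 4 by near: m.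
    by rewrite sub0r normrN; apply: le_lt_trans; exact: ler_norm.
  apply: filterS => m hm.
  have [sg [N [c2 [[sgP sgM] hc2 eS ef]]]] := step_merge hW t0 (tauP m) (@hc m) tau'P hc'.
  rewrite (eq_integral (fun w => ((step_sum W sg c2 j N w) ^+ 2)%:E)); last by move=> w _; rewrite eS.
  rewrite (energy_step hW cov1 sgM sgP j hc2) (eq_energy ef).
  have j1 := jointly_measurable_step (t := t) hW (tau0 m) (@tauMN m) (hc m).
  have j2 := jointly_measurable_step (t := t) hW tau'0 tau'MN hc'.
  apply: (le_trans (energy_triangle (p := 2) (q := 2) P (ler0n _ 2) (ler0n _ 2) (jointly_measurableB j1 j2) (jointly_measurableB j1 mK) (jointly_measurableB j2 mK) _)).
    move=> r w _; rewrite (_ : _ - _ = (step_fun (tau m) (c m) (n m) r w - K r w) - (step_fun tau' c' n' r w - K r w)).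
      exact: sqrB_le.
    by rewrite opprB addrA subrK.
  exact: lee_twice.
apply: (le_trans (fatou_in_probability mG _ _ _ E2 cvY)).
- exact: measurable_funB.
- by move=> m; exact: measurable_funB.
- by rewrite addr_ge0// mulr_ge0// ltW.
rewrite -EFinD lee_fin; lra.
Unshelve. all: by end_near.
Qed.

End limits.
End ItoIsometry.

(** * Covariances of Ito integrals *)

Section ItoCovariance.
Context {R : realType} {d : measure_display} {T : measurableType d}.
Variable P : probability T R.
Variable F : R -> set (set T).
Variable J : eqType.
Variables (W : J -> R -> T -> R) (cov : J -> J -> R).
Hypothesis hW : is_noise P F W cov.
Hypothesis cov1 : forall j, cov j j = 1.
Local Notation leb := (@lebesgue_measure R).

Lemma energy_mono (s t : R) D : jointly_measurable t D -> s <= t ->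
  (energy P s D <= energy P t D)%E.
Proof.
move=> mD st; have sub : (`]0, s] : set R) `<=` `]0, t].
  by move=> r /=; rewrite !in_itv/= => /andP[-> /le_trans]; exact.
have mDs : jointly_measurable s D.
  apply: measurable_funS mD; first exact: measurableX.
  by move=> [r w] /= [/sub].
apply: ge0_le_integral => //.
- by move=> w _; apply: integral_ge0 => r _; rewrite lee_fin sqr_ge0.
- exact: measurable_path_energy.
- exact: measurable_path_energy.
- move=> w _; apply: ge0_subset_integral => //.
    apply/measurable_EFinP; apply: measurable_funX.
    exact: jointly_measurable_section.
  by move=> r _; rewrite lee_fin sqr_ge0.
Qed.

Lemma sqrD_eta (x y eta : R) : 0 < eta ->
  (x + y) ^+ 2 <= (1 + eta) * x ^+ 2 + (1 + eta^-1) * y ^+ 2.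
Proof.
move=> e0; rewrite -subr_ge0.
rewrite (_ : _ - _ = eta^-1 * (eta * x - y) ^+ 2); last by field; rewrite gt_eqF.
by rewrite mulr_ge0 ?sqr_ge0// invr_ge0 ltW.
Qed.

Lemma fine_le_combo (x y z : \bar R) (p q : R) : x \is a fin_num -> y \is a fin_num ->
  z \is a fin_num -> (x <= p%:E * y + q%:E * z)%E -> fine x <= p * fine y + q * fine z.
Proof.
by move=> /fineK <- /fineK <- /fineK <-; rewrite -!EFinM -EFinD lee_fin.
Qed.

(** A substitute for the reverse triangle inequality when only squared norms are at hand: [u m] and
    [a] bound each other up to a factor close to 1 and a multiple of [v m]. *)
Lemma cvg_of_eta (a : R) (u v : nat -> R) : 0 <= a ->
  (\forall m \near \oo, forall eta : R, 0 < eta -> 0 <= u m /\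
     (u m <= (1 + eta) * a + (1 + eta^-1) * v m /\ a <= (1 + eta) * u m + (1 + eta^-1) * v m)) ->
  v m @[m --> \oo] --> (0 : R) -> u m @[m --> \oo] --> a.
Proof.
move=> a0 huv cv; apply/cvgrPdist_lt => e e0.
(* The instance with parameter 1 bounds [u m] by [2 * a + 2] once [v m < 1], so this [eta]
   contributes at most [e / 2] on either side. *)
pose eta := e / (2 * (2 * a + 3)).
have a30 : 0 < 2 * a + 3 by rewrite ltr_wpDl// mulr_ge0.
have eta0 : 0 < eta by rewrite divr_gt0// mulr_gt0.
pose q := 1 + eta^-1; have q0 : 0 < q by rewrite addr_gt0// invr_gt0.
pose dl := Num.min 1 (e / (2 * q)).
have dl0 : 0 < dl by rewrite lt_min ltr01 divr_gt0// mulr_gt0.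
move/cvgrPdist_lt: cv => /(_ _ dl0) cv.
near=> m.
have hm : forall eta : R, 0 < eta -> 0 <= u m /\
     (u m <= (1 + eta) * a + (1 + eta^-1) * v m /\ a <= (1 + eta) * u m + (1 + eta^-1) * v m).
  by near: m.
have : `|0 - v m| < dl by near: m.
rewrite sub0r normrN => /(le_lt_trans (ler_norm _)).
have [] := hm 1 ltr01; have [_ []] := hm eta eta0.
move: (u m) (v m) => am dm.
rewrite lt_min invr1 -/q => h2 h3 am0 [h1 _] /andP[d1 d2].
have qd : q * dm < e / 2.
  have e' : e / (2 * q) = q^-1 * (e / 2) by field; rewrite gt_eqF.
  by rewrite -ltr_pdivlMl// -e'.
have am3 : am <= 2 * a + 2 by lra.
have ea : eta * (2 * a + 2) <= e / 2.
  rewrite (@le_trans _ _ (eta * (2 * a + 3)))//; first by rewrite ler_pM2l// lerD2l ler_nat.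
  by rewrite /eta; move: (2 * a + 3) a30 => x x0; rewrite le_eqVlt; apply/orP; left; apply/eqP; field; rewrite gt_eqF.
have e1 : eta * a <= eta * (2 * a + 2) by rewrite ler_pM2l//; lra.
have e2 : eta * am <= eta * (2 * a + 2) by rewrite ler_pM2l.
by rewrite ltr_norml; apply/andP; split; lra.
Unshelve. all: by end_near.
Qed.

Lemma cvg_energy t (D : nat -> R -> T -> R) K : (energy P t K < +oo)%E ->
  (forall m, jointly_measurable t (D m)) -> jointly_measurable t K ->
  energy P t (fun s w => D m s w - K s w) @[m --> \oo] --> 0%E ->
  energy P t (D m) @[m --> \oo] --> energy P t K.
Proof.
move=> Kfin jD jK cv.
have fK : energy P t K \is a fin_num by rewrite ge0_fin_numE// energy_ge0.
have [cf ce] := (fine_cvgP _ _).1 cv.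
pose a := fine (energy P t K); have aE : energy P t K = a%:E by rewrite /a fineK.
have a0 : 0 <= a by rewrite fine_ge0// energy_ge0.
have finD : \forall m \near \oo, energy P t (D m) \is a fin_num /\
    forall eta : R, 0 < eta -> 0 <= fine (energy P t (D m)) /\
      (fine (energy P t (D m)) <= (1 + eta) * a + (1 + eta^-1) * fine (energy P t (fun s w => D m s w - K s w))%R /\
      a <= (1 + eta) * fine (energy P t (D m)) + (1 + eta^-1) * fine (energy P t (fun s w => D m s w - K s w))%R).
  near=> m; have fm : energy P t (fun s w => D m s w - K s w) \is a fin_num by near: m.
  have jB := jointly_measurableB (jD m) jK.
  have h1 (eta : R) : 0 < eta -> (energy P t (D m) <= (1 + eta)%:E * energy P t K +
      (1 + eta^-1)%:E * energy P t (fun s w => D m s w - K s w)%R)%E.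
    move=> e0; have ei : 0 < eta^-1 by rewrite invr_gt0.
    apply: energy_triangle => //; first by rewrite addr_ge0// ltW.
      by rewrite addr_ge0// ltW.
    by move=> s w _; rewrite -[in X in X <= _](subrK (K s w) (D m s w)) addrC; exact: sqrD_eta.
  have fD : energy P t (D m) \is a fin_num.
    rewrite ge0_fin_numE; last exact: energy_ge0.
    apply: le_lt_trans (h1 1 ltr01) _.
    by rewrite -(fineK fm) aE -!EFinM -EFinD ltry.
  split; first exact: fD.
  move=> eta e0; have ei : 0 < eta^-1 by rewrite invr_gt0.
  have h2 : (energy P t K <= (1 + eta)%:E * energy P t (D m) +
      (1 + eta^-1)%:E * energy P t (fun s w => D m s w - K s w)%R)%E.
    apply: energy_triangle => //; first by rewrite addr_ge0// ltW.
      by rewrite addr_ge0// ltW.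
    move=> s w _; rewrite -[X in _ + _ * X]sqrrN opprB.
    by rewrite -[in X in X <= _](subrK (D m s w) (K s w)) addrC; exact: sqrD_eta.
  split; first by apply: fine_ge0; exact: energy_ge0.
  by split; [exact: fine_le_combo fD fK fm (h1 eta e0)|exact: fine_le_combo fK fD fm h2].
rewrite aE; apply/fine_cvgP; split; first by apply: filterS finD => m [].
apply: (@cvg_of_eta a (fun m => fine (energy P t (D m)))
  (fun m => fine (energy P t (fun s w => D m s w - K s w))) a0 _ ce).
by apply: filterS finD => m [_ hm] eta /hm.
Unshelve. all: by end_near.
Qed.

(** The integral itself comes with convergence in probability only; this record adds step integrands
    that converge in energy, from which the L^2 theory follows. *)
Record ito_approx (t : R) (j : J) (H : R -> T -> R) (I : T -> R)
    (tau : nat -> nat -> R) (n : nat -> nat) (c : nat -> nat -> T -> R) : Prop := ItoApprox {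
  approx_ito : is_ito_integral P F (W j) H t I;
  approx_measurable : measurable_fun setT I;
  approx_joint : jointly_measurable t H;
  approx_coefs : forall m, step_coefs F (tau m) (n m) (c m);
  approx_cvg : energy P t (fun s w => step_fun (tau m) (c m) (n m) s w - H s w) @[m --> \oo] --> 0%E
}.

Arguments approx_coefs {t j H I tau n c} _ m _ _.

Section grids.
Variables (t : R) (tau : nat -> nat -> R) (n : nat -> nat).
Hypothesis t0 : 0 <= t.
Hypothesis tauM : forall m, {homo tau m : i j / (i <= j)%N >-> i <= j}.
Hypothesis tauP : forall m, partition_of t (tau m) (n m).

Let tau0 m : 0 <= tau m 0. Proof. by have [-> _ _] := tauP m. Qed.
Let tauMN m i k : (i <= k)%N -> (k <= n m)%N -> tau m i <= tau m k.
Proof. by move=> + _; exact: tauM. Qed.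

Section one_integral.
Variables (j : J) (H : R -> T -> R) (I : T -> R) (c : nat -> nat -> T -> R).
Hypothesis A : ito_approx t j H I tau n c.
Let Y m := step_sum W (tau m) (c m) j (n m).

Let sY m : sqint P setT (Y m).
Proof. exact: (step_sum_sqint hW (@tauMN m) (tau0 m) j (approx_coefs A m) (leqnn _)). Qed.

Let jS m : jointly_measurable t (step_fun (tau m) (c m) (n m)).
Proof. exact: (jointly_measurable_step hW (tau0 m) (@tauMN m) (approx_coefs A m)). Qed.

Lemma ito_approx_le m (e : R) :
  (energy P t (fun s w => step_fun (tau m) (c m) (n m) s w - H s w)%R <= e%:E)%E ->
  (\int[P]_w ((I w - Y m w) ^+ 2)%:E <= (4 * e)%:E)%E.
Proof.
move=> he.
exact: (@ito_approximation_le _ _ _ _ _ _ _ _ hW cov1 t setT tau n t0 measurableT tauM tauP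
  j H H I c (tau m) (n m) (c m) e (approx_ito A) (approx_measurable A) (approx_joint A)
  (fun _ _ _ _ => erefl) (approx_coefs A) (approx_cvg A) (tauM m) (tauP m) (approx_coefs A m) he).
Qed.

(** One approximant at finite energy distance suffices: its elementary integral is square
    integrable, and so is its difference from [I] by [ito_approx_le]. *)
Lemma ito_approx_sqint : sqint P setT I.
Proof.
have [cf /cvgrPdist_lt/(_ _ ltr01) ce] := (fine_cvgP _ _).1 (approx_cvg A).
have [m fm hm] : exists2 m, energy P t (fun s w => step_fun (tau m) (c m) (n m) s w - H s w) \is a fin_num &
    `|0 - fine (energy P t (fun s w => step_fun (tau m) (c m) (n m) s w - H s w))| < 1.
  have [n0 _ h0] := cf; have [n1 _ h1] := ce.
  by exists (maxn n0 n1); [apply: h0; rewrite /= leq_maxl|apply: h1; rewrite /= leq_maxr].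
have := @ito_approx_le m _ _; rewrite -(fineK fm) => /(_ _ (lexx _)) h.
have mI := approx_measurable A.
have sD : sqint P setT (fun w => I w - Y m w).
  split; first by apply: measurable_funB => //; case: (sY m).
  apply/integrableP; split.
    apply/measurable_EFinP; apply: measurable_funX; apply: measurable_funB => //.
    by case: (sY m).
  under eq_integral do rewrite /= ger0_norm ?sqr_ge0//.
  exact: le_lt_trans h (ltry _).
have := sqintD measurableT sD (sY m); congr (sqint _ _ _).
by apply/funext => w; rewrite subrK.
Qed.

Lemma ito_approx_cvg : \int[P]_w ((Y m w - I w) ^+ 2) @[m --> \oo] --> (0 : R).
Proof.
have [cf ce] := (fine_cvgP _ _).1 (approx_cvg A).
have sI := ito_approx_sqint.
apply/cvgrPdist_lt => e e0; have e40 : 0 < e / 4 by rewrite divr_gt0.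
move/cvgrPdist_lt: ce => /(_ _ e40) ce; near=> m.
have fm : energy P t (fun s w => step_fun (tau m) (c m) (n m) s w - H s w) \is a fin_num by near: m.
have : `|0 - fine (energy P t (fun s w => step_fun (tau m) (c m) (n m) s w - H s w))| < e / 4 by near: m.
rewrite sub0r normrN => /(le_lt_trans (ler_norm _)) hd.
have := @ito_approx_le m _ _; rewrite -(fineK fm) => /(_ _ (lexx _)) h.
have sD : sqint P setT (fun w => Y m w - I w) by exact: sqintB.
have ge0 : 0 <= \int[P]_w ((Y m w - I w) ^+ 2).
  by apply: fine_ge0; apply: integral_ge0 => w _; rewrite lee_fin sqr_ge0.
rewrite sub0r normrN ger0_norm// -lte_fin.
rewrite /Rintegral fineK; last exact: (integrable_fin_num measurableT sD.2).
rewrite (eq_integral (fun w => ((I w - Y m w) ^+ 2)%:E)); last first.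
  by move=> w _; rewrite -sqrrN opprB.
apply: (le_lt_trans h); rewrite lte_fin; lra.
Unshelve. all: by end_near.
Qed.

Lemma ito_approx_energy_fin : (energy P t H < +oo)%E.
Proof.
have [cf _] := (fine_cvgP _ _).1 (approx_cvg A).
have [m fm] : exists m, energy P t (fun s w => step_fun (tau m) (c m) (n m) s w - H s w) \is a fin_num.
  by have [n0 _ h0] := cf; exists n0; apply: h0 => /=.
apply: (@le_lt_trans _ _ (2%:E * energy P t (step_fun (tau m) (c m) (n m)) +
    2%:E * energy P t (fun s w => step_fun (tau m) (c m) (n m) s w - H s w)%R)%E).
  apply: energy_triangle => //; first exact: approx_joint A.
    by apply: jointly_measurableB => //; exact: approx_joint A.
  move=> s w _; have := sqrB_le (step_fun (tau m) (c m) (n m) s w)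
    (step_fun (tau m) (c m) (n m) s w - H s w).
  by rewrite opprB addrC subrK.
rewrite -(energy_step hW cov1 (@tauM m) (tauP m) j (approx_coefs A m)) -(fineK fm).
rewrite -(fineK (integrable_fin_num measurableT (sY m).2)) -!EFinM -EFinD.
exact: ltry.
Qed.

End one_integral.

(** Convergence of inner products reduces this to elementary integrals. Their covariance involves
    products of coefficients, which become energies when the integrands coincide; in the model,
    correlated noises share a site and hence the integrand. *)
Lemma ito_covariance j k H H' I I' c c' :
  ito_approx t j H I tau n c -> ito_approx t k H' I' tau n c' ->
  cov j k = 0 \/ (H = H' /\ c = c') ->
  \int[P]_w (I w * I' w) = cov j k * fine (energy P t H).
Proof.
move=> A A' hc.
have sY (l : J) (K : R -> T -> R) (Il : T -> R) cl : ito_approx t l K Il tau n cl ->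
    forall m, sqint P setT (step_sum W (tau m) (cl m) l (n m)).
  by move=> Al m; exact: (step_sum_sqint hW (@tauMN m) (tau0 m) l (approx_coefs Al m) (leqnn _)).
have cv := cvg_Rintegral_mul measurableT (sY _ _ _ _ A) (sY _ _ _ _ A')
  (ito_approx_sqint A) (ito_approx_sqint A') (ito_approx_cvg A) (ito_approx_cvg A').
suff cv2 : \int[P]_w (step_sum W (tau m) (c m) j (n m) w * step_sum W (tau m) (c' m) k (n m) w)
    @[m --> \oo] --> cov j k * fine (energy P t H).
  by apply: cvg_unique cv cv2; exact: norm_hausdorff.
have iso m := step_sum_isometry hW (@tauMN m) (tau0 m) j k (approx_coefs A m) (approx_coefs A' m) (leqnn _).
have [c0|[HH cc]] := hc.
  rewrite c0 mul0r; apply: cvg_near_cst; apply: nearW => m.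
  by rewrite iso c0 mul0r.
have fE : energy P t H \is a fin_num.
  by rewrite ge0_fin_numE; [exact: (ito_approx_energy_fin A)|exact: energy_ge0].
have jS m : jointly_measurable t (step_fun (tau m) (c m) (n m)).
  exact: (jointly_measurable_step hW (tau0 m) (@tauMN m) (approx_coefs A m)).
have cvE := cvg_energy (ito_approx_energy_fin A) jS (approx_joint A) (approx_cvg A).
have cvf : fine (energy P t (step_fun (tau m) (c m) (n m))) @[m --> \oo] --> fine (energy P t H).
  by move: cvE; rewrite -{1}(fineK fE) => /fine_cvgP[].
apply: cvg_trans (cvgMl_tmp (a := cov j k) cvf).
apply: near_eq_cvg; apply: nearW => m /=.
rewrite iso; congr (_ * _).
have iso' := step_sum_isometry hW (@tauMN m) (tau0 m) j j (approx_coefs A m) (approx_coefs A m) (leqnn _).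
rewrite -(energy_step hW cov1 (@tauM m) (tauP m) j (approx_coefs A m)).
rewrite -cc -[RHS]mul1r -(cov1 j) -iso'.
by rewrite /Rintegral; congr fine; apply: eq_integral => w _; rewrite expr2.
Qed.

End grids.
End ItoCovariance.

Arguments approx_coefs {R d T P F J W t j H I tau n c} _ m _ _.

(** * Left continuous integrands and martingale increments *)

Section ItoApproximation.
Context {R : realType} {d : measure_display} {T : measurableType d}.
Variable P : probability T R.
Variable F : R -> set (set T).
Variable J : eqType.
Variables (W : J -> R -> T -> R) (cov : J -> J -> R).
Hypothesis hW : is_noise P F W cov.
Hypothesis cov1 : forall j, cov j j = 1.
Local Notation leb := (@lebesgue_measure R).

Lemma grid2_partition (s t : R) m : 0 <= s -> s <= t ->
  partition_of t (grid2 s t m) (m.+1 + m.+1).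
Proof.
move=> s0 st; split; [exact: grid20|exact: grid2_last|].
by move=> i k ik _; exact: grid2_homo.
Qed.

Section left_continuous.
Variables (s t C : R) (D : R -> T -> R).
Hypotheses (s0 : 0 <= s) (st : s <= t).
Hypothesis Dad : forall r, 0 <= r -> r <= t -> measurable_wrt (F r) (D r).
Hypothesis DC : forall r w, 0 <= r -> r <= t -> `|D r w| <= C.
Hypothesis Dl : forall w r, 0 < r <= t -> left_cont (D ^~ w) r.

Let t0 : 0 <= t. Proof. exact: le_trans s0 st. Qed.
Let tau := grid2 s t.
Let n m := (m.+1 + m.+1)%N.
Let S m := step_fun (tau m) (fun k => D (tau m k)) (n m).

Lemma left_cont_joint : jointly_measurable t D.
Proof.
apply: measurable_left_cont => // r /andP[r0 rt].
exact: (adapted_measurable hW r0 (Dad r0 rt)).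
Qed.

Lemma left_cont_coefs : forall m, step_coefs F (tau m) (n m) (fun k => D (tau m k)).
Proof.
move=> m k kn; have k0 : 0 <= tau m k by exact: grid2_ge0.
have kt : tau m k <= t by apply: grid2_le => //; exact: ltnW.
by split; [exact: Dad|exists C => w; exact: DC].
Qed.

(** Dominated convergence twice, in time along each path and then over the probability space; the
    differences are bounded by [2 * C] throughout. *)
Lemma left_cont_energy : energy P t (fun r w => S m r w - D r w) @[m --> \oo] --> 0%E.
Proof.
have tM m : {homo tau m : i j / (i <= j)%N >-> i <= j} by exact: grid2_homo.
have tP m : partition_of t (tau m) (n m) by exact: grid2_partition.
have t00 m : 0 <= tau m 0 by have [-> _ _] := tP m.
have jS m : jointly_measurable t (S m).
  by apply: (jointly_measurable_step hW (t00 m) _ (@left_cont_coefs m)) => i k ik _; exact: tM.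
have jB m : jointly_measurable t (fun r w => S m r w - D r w).
  by apply: jointly_measurableB => //; exact: left_cont_joint.
have C0 : 0 <= C by have := DC point (lexx 0) t0; apply: le_trans.
have SC m r w : 0 < r <= t -> `|S m r w - D r w| <= 2 * C.
  move=> rt; have [k kn ek] := step_fun_eq (tM m) (tP m) (fun k => D (tau m k)) w rt.
  rewrite /S ek (le_trans (ler_normB _ _))// mulr2n mulrDl mul1r lerD//.
    by apply: DC; [exact: grid2_ge0|apply: grid2_le => //; exact: ltnW].
  by case/andP: rt => r0 rt; apply: DC => //; exact: ltW.
have SC2 m r w : 0 < r <= t -> `|(S m r w - D r w) ^+ 2| <= (2 * C) ^+ 2.
  by move=> rt; rewrite normrX lerXn2r ?nnegrE// ?mulr_ge0// SC.
pose e m w := \int[leb]_(r in `]0, t]) ((S m r w - D r w) ^+ 2).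
have ii m w : leb.-integrable `]0, t] (EFin \o (fun r => (S m r w - D r w) ^+ 2)).
  apply: (bounded_integrable_oc (M := (2 * C) ^+ 2)).
    apply: measurable_funX; exact: (jointly_measurable_section w (jB m)).
  by move=> r rt; exact: SC2.
have eE m w : (\int[leb]_(r in `]0%R, t]) ((S m r w - D r w) ^+ 2)%:E)%E = (e m w)%:E.
  by rewrite /e /Rintegral fineK//; exact: integrable_fin_num (ii m w).
have me m : measurable_fun setT (e m).
  apply/measurable_EFinP; apply: eq_measurable_fun (measurable_path_energy (jB m)) => w _.
  exact: eE.
have e0 m w : 0 <= e m w.
  by rewrite -lee_fin -eE; apply: integral_ge0 => r _; rewrite lee_fin sqr_ge0.
have eb m w : `|e m w| <= (2 * C) ^+ 2 * t.
  rewrite (le_trans (le_normr_Rintegral_oc (M := (2 * C) ^+ 2) t0 _ _)) ?subr0//.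
    apply: measurable_funX; exact: (jointly_measurable_section w (jB m)).
  by move=> r rt; exact: SC2.
have ecv w : e m w @[m --> \oo] --> (0 : R).
  have := @Rintegral_dominated_cvg _ _ _ leb `]0, t]%classic
    (fun m r => (S m r w - D r w) ^+ 2) (fun=> 0) (fun=> (2 * C) ^+ 2) (measurable_itv _).
  case.
  - move=> m; apply: measurable_funX; exact: (jointly_measurable_section w (jB m)).
  - move=> r; rewrite /= in_itv/= => rt.
    have cS : S m r w @[m --> \oo] --> D r w.
      apply: (cvg_sum_step_left t0 (tau := tau) (n := n) (x := D ^~ w) tM _ _ _ rt) => //.
      + by move=> m; have [-> _ _] := tP m.
      + by move=> m; have [_ -> _] := tP m.
      + by move=> m k; exact: grid2_mesh.
      + exact: Dl.
    have c1 : (S m r w - D r w) @[m --> \oo] --> (0 : R).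
      by rewrite -(subrr (D r w)); apply: cvgB cS _; exact: cvg_cst.
    rewrite -[X in _ --> X](mulr0 (0 : R)).
    exact: (cvgM c1 c1).
  - by apply: (bounded_integrable_oc (M := `|(2 * C) ^+ 2|)).
  - by move=> m r; rewrite /= in_itv/= => rt; exact: SC2.
  move=> _; rewrite (_ : \int[leb]_(x in `]0, t]) 0 = 0)//.
  by rewrite Rintegral_cst_oc// mul0r.
have := @Rintegral_dominated_cvg _ _ _ P setT e (fun=> 0) (fun=> (2 * C) ^+ 2 * t) measurableT
  me (fun w _ => ecv w) _ (fun m w _ => eb m w).
case.
  by apply: (@bounded_integrable _ _ _ _ _ `|(2 * C) ^+ 2 * t|).
move=> _; rewrite (Rintegral_prob_cst P) => ce.
have ie m : P.-integrable setT (EFin \o e m) by exact: bounded_integrable (eb m).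
have -> : (fun m => energy P t (fun r w => S m r w - D r w)) = EFin \o (fun m => \int[P]_w e m w).
  apply/funext => m; rewrite /energy /= /Rintegral fineK; last exact: integrable_fin_num (ie m).
  by apply: eq_integral => w _; rewrite eE.
by apply/(fine_cvgP _ (0 : R)); split; [exact: nearW|exact: ce].
Qed.

End left_continuous.

Arguments left_cont_coefs [s t C D] _ _ _ _ m _ _.

Section increments.
Variables (s t : R) (j : J) (H : R -> T -> R) (It Is : T -> R).
Variables (mm : nat -> nat) (c : nat -> nat -> T -> R).
Hypotheses (s0 : 0 <= s) (st : s <= t).
Let tau m := grid2 s t (mm m).
Hypothesis A : ito_approx P F W t j H It tau (fun m => (mm m).+1 + (mm m).+1)%N c.
Hypothesis itos : is_ito_integral P F (W j) H s Is.
Hypothesis mIs : measurable_fun setT Is.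

Let t0 : 0 <= t. Proof. exact: le_trans s0 st. Qed.
Let tM m : {homo tau m : i j / (i <= j)%N >-> i <= j}. Proof. exact: grid2_homo. Qed.
Let tP m : partition_of t (tau m) ((mm m).+1 + (mm m).+1). Proof. exact: grid2_partition. Qed.
Let sP m : partition_of s (tau m) (mm m).+1.
Proof.
split; [exact: grid20|exact: grid2_mid|].
by move=> i k ik _; exact: tM.
Qed.
Let tau0 m : 0 <= tau m 0. Proof. by have [-> _ _] := tP m. Qed.
Let tMN m (N : nat) i k : (i <= k)%N -> (k <= N)%N -> tau m i <= tau m k.
Proof. by move=> + _; exact: tM. Qed.

Let half m : ((mm m).+1 <= (mm m).+1 + (mm m).+1)%N. Proof. by rewrite leq_addl. Qed.

(** Since [s] is a grid point, the first half of each grid partitions [[0, s]], and the same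
    coefficients restricted to it approximate the integral up to [s]. *)
Let As : ito_approx P F W s j H Is tau (fun m => (mm m).+1) c.
Proof.
have jH : jointly_measurable t H := approx_joint A.
have jHs : jointly_measurable s H.
  apply: measurable_funS jH; first exact: measurableX.
  by move=> [r w] /=; rewrite !in_itv/= => -[/andP[-> /le_trans h] _]; rewrite h.
split=> //.
- by move=> m k km; apply: (approx_coefs A m); exact: leq_trans km (half m).
- have jB m : jointly_measurable t (fun r w => step_fun (tau m) (c m) ((mm m).+1 + (mm m).+1) r w - H r w).
    apply: jointly_measurableB => //.
    exact: (jointly_measurable_step hW (tau0 m) (@tMN m _) (approx_coefs A m)).
  apply: (@squeeze_cvge _ _ _ _ (fun=> 0%E) _
    (fun m => energy P t (fun r w => step_fun (tau m) (c m) ((mm m).+1 + (mm m).+1) r w - H r w))).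
  + apply: nearW => m; rewrite energy_ge0/=.
    apply: le_trans (energy_mono P (jB m) st); rewrite le_eqVlt; apply/orP; left; apply/eqP.
    apply: eq_energy => r w /andP[r0 rs]; congr (_ - _).
    rewrite /step_fun big_split_ord/= [X in _ + X]big1 ?addr0// => i _.
    rewrite ltNge (le_trans rs) ?mulr0//=.
    have [_ <- _] := sP m; exact/tM/leq_addr.
  + exact: cvg_cst.
  + exact: approx_cvg A.
Qed.

(** Both integrals are limits of partial sums of the same elementary integrals, and the part after
    [s] is orthogonal to whatever is known at time [s]. This is why the grids pass through [s]. *)
Lemma ito_increment_mart (Z : T -> R) : measurable_wrt (F s) Z -> sqint P setT Z ->
  \int[P]_w (Z w * (It w - Is w)) = 0.
Proof.
move=> mZ sZ.
have st2 m : sqint P setT (step_sum W (tau m) (c m) j ((mm m).+1 + (mm m).+1)).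
  exact: (step_sum_sqint hW (@tMN m _) (tau0 m) j (approx_coefs A m) (leqnn _)).
have ss2 m : sqint P setT (step_sum W (tau m) (c m) j (mm m).+1).
  exact: (step_sum_sqint hW (@tMN m _) (tau0 m) j (approx_coefs A m) (half m)).
have sIt := ito_approx_sqint hW cov1 t0 tM tP A.
have sIs := ito_approx_sqint hW cov1 s0 tM sP As.
have c1 := ito_approx_cvg hW cov1 t0 tM tP A.
have c2 := ito_approx_cvg hW cov1 s0 tM sP As.
have cZ : \int[P]_w ((Z w - Z w) ^+ 2) @[m --> \oo] --> (0 : R).
  apply: cvg_near_cst; apply: nearW => m; rewrite -[RHS](Rintegral_prob_cst P).
  by apply: eq_Rintegral => w _; rewrite subrr expr0n.
have d1 := cvg_Rintegral_mul measurableT (fun=> sZ) st2 sZ sIt cZ c1.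
have d2 := cvg_Rintegral_mul measurableT (fun=> sZ) ss2 sZ sIs cZ c2.
have iZ f : sqint P setT f -> P.-integrable setT (EFin \o (fun w => Z w * f w)).
  by move=> sf; exact: sqint_mul.
have sub f g : sqint P setT f -> sqint P setT g ->
    \int[P]_w (Z w * (f w - g w)) = \int[P]_w (Z w * f w) - \int[P]_w (Z w * g w).
  move=> sf sg; rewrite -RintegralB//; last 2 first.
  - exact: iZ.
  - exact: iZ.
  by apply: eq_Rintegral => w _; rewrite mulrBr.
rewrite sub//.
pose y m := \int[P]_w (Z w * step_sum W (tau m) (c m) j ((mm m).+1 + (mm m).+1) w) -
  \int[P]_w (Z w * step_sum W (tau m) (c m) j (mm m).+1 w).
have d12 : y m @[m --> \oo] --> \int[P]_w (Z w * It w) - \int[P]_w (Z w * Is w) by exact: cvgB.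
suff z : y m @[m --> \oo] --> (0 : R) by apply: cvg_unique d12 z; exact: norm_hausdorff.
apply: cvg_near_cst; apply: nearW => m; rewrite /y -sub//.
apply: (step_sum_mart hW (@tMN m ((mm m).+1 + (mm m).+1)) (tau0 m)) => //.
- exact: (approx_coefs A m).
- by rewrite half leqnn.
- by have [_ -> _] := sP m.
Qed.

End increments.

(** A diagonal choice: [D N l] approximates [H l], and for each [N] the grid is fine enough that
    reading [D N l] on it costs energy at most 1/(N+1). One grid has to serve both [j] and [k],
    because covariances are computed on a common partition. *)
Lemma approx_pair_exists (s t : R) (j k : J) (H : J -> R -> T -> R)
    (I : J -> T -> R) (D : nat -> J -> R -> T -> R) (C : nat -> R) :
  0 <= s -> s <= t ->
  (forall l, is_ito_integral P F (W l) (H l) t (I l)) ->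
  (forall l, measurable_fun setT (I l)) -> (forall l, jointly_measurable t (H l)) ->
  (forall N l r, 0 <= r -> r <= t -> measurable_wrt (F r) (D N l r)) ->
  (forall N l, exists C, forall r w, 0 <= r -> r <= t -> `|D N l r w| <= C) ->
  (forall N l w r, 0 < r <= t -> left_cont (D N l ^~ w) r) ->
  (forall l, energy P t (fun r w => D N l r w - H l r w) @[N --> \oo] --> 0%E) ->
  exists mm : nat -> nat, forall l, l \in [:: j; k] ->
    ito_approx P F W t l (H l) (I l) (fun N => grid2 s t (mm N))
      (fun N => (mm N).+1 + (mm N).+1)%N (fun N i => D N l (grid2 s t (mm N) i)).
Proof.
move=> s0 st ito mI jH Dad DC Dl Dcv.
pose Q N m l := step_fun (grid2 s t m) (fun i => D N l (grid2 s t m i)) (m.+1 + m.+1).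
have cvQ N l : energy P t (fun r w => Q N m l r w - D N l r w) @[m --> \oo] --> 0%E.
  have [C' hC'] := DC N l.
  exact: (left_cont_energy s0 st (Dad N l) hC' (Dl N l)).
have ex N : exists m, forall l, l \in [:: j; k] ->
    (energy P t (fun r w => Q N m l r w - D N l r w)%R <= (N.+1%:R^-1)%:E)%E.
  have ev l : \forall m \near \oo, (energy P t (fun r w => Q N m l r w - D N l r w)%R <= (N.+1%:R^-1)%:E)%E.
    have e0 : 0 < N.+1%:R^-1 :> R by rewrite invr_gt0.
    have [cf /cvgrPdist_lt/(_ _ e0) ce] := (fine_cvgP _ _).1 (cvQ N l).
    near=> m; have fm : energy P t (fun r w => Q N m l r w - D N l r w) \is a fin_num by near: m.
    rewrite -(fineK fm) lee_fin ltW//.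
    have : `|0 - fine (energy P t (fun r w => Q N m l r w - D N l r w))| < N.+1%:R^-1 by near: m.
    by rewrite sub0r normrN; apply: le_lt_trans; exact: ler_norm.
  have [n1 _ h1] := ev j; have [n2 _ h2] := ev k; exists (maxn n1 n2) => l.
  rewrite !inE => /orP[/eqP->|/eqP->].
    by apply: h1; rewrite /= leq_maxl.
  by apply: h2; rewrite /= leq_maxr.
have [mm hmm] := choice ex.
exists mm => l ljk; split=> //.
- move=> N; have [C' hC'] := DC N l; exact: (left_cont_coefs s0 st (Dad N l) hC').
- have tM m : {homo grid2 s t m : i j / (i <= j)%N >-> i <= j} by exact: grid2_homo.
  have jQ N m : jointly_measurable t (Q N m l).
    have [C' hC'] := DC N l.
    apply: (jointly_measurable_step hW _ _ (left_cont_coefs s0 st (Dad N l) hC' m)).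
      exact: grid2_ge0.
    by move=> i i' ii _; exact: tM.
  have jD N : jointly_measurable t (D N l).
    have [C' hC'] := DC N l; exact: (left_cont_joint s0 st (Dad N l) (Dl N l)).
  apply: (@squeeze_cvge _ _ _ _ (fun=> 0%E) _
    (fun N => (2%:E * (N.+1%:R^-1)%:E + 2%:E * energy P t (fun r w => D N l r w - H l r w)%R)%E)).
  + apply: nearW => N; rewrite energy_ge0/=.
    apply: (@le_trans _ _ (2%:E * energy P t (fun r w => Q N (mm N) l r w - D N l r w)%R +
        2%:E * energy P t (fun r w => D N l r w - H l r w)%R)%E).
      apply: energy_triangle => //.
      * exact: (jointly_measurableB (jQ N (mm N)) (jH l)).
      * exact: (jointly_measurableB (jQ N (mm N)) (jD N)).
      * exact: (jointly_measurableB (jD N) (jH l)).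
      * move=> r w _; have := sqrB_le (Q N (mm N) l r w - D N l r w) (H l r w - D N l r w).
        rewrite opprB addrA subrK => /le_trans; apply; rewrite lerD2l.
        by rewrite -sqrrN opprB.
    by apply: leeD => //; apply: lee_wpmul2l; rewrite ?lee_fin// hmm.
  + exact: cvg_cst.
  + rewrite -[X in _ --> X](adde0 0%E); apply: cvgeD => //.
      rewrite -(mule0 2%:E); apply: cvgeZl => //.
      by apply: cvg_EFin; [exact: nearW|exact: cvg_harmonic].
    by rewrite -(mule0 2%:E); apply: cvgeZl.
Unshelve. all: by end_near.
Qed.

End ItoApproximation.

(** * Weighted sums, regular processes and products of semimartingales *)

Section WeightedSums.
Context {R : realType} {I : countType}.
Variable om : I -> R.

(** A single term is below its column sum; dividing by [om i] turns the column condition into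
    domination of each row by a multiple of the weight. *)
Lemma column_dominated (B : I -> I -> R) (C : R) i j : (forall i, 0 < om i) ->
  (forall i j, 0 <= B i j) ->
  (\esum_(i in [set: I]) (om i * B i j)%:E <= (C * om j)%:E)%E -> B i j <= C / om i * om j.
Proof.
move=> w0 B0 h; rewrite mulrAC ler_pdivlMr// mulrC -lee_fin; apply: le_trans h.
by apply: (le_esum_term (f := fun i => (om i * B i j)%:E)) => k; rewrite lee_fin mulr_ge0// ltW.
Qed.

Hypothesis om0 : forall i, 0 <= om i.
Implicit Types (f g c : I -> R).

Definition wsum c f : R := fine (\esum_(i in [set: I]) (c i * f i)%:E)%E.

Definition summable f := (forall i, 0 <= f i) /\
  (\esum_(i in [set: I]) (om i * f i)%:E < +oo)%E.

Lemma esum_wsum c f : (forall i, 0 <= c i * f i) ->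
  (\esum_(i in [set: I]) (c i * f i)%:E < +oo)%E ->
  (\esum_(i in [set: I]) (c i * f i)%:E = (wsum c f)%:E)%E.
Proof.
move=> f0 ff; rewrite /wsum fineK// ge0_fin_numE//.
by apply: esum_ge0 => i _; rewrite lee_fin.
Qed.

Lemma wsum_ge0 c f : (forall i, 0 <= c i * f i) -> 0 <= wsum c f.
Proof. by move=> f0; apply: fine_ge0; apply: esum_ge0 => i _; rewrite lee_fin. Qed.

Section dominated.
Variables (c : I -> R) (L : R).
Hypotheses (c0 : forall i, 0 <= c i) (L0 : 0 <= L) (cL : forall i, c i <= L * om i).

Lemma dominated_esum_le f : summable f ->
  (\esum_(i in [set: I]) (c i * f i)%:E <= L%:E * \esum_(i in [set: I]) (om i * f i)%:E)%E.
Proof.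
move=> [f0 _]; rewrite -esumZl//; last by move=> i; rewrite lee_fin mulr_ge0.
by apply: le_esum => i _; rewrite -EFinM lee_fin mulrA ler_wpM2r.
Qed.

Lemma dominated_esum f : summable f ->
  (\esum_(i in [set: I]) (c i * f i)%:E = (wsum c f)%:E)%E.
Proof.
move=> sf; have [f0 ff] := sf; apply: esum_wsum; first by move=> i; rewrite mulr_ge0.
apply: le_lt_trans (dominated_esum_le sf) _.
rewrite (esum_wsum _ ff); first by rewrite -EFinM ltry.
by move=> i; rewrite mulr_ge0.
Qed.

Lemma dominated_wsum_ge0 f : summable f -> 0 <= wsum c f.
Proof. by move=> [f0 _]; apply: wsum_ge0 => i; rewrite mulr_ge0. Qed.

Lemma dominated_wsum_le f : summable f -> wsum c f <= L * wsum om f.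
Proof.
move=> sf; have [f0 ff] := sf; rewrite -lee_fin -dominated_esum//.
rewrite EFinM -esum_wsum//; first exact: dominated_esum_le.
by move=> i; rewrite mulr_ge0.
Qed.

(** Subtraction of [esum] is avoided: c u <= c v + c |u - v| holds termwise between nonnegative
    families, and then the roles of [f] and [g] are exchanged. *)
Lemma dominated_wsum_dist f g (e : R) : summable f -> summable g ->
  (\esum_(i in [set: I]) (om i * `|f i - g i|)%:E <= e%:E)%E ->
  `|wsum c f - wsum c g| <= L * e.
Proof.
have one (u v : I -> R) : summable u -> summable v ->
    (\esum_(i in [set: I]) (om i * `|u i - v i|)%:E <= e%:E)%E -> wsum c u - wsum c v <= L * e.
  move=> su sv h; have [u0 _] := su; have [v0 _] := sv.
  rewrite lerBlDl -lee_fin -dominated_esum// EFinD -dominated_esum//.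
  apply: (@le_trans _ _ (\esum_(i in [set: I]) (c i * v i)%:E +
     \esum_(i in [set: I]) (L%:E * (om i * `|u i - v i|)%:E))%E).
    rewrite -esumD//; last 2 first.
    - by move=> i _; rewrite lee_fin mulr_ge0.
    - by move=> i _; rewrite mule_ge0// lee_fin mulr_ge0.
    apply: le_esum => i _; rewrite -EFinM -EFinD lee_fin mulrA.
    apply: (@le_trans _ _ (c i * v i + c i * `|u i - v i|)).
      by rewrite -mulrDr ler_wpM2l// -lerBlDl ler_norm.
    by rewrite lerD2l ler_wpM2r.
  rewrite leeD2l// esumZl//; last by move=> i; rewrite lee_fin mulr_ge0.
  by rewrite EFinM lee_wpmul2l// lee_fin.
move=> sf sg h; rewrite ler_norml lerNl opprB !one//.
rewrite (eq_esum (b := fun i => (om i * `|f i - g i|)%:E))// => i _.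
by rewrite distrC.
Qed.

End dominated.

End WeightedSums.

(* Paths are meaningful for s >= 0 only; the max extends them to R. *)
Definition half_continuous {R : realType} (g : R -> R) : Prop :=
  continuous (fun s : R => g (Num.max s 0)).

Section HalfContinuous.
Context {R : realType}.
Implicit Types (g h : R -> R).

Lemma half_continuousP g : half_continuous g <-> forall s, 0 <= s -> forall e, 0 < e ->
  exists2 dl : R, 0 < dl & forall r, 0 <= r -> `|r - s| < dl -> `|g r - g s| <= e.
Proof.
split=> [cg s s0 e e0|h s].
  have /cvgrPdist_le/(_ e e0) := cg s.
  move=> /nbhs_ballP[dl /= dl0 hdl]; exists dl => // r r0 rs.
  have := hdl r; rewrite /ball/= distrC => /(_ rs).
  by rewrite !max_l// distrC.
apply/cvgrPdist_le => e e0.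
have m0 : 0 <= Num.max s 0 by rewrite le_max lexx orbT.
have [dl dl0 hdl] := h _ m0 e e0.
apply/nbhs_ballP; exists dl => //= r; rewrite /ball/= => sr.
rewrite distrC hdl//; first by rewrite le_max lexx orbT.
apply: le_lt_trans sr; rewrite distrC /Num.max.
case: (ltrP r 0) => r0; case: (ltrP s 0) => s0; rewrite ?subrr ?normr0//.
- by rewrite subr0 ger0_norm// (le_trans _ (ler_norm _))// lerBrDr gerDl ltW.
- by rewrite sub0r normrN ger0_norm// distrC (le_trans _ (ler_norm _))// lerBrDr gerDl ltW.
Qed.

Lemma half_continuous_left g s : half_continuous g -> 0 < s -> left_cont g s.
Proof.
move=> /half_continuousP cg s0 e e0.
have e20 : 0 < e / 2 by rewrite divr_gt0.
have [dl dl0 h] := cg s (ltW s0) _ e20; exists dl => // r r0 r1 r2.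
rewrite (le_lt_trans (h r r0 _))//; last by rewrite ltr_pdivrMr// ltr_pMr// ltrDl.
by rewrite ltr0_norm ?subr_lt0// opprB ltrBlDr -ltrBlDl.
Qed.

Lemma half_continuous_bounded g t : half_continuous g -> 0 <= t ->
  exists C : R, forall s, 0 <= s <= t -> `|g s| <= C.
Proof.
move=> cg t0.
have cn : continuous (fun s : R => `|g (Num.max s 0)|).
  by move=> s; apply: continuous_comp (cg s) _; exact: norm_continuous.
have [c _ hc] := EVT_max t0 (continuous_subspaceT cn (A := `[0, t]%classic)).
exists `|g (Num.max c 0)| => s st; have := hc s; rewrite in_itv/= => /(_ st).
by case/andP: st => s0 _; rewrite (max_l s0).
Qed.

Lemma half_continuousM g h : half_continuous g -> half_continuous h ->
  half_continuous (fun s => g s * h s).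
Proof. by move=> cg ch s; apply: cvgM; [exact: cg|exact: ch]. Qed.

Lemma half_continuousD g h : half_continuous g -> half_continuous h ->
  half_continuous (fun s => g s + h s).
Proof. by move=> cg ch s; apply: cvgD; [exact: cg|exact: ch]. Qed.

Lemma half_continuousB g h : half_continuous g -> half_continuous h ->
  half_continuous (fun s => g s - h s).
Proof. by move=> cg ch s; apply: cvgB; [exact: cg|exact: ch]. Qed.

Lemma half_continuous_cst (k : R) : half_continuous (fun=> k).
Proof. by move=> s; exact: cvg_cst. Qed.

Lemma half_continuous_comp (k : R -> R) g : continuous k -> half_continuous g ->
  half_continuous (fun s => k (g s)).
Proof. by move=> ck cg s; apply: continuous_comp (cg s) (ck _). Qed.

Lemma half_continuous_measurable (g : R -> R) (t : R) : half_continuous g -> measurable_fun `]0, t] g.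
Proof.
move=> cg; apply: (@eq_measurable_fun _ _ _ _ _ (fun s : R => g (Num.max s 0)) g).
  by move=> s; rewrite inE/= in_itv/= => /andP[/ltW s0 _]; rewrite max_l.
by apply: measurable_funTS; exact: continuous_measurable_fun.
Qed.

Lemma half_continuous_integrable g (t : R) : 0 <= t -> half_continuous g ->
  (@lebesgue_measure R).-integrable `]0, t] (EFin \o g).
Proof.
move=> t0 cg; have [C hC] := half_continuous_bounded cg t0.
apply: (bounded_integrable_oc (M := C)); first exact: half_continuous_measurable.
by move=> s /andP[s0 st]; apply: hC; rewrite (ltW s0).
Qed.

End HalfContinuous.

(** * Averages over the rates and paths in the weighted space *)

Section LatticeAverages.
Context {R : realType} {d : nat}.
Local Notation I := (lattice d).
Variables (a : I -> I -> R) (om : I -> R) (K : R).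
Hypotheses (ha : is_rates a) (hom : is_weight a om).
Hypothesis K0 : 0 <= K.
Hypothesis hK : forall j, (\esum_(i in [set: I]) (om i * a i j)%:E <= (K * om j)%:E)%E.
Implicit Types (f g : I -> R).

Local Notation norm := (wsum om).
Definition avg f i := wsum (a i) f.

Lemma weight_ge0 i : 0 <= om i. Proof. by rewrite ltW// (weight_gt0 hom). Qed.

Lemma in_E_summable f : in_E om f -> summable om f.
Proof.
move=> [f0 ff]; split=> //; apply: le_lt_trans ff; apply: le_esum => i _.
by rewrite lee_fin mulrC.
Qed.

Lemma rates_dominated i j : a i j <= K / om i * om j.
Proof.
exact: (column_dominated i (weight_gt0 hom) (rates_ge0 ha) (hK j)).
Qed.

Lemma rates_bound_ge0 i : 0 <= K / om i. Proof. by rewrite divr_ge0// weight_ge0. Qed.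

Let a0 i j : 0 <= a i j. Proof. exact: (rates_ge0 ha). Qed.
Let om1 i : om i <= 1 * om i. Proof. by rewrite mul1r. Qed.

Lemma norm_ge0 f : summable om f -> 0 <= norm f.
Proof. by move=> sf; exact: (dominated_wsum_ge0 weight_ge0 sf). Qed.

Lemma summable_le f i : summable om f -> f i <= norm f / om i.
Proof.
move=> sf; have oi := weight_gt0 hom i; rewrite ler_pdivlMr// mulrC -lee_fin.
rewrite -(dominated_esum weight_ge0 weight_ge0 ler01 om1 sf).
apply: (@le_esum_term _ _ (fun i => (om i * f i)%:E)) => k.
by have [f0 _] := sf; rewrite lee_fin mulr_ge0 ?weight_ge0.
Qed.

Lemma avgE f i : summable om f -> (\esum_(j in [set: I]) (a i j * f j)%:E = (avg f i)%:E)%E.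
Proof. exact: (dominated_esum weight_ge0 (a0 i) (rates_bound_ge0 i) (rates_dominated i)). Qed.

Lemma avg_ge0 f i : summable om f -> 0 <= avg f i.
Proof. exact: (dominated_wsum_ge0 (a0 i)). Qed.

Lemma avg_le f i : summable om f -> avg f i <= K / om i * norm f.
Proof. exact: (dominated_wsum_le weight_ge0 (a0 i) (rates_bound_ge0 i) (rates_dominated i)). Qed.

(** Summing in the other order meets the column condition: averaging acts on the weighted l^1 space
    with norm at most [K], the estimate behind the later use of Gronwall's inequality. *)
Lemma sum_avg_le f : summable om f ->
  (\esum_(i in [set: I]) (om i * avg f i)%:E <= (K * norm f)%:E)%E.
Proof.
move=> sf; have [f0 ff] := sf.
rewrite (eq_esum (b := fun i => (\esum_(j in [set: I]) ((om i * a i j * f j)%:E))%E)); last first.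
  move=> i _; rewrite EFinM -avgE// -esumZl ?weight_ge0//; last by move=> j; rewrite lee_fin mulr_ge0.
  by apply: eq_esum => j _; rewrite -EFinM mulrA.
rewrite esum_exchange; last by move=> i j; rewrite lee_fin !mulr_ge0 ?weight_ge0.
rewrite EFinM -(dominated_esum weight_ge0 weight_ge0 ler01 om1 sf) -esumZl//; last first.
  by move=> j; rewrite lee_fin mulr_ge0 ?weight_ge0.
apply: le_esum => j _.
rewrite (eq_esum (b := fun i => ((om i * a i j)%:E * (f j)%:E)%E)); last by move=> i _; rewrite -EFinM.
rewrite esumZr//; last by move=> i; rewrite lee_fin mulr_ge0 ?weight_ge0.
by rewrite -EFinM mulrA EFinM lee_wpmul2r// lee_fin.
Qed.

(** [drift] sums positive and negative parts separately. With g_j = a_ij (f_j - f_i), termwise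
    max(g_j, 0) + a_ij f_i = max(-g_j, 0) + a_ij f_j; all terms are nonnegative, and summing over j
    gives the claim because rows of [a] have mass 1. *)
Lemma drift_avg f i : summable om f -> drift a f i = avg f i - f i.
Proof.
move=> sf; have [f0 _] := sf; rewrite /drift /abs_sum.
pose g j := a i j * (f j - f i).
have gp j : Num.max (g j) 0 <= a i j * f j.
  by rewrite ge_max mulr_ge0// andbT ler_wpM2l// lerBlDr lerDl.
have gm j : Num.max (- g j) 0 <= a i j * f i.
  by rewrite ge_max mulr_ge0// andbT -mulrN ler_wpM2l// opprB lerBlDr lerDl.
have g0 j : 0 <= Num.max (g j) 0 by rewrite le_max lexx orbT.
have g0' j : 0 <= Num.max (- g j) 0 by rewrite le_max lexx orbT.
have sa : (\esum_(j in [set: I]) (a i j * f i)%:E = (f i)%:E)%E.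
  rewrite (eq_esum (b := fun j => ((a i j)%:E * (f i)%:E)%E)); last by move=> j _; rewrite EFinM.
  rewrite esumZr//; last by move=> j; rewrite lee_fin.
  by transitivity (1 * (f i)%:E)%E; [congr (_ * _)%E; exact: (rates_sum1 ha)|rewrite mul1e].
have fp : (\esum_(j in [set: I]) (Num.max (g j) 0)%:E)%E \is a fin_num.
  rewrite ge0_fin_numE; last by apply: esum_ge0 => j _; rewrite lee_fin.
  apply: (@le_lt_trans _ _ (\esum_(j in [set: I]) (a i j * f j)%:E)%E).
    by apply: le_esum => j _; rewrite lee_fin.
  by rewrite avgE// ltry.
have fm : (\esum_(j in [set: I]) (Num.max (- g j) 0)%:E)%E \is a fin_num.
  rewrite ge0_fin_numE; last by apply: esum_ge0 => j _; rewrite lee_fin.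
  apply: (@le_lt_trans _ _ (\esum_(j in [set: I]) (a i j * f i)%:E)%E).
    by apply: le_esum => j _; rewrite lee_fin.
  by rewrite sa ltry.
have key : (\esum_(j in [set: I]) (Num.max (g j) 0)%:E + (f i)%:E =
    \esum_(j in [set: I]) (Num.max (- g j) 0)%:E + (avg f i)%:E)%E.
  rewrite -sa -avgE// -!esumD//; try by move=> j _; rewrite lee_fin// mulr_ge0.
  apply: eq_esum => j _; rewrite -!EFinD; congr (_%:E).
  have e : a i j * f j = g j + a i j * f i by rewrite /g mulrBr subrK.
  rewrite e addrA; congr (_ + _); have [h|h] := leP 0 (g j).
    have h' : - g j <= 0 by rewrite oppr_le0.
    by rewrite (elimT max_idPr h') add0r.
  have h' : 0 <= - g j by rewrite oppr_ge0 ltW.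
  by rewrite (elimT max_idPl h') addNr.
move: key; rewrite -(fineK fp) -(fineK fm) -!EFinD => -[key].
rewrite -/(g _); apply/eqP; rewrite subr_eq addrAC -subr_eq opprK [X in _ == X]addrC; apply/eqP.
exact: key.
Qed.

Section paths.
Variable x : R -> I -> R.
Hypothesis xE : E_path om x.

Lemma E_path_summable t : 0 <= t -> summable om (x t).
Proof. by move=> t0; apply: in_E_summable; exact: xE.1. Qed.

Lemma E_path_near t e : 0 <= t -> 0 < e -> exists2 dl : R, 0 < dl &
  forall s, 0 <= s -> `|s - t| < dl ->
    (\esum_(j in [set: I]) (om j * `|x s j - x t j|)%:E <= e%:E)%E.
Proof.
move=> t0 e0; have /fine_cvgP[cf /cvgrPdist_le/(_ e e0) ce] := xE.2 t t0.
have [/nbhs_ballP[d1 /= d10 h1] /nbhs_ballP[d2 /= d20 h2]] := (cf, ce).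
exists (Num.min d1 d2); first by rewrite lt_min d10.
move=> s s0; rewrite lt_min => /andP[s1 s2].
have hf : (\esum_(j in [set: I]) (`|x s j - x t j| * om j)%:E)%E \is a fin_num.
  by apply: h1 => //; rewrite /ball/= distrC.
have := h2 s; rewrite /ball/= distrC => /(_ s2 s0).
rewrite sub0r normrN => he; rewrite (eq_esum (b := fun j => (`|x s j - x t j| * om j)%:E)); last first.
  by move=> j _; rewrite mulrC.
rewrite -(fineK hf) lee_fin (le_trans _ he)//; exact: ler_norm.
Qed.

(** Functionals dominated by the weight are Lipschitz for the distance in which the paths are
    continuous. *)
Lemma E_path_wsum_continuous (c : I -> R) (L : R) : (forall i, 0 <= c i) -> 0 <= L ->
  (forall i, c i <= L * om i) -> half_continuous (fun t => wsum c (x t)).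
Proof.
move=> c0 L0 cL; apply/half_continuousP => s s0 e e0.
have e'0 : 0 < e / (L + 1) by rewrite divr_gt0// ltr_wpDl.
have [dl dl0 h] := E_path_near s0 e'0; exists dl => // r r0 rs.
apply: le_trans (dominated_wsum_dist weight_ge0 c0 L0 cL (E_path_summable r0) (E_path_summable s0) (h r r0 rs)) _.
rewrite mulrCA ler_piMr ?(ltW e0)// ler_pdivrMr ?ltr_wpDl// mul1r.
by rewrite lerDl.
Qed.

Lemma E_path_norm_continuous : half_continuous (fun t => norm (x t)).
Proof. exact: E_path_wsum_continuous weight_ge0 ler01 om1. Qed.

Lemma E_path_avg_continuous i : half_continuous (fun t => avg (x t) i).
Proof. exact: E_path_wsum_continuous (a0 i) (rates_bound_ge0 i) (rates_dominated i). Qed.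

Lemma E_path_continuous i : half_continuous (x ^~ i).
Proof.
apply/half_continuousP => s s0 e e0.
have oi := weight_gt0 hom i; have e'0 : 0 < om i * e by rewrite mulr_gt0.
have [dl dl0 h] := E_path_near s0 e'0; exists dl => // r r0 rs.
have := h r r0 rs; have := @le_esum_term _ _ (fun j => (om j * `|x r j - x s j|)%:E) i.
move=> /(_ (fun j => _)) h1 /(le_trans (h1 _)).
by rewrite lee_fin ler_pM2l//; apply => j; rewrite lee_fin mulr_ge0// weight_ge0.
Qed.

End paths.
End LatticeAverages.

(** * Exchanging time integrals and expectations *)

Section StripIntegrals.
Context {R : realType} {d : measure_display} {T : measurableType d}.
Variable P : probability T R.
Local Notation leb := (@lebesgue_measure R).

(** With [m] the mean of [g] over the interval, the two sides differ by [t] times the nonnegative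
    integral of [(g - m) ^+ 2]. *)
Lemma Rintegral_sqr_le (t C : R) (g : R -> R) : 0 <= t -> measurable_fun `]0, t] g ->
  (forall s, 0 < s <= t -> `|g s| <= C) ->
  (\int[leb]_(s in `]0, t]) g s) ^+ 2 <= t * \int[leb]_(s in `]0, t]) (g s ^+ 2).
Proof.
move=> t0 mg gC; have [->|tn0] := eqVneq t 0.
  by rewrite !Rintegral_oc_set0 mul0r expr0n.
have t_gt0 : 0 < t by rewrite lt_neqAle eq_sym tn0.
have ig : leb.-integrable `]0, t] (EFin \o g) by exact: bounded_integrable_oc gC.
have ig2 : leb.-integrable `]0, t] (EFin \o (fun s => g s ^+ 2)).
  apply: (bounded_integrable_oc (M := C ^+ 2)); first exact: measurable_funX.
  by move=> s st; rewrite normrX lerXn2r ?nnegrE// ?gC// (le_trans _ (gC s st)).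
have mL := measurable_oc 0 t.
pose m := (\int[leb]_(s in `]0, t]) g s) / t.
have ic (k : R) : leb.-integrable `]0, t] (EFin \o (fun=> k)).
  by apply: (bounded_integrable_oc (M := `|k|)).
have img := rintegrableZl mL (2 * m) ig.
have ge0 : 0 <= \int[leb]_(s in `]0, t]) ((g s - m) ^+ 2).
  by apply: fine_ge0; apply: integral_ge0 => s _; rewrite lee_fin sqr_ge0.
move: ge0; rewrite (_ : \int[leb]_(s in _) _ =
  \int[leb]_(s in `]0, t]) (g s ^+ 2 - 2 * m * g s + m ^+ 2)); last first.
  by apply: eq_Rintegral => s _; ring.
have i12 := rintegrableB mL ig2 img.
rewrite RintegralD// RintegralB// RintegralZl// Rintegral_cst_oc// subr0.
have -> : \int[leb]_(s in `]0, t]) g s = m * t by rewrite /m divfK.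
move: (\int[leb]_(s in _) _) => S h.
rewrite (_ : (m * t) ^+ 2 = t * (m ^+ 2 * t)); last by ring.
rewrite ler_pM2l//.
have : 0 <= S - m ^+ 2 * t.
  by move: h; rewrite (_ : _ + _ = S - m ^+ 2 * t)//; ring.
by rewrite subr_ge0.
Qed.

Section fubini.
Variables (t C : R).

Lemma strip_fubini_ge0 (f : R -> T -> R) : jointly_measurable t f ->
  (forall s w, 0 < s <= t -> 0 <= f s w) ->
  (forall w, leb.-integrable `]0, t] (EFin \o (f ^~ w))) ->
  (forall s, 0 < s <= t -> P.-integrable setT (EFin \o f s)) ->
  (forall s, 0 < s <= t -> \int[P]_w f s w <= C) ->
  [/\ P.-integrable setT (EFin \o (fun w => \int[leb]_(s in `]0, t]) f s w)),
    leb.-integrable `]0, t] (EFin \o (fun s => \int[P]_w f s w)) &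
    \int[P]_w (\int[leb]_(s in `]0, t]) f s w) = \int[leb]_(s in `]0, t]) (\int[P]_w f s w)].
Proof.
move=> jf f0 iw is_ fC.
have mL := measurable_oc 0 t.
pose mD := measurable_itv `]0, t] : measurable (`]0, t]%classic : set R).
pose g (z : R * T) := (f z.1 z.2)%:E.
have mg : measurable_fun (`]0, t] `*` setT) g by exact/measurable_EFinP.
have g0 z : (`]0, t] `*` [set: T]) z -> (0 <= g z)%E.
  by move=> [/=]; rewrite in_itv/= => zt _; rewrite lee_fin f0.
have e1 w : (\int[leb]_(s in `]0%R, t]) g (s, w))%E = (\int[leb]_(s in `]0, t]) f s w)%:E.
  by rewrite /Rintegral fineK//; exact: integrable_fin_num (iw w).
have e2 s : 0 < s <= t -> (\int[P]_w g (s, w))%E = (\int[P]_w f s w)%:E.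
  by move=> st; rewrite /Rintegral fineK//; exact: integrable_fin_num (is_ s st).
have m1 : measurable_fun setT (fun w => \int[leb]_(s in `]0, t]) f s w).
  apply/measurable_EFinP; have := measurable_tonelli_strip2 mD mg g0.
  by apply: eq_measurable_fun => w _; exact: e1.
have m2 : measurable_fun `]0, t] (fun s => \int[P]_w f s w).
  apply/measurable_EFinP; have := measurable_tonelli_strip P mD mg g0.
  by apply: eq_measurable_fun => s; rewrite inE/= in_itv/= => st; exact: e2.
have i2 : leb.-integrable `]0, t] (EFin \o (fun s => \int[P]_w f s w)).
  apply: (bounded_integrable_oc (M := C)) => // s st.
  rewrite ger0_norm ?fC//; apply: fine_ge0; apply: integral_ge0 => w _.
  by rewrite lee_fin f0.
have ton := tonelli_strip P mD mg g0.
have E : (\int[P]_w (\int[leb]_(s in `]0%R, t]) f s w)%R%:E =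
    \int[leb]_(s in `]0%R, t]) (\int[P]_w f s w)%R%:E)%E.
  under eq_integral do rewrite -e1.
  rewrite -ton; apply: eq_integral => s; rewrite inE/= in_itv/= => st.
  exact: e2.
have i1 : P.-integrable setT (EFin \o (fun w => \int[leb]_(s in `]0, t]) f s w)).
  apply/integrableP; split; first exact/measurable_EFinP.
  under eq_integral => w _.
    rewrite /= ger0_norm; last first.
      apply: fine_ge0; apply: integral_ge0 => s /=; rewrite in_itv/= => st.
      by rewrite lee_fin f0.
    over.
  rewrite E; have := integrable_fin_num mL i2.
  rewrite ge0_fin_numE//; apply: integral_ge0 => s; rewrite /= in_itv/= => st.
  by rewrite lee_fin; apply: fine_ge0; apply: integral_ge0 => w _; rewrite lee_fin f0.
by split=> //; rewrite /Rintegral; congr fine; exact: E.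
Qed.

(** The integrand splits into the nonnegative parts (|f| + f) / 2 and (|f| - f) / 2, both controlled
    by |f|. *)
Lemma strip_fubini (f : R -> T -> R) : jointly_measurable t f ->
  (forall w, leb.-integrable `]0, t] (EFin \o (f ^~ w))) ->
  (forall s, 0 < s <= t -> P.-integrable setT (EFin \o f s)) ->
  (forall s, 0 < s <= t -> \int[P]_w `|f s w| <= C) ->
  [/\ P.-integrable setT (EFin \o (fun w => \int[leb]_(s in `]0, t]) f s w)),
    leb.-integrable `]0, t] (EFin \o (fun s => \int[P]_w f s w)) &
    \int[P]_w (\int[leb]_(s in `]0, t]) f s w) = \int[leb]_(s in `]0, t]) (\int[P]_w f s w)].
Proof.
move=> jf iw is_ fC.
have mL := measurable_oc 0 t.
pose g s w := (`|f s w| + f s w) / 2; pose h s w := (`|f s w| - f s w) / 2.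
have fgh s w : f s w = g s w - h s w by rewrite /g /h; field.
have g0 s w : 0 < s <= t -> 0 <= g s w.
  by move=> _; rewrite divr_ge0// -lerBlDr sub0r -normrN ler_norm.
have h0 s w : 0 < s <= t -> 0 <= h s w.
  by move=> _; rewrite divr_ge0// subr_ge0 ler_norm.
have jn : jointly_measurable t (fun s w => `|f s w|).
  by apply: measurableT_comp jf; exact: normr_measurable.
have jg : jointly_measurable t g.
  by apply: measurable_funM => //; exact: measurable_funD.
have jh : jointly_measurable t h.
  by apply: measurable_funM => //; exact: measurable_funB.
have iwn w : leb.-integrable `]0, t] (EFin \o (fun s => `|f s w|)).
  by apply: eq_integrable (integrable_abse (iw w)).
have isn s : 0 < s <= t -> P.-integrable setT (EFin \o (fun w => `|f s w|)).
  by move=> st; apply: eq_integrable (integrable_abse (is_ s st)).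
have iwg w : leb.-integrable `]0, t] (EFin \o (g ^~ w)) :=
  rintegrableZr mL 2^-1 (rintegrableD mL (iwn w) (iw w)).
have iwh w : leb.-integrable `]0, t] (EFin \o (h ^~ w)) :=
  rintegrableZr mL 2^-1 (rintegrableB mL (iwn w) (iw w)).
have isg s (st : 0 < s <= t) : P.-integrable setT (EFin \o g s) :=
  rintegrableZr measurableT 2^-1 (rintegrableD measurableT (isn s st) (is_ s st)).
have ish s (st : 0 < s <= t) : P.-integrable setT (EFin \o h s) :=
  rintegrableZr measurableT 2^-1 (rintegrableB measurableT (isn s st) (is_ s st)).
have gC s : 0 < s <= t -> \int[P]_w g s w <= C.
  move=> st; apply: le_trans (fC s st); apply: le_Rintegral => //; first exact: isg.
    exact: isn.
  by move=> w _; rewrite /g ler_pdivrMr// mulrDr mulr1 lerD2l ler_norm.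
have hC s : 0 < s <= t -> \int[P]_w h s w <= C.
  move=> st; apply: le_trans (fC s st); apply: le_Rintegral => //; first exact: ish.
    exact: isn.
  by move=> w _; rewrite /h ler_pdivrMr// mulrDr mulr1 lerD2l -normrN ler_norm.
have [ig1 ig2 eg] := strip_fubini_ge0 jg g0 iwg isg gC.
have [ih1 ih2 eh] := strip_fubini_ge0 jh h0 iwh ish hC.
have E1 w : \int[leb]_(s in `]0, t]) f s w =
    \int[leb]_(s in `]0, t]) g s w - \int[leb]_(s in `]0, t]) h s w.
  by rewrite -RintegralB//; apply: eq_Rintegral => s _; exact: fgh.
have E2 s : 0 < s <= t -> \int[P]_w f s w = \int[P]_w g s w - \int[P]_w h s w.
  move=> st; rewrite -RintegralB//; [|exact: isg|exact: ish].
  by apply: eq_Rintegral => w _; exact: fgh.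
split.
- apply: eq_integrable (integrableB measurableT ig1 ih1) => // w _ /=.
  by rewrite E1 EFinB.
- apply: eq_integrable (integrableB mL ig2 ih2) => // s; rewrite inE/= in_itv/= => st.
  by rewrite E2// EFinB.
- transitivity (\int[P]_w ((\int[leb]_(s in `]0, t]) g s w) - (\int[leb]_(s in `]0, t]) h s w))).
    by apply: eq_Rintegral => w _; exact: E1.
  rewrite (RintegralB measurableT ig1 ih1) eg eh -(RintegralB mL ig2 ih2); apply: eq_Rintegral => s.
  by rewrite inE/= in_itv/= => st; rewrite E2.
Qed.

End fubini.
End StripIntegrals.

Section RegularProcesses.
Context {R : realType} {d : measure_display} {T : measurableType d}.
Variable P : probability T R.
Local Notation leb := (@lebesgue_measure R).
Implicit Types (f g : R -> T -> R).

(** Continuity of every path gives joint measurability and pathwise integrability; L^2 bounds that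
    are uniform on bounded time intervals give Fubini for products of two such processes. *)
Definition regular f : Prop := (forall w, half_continuous (f ^~ w)) /\
  forall T0 : R, 0 <= T0 -> exists C : R, forall s, 0 <= s <= T0 ->
    sqint P setT (f s) /\ \int[P]_w (f s w ^+ 2) <= C.

Lemma regular_sqint f s : 0 <= s -> regular f -> sqint P setT (f s).
Proof. by move=> s0 [_ /(_ s s0)[C /(_ s)]]; rewrite s0 lexx => /(_ isT)[]. Qed.

Lemma regular_joint f t : 0 <= t -> regular f -> jointly_measurable t f.
Proof.
move=> t0 rf; apply: measurable_left_cont => // [s /andP[s0 _]|w s /andP[s0 _]].
  exact: (regular_sqint s0 rf).1.
by apply: half_continuous_left => //; exact: rf.1.
Qed.

Lemma regular_frozen (Z : T -> R) : sqint P setT Z -> regular (fun=> Z).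
Proof.
move=> sZ; split=> [w|T0 _]; first exact: (half_continuous_cst (k := Z w)).
by exists (\int[P]_w (Z w ^+ 2)).
Qed.

Lemma sqint_cst (k : R) : sqint P setT (fun=> k).
Proof. by split=> //; exact: finite_measure_integrable_cst. Qed.

Lemma regularD f g : regular f -> regular g -> regular (fun s w => f s w + g s w).
Proof.
move=> [cf hf] [cg hg]; split=> [w|T0 T00]; first exact: (half_continuousD (cf w) (cg w)).
have [C hC] := hf T0 T00; have [C' hC'] := hg T0 T00; exists (2 * C + 2 * C') => s sT.
have [sf fC] := hC s sT; have [sg gC] := hC' s sT; split; first exact: sqintD.
by apply: le_trans (Rintegral_sqrD_le measurableT sf sg) _; rewrite lerD// ler_wpM2l.
Qed.

Lemma regularZ (k : R) f : regular f -> regular (fun s w => k * f s w).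
Proof.
move=> [cf hf]; split=> [w|T0 T00].
  exact: (half_continuousM (half_continuous_cst (k := k)) (cf w)).
have [C hC] := hf T0 T00; exists (k ^+ 2 * C) => s sT.
have [sf fC] := hC s sT; split; first exact: sqintZ.
rewrite (_ : \int[P]_w _ = \int[P]_w (k ^+ 2 * f s w ^+ 2)); last first.
  by apply: eq_Rintegral => w _; rewrite exprMn.
by rewrite RintegralZl ?ler_wpM2l ?sqr_ge0//; exact: sf.2.
Qed.

Lemma regularB f g : regular f -> regular g -> regular (fun s w => f s w - g s w).
Proof.
move=> rf rg; rewrite (_ : (fun s w => _) = fun s w => f s w + (-1) * g s w).
  exact: regularD rf (regularZ (-1) rg).
by apply/funext => s; apply/funext => w; rewrite mulN1r.
Qed.

Lemma regular_mul_integrable f g s : 0 <= s -> regular f -> regular g ->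
  P.-integrable setT (EFin \o (fun w => f s w * g s w)).
Proof. by move=> s0 rf rg; apply: sqint_mul => //; exact: regular_sqint. Qed.

Lemma regular_path_integrable f g t w : 0 <= t -> regular f -> regular g ->
  leb.-integrable `]0, t] (EFin \o (fun s => f s w * g s w)).
Proof.
move=> t0 rf rg; have [C hC] := half_continuous_bounded (half_continuousM (rf.1 w) (rg.1 w)) t0.
apply: (bounded_integrable_oc (M := C)) => [|s /andP[/ltW s0 st]]; last by rewrite hC ?s0.
apply: measurable_funM.
  exact: (jointly_measurable_section w (regular_joint t0 rf)).
exact: (jointly_measurable_section w (regular_joint t0 rg)).
Qed.

Lemma regular_fubini f g t : 0 <= t -> regular f -> regular g ->
  [/\ P.-integrable setT (EFin \o (fun w => \int[leb]_(s in `]0, t]) (f s w * g s w))),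
    leb.-integrable `]0, t] (EFin \o (fun s => \int[P]_w (f s w * g s w))) &
    \int[P]_w (\int[leb]_(s in `]0, t]) (f s w * g s w)) =
    \int[leb]_(s in `]0, t]) (\int[P]_w (f s w * g s w))].
Proof.
move=> t0 rf rg; have [C hC] := rf.2 t t0; have [C' hC'] := rg.2 t t0.
apply: (strip_fubini (P := P) (C := C + C') (f := fun s w => f s w * g s w)).
- by apply: measurable_funM; exact: regular_joint.
- by move=> w; exact: regular_path_integrable.
- by move=> s /andP[/ltW s0 _]; exact: regular_mul_integrable.
move=> s /andP[/ltW s0 st]; have st' : 0 <= s <= t by rewrite s0.
have [[_ if2] fC] := hC s st'; have [[_ ig2] gC] := hC' s st'.
apply: (@le_trans _ _ (\int[P]_w (f s w ^+ 2 + g s w ^+ 2))); last by rewrite RintegralD// lerD.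
apply: le_Rintegral => //.
- exact: (integrable_norm (regular_mul_integrable s0 rf rg)).
- exact: rintegrableD.
move=> w _; rewrite normrM -(real_normK (num_real (f s w))) -(real_normK (num_real (g s w))).
by have := normr_ge0 (f s w); have := normr_ge0 (g s w); nra.
Qed.

(** After Fubini, [N t] may be replaced by [N s] at each time [s], since [al s] is orthogonal to the
    later increment of [N]. *)
Lemma drift_martingale (al N : R -> T -> R) t : 0 <= t -> regular al -> regular N ->
  (forall s, 0 <= s <= t -> \int[P]_w (al s w * (N t w - N s w)) = 0) ->
  \int[P]_w ((\int[leb]_(s in `]0, t]) al s w) * N t w) =
  \int[leb]_(s in `]0, t]) \int[P]_w (al s w * N s w).
Proof.
move=> t0 ra rN hN; have sN := regular_sqint t0 rN.
have rF := regular_frozen sN.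
have r1 : regular (fun (_ : R) (_ : T) => 1 : R) by apply: regular_frozen; exact: sqint_cst.
have [_ _ e] := regular_fubini t0 ra rF.
transitivity (\int[P]_w \int[leb]_(s in `]0, t]) (al s w * N t w)).
  apply: eq_Rintegral => w _; rewrite RintegralZr//.
  have := regular_path_integrable w t0 ra r1.
  by apply: eq_integrable => // s _ /=; rewrite mulr1.
rewrite e; apply: eq_Rintegral => s; rewrite inE/= in_itv/= => /andP[/ltW s0 st].
have st' : 0 <= s <= t by rewrite s0.
have i1 := sqint_mul measurableT (regular_sqint s0 ra) sN.
have i2 := regular_mul_integrable s0 ra rN.
apply/eqP; rewrite -subr_eq0 -RintegralB//; apply/eqP; rewrite -[RHS](hN s st').
by apply: eq_Rintegral => w _; rewrite mulrBr.
Qed.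

(** Integration by parts in expectation. [X' = X - M] and [Y' = Y - N] are of finite variation and
    obey the pathwise product rule; the mixed terms are given by [drift_martingale], and adding them
    turns [Y'] and [X'] in the drift terms back into [Y] and [X]. The expectation of [M t * N t] is
    left over. *)
Lemma semimartingale_product (al be M N X Y : R -> T -> R) t : 0 <= t ->
  regular al -> regular be -> regular M -> regular N -> regular X -> regular Y ->
  (forall s w, 0 <= s -> X s w = 1 + (\int[leb]_(r in `]0, s]) al r w) + M s w) ->
  (forall s w, 0 <= s -> Y s w = 1 + (\int[leb]_(r in `]0, s]) be r w) + N s w) ->
  (forall s, 0 <= s <= t -> \int[P]_w (al s w * (N t w - N s w)) = 0) ->
  (forall s, 0 <= s <= t -> \int[P]_w (be s w * (M t w - M s w)) = 0) ->
  \int[P]_w M t w = 0 -> \int[P]_w N t w = 0 ->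
  leb.-integrable `]0, t] (EFin \o (fun s => \int[P]_w (al s w * Y s w))) /\
  leb.-integrable `]0, t] (EFin \o (fun s => \int[P]_w (X s w * be s w))) /\
  \int[P]_w (X t w * Y t w) = 1 +
    (\int[leb]_(s in `]0, t]) \int[P]_w (al s w * Y s w)) +
    (\int[leb]_(s in `]0, t]) \int[P]_w (X s w * be s w)) + \int[P]_w (M t w * N t w).
Proof.
move=> t0 ra rb rM rN rX rY eX eY aN bM M0 N0.
have mL := measurable_oc 0 t.
have [_ iaY _] := regular_fubini t0 ra rY; have [_ iXb _] := regular_fubini t0 rX rb.
split=> //; split=> //.
pose A s w := \int[leb]_(r in `]0, s]) al r w; pose B s w := \int[leb]_(r in `]0, s]) be r w.
have r1 : regular (fun (_ : R) (_ : T) => 1 : R) by apply: regular_frozen; exact: sqint_cst.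
pose X' s w := X s w - M s w; pose Y' s w := Y s w - N s w.
have rX' : regular X' := regularB rX rM; have rY' : regular Y' := regularB rY rN.
have eX' s w : 0 <= s -> X' s w = 1 + A s w by move=> s0; rewrite /X' eX// addrK.
have eY' s w : 0 <= s -> Y' s w = 1 + B s w by move=> s0; rewrite /Y' eY// addrK.
have [iaY' iaY'2 eaY'] := regular_fubini t0 ra rY'.
have [iXb' iXb'2 eXb'] := regular_fubini t0 rX' rb.
have prod w : X' t w * Y' t w = 1 + (\int[leb]_(s in `]0, t]) (al s w * Y' s w)) +
    \int[leb]_(s in `]0, t]) (X' s w * be s w).
  have [C1 h1] := half_continuous_bounded (ra.1 w) t0.
  have [C2 h2] := half_continuous_bounded (rb.1 w) t0.
  have X0 : X' 0 w = 1 by rewrite eX'// /A Rintegral_oc_set0 addr0.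
  have Y0 : Y' 0 w = 1 by rewrite eY'// /B Rintegral_oc_set0 addr0.
  rewrite (@Rintegral_product _ t (`|C1| + `|C2|) (X' ^~ w) (Y' ^~ w) (al ^~ w) (be ^~ w)) ?X0 ?Y0//.
  - by rewrite mulr1 RintegralD ?addrA//; exact: regular_path_integrable.
  - exact: (jointly_measurable_section w (regular_joint t0 ra)).
  - exact: (jointly_measurable_section w (regular_joint t0 rb)).
  - exact: (jointly_measurable_section w (regular_joint t0 rX')).
  - exact: (jointly_measurable_section w (regular_joint t0 rY')).
  - by move=> s st; rewrite (le_trans (h1 s st))// (le_trans (ler_norm _))// lerDl.
  - by move=> s st; rewrite (le_trans (h2 s st))// (le_trans (ler_norm _))// lerDr.
  - by move=> s /andP[s0 _]; rewrite eX'.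
  - by move=> s /andP[s0 _]; rewrite eY'.
have sM := regular_sqint t0 rM; have sN := regular_sqint t0 rN.
have s1 := sqint_cst 1.
have iM : P.-integrable setT (EFin \o M t).
  by apply: eq_integrable (sqint_mul measurableT sM s1) => // w _ /=; rewrite mulr1.
have iN : P.-integrable setT (EFin \o N t).
  by apply: eq_integrable (sqint_mul measurableT sN s1) => // w _ /=; rewrite mulr1.
have sA : sqint P setT (A t).
  rewrite (_ : A t = fun w => X' t w - 1); last by apply/funext => w; rewrite eX'// addrC addKr.
  exact: sqintB (regular_sqint t0 rX') s1.
have sB : sqint P setT (B t).
  rewrite (_ : B t = fun w => Y' t w - 1); last by apply/funext => w; rewrite eY'// addrC addKr.
  exact: sqintB (regular_sqint t0 rY') s1.
have iAN := sqint_mul measurableT sA sN; have iBM := sqint_mul measurableT sB sM.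
have iMN := sqint_mul measurableT sM sN.
have cst1 : P.-integrable setT (EFin \o (fun=> 1 : R)) by exact: finite_measure_integrable_cst.
pose U w := \int[leb]_(s in `]0, t]) (al s w * Y' s w).
pose V w := \int[leb]_(s in `]0, t]) (X' s w * be s w).
transitivity (\int[P]_w (1 + (U w + (V w + (M t w + (N t w + (A t w * N t w + (B t w * M t w + M t w * N t w)))))))).
  apply: eq_Rintegral => w _.
  have -> : X t w * Y t w = X' t w * Y' t w + X' t w * N t w + Y' t w * M t w + M t w * N t w.
    by rewrite /X' /Y'; ring.
  by rewrite prod eX'// eY'// -/(U w) -/(V w); ring.
have i7 := rintegrableD measurableT iBM iMN; have i6 := rintegrableD measurableT iAN i7; have i5 := rintegrableD measurableT iN i6.
have i4 := rintegrableD measurableT iM i5; have i3 := rintegrableD measurableT iXb' i4; have i2 := rintegrableD measurableT iaY' i3.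
(* An opaque name keeps unification from unfolding the double integrals. *)
have [E hE] : exists E : (R -> T -> R) -> (R -> T -> R) -> R, forall f g,
    E f g = \int[leb]_(s in `]0, t]) (\int[P]_w (f s w * g s w)).
  by exists (fun f g => \int[leb]_(s in `]0, t]) (\int[P]_w (f s w * g s w))).
have [mn hmn] : exists r : R, r = \int[P]_w (M t w * N t w) by eexists.
transitivity (1 + (E al Y' + (E X' be + (E al N + (E be M + mn))))).
  rewrite RintegralD// RintegralD// RintegralD// RintegralD// RintegralD// RintegralD// RintegralD//.
  rewrite (Rintegral_prob_cst P) M0 N0 !add0r (drift_martingale t0 ra rN aN) (drift_martingale t0 rb rM bM).
  by rewrite /U /V eaY' eXb' !hE hmn.
have splitE f g h : regular f -> regular g -> regular h ->
    E f g = E f (fun s w => g s w - h s w) + E f h.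
  move=> rf rg rh; have [_ i1 _] := regular_fubini t0 rf (regularB rg rh).
  have [_ i2' _] := regular_fubini t0 rf rh.
  rewrite !hE -RintegralD//; apply: eq_Rintegral => s; rewrite inE/= in_itv/= => /andP[/ltW s0 _].
  rewrite -RintegralD//.
  - by apply: eq_Rintegral => w _; rewrite -mulrDr subrK.
  - exact: (regular_mul_integrable s0 rf (regularB rg rh)).
  - exact: (regular_mul_integrable s0 rf rh).
have commE f g : E f g = E g f.
  by rewrite !hE; apply: eq_Rintegral => s _; apply: eq_Rintegral => w _; rewrite mulrC.
have e1 : E al Y = E al Y' + E al N by exact: splitE.
have e2 : E X be = E X' be + E be M by rewrite (commE X) (commE X'); exact: splitE.
rewrite -hmn -(hE al Y) -(hE X be) e1 e2.
by move: (E al Y') (E al N) (E X' be) (E be M) => p q r s; ring.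
Qed.

End RegularProcesses.

(** * Uniqueness and the expectations of the pair of chains *)

Section PositiveSystem.
Context {R : realType} {S : countType}.
Local Notation leb := (@lebesgue_measure R).
Variables (B : S -> S -> R) (wt : S -> R) (C : R).
Hypotheses (B0 : forall x y, 0 <= B x y) (wt0 : forall x, 0 < wt x) (C0 : 0 < C).
Hypothesis BC : forall y, (\esum_(x in [set: S]) (wt x * B x y)%:E <= (C * wt y)%:E)%E.

Definition kernel_op (f : S -> R) (x : S) : R := wsum (B x) f.

Let w0 x : 0 <= wt x. Proof. exact: ltW. Qed.
Let L x : R := C / wt x.
Let L0 x : 0 <= L x. Proof. by rewrite divr_ge0// ltW. Qed.
Let BL x y : B x y <= L x * wt y.
Proof.
exact: (column_dominated x wt0 B0 (BC y)).
Qed.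

Lemma kernel_opE f x : summable wt f ->
  (\esum_(y in [set: S]) (B x y * f y)%:E = (kernel_op f x)%:E)%E.
Proof. exact: (dominated_esum w0 (B0 x) (L0 x) (BL x)). Qed.

Lemma kernel_op_ge0 f x : summable wt f -> 0 <= kernel_op f x.
Proof. exact: (dominated_wsum_ge0 (B0 x)). Qed.

(** The column condition [BC] is precisely what bounds the kernel by [C] on the weighted l^1
    space. *)
Lemma kernel_op_norm f : summable wt f ->
  summable wt (kernel_op f) /\ wsum wt (kernel_op f) <= C * wsum wt f.
Proof.
move=> sf; have [f0 ff] := sf.
have h : (\esum_(x in [set: S]) (wt x * kernel_op f x)%:E <= (C * wsum wt f)%:E)%E.
  have -> : (\esum_(x in [set: S]) (wt x * kernel_op f x)%:E =
      \esum_(y in [set: S]) \esum_(x in [set: S]) ((wt x * B x y) * f y)%:E)%E.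
    rewrite -esum_exchange; last by move=> x y; rewrite lee_fin !mulr_ge0.
    apply: eq_esum => x _; rewrite EFinM -kernel_opE// -esumZl//.
      by apply: eq_esum => y _; rewrite -EFinM mulrA.
    by move=> y; rewrite lee_fin mulr_ge0.
  rewrite EFinM -esum_wsum//; last by move=> y; rewrite mulr_ge0.
  rewrite -esumZl//; first last.
  - by move=> y; rewrite lee_fin mulr_ge0.
  - exact: ltW.
  apply: le_esum => y _.
  rewrite (eq_esum (b := fun x => ((wt x * B x y)%:E * (f y)%:E)%E))//.
  rewrite esumZr//; last by move=> x; rewrite lee_fin mulr_ge0.
  by rewrite -EFinM mulrA EFinM lee_wpmul2r// lee_fin.
have k0 x : 0 <= kernel_op f x by exact: kernel_op_ge0.
have sk : summable wt (kernel_op f) by split=> //; exact: le_lt_trans h (ltry _).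
split=> //; rewrite -lee_fin -esum_wsum//; first by move=> x; rewrite mulr_ge0.
exact: sk.2.
Qed.

Lemma iter_kernel_norm f n : summable wt f ->
  summable wt (iter n kernel_op f) /\ wsum wt (iter n kernel_op f) <= C ^+ n * wsum wt f.
Proof.
move=> sf; elim: n => [|n [sn hn]] /=; first by rewrite expr0 mul1r.
have [s1 h1] := kernel_op_norm sn; split=> //; apply: le_trans h1 _.
by rewrite exprS -mulrA ler_wpM2l// ltW.
Qed.

Lemma iter_kernel_bound f n x : summable wt f ->
  0 <= iter n kernel_op f x <= C ^+ n * (wsum wt f / wt x).
Proof.
move=> sf; have [sn hn] := iter_kernel_norm n sf; rewrite sn.1/=.
rewrite mulrA ler_pdivlMr// mulrC; apply: le_trans hn.
rewrite -lee_fin -esum_wsum//; last 2 first.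
- by move=> y; rewrite mulr_ge0// sn.1.
- exact: sn.2.
apply: (le_esum_term (f := fun x => (wt x * iter n kernel_op f x)%:E)) => y.
by rewrite lee_fin mulr_ge0// sn.1.
Qed.

Section evolution.
Variables (T0 M : R) (g0 : S -> R) (G : R -> S -> R).
Hypothesis T00 : 0 <= T0.
Hypothesis sg0 : summable wt g0.
Hypothesis sG : forall s, 0 <= s <= T0 -> summable wt (G s) /\ wsum wt (G s) <= M.
Hypothesis mG : forall x, measurable_fun `]0, T0] (G ^~ x).
Hypothesis eG : forall s x, 0 <= s <= T0 ->
  G s x = g0 x + \int[leb]_(r in `]0, s]) kernel_op (G r) x.

Let It n s x := iter n kernel_op (G s) x.

Let It_bound n s x : 0 <= s <= T0 -> 0 <= It n s x <= C ^+ n * (M / wt x).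
Proof.
move=> sT; have [s1 s2] := sG sT; have /andP[h1 h2] := iter_kernel_bound n x s1.
rewrite h1 (le_trans h2)//; apply: ler_wpM2l; first by rewrite exprn_ge0// ltW.
by rewrite ler_wpM2r// invr_ge0.
Qed.

Let It_ge0 n s x : 0 <= s <= T0 -> 0 <= It n s x.
Proof. by move=> sT; have /andP[] := It_bound n x sT. Qed.

Let sIt n s : 0 <= s <= T0 -> summable wt (It n s).
Proof. by move=> sT; exact: (iter_kernel_norm n (sG sT).1).1. Qed.

Lemma measurable_iter_kernel n x : measurable_fun `]0, T0] (fun s => It n s x).
Proof.
elim: n x => [|n IH] x; first exact: mG.
apply/measurable_EFinP; apply: (eq_measurable_fun (fun s => \esum_(y in [set: S]) (B x y * It n s y)%:E)%E).
  move=> s; rewrite inE/= in_itv/= => /andP[/ltW s00 sT].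
  by rewrite kernel_opE//; apply: sIt; rewrite s00.
apply: measurable_fun_esum => //.
- move=> y s /=; rewrite in_itv/= => /andP[/ltW s00 sT].
  by rewrite lee_fin mulr_ge0// It_ge0// s00.
- by move=> y; apply/measurable_EFinP; apply: measurable_funM.
Qed.

Let It_integrable n s x : 0 <= s <= T0 -> leb.-integrable `]0, s] (EFin \o (fun r => It n r x)).
Proof.
move=> /andP[s00 sT]; apply: (bounded_integrable_oc (M := C ^+ n * (M / wt x))).
  apply: measurable_funS (measurable_iter_kernel n x) => //.
  by move=> r /=; rewrite !in_itv/= => /andP[-> rs]; rewrite (le_trans rs).
move=> r /andP[/ltW r0 rs]; have rT : 0 <= r <= T0 by rewrite r0 (le_trans rs).
by have /andP[h1 h2] := It_bound n x rT; rewrite ger0_norm.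
Qed.

(** The nonnegative kernel commutes with the time integral by Tonelli, so the integral equation is
    inherited by every iterate, each being a primitive of the next. *)
Lemma iter_kernel_equation n s x : 0 <= s <= T0 ->
  It n s x = iter n kernel_op g0 x + \int[leb]_(r in `]0, s]) It n.+1 r x.
Proof.
elim: n x => [|n IH] x sT; first exact: eG.
have mL := measurable_oc 0 s.
have /andP[s00 _] := sT.
have rT r : 0 < r <= s -> 0 <= r <= T0.
  by move=> /andP[/ltW -> rs]; rewrite (le_trans rs)//; have /andP[] := sT.
have sg := (iter_kernel_norm n sg0).1.
have I0 y : 0 <= \int[leb]_(r in `]0, s]) It n.+1 r y.
  by apply: Rintegral_ge0 => r /=; rewrite in_itv/= => rs; exact: (It_ge0 n.+1 y (rT r rs)).
have eE k y : ((\int[leb]_(r in `]0, s]) It k r y)%:E = \int[leb]_(r in `]0%R, s]) (It k r y)%:E)%E.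
  by rewrite /Rintegral fineK//; exact: (integrable_fin_num mL (It_integrable k y sT)).
apply: EFin_inj; rewrite EFinD eE /= -!kernel_opE//; last exact: (sIt n sT).
have -> : (\int[leb]_(r in `]0%R, s]) (kernel_op (It n.+1 r) x)%:E =
    \int[leb]_(r in `]0%R, s]) \esum_(y in [set: S]) (B x y * It n.+1 r y)%:E)%E.
  apply: eq_integral => r; rewrite inE/= in_itv/= => rs; rewrite kernel_opE//; exact: (sIt n.+1 (rT r rs)).
rewrite ge0_integral_esum//; first last.
- move=> y; apply/measurable_EFinP; apply: measurable_funM => //.
  by apply/measurable_EFinP; exact: measurable_int (It_integrable n.+1 y sT).
- by move=> y r /=; rewrite in_itv/= => rs; rewrite lee_fin mulr_ge0//; exact: (It_ge0 n.+1 y (rT r rs)).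
rewrite -esumD; first last.
- by move=> y _; apply: integral_ge0 => r /=; rewrite in_itv/= => rs; rewrite lee_fin mulr_ge0//; exact: (It_ge0 n.+1 y (rT r rs)).
- by move=> y _; rewrite lee_fin mulr_ge0// sg.1.
apply: eq_esum => y _; rewrite -/(It n s y) IH// mulrDr EFinD; congr (_ + _)%E.
rewrite EFinM eE -ge0_integralZl//.
- exact: measurable_int (It_integrable n.+1 y sT).
- by move=> r /=; rewrite in_itv/= => rs; rewrite lee_fin; exact: (It_ge0 n.+1 y (rT r rs)).
- by rewrite lee_fin.
Qed.

(* The bound O(C^n) makes the Taylor remainders of the difference vanish. *)
Lemma positive_system_unique (z : nat -> R -> R) (M' : R) x :
  (forall n, measurable_fun `]0, T0] (z n)) ->
  (forall n s, 0 <= s <= T0 -> `|z n s| <= M' * C ^+ n) ->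
  (forall n s, 0 <= s <= T0 -> leb.-integrable `]0, s] (EFin \o z n) /\
    z n s = iter n kernel_op g0 x + \int[leb]_(r in `]0, s]) z n.+1 r) ->
  G T0 x = z 0 T0.
Proof.
move=> mz bz ez; apply/eqP; rewrite -subr_eq0; apply/eqP.
apply: (@iterated_integral_eq0 _ T0 (M / wt x + M') C (fun n s => It n s x - z n s)) => //.
- by move=> n; apply: measurable_funB => //; exact: measurable_iter_kernel.
- move=> n s sT; apply: le_trans (ler_normB _ _) _; rewrite mulrDl lerD ?bz//.
  by have /andP[h1 h2] := It_bound n x sT; rewrite ger0_norm// mulrC.
- move=> n s sT; rewrite (iter_kernel_equation n x sT) (ez n s sT).2.
  have mL := measurable_oc 0 s.
  rewrite RintegralB//; first by rewrite opprD addrACA subrr add0r.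
  - exact: It_integrable.
  - exact: (ez n.+1 s sT).1.
Qed.

End evolution.
End PositiveSystem.

Lemma esum_bool {R : realType} (f : bool -> \bar R) : (forall b, 0 <= f b)%E ->
  (\esum_(b in [set: bool]) f b = f true + f false)%E.
Proof.
move=> f0; rewrite -[in RHS](esum_delta true f0) -[in RHS](esum_delta false f0) -esumD.
- by apply: eq_esum => -[] _ /=; rewrite ?mul1e ?mul0e ?adde0 ?add0e.
- by move=> b _; rewrite mule_ge0// lee_fin.
- by move=> b _; rewrite mule_ge0// lee_fin.
Qed.

(** * The moment system as a nonnegative kernel *)

Section PairKernel.
Context {R : realType} {d : nat}.
Local Notation I := (lattice d).
Variables (a : I -> I -> R) (om : I -> R) (K kappa lam c : R).
Hypotheses (ha : is_rates a) (hom : is_weight a om).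
Hypothesis K0 : 0 <= K.
Hypothesis hK : forall j, (\esum_(i in [set: I]) (om i * a i j)%:E <= (K * om j)%:E)%E.
Hypothesis kappa0 : 0 < kappa.
Hypothesis c2 : 2 + `|lam| <= c.
Local Notation A := (pair_rate a).

Definition diagonal (x : I * I) : bool := x.1 == x.2.
Definition pair_weight (x : I * I) : R := om x.1 * om x.2.

(* The components [false] and [true] carry E[u v] and E[u^2]. *)
Definition system_kernel (p q : bool * (I * I)) : R :=
  if p.1 == q.1 then
    A p.2 q.2 + (q.2 == p.2)%:R * ((if p.1 then 0 else lam * (diagonal p.2)%:R) + (c - 2))
  else if p.1 then (q.2 == p.2)%:R * (kappa * (diagonal p.2)%:R) else 0.

Definition system_weight (p : bool * (I * I)) : R := pair_weight p.2.

(** One constant for two purposes: 2K, |lam| + c and kappa bound the column sums relative to the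
    weight, and with 2 in place of 2K they bound the row sums in [kernel_iter_bounded]. *)
Definition system_bound : R := 2 * K + 2 + `|lam| + c + kappa.

Let A0 x y : 0 <= A x y. Proof. exact: pair_rate_ge0. Qed.
Let c0 : 0 <= c. Proof. by rewrite (le_trans _ c2)// addr_ge0. Qed.

Lemma system_bound_gt0 : 0 < system_bound.
Proof.
by rewrite /system_bound; have := normr_ge0 lam; have := K0; have := kappa0; have := c0; lra.
Qed.

Let coef_ge0 (b : bool) : 0 <= lam * b%:R + (c - 2).
Proof.
have := ler_norm (- lam); rewrite normrN => h; move: c2.
by case: b; rewrite ?mulr1 ?mulr0; have := normr_ge0 lam; lra.
Qed.

Let coef_le (b : bool) : lam * b%:R + (c - 2) <= `|lam| + c.
Proof. by have := ler_norm lam; case: b; rewrite ?mulr1 ?mulr0; have := normr_ge0 lam; lra. Qed.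

Let coef_if (p : bool * (I * I)) :
  0 <= (if p.1 then 0 else lam * (diagonal p.2)%:R) + (c - 2) <= `|lam| + c.
Proof.
case: p => -[] x /=; last by rewrite coef_ge0 coef_le.
by have := coef_ge0 false; have := coef_le false; rewrite mulr0 => -> ->.
Qed.

Lemma pair_weight_gt0 x : 0 < pair_weight x.
Proof. by rewrite mulr_gt0//; exact: weight_gt0 hom _. Qed.

Lemma system_weight_gt0 p : 0 < system_weight p.
Proof. exact: pair_weight_gt0. Qed.

Lemma system_kernel_ge0 p q : 0 <= system_kernel p q.
Proof.
rewrite /system_kernel; case: ifP => _.
  by rewrite addr_ge0// mulr_ge0//; have /andP[] := coef_if p.
by case: ifP => // _; rewrite !mulr_ge0// ltW.
Qed.

Lemma pair_rate_column y :
  (\esum_(x in [set: I * I]) (pair_weight x * A x y)%:E <= (2 * K * pair_weight y)%:E)%E.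
Proof.
have o0 i : 0 <= om i by apply: ltW; exact: weight_gt0 hom i.
have a0 := rates_ge0 ha.
rewrite esum_pair; last by move=> x; rewrite lee_fin mulr_ge0//; apply/ltW/pair_weight_gt0.
have e1 : (\esum_(i in [set: I]) \esum_(j in [set: I]) (om i * om j * (a i y.1 * (j == y.2)%:R))%:E
    <= (K * pair_weight y)%:E)%E.
  rewrite (eq_esum (b := fun i => ((om i * a i y.1)%:E * (om y.2)%:E)%E)); last first.
    move=> i _; rewrite (eq_esum (b := fun j => ((j == y.2)%:R%:E * (om i * om j * a i y.1)%:E)%E)).
      by rewrite esum_delta -?EFinM; [congr (_%:E); ring|move=> j; rewrite lee_fin !mulr_ge0].
    by move=> j _; rewrite -EFinM; congr (_%:E); ring.
  rewrite esumZr//; last by move=> i; rewrite lee_fin mulr_ge0.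
  rewrite /pair_weight mulrA EFinM lee_wpmul2r// lee_fin//.
have e2 : (\esum_(i in [set: I]) \esum_(j in [set: I]) (om i * om j * ((i == y.1)%:R * a j y.2))%:E
    <= (K * pair_weight y)%:E)%E.
  rewrite (eq_esum (b := fun i => ((i == y.1)%:R%:E * ((om i)%:E * \esum_(j in [set: I]) (om j * a j y.2)%:E))%E)); last first.
    move=> i _; rewrite -esumZl//; last by move=> j; rewrite lee_fin mulr_ge0.
    rewrite -esumZl//; last by move=> j; rewrite -EFinM lee_fin !mulr_ge0.
    by apply: eq_esum => j _; rewrite -!EFinM; congr (_%:E); ring.
  rewrite esum_delta; last first.
    by move=> i; rewrite mule_ge0 ?lee_fin// esum_ge0// => j _; rewrite lee_fin mulr_ge0.
  rewrite /pair_weight mulrCA EFinM lee_wpmul2l// lee_fin//.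
have -> : (2 * K * pair_weight y)%:E = ((K * pair_weight y)%:E + (K * pair_weight y)%:E)%E.
  by rewrite -EFinD; congr (_%:E); ring.
apply: le_trans (leeD e1 e2); rewrite -esumD; last 2 first.
- by move=> i _; apply: esum_ge0 => j _; rewrite lee_fin !mulr_ge0.
- by move=> i _; apply: esum_ge0 => j _; rewrite lee_fin !mulr_ge0.
apply: le_esum => i _; rewrite -esumD; last 2 first.
- by move=> j _; rewrite lee_fin !mulr_ge0.
- by move=> j _; rewrite lee_fin !mulr_ge0.
by apply: le_esum => j _; rewrite -EFinD lee_fin /pair_rate /pair_weight /= mulrDr.
Qed.

Lemma system_kernel_column q :
  (\esum_(p in [set: bool * (I * I)]) (system_weight p * system_kernel p q)%:E <=
   (system_bound * system_weight q)%:E)%E.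
Proof.
case: q => b y; have w0 x : 0 <= pair_weight x by apply/ltW/pair_weight_gt0.
have dl k : 0 <= k -> (\esum_(x in [set: I * I]) (pair_weight x * ((y == x)%:R * k))%:E =
    (pair_weight y * k)%:E)%E.
  move=> k0; rewrite (eq_esum (b := fun x => ((x == y)%:R%:E * (pair_weight x * k)%:E)%E)).
    by rewrite esum_delta// => x; rewrite lee_fin mulr_ge0.
  by move=> x _; rewrite -EFinM eq_sym; congr (_%:E); ring.
have col b' : (\esum_(x in [set: I * I]) (pair_weight x * system_kernel (b', x) (b, y))%:E <=
    ((if b' == b then (2 * K + (`|lam| + c)) else kappa) * pair_weight y)%:E)%E.
  have lc0 : 0 <= `|lam| + c by rewrite addr_ge0.
  rewrite /system_kernel /=; case: (b' == b).
    have -> : ((2 * K + (`|lam| + c)) * pair_weight y)%:E =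
        ((2 * K * pair_weight y)%:E + (pair_weight y * (`|lam| + c))%:E)%E.
      by rewrite -EFinD; congr (_%:E); ring.
    rewrite -dl//; apply: le_trans (leeD (pair_rate_column y) (lexx _)); rewrite -esumD; last 2 first.
    - by move=> x _; rewrite lee_fin mulr_ge0.
    - by move=> x _; rewrite lee_fin mulr_ge0// mulr_ge0.
    apply: le_esum => x _; rewrite -EFinD lee_fin -mulrDr ler_wpM2l// lerD2l ler_wpM2l//.
    by have /andP[] := coef_if (b', x).
  rewrite mulrC -dl; last exact: ltW.
  apply: le_esum => x _; rewrite lee_fin ler_wpM2l//.
  case: (b'); last by rewrite !mulr_ge0// ltW.
  by rewrite ler_wpM2l//; case: (diagonal x); rewrite ?mulr1 ?mulr0// ltW.
rewrite esum_pair; last by move=> p; rewrite lee_fin; apply: mulr_ge0; [exact: w0|exact: system_kernel_ge0].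
rewrite esum_bool; last first.
  by move=> b'; apply: esum_ge0 => x _; rewrite lee_fin; apply: mulr_ge0; [exact: w0|exact: system_kernel_ge0].
apply: le_trans (leeD (col true) (col false)) _.
rewrite -EFinD lee_fin -mulrDl /system_weight ler_wpM2r// /system_bound.
have := normr_ge0 lam; have := K0; have := kappa0; have := c0.
by case: b {col} => /=; lra.
Qed.

Lemma system_weight_summable : summable system_weight (fun=> 1).
Proof.
have o0 i : 0 <= om i by apply: ltW; exact: weight_gt0 hom i.
split=> //; under eq_esum do rewrite mulr1.
have S0 : (0 <= \esum_(i in [set: I]) (om i)%:E)%E by apply: esum_ge0 => i _; rewrite lee_fin.
have Sf : (\esum_(i in [set: I]) (om i)%:E = (fine (\esum_(i in [set: I]) (om i)%:E))%:E)%E.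
  by rewrite fineK// ge0_fin_numE//; exact: weight_summable hom.
rewrite esum_pair; last by move=> p; rewrite lee_fin; apply/ltW/system_weight_gt0.
rewrite esum_bool; last by move=> b; apply: esum_ge0 => x _; rewrite lee_fin; apply/ltW/system_weight_gt0.
rewrite /system_weight /=.
have -> : (\esum_(x in [set: I * I]) (pair_weight x)%:E =
    (fine (\esum_(i in [set: I]) (om i)%:E) * fine (\esum_(i in [set: I]) (om i)%:E))%:E)%E.
  rewrite esum_pair; last by move=> x; rewrite lee_fin; apply/ltW/pair_weight_gt0.
  rewrite EFinM -{1}Sf -esumZr//.
  - by apply: eq_esum => i _; rewrite -Sf -esumZl.
  - by rewrite -lee_fin -Sf.
by rewrite -EFinD ltry.
Qed.

(** The second hypothesis says that the row sum is finite, so that [fine] loses nothing. It is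
    verified differently for bounded families on the chain side and for weighted summable ones on
    the moment side. *)
Lemma system_kernel_rowE (f : bool * (I * I) -> R) b x : (forall p, 0 <= f p) ->
  (\esum_(y in [set: I * I]) (A x y * f (b, y))%:E = (gen_op A (fun y => f (b, y)) x)%:E)%E ->
  kernel_op system_kernel f (b, x) =
    if b then gen_op A (fun y => f (true, y)) x + (c - 2) * f (true, x) +
              kappa * (diagonal x)%:R * f (false, x)
    else fk_op A diagonal lam c (fun y => f (false, y)) x.
Proof.
move=> f0 eA; rewrite /kernel_op /wsum.
rewrite esum_pair; last by move=> q; rewrite lee_fin mulr_ge0// system_kernel_ge0.
rewrite esum_bool; last first.
  by move=> b'; apply: esum_ge0 => y _; rewrite lee_fin mulr_ge0// system_kernel_ge0.
have dl b' k : 0 <= k -> (\esum_(y in [set: I * I]) ((y == x)%:R * k * f (b', y))%:E =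
    (k * f (b', x))%:E)%E.
  move=> k0; rewrite (eq_esum (b := fun y => ((y == x)%:R%:E * (k * f (b', y))%:E)%E)).
    by rewrite esum_delta// => y; rewrite lee_fin mulr_ge0.
  by move=> y _; rewrite -EFinM mulrA.
have diagE b' k : 0 <= k -> b' = b ->
    (\esum_(y in [set: I * I]) ((A x y + (y == x)%:R * k) * f (b', y))%:E =
     (gen_op A (fun y => f (b, y)) x + k * f (b, x))%:E)%E.
  move=> k0 ->; rewrite EFinD -eA -dl// -esumD.
  - by apply: eq_esum => y _; rewrite -EFinD mulrDl.
  - by move=> y _; rewrite lee_fin mulr_ge0.
  - by move=> y _; rewrite lee_fin !mulr_ge0.
case: b eA diagE => eA diagE; rewrite /system_kernel /=.
  rewrite diagE//; last by have /andP[] := coef_if (true, x).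
  by rewrite dl ?mulr_ge0// 1?ltW// -EFinD /= add0r.
by rewrite diagE// esum1 ?add0e// => y _; rewrite mul0r.
Qed.

Let Amass := pair_rate_mass ha.

(** The chain is tested on bounded functions; the rows of the kernel sum to at most 2 + |lam| + c +
    kappa, which is below [system_bound]. *)
Lemma kernel_iter_bounded n p :
  0 <= iter n (kernel_op system_kernel) (fun=> 1) p <= system_bound ^+ n.
Proof.
elim: n p => [|n IH] p; first by rewrite expr0 lexx ler01.
set f := iter n _ _ in IH *; rewrite [iter _ _ _]/= -/f.
have f0 q : 0 <= f q by have /andP[] := IH q.
have Cn0 : 0 <= system_bound ^+ n by rewrite exprn_ge0// ltW// system_bound_gt0.
case: p => b x.
have fb y : 0 <= f (b, y) <= system_bound ^+ n := IH (b, y).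
have eA := EFin_gen_op A0 Amass fb x.
have /andP[g0 gC] := gen_op_le A0 Amass x fb.
have := coef_ge0 (diagonal x); have := coef_le (diagonal x).
have := coef_ge0 false; have := coef_le false; rewrite mulr0 add0r => h1 h2 h3 h4.
rewrite system_kernel_rowE// exprS /fk_op; set Cn := system_bound ^+ n in fb gC Cn0 *.
have := IH (false, x); have := IH (true, x); rewrite -/Cn => /andP[t0 tC] /andP[f0' fC].
have kd : 0 <= kappa * (diagonal x)%:R <= kappa.
  by case: (diagonal x); rewrite ?mulr1 ?mulr0 ?lexx ?andbT ltW.
have n0 := normr_ge0 lam.
case: b {fb eA} g0 gC => g0 gC.
  apply/andP; split.
    apply: addr_ge0; first by apply: addr_ge0 => //; exact: mulr_ge0.
    by apply: mulr_ge0 => //; have /andP[] := kd.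
  apply: (@le_trans _ _ (2 * Cn + (`|lam| + c) * Cn + kappa * Cn)).
    rewrite lerD// ?lerD// ler_pM//; first by have /andP[] := kd.
    by have /andP[] := kd.
  by rewrite -!mulrDl ler_wpM2r// /system_bound; have := K0; lra.
apply/andP; split; first by rewrite addr_ge0// mulr_ge0.
apply: (@le_trans _ _ (2 * Cn + (`|lam| + c) * Cn)).
  by rewrite lerD// ler_pM.
by rewrite -!mulrDl ler_wpM2r// /system_bound; have := K0; have := kappa0; lra.
Qed.

(** The rates are translation invariant, so both sums over the lattice are reindexed by the shift
    [z]. *)
Lemma gen_op_shift (f : I * I -> R) z x : (forall y, 0 <= f y) ->
  (forall y, f (y.1 + z, y.2 + z) = f y) -> gen_op A f (x.1 + z, x.2 + z) = gen_op A f x.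
Proof.
move=> f0 fz; congr fine.
have sh i k : a (i + z) (k + z) = a i k.
  by rewrite (rates_shift ha) [RHS](rates_shift ha); congr (a 0 _); rewrite opprD addrACA subrr addr0.
have bij : set_bij [set: I] [set: I] (fun k => k + z).
  split=> //; first by move=> u v _ _; exact: addIr.
  by move=> u _; exists (u - z) => //; rewrite subrK.
have a0 := rates_ge0 ha.
rewrite (eq_esum (b := fun y => ((A (x.1 + z, x.2 + z) y)%:E * (f y)%:E)%E))//.
rewrite [RHS](eq_esum (b := fun y => ((A x y)%:E * (f y)%:E)%E))//.
rewrite !esum_pair_rate//.
congr (_ + _)%E.
  rewrite (reindex_esum setT setT (fun k => k + z))//=.
  by apply: eq_esum => k _; rewrite sh -[in RHS](fz (k, x.2)).
rewrite (reindex_esum setT setT (fun k => k + z))//=.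
by apply: eq_esum => k _; rewrite sh -[in RHS](fz (x.1, k)).
Qed.

Lemma kernel_iter_shift n b x z :
  iter n (kernel_op system_kernel) (fun=> 1) (b, (x.1 + z, x.2 + z)) =
  iter n (kernel_op system_kernel) (fun=> 1) (b, x).
Proof.
elim: n b x => [|n IH] b x//; have bd := kernel_iter_bounded n.
set f := iter n _ _ in IH bd *; rewrite ![iter n.+1 _ _]/= -/f.
have f0 q : 0 <= f q by have /andP[] := bd q.
have fb y : 0 <= f (b, y) <= system_bound ^+ n := bd (b, y).
have eA y := EFin_gen_op A0 Amass fb y.
rewrite !system_kernel_rowE//.
have dz : diagonal (x.1 + z, x.2 + z) = diagonal x by rewrite /diagonal /= (inj_eq (addIr z)).
case: b {fb eA}; first by rewrite gen_op_shift// !IH dz.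
by rewrite /fk_op gen_op_shift// !IH dz.
Qed.

(** A consequence of translation invariance that makes the common starting site of the two chains
    immaterial. *)
Lemma kernel_iter_diagonal n b i j :
  iter n (kernel_op system_kernel) (fun=> 1) (b, (i, i)) =
  iter n (kernel_op system_kernel) (fun=> 1) (b, (j, j)).
Proof. by have := kernel_iter_shift n b (j, j) (i - j); rewrite /= addrC subrK. Qed.

End PairKernel.

Lemma measurable_lipschitz {R : realType} (Z : R -> R) (T0 C : R) : 0 <= T0 ->
  (forall s r, 0 <= s -> s <= r -> r <= T0 -> `|Z r - Z s| <= C * (r - s)) ->
  measurable_fun `]0, T0] Z.
Proof.
move=> T00 hZ.
have hl w s : 0 < s <= T0 -> left_cont ((fun s (_ : R) => Z s) ^~ w) s.
  move=> /andP[s0 sT] e e0; exists (e / (`|C| + 1)) => [|r r0 sr rs].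
    by rewrite divr_gt0// ltr_wpDl.
  rewrite distrC; apply: le_lt_trans (hZ r s r0 (ltW rs) sT) _.
  apply: (@le_lt_trans _ _ (`|C| * (s - r))).
    by rewrite ler_wpM2r ?ler_norm// subr_ge0 ltW.
  apply: (@le_lt_trans _ _ ((`|C| + 1) * (s - r))).
    by rewrite ler_wpM2r ?lerDl// subr_ge0 ltW.
  by rewrite mulrC -ltr_pdivlMr ?ltr_wpDl// ltrBlDl -ltrBlDr.
have := measurable_left_cont (T := R) (X := fun s _ => Z s) T00 (fun s _ => measurable_cst _) hl.
exact: (measurable_section (f := fun z : R * R => Z z.1) 0 (measurable_itv _)).
Qed.

(** * Moments as a solution of the kernel system *)

Section Comparison.
Context {R : realType} {d : nat}.
Local Notation I := (lattice d).
Local Notation leb := (@lebesgue_measure R).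
Variables (a : I -> I -> R) (om : I -> R) (K kappa lam c T0 E0 : R).
Hypotheses (ha : is_rates a) (hom : is_weight a om).
Hypothesis K0 : 0 <= K.
Hypothesis hK : forall j, (\esum_(i in [set: I]) (om i * a i j)%:E <= (K * om j)%:E)%E.
Hypothesis kappa0 : 0 < kappa.
Hypothesis c2 : 2 + `|lam| <= c.
Hypothesis T00 : 0 <= T0.
Local Notation A := (pair_rate a).
Local Notation op := (kernel_op (system_kernel a kappa lam c)).
Local Notation wt := (system_weight om).

Let A0 x y : 0 <= A x y. Proof. exact: pair_rate_ge0. Qed.
Let c0 : 0 <= c. Proof. by rewrite (le_trans _ c2)// addr_ge0. Qed.
Let w0 x : 0 < pair_weight om x. Proof. exact: (pair_weight_gt0 hom x). Qed.

Section moments.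
Variable m : bool -> R -> I * I -> R.
Hypothesis m0 : forall b s x, 0 <= s -> 0 <= m b s x.
Hypothesis mN : forall b s, 0 <= s <= T0 ->
  (\esum_(x in [set: I * I]) (pair_weight om x * m b s x)%:E <= E0%:E)%E.
Hypothesis mm : forall b x, measurable_fun `]0, T0] (m b ^~ x).
Let g b x r := gen_op A (m b r) x - 2 * m b r x +
  (if b then kappa else lam) * (diagonal x)%:R * m false r x.
Hypothesis me : forall b s x, 0 <= s <= T0 -> leb.-integrable `]0, s] (EFin \o g b x) /\
  m b s x = 1 + \int[leb]_(r in `]0, s]) g b x r.

(** The factor absorbs the negative diagonal part of the moment equation, which is thereby driven by
    the nonnegative kernel. *)
Definition discounted_moment (s : R) (p : bool * (I * I)) : R := expR (c * s) * m p.1 s p.2.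

Let E00 : 0 <= E0.
Proof.
have T0T : 0 <= T0 <= T0 by rewrite T00 lexx.
rewrite -lee_fin; apply: le_trans (mN false T0T); apply: esum_ge0 => x _.
by rewrite lee_fin mulr_ge0 ?m0// ltW.
Qed.

Let sm b s : 0 <= s <= T0 -> summable (pair_weight om) (m b s).
Proof.
move=> sT; split; first by move=> x; apply: m0; have /andP[] := sT.
exact: le_lt_trans (mN b sT) (ltry _).
Qed.

Let normE b s : 0 <= s <= T0 -> wsum (pair_weight om) (m b s) <= E0.
Proof.
move=> sT; have [h1 h2] := sm b sT.
by rewrite -lee_fin -esum_wsum//; [exact: mN|move=> x; rewrite mulr_ge0// ltW].
Qed.

Let pw0 x : 0 <= pair_weight om x. Proof. exact: ltW. Qed.
Let L x : R := 2 * K / pair_weight om x.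
Let L0 x : 0 <= L x. Proof. by apply: divr_ge0; [exact: mulr_ge0|exact: ltW]. Qed.
Let AL x y : A x y <= L x * pair_weight om y.
Proof.
exact: (column_dominated x w0 A0 (pair_rate_column ha hom hK y)).
Qed.

Let genE b s x : 0 <= s <= T0 ->
  (\esum_(y in [set: I * I]) (A x y * m b s y)%:E = (gen_op A (m b s) x)%:E)%E.
Proof. by move=> sT; exact: (dominated_esum pw0 (A0 x) (L0 x) (AL x) (sm b sT)). Qed.

Let gen_bound b s x : 0 <= s <= T0 -> 0 <= gen_op A (m b s) x <= L x * E0.
Proof.
move=> sT; apply/andP; split; first exact: (dominated_wsum_ge0 (A0 x) (sm b sT)).
apply: le_trans (dominated_wsum_le pw0 (A0 x) (L0 x) (AL x) (sm b sT)) _.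
by apply: ler_wpM2l => //; exact: normE.
Qed.

Let m_bound b s x : 0 <= s <= T0 -> 0 <= m b s x <= E0 / pair_weight om x.
Proof.
move=> sT; rewrite m0/=; last by have /andP[] := sT.
rewrite ler_pdivlMr// mulrC -lee_fin; apply: le_trans (mN b sT).
apply: (le_esum_term (f := fun x => (pair_weight om x * m b s x)%:E)) => y.
by rewrite lee_fin mulr_ge0 ?m0//; have /andP[] := sT.
Qed.

Lemma discounted_moment_norm s : 0 <= s <= T0 ->
  summable wt (discounted_moment s) /\ wsum wt (discounted_moment s) <= expR (c * T0) * (2 * E0).
Proof.
move=> sT; have /andP[s0 sT'] := sT.
have d0 p : 0 <= discounted_moment s p by rewrite mulr_ge0 ?expR_ge0 ?m0.
have h : (\esum_(p in [set: bool * (I * I)]) (wt p * discounted_moment s p)%:E <=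
    (expR (c * T0) * (2 * E0))%:E)%E.
  have e0 b x : 0 <= pair_weight om x * m b s x by rewrite mulr_ge0 ?m0.
  rewrite esum_pair; last by move=> p; rewrite lee_fin; apply: mulr_ge0 => //; exact: pw0.
  rewrite esum_bool; last first.
    by move=> b; apply: esum_ge0 => x _; rewrite lee_fin; apply: mulr_ge0 => //; exact: pw0.
  have one b : (\esum_(x in [set: I * I]) (wt (b, x) * discounted_moment s (b, x))%:E <=
      (expR (c * T0) * E0)%:E)%E.
    rewrite (eq_esum (b := fun x => ((expR (c * s))%:E * (pair_weight om x * m b s x)%:E)%E)); last first.
      by move=> x _; rewrite -EFinM /discounted_moment /system_weight/=; congr (_%:E); ring.
    rewrite esumZl ?expR_ge0//; last by move=> x; rewrite lee_fin.
    rewrite EFinM; apply: lee_pmul.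
    - by rewrite lee_fin expR_ge0.
    - by apply: esum_ge0 => x _; rewrite lee_fin.
    - by rewrite lee_fin ler_expR ler_wpM2l.
    - exact: mN.
  apply: le_trans (leeD (one true) (one false)) _.
  by rewrite -EFinD lee_fin -mulrDr mulr_natl mulr2n.
have sd : summable wt (discounted_moment s) by split=> //; exact: le_lt_trans h (ltry _).
split=> //; rewrite -lee_fin -esum_wsum//; first by move=> p; apply: mulr_ge0 => //; exact: pw0.
exact: sd.2.
Qed.

Lemma discounted_moment_op s b x : 0 <= s <= T0 ->
  op (discounted_moment s) (b, x) =
  c * expR (c * s) * m b s x + expR (c * s) * g b x s.
Proof.
move=> sT; have /andP[s0 sT'] := sT.
have d0 p : 0 <= discounted_moment s p by rewrite mulr_ge0 ?expR_ge0 ?m0.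
have eA : (\esum_(y in [set: I * I]) (A x y * discounted_moment s (b, y))%:E =
    (expR (c * s) * gen_op A (m b s) x)%:E)%E.
  rewrite EFinM -genE// -esumZl ?expR_ge0//.
    by apply: eq_esum => y _; rewrite -EFinM /discounted_moment/=; congr (_%:E); ring.
  by move=> y; rewrite lee_fin mulr_ge0 ?m0.
have eG : gen_op A (fun y => discounted_moment s (b, y)) x = expR (c * s) * gen_op A (m b s) x.
  by rewrite {1}/gen_op eA.
rewrite system_kernel_rowE//; last by rewrite eA eG.
by case: b eA eG => _ eG; rewrite ?/fk_op eG /discounted_moment /g/=; ring.
Qed.

Let g_bound b x : exists C, forall s, 0 <= s <= T0 -> `|g b x s| <= C.
Proof.
pose q := E0 / pair_weight om x.
exists (L x * E0 + 2 * q + (kappa + `|lam|) * q) => s sT.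
have /andP[h1 h2] := gen_bound b x sT.
have /andP[h3 h4] := m_bound b x sT; have /andP[h5 h6] := m_bound false x sT.
rewrite /g; apply: le_trans (ler_normD _ _) _; apply: lerD.
  apply: le_trans (ler_normB _ _) _; rewrite !ger0_norm ?mulr_ge0//; apply: lerD => //.
  by rewrite ler_wpM2l.
rewrite !normrM (ger0_norm h5) ler_pM ?mulr_ge0//.
rewrite -[leRHS]mulr1 ler_pM//; last by case: (diagonal x); rewrite ?normr1 ?normr0.
by case: b {h1 h2 h3 h4}; rewrite ?(gtr0_norm kappa0) ?lerDl ?lerDr// ltW.
Qed.

(** The product rule for [expR (c * s)] and the moment; [discounted_moment_op] identifies the
    resulting integrand. *)
Lemma discounted_moment_equation s p : 0 <= s <= T0 ->
  discounted_moment s p = 1 + \int[leb]_(r in `]0, s]) op (discounted_moment r) p.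
Proof.
case: p => b x sT; have /andP[s0 sT'] := sT.
have [C hC] := g_bound b x.
have sub (f : R -> R) : measurable_fun `]0, T0] f -> measurable_fun `]0, s] f.
  move=> mf; apply: measurable_funS mf => //.
  by move=> r /=; rewrite !in_itv/= => /andP[-> rs]; rewrite (le_trans rs).
have mg : measurable_fun `]0, s] (g b x).
  by apply/measurable_EFinP; exact: measurable_int (me b x sT).1.
have ss r : 0 <= r <= s -> 0 <= r <= T0 by move=> /andP[-> rs]; rewrite (le_trans rs).
have /= e := @Rintegral_product _ s (c * expR (c * s) + `|C|) (fun r => expR (c * r)) (m b ^~ x)
  (fun r => c * expR (c * r)) (g b x) s0.
have T0z : (0 : R) <= 0 <= T0 by rewrite lexx.
have mb0 : m b 0 x = 1 by rewrite (me b x T0z).2 Rintegral_oc_set0 addr0.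
rewrite {1}/discounted_moment/= e.
- rewrite mb0 mulr0 expR0 mulr1; congr (_ + _).
  apply: eq_Rintegral => r; rewrite inE/= in_itv/= => /andP[/ltW r0 rs].
  by rewrite discounted_moment_op// ss// r0.
- by apply: measurable_funM => //; exact: measurable_fun_expRM.
- exact: mg.
- exact: measurable_fun_expRM.
- by apply: sub; exact: mm.
- move=> r /andP[r0 rs]; rewrite ger0_norm ?mulr_ge0 ?expR_ge0//.
  rewrite (@le_trans _ _ (c * expR (c * s)))// ?lerDl//.
  by rewrite ler_wpM2l// ler_expR ler_wpM2l.
- move=> r rs; apply: le_trans (hC r (ss r rs)) _; apply: le_trans (ler_norm _) _.
  by rewrite lerDr mulr_ge0// expR_ge0.
- by move=> r /andP[r0 _]; rewrite mulr0 expR0 -Rintegral_expR.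
- by move=> r rs; rewrite (me b x (ss r rs)).2 mb0.
Qed.

Lemma moment_unique (z : nat -> R -> R) (M' : R) b x :
  (forall n, measurable_fun `]0, T0] (z n)) ->
  (forall n s, 0 <= s <= T0 -> `|z n s| <= M' * system_bound K kappa lam c ^+ n) ->
  (forall n s, 0 <= s <= T0 -> leb.-integrable `]0, s] (EFin \o z n) /\
    z n s = iter n op (fun=> 1) (b, x) + \int[leb]_(r in `]0, s]) z n.+1 r) ->
  m b T0 x = expR (- (c * T0)) * z 0 T0.
Proof.
move=> mz bz ez.
have := positive_system_unique (system_kernel_ge0 ha kappa0 c2) (system_weight_gt0 hom)
  (system_bound_gt0 K0 kappa0 c2) (system_kernel_column ha hom K0 hK kappa0 c2) T00
  (system_weight_summable hom) discounted_moment_norm _ discounted_moment_equation mz bz ez.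
move=> <-; last first.
  by move=> p; apply: measurable_funM; [exact: measurable_fun_expRM|exact: mm].
by rewrite /discounted_moment/= mulrA -expRD addrC subrr expR0 mul1r.
Qed.

End moments.
End Comparison.

(** * Expectations of the pair of chains as comparison sequences *)

Section ChainComparison.
Context {R : realType} {d : nat}.
Local Notation I := (lattice d).
Local Notation leb := (@lebesgue_measure R).
Variables (a : I -> I -> R) (K kappa lam c T0 : R).
Hypotheses (ha : is_rates a) (K0 : 0 <= K) (kappa0 : 0 < kappa).
Hypothesis c2 : 2 + `|lam| <= c.
Hypothesis T00 : 0 <= T0.
Context {dT : measure_display} {T : measurableType dT}.
Variable P : probability T R.
Variables X1 X2 : R -> T -> I.
Hypotheses (hX1 : is_markov_chain P a X1) (hX2 : is_markov_chain P a X2).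
Hypothesis hX12 : indep_processes P X1 X2.
Hypothesis hX0 : {ae P, forall w, X1 0 w = X2 0 w}.
Local Notation A := (pair_rate a).
Local Notation op := (kernel_op (system_kernel a kappa lam c)).
Local Notation Y := (pair_chain X1 X2).
Local Notation phi n b := (fun x => iter n op (fun=> 1) (b, x)).
Local Notation Cn := (system_bound K kappa lam c).
Variable k : I.

Let A0 x y : 0 <= A x y. Proof. exact: pair_rate_ge0. Qed.
Let c0 : 0 <= c. Proof. by rewrite (le_trans _ c2)// addr_ge0. Qed.
Let phi_bound n b x : 0 <= phi n b x <= Cn ^+ n.
Proof. exact: kernel_iter_bounded. Qed.

Let sG := @pair_past_sigma R d dT T X1 X2.
Let Gm r (r0 : 0 <= r) := @pair_past_measurable R d a dT T P X1 X2 hX1 hX2 r r0.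
Let GM r s (r0 : 0 <= r) (rs : r <= s) := @pair_past_mono R d dT T X1 X2 r s r0 rs.
Let XG r x (r0 : 0 <= r) := @pair_past_event R d dT T X1 X2 r x r0.
Let rc w r (r0 : 0 <= r) := @pair_chain_rc R d a dT T P X1 X2 hX1 hX2 w r r0.

(** For [b = false] the Feynman-Kac equation makes each member the primitive of the next one in [n],
    as the uniqueness argument requires. *)
Definition pair_expectation n b s : R :=
  \int[P]_w (fk_weight Y diagonal lam c s w * phi n b (Y s w)).

Lemma measurable_pair_fun s (f : I * I -> R) : 0 <= s -> measurable_fun setT (fun w => f (Y s w)).
Proof.
exact: (@measurable_countable_fun _ _ _ _ _ _ sG Gm XG s f).
Qed.

(** The chains start together at an unspecified, possibly random site, and the iterates are constant
    along the diagonal. *)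
Lemma pair_expectation_start n b : \int[P]_w phi n b (Y 0 w) = phi n b (k, k).
Proof.
rewrite -[RHS](Rintegral_prob_cst P); congr fine.
apply: ge0_ae_eq_integral => //.
- by apply/measurable_EFinP; exact: (measurable_pair_fun (phi n b) (lexx 0)).
- by move=> w _; rewrite lee_fin; have /andP[] := phi_bound n b (Y 0 w).
- by move=> w _; rewrite lee_fin; have /andP[] := phi_bound n b (k, k).
apply: filterS hX0 => w e _; congr (_%:E); rewrite /pair_chain e.
exact: (kernel_iter_diagonal ha K0 kappa0 c2).
Qed.

Lemma fk_weight_le s w : 0 <= s <= T0 -> 0 <= fk_weight Y diagonal lam c s w <= expR ((`|lam| + c) * T0).
Proof. exact: (@fk_weight_bound _ _ _ _ _ _ sG Gm XG rc diagonal _ _ c2 T0 s w). Qed.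

Lemma measurable_pair_occup s : 0 <= s -> measurable_fun setT (occup Y diagonal s).
Proof.
exact: (@measurable_occup _ _ _ _ _ _ sG Gm GM XG rc diagonal s).
Qed.

Lemma pair_expectation_integrable s (f : I * I -> R) C : 0 <= s <= T0 -> (forall x, 0 <= f x <= C) ->
  P.-integrable setT (EFin \o (fun w => fk_weight Y diagonal lam c s w * f (Y s w))) /\
  0 <= \int[P]_w (fk_weight Y diagonal lam c s w * f (Y s w)) <= expR ((`|lam| + c) * T0) * C.
Proof.
move=> sT fC; have /andP[s0 _] := sT.
have f0 x : 0 <= f x by have /andP[] := fC x.
have w0 w : 0 <= fk_weight Y diagonal lam c s w by have /andP[] := fk_weight_le w sT.
have mf : measurable_fun setT (fun w => fk_weight Y diagonal lam c s w * f (Y s w)).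
  apply: measurable_funM; last exact: measurable_pair_fun.
  apply: measurableT_comp => //; apply: measurable_funD => //.
  by apply: measurable_funM => //; exact: measurable_pair_occup.
have b w : `|fk_weight Y diagonal lam c s w * f (Y s w)| <= expR ((`|lam| + c) * T0) * C.
  rewrite ger0_norm ?mulr_ge0//; apply: ler_pM => //.
    by have /andP[] := fk_weight_le w sT.
  by have /andP[] := fC (Y s w).
split; first exact: bounded_integrable mf b.
apply/andP; split; first by apply: Rintegral_ge0 => w _; rewrite mulr_ge0.
by apply: le_trans (ler_norm _) _; exact: le_normr_Rintegral_prob.
Qed.

Lemma pair_expectation_bound n b s : 0 <= s <= T0 ->
  0 <= pair_expectation n b s <= expR ((`|lam| + c) * T0) * Cn ^+ n.
Proof. by move=> sT; exact: (pair_expectation_integrable sT (phi_bound n b)).2. Qed.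

Lemma iter_opE n b x : phi n.+1 b x =
  if b then gen_op A (phi n true) x + (c - 2) * phi n true x + kappa * (diagonal x)%:R * phi n false x
  else fk_op A diagonal lam c (phi n false) x.
Proof.
rewrite /= system_kernel_rowE//.
  by move=> p; have /andP[] := kernel_iter_bounded ha K0 kappa0 c2 n p.
exact/esym/(EFin_gen_op A0 (pair_rate_mass ha) (phi_bound n b)).
Qed.

Lemma pair_expectation_equation n s : 0 <= s <= T0 ->
  leb.-integrable `]0, s] (EFin \o pair_expectation n.+1 false) /\
  pair_expectation n false s = phi n false (k, k) +
    \int[leb]_(r in `]0, s]) pair_expectation n.+1 false r.
Proof.
move=> /andP[s0 _].
have e r : \int[P]_w (fk_weight Y diagonal lam c r w * fk_op A diagonal lam c (phi n false) (Y r w)) =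
    pair_expectation n.+1 false r.
  by apply: eq_Rintegral => w _; rewrite (iter_opE n false).
have [h1 h2] := pair_fk_equation ha hX1 hX2 hX12 diagonal c2 s0 (phi_bound n false).
split; first by apply: eq_integrable h1 => // r _ /=; rewrite e.
rewrite /pair_expectation h2 pair_expectation_start; congr (_ + _).
by apply: eq_Rintegral => r _; exact: e.
Qed.

(** As a primitive of a bounded function it is Lipschitz in time. *)
Lemma pair_expectation_measurable n : measurable_fun `]0, T0] (pair_expectation n false).
Proof.
pose M := expR ((`|lam| + c) * T0) * Cn ^+ n.+1.
apply: (measurable_lipschitz (C := M)) => // s r s0 sr rT.
have r0 := le_trans s0 sr; have sT := le_trans sr rT.
have rT' : 0 <= r <= T0 by rewrite r0.
have sT' : 0 <= s <= T0 by rewrite s0.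
have [i1 e1] := pair_expectation_equation n rT'; have [_ e2] := pair_expectation_equation n sT'.
rewrite e1 e2 (Rintegral_cat s0 sr i1) opprD addrACA subrr add0r addrAC subrr add0r.
have T0T : 0 <= T0 <= T0 by rewrite T00 lexx.
have [iT _] := pair_expectation_equation n T0T.
apply: le_normr_Rintegral_oc => //.
  apply: (measurable_funS (E := `]0, T0]%classic)) => //.
    by move=> u /=; rewrite !in_itv/= => /andP[su ur]; rewrite (le_lt_trans s0 su) (le_trans ur).
  by apply/measurable_EFinP; exact: measurable_int iT.
move=> u /andP[su ur]; have uT : 0 <= u <= T0 by rewrite (le_trans s0 (ltW su)) (le_trans ur).
by have /andP[h1 h2] := pair_expectation_bound n.+1 false uT; rewrite ger0_norm.
Qed.

Lemma pair_expectation_time_integrable n s : 0 <= s <= T0 ->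
  leb.-integrable `]0, s] (EFin \o pair_expectation n false).
Proof.
move=> /andP[s0 sT]; apply: (bounded_integrable_oc (M := expR ((`|lam| + c) * T0) * Cn ^+ n)).
  apply: measurable_funS (pair_expectation_measurable n) => //.
  by move=> u /=; rewrite !in_itv/= => /andP[-> ur]; rewrite (le_trans ur).
move=> u /andP[/ltW u0 us]; have uT : 0 <= u <= T0 by rewrite u0 (le_trans us).
by have /andP[h1 h2] := pair_expectation_bound n false uT; rewrite ger0_norm.
Qed.

Lemma pair_expectation0 : expR (- (c * T0)) * pair_expectation 0 false T0 =
  \int[P]_w expR (lam * occup Y diagonal T0 w).
Proof.
have T0T : 0 <= T0 <= T0 by rewrite T00 lexx.
have one (x : I * I) : 0 <= (1 : R) <= 1 by rewrite ler01 lexx.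
have i1 := (pair_expectation_integrable (f := fun=> 1) T0T one).1.
rewrite /pair_expectation -RintegralZl//; apply: eq_Rintegral => w _ /=.
by rewrite mulr1 -expRD addrC /fk_weight addrK.
Qed.

(* For rho <> 0 the second moment is an affine function of the mixed one. *)
Definition affine_expectation rho n s : R :=
  (1 - rho^-1) * (c ^+ n * expR (c * s)) + rho^-1 * pair_expectation n false s.

(** Induction on [n]: [gen_op] is linear and doubles constants, so the full operator multiplies
    constants by [c], while the coupling [kappa] on the diagonal is [rho^-1] times the potential
    [lam] there. *)
Lemma iter_op_true rho n x : rho != 0 -> lam = kappa * rho ->
  phi n true x = (1 - rho^-1) * c ^+ n + rho^-1 * phi n false x.
Proof.
move=> r0 lamE; elim: n x => [|n IH] x; first by rewrite /= expr0 !mulr1 subrK.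
have lin : gen_op A (phi n true) x = (1 - rho^-1) * (2 * c ^+ n) + rho^-1 * gen_op A (phi n false) x.
  (* [1 - rho^-1] and [rho^-1] may be negative, whereas [esum] is additive on nonnegative terms;
     adding the same multiple [p] on both sides makes all coefficients nonnegative. *)
  have [p hp] : exists p : R, 0 <= p /\ 0 <= p + (1 - rho^-1) /\ 0 <= p + rho^-1.
    exists (`|1 - rho^-1| + `|rho^-1|); split; first by rewrite addr_ge0.
    have := ler_norm (- (1 - rho^-1)); have := ler_norm (- rho^-1); rewrite !normrN => h1 h2.
    by have := normr_ge0 (1 - rho^-1); have := normr_ge0 (rho^-1); lra.
  have [p0 [p1 p2]] := hp.
  have cn0 : 0 <= c ^+ n by rewrite exprn_ge0.
  have et := EFin_gen_op A0 (pair_rate_mass ha) (phi_bound n true) x.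
  have ef := EFin_gen_op A0 (pair_rate_mass ha) (phi_bound n false) x.
  have f0 b y : 0 <= phi n b y by have /andP[] := phi_bound n b y.
  have key : gen_op A (phi n true) x + p * (2 * c ^+ n) + p * gen_op A (phi n false) x =
      (p + (1 - rho^-1)) * (2 * c ^+ n) + (p + rho^-1) * gen_op A (phi n false) x.
    apply: EFin_inj; rewrite !EFinD et !(EFinM _ (gen_op _ _ _)) ef.
    have ec q : 0 <= q -> (q * (2 * c ^+ n))%:E = (\esum_(y in [set: I * I]) (A x y * (q * c ^+ n))%:E)%E.
      move=> q0; under eq_esum do rewrite EFinM.
      rewrite esumZr ?mulr_ge0//; last by move=> y; rewrite lee_fin.
      by rewrite (pair_rate_mass ha) -EFinM; congr (_%:E); ring.
    have eZ q : 0 <= q -> (q%:E * (\esum_(y in [set: I * I]) (A x y * phi n false y)%:E) =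
        \esum_(y in [set: I * I]) (A x y * (q * phi n false y))%:E)%E.
      move=> q0; rewrite -esumZl//; last by move=> y; rewrite lee_fin mulr_ge0.
      by apply: eq_esum => y _; rewrite -EFinM; congr (_%:E); ring.
    rewrite !ec// !eZ// -!esumD; first last.
    - by move=> y _; do ?apply: adde_ge0; rewrite lee_fin !mulr_ge0.
    - by move=> y _; do ?apply: adde_ge0; rewrite lee_fin !mulr_ge0.
    - by move=> y _; do ?apply: adde_ge0; rewrite lee_fin !mulr_ge0.
    - by move=> y _; do ?apply: adde_ge0; rewrite lee_fin !mulr_ge0.
    - by move=> y _; do ?apply: adde_ge0; rewrite lee_fin !mulr_ge0.
    - by move=> y _; do ?apply: adde_ge0; rewrite lee_fin !mulr_ge0.
    apply: eq_esum => y _; rewrite -!EFinD; congr (_%:E); rewrite IH; ring.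
  by move: key; lra.
rewrite (iter_opE n true) (iter_opE n false) lin IH /fk_op exprS lamE.
by field.
Qed.

Lemma affine_expectation_equation rho n s : rho != 0 -> lam = kappa * rho -> 0 <= s <= T0 ->
  leb.-integrable `]0, s] (EFin \o affine_expectation rho n) /\
  affine_expectation rho n s = phi n true (k, k) +
    \int[leb]_(r in `]0, s]) affine_expectation rho n.+1 r.
Proof.
move=> r0 lamE sT; have /andP[s0 sT'] := sT.
have mL := measurable_oc 0 s.
have ie q : leb.-integrable `]0, s] (EFin \o (fun r => q * expR (c * r))).
  apply: (bounded_integrable_oc (M := `|q| * expR (c * s))).
    by apply: measurable_funM => //; exact: measurable_fun_expRM.
  move=> r /andP[/ltW r0' rs]; rewrite normrM ler_wpM2l// ger0_norm ?expR_ge0//.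
  by rewrite ler_expR ler_wpM2l.
have ip q n' := rintegrableZl mL q (pair_expectation_time_integrable n' sT).
have aE n' r : affine_expectation rho n' r =
    (1 - rho^-1) * c ^+ n' * expR (c * r) + rho^-1 * pair_expectation n' false r.
  by rewrite /affine_expectation mulrA.
split.
  apply: eq_integrable (integrableD mL (ie ((1 - rho^-1) * c ^+ n)) (ip rho^-1 n)) => // r _ /=.
  by rewrite aE.
rewrite (_ : \int[leb]_(r in `]0, s]) affine_expectation rho n.+1 r =
    \int[leb]_(r in `]0, s]) ((1 - rho^-1) * c ^+ n.+1 * expR (c * r) +
      rho^-1 * pair_expectation n.+1 false r)); last by apply: eq_Rintegral => r _; rewrite aE.
have eZ : \int[leb]_(r in `]0, s]) (rho^-1 * pair_expectation n.+1 false r) =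
    rho^-1 * \int[leb]_(r in `]0, s]) pair_expectation n.+1 false r.
  by apply: RintegralZl => //; exact: pair_expectation_time_integrable.
rewrite RintegralD// eZ.
have -> : \int[leb]_(r in `]0, s]) ((1 - rho^-1) * c ^+ n.+1 * expR (c * r)) =
    (1 - rho^-1) * c ^+ n * (expR (c * s) - 1).
  rewrite (Rintegral_expR c s0) addrAC subrr add0r -RintegralZl//.
  by apply: eq_Rintegral => r _; rewrite exprSr; ring.
rewrite aE (pair_expectation_equation n sT).2 (iter_op_true n _ r0 lamE).
by ring.
Qed.

(* For rho = 0 the weight is deterministic and the local time enters linearly. *)
Definition linear_expectation n s : R :=
  c ^+ n * kappa * (expR (c * s) * \int[P]_w occup Y diagonal s w) + pair_expectation n true s.

Let prob_diag s := \int[P]_w (diagonal (Y s w))%:R.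

Let diag_bound s w : 0 <= ((diagonal (Y s w))%:R : R) <= 1.
Proof. by case: (diagonal _); rewrite ?lexx ?ler01. Qed.

Let diag_integrable s : 0 <= s -> P.-integrable setT (EFin \o (fun w => (diagonal (Y s w))%:R : R)).
Proof.
move=> s0; apply: (@bounded_integrable dT T R P _ 1).
  exact: (measurable_pair_fun (fun x => (diagonal x)%:R) s0).
by move=> w; have /andP[h1 h2] := diag_bound s w; rewrite ger0_norm.
Qed.

Let prob_diag_bound s : 0 <= s -> 0 <= prob_diag s <= 1.
Proof.
move=> s0; apply/andP; split; first by apply: Rintegral_ge0 => w _; have /andP[] := diag_bound s w.
rewrite -[leRHS](Rintegral_prob_cst P); apply: le_Rintegral => //.
- exact: diag_integrable.
- exact: finite_measure_integrable_cst.
- by move=> w _; have /andP[] := diag_bound s w.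
Qed.

Lemma mean_occup s : 0 <= s -> leb.-integrable `]0, s] (EFin \o prob_diag) /\
  \int[P]_w occup Y diagonal s w = \int[leb]_(r in `]0, s]) prob_diag r.
Proof.
move=> s0.
have jm : jointly_measurable s (fun r w => (diagonal (Y r w))%:R : R).
  apply: measurable_right_cont => // [r /andP[r0 _]|w r /andP[r0 _]].
    exact: (measurable_pair_fun (fun x => (diagonal x)%:R) r0).
  exact: (@right_cont_fun _ _ _ _ _ rc (fun x => (diagonal x)%:R) w r (ltW r0)).
have [_ h1 h2] := strip_fubini_ge0 (P := P) (C := 1) jm
  (fun r w _ => proj1 (andP (diag_bound r w)))
  (fun w => @occup_integrable _ _ _ _ _ _ sG Gm XG rc diagonal 0 s w (lexx 0) s0)
  (fun r rs => diag_integrable (ltW (proj1 (andP rs))))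
  (fun r rs => proj2 (andP (prob_diag_bound (ltW (proj1 (andP rs)))))).
by split.
Qed.

Let mocc s := \int[P]_w occup Y diagonal s w.

Let mocc_bound s : 0 <= s <= T0 -> 0 <= mocc s <= T0.
Proof.
move=> /andP[s0 sT]; rewrite /mocc (mean_occup s0).2; apply/andP; split.
  apply: Rintegral_ge0 => r /=; rewrite in_itv/= => /andP[/ltW r0 _].
  by have /andP[] := prob_diag_bound r0.
apply: le_trans (ler_norm _) _; apply: (@le_trans _ _ (1 * (s - 0))); last by rewrite subr0 mul1r.
apply: le_normr_Rintegral_oc => //.
  by apply/measurable_EFinP; exact: measurable_int (mean_occup s0).1.
by move=> r /andP[/ltW r0 _]; have /andP[h1 h2] := prob_diag_bound r0; rewrite ger0_norm.
Qed.

Let measurable_mocc : measurable_fun `]0, T0] mocc.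
Proof.
apply: (measurable_lipschitz (C := 1)) => // s r s0 sr rT.
have r0 := le_trans s0 sr; rewrite /mocc (mean_occup s0).2 (mean_occup r0).2.
rewrite (Rintegral_cat s0 sr (mean_occup r0).1) addrAC subrr add0r.
apply: le_normr_Rintegral_oc => //.
  apply: (measurable_funS (E := `]0, r]%classic)) => //.
    by move=> u /=; rewrite !in_itv/= => /andP[su ->]; rewrite (le_lt_trans s0 su).
  by apply/measurable_EFinP; exact: measurable_int (mean_occup r0).1.
move=> u /andP[su ur]; have u0 := le_trans s0 (ltW su).
by have /andP[h1 h2] := prob_diag_bound u0; rewrite ger0_norm.
Qed.

Section zero_correlation.
Hypothesis lam0 : lam = 0.

Lemma iter_op_false n x : phi n false x = c ^+ n.
Proof.
elim: n x => [|n IH] x; first by rewrite expr0.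
rewrite (iter_opE n false) /fk_op IH.
have -> : gen_op A (phi n false) x = 2 * c ^+ n.
  rewrite /gen_op; under eq_esum do rewrite IH EFinM.
  rewrite esumZr ?exprn_ge0//; last by move=> y; rewrite lee_fin.
  by rewrite (pair_rate_mass ha).
by rewrite lam0 exprS; ring.
Qed.

Let weightE s w : fk_weight Y diagonal lam c s w = expR (c * s).
Proof. by rewrite /fk_weight lam0 mul0r add0r. Qed.

Let bounded_exp_integrable (f : R -> R) M s : 0 <= s <= T0 -> measurable_fun `]0, T0] f ->
  (forall r, 0 < r <= T0 -> `|f r| <= M) -> leb.-integrable `]0, s] (EFin \o (fun r => expR (c * r) * f r)).
Proof.
move=> /andP[s0 sT] mf fM; apply: (bounded_integrable_oc (M := expR (c * T0) * M)).
  apply: measurable_funM; first exact: measurable_fun_expRM.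
  apply: measurable_funS mf => //.
  by move=> u /=; rewrite !in_itv/= => /andP[-> ur]; rewrite (le_trans ur).
move=> r /andP[r0 rs]; have rT := le_trans rs sT.
rewrite normrM ger0_norm ?expR_ge0// ler_pM ?expR_ge0//.
  by rewrite ler_expR ler_wpM2l.
by rewrite fM// r0.
Qed.

Let integrable_exp_mocc s : 0 <= s <= T0 -> leb.-integrable `]0, s] (EFin \o (fun r => expR (c * r) * mocc r)).
Proof.
move=> sT; apply: (bounded_exp_integrable (M := T0)) => // r /andP[/ltW r0 rT].
by have /andP[h1 h2] := mocc_bound (introT andP (conj r0 rT)); rewrite ger0_norm.
Qed.

Let integrable_exp_diag s : 0 <= s <= T0 -> leb.-integrable `]0, s] (EFin \o (fun r => expR (c * r) * prob_diag r)).
Proof.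
move=> sT; apply: (bounded_exp_integrable (M := 1)) => //.
  by apply/measurable_EFinP; exact: measurable_int (mean_occup T00).1.
by move=> r /andP[/ltW r0 rT]; have /andP[h1 h2] := prob_diag_bound r0; rewrite ger0_norm.
Qed.

(** The kernel adds to [fk_op] a source, [kappa] on the diagonal times [phi n false = c ^+ n]. The
    Feynman-Kac equation for [phi n true] lacks it, hence the subtracted integral of the probability
    of being on the diagonal. *)
Lemma pair_expectation_true_equation n s : 0 <= s <= T0 ->
  leb.-integrable `]0, s] (EFin \o pair_expectation n.+1 true) /\
  pair_expectation n true s = phi n true (k, k) +
    (\int[leb]_(r in `]0, s]) pair_expectation n.+1 true r) -
    c ^+ n * kappa * \int[leb]_(r in `]0, s]) (expR (c * r) * prob_diag r).
Proof.
move=> sT; have /andP[s0 _] := sT.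
have mL := measurable_oc 0 s.
pose q := c ^+ n * kappa.
have e r : 0 <= r <= T0 ->
    \int[P]_w (fk_weight Y diagonal lam c r w * fk_op A diagonal lam c (phi n true) (Y r w)) +
    q * (expR (c * r) * prob_diag r) = pair_expectation n.+1 true r.
  move=> rT; have /andP[r0 _] := rT.
  have ie := rintegrableZl measurableT (q * expR (c * r)) (diag_integrable r0).
  rewrite mulrA -RintegralZl//; last exact: diag_integrable.
  rewrite -RintegralD//; last first.
    exact: (pair_expectation_integrable rT (fun x => fk_op_ge0 A0 (pair_rate_mass ha) diagonal c2 x (phi_bound n true))).1.
  apply: eq_Rintegral => w _; rewrite (iter_opE n true) weightE /fk_op iter_op_false lam0 /q; ring.
have [h1 h2] := pair_fk_equation ha hX1 hX2 hX12 diagonal c2 s0 (phi_bound n true).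
have iq := integrable_exp_diag sT.
have iqq := rintegrableZl mL q iq.
have rT r : 0 < r <= s -> 0 <= r <= T0.
  by move=> /andP[/ltW -> rs]; rewrite (le_trans rs)//; have /andP[] := sT.
split.
  apply: eq_integrable (integrableD mL h1 iqq) => // r; rewrite inE/= in_itv/= => /rT rs.
  by rewrite -e.
rewrite [LHS]h2 pair_expectation_start -addrA; congr (_ + _).
rewrite (_ : \int[leb]_(r in `]0, s]) pair_expectation n.+1 true r = \int[leb]_(r in `]0, s])
   (\int[P]_w (fk_weight Y diagonal lam c r w * fk_op A diagonal lam c (phi n true) (Y r w)) +
    q * (expR (c * r) * prob_diag r))); last first.
  by apply: eq_Rintegral => r; rewrite inE/= in_itv/= => /rT rs; rewrite e.
by rewrite RintegralD// [in RHS]RintegralZl// addrK.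
Qed.

Lemma pair_expectation_true_integrable n s : 0 <= s <= T0 ->
  leb.-integrable `]0, s] (EFin \o pair_expectation n true).
Proof.
move=> sT; case: n => [|n]; first exact: (pair_expectation_time_integrable 0 sT).
exact: (pair_expectation_true_equation n sT).1.
Qed.

(** Differentiating [expR (c * s)] times the mean occupation time gives two terms: one is the
    occupation part of the next member, the other cancels the integral subtracted in
    [pair_expectation_true_equation]. *)
Lemma linear_expectation_equation n s : 0 <= s <= T0 ->
  leb.-integrable `]0, s] (EFin \o linear_expectation n) /\
  linear_expectation n s = phi n true (k, k) + \int[leb]_(r in `]0, s]) linear_expectation n.+1 r.
Proof.
move=> sT; have /andP[s0 sT'] := sT.
have mL := measurable_oc 0 s.
have im n' := rintegrableZl mL (c ^+ n' * kappa) (integrable_exp_mocc sT).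
split.
  exact: rintegrableD (im n) (pair_expectation_true_integrable n sT).
rewrite /linear_expectation -/(mocc s) (pair_expectation_true_equation n sT).2.
have prod : expR (c * s) * mocc s =
    \int[leb]_(r in `]0, s]) (c * (expR (c * r) * mocc r) + expR (c * r) * prob_diag r).
  have sub (f : R -> R) : measurable_fun `]0, T0] f -> measurable_fun `]0, s] f.
    move=> mf; apply: measurable_funS mf => //.
    by move=> r /=; rewrite !in_itv/= => /andP[-> rs]; rewrite (le_trans rs).
  have mo0 : mocc 0 = 0 by rewrite /mocc (mean_occup (lexx 0)).2 Rintegral_oc_set0.
  have /= e := @Rintegral_product _ s (c * expR (c * s) + 1) (fun r => expR (c * r)) mocc
    (fun r => c * expR (c * r)) prob_diag s0.
  rewrite e.
  - by rewrite mo0 mulr0 add0r; apply: eq_Rintegral => r _; rewrite mulrA.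
  - by apply: measurable_funM => //; exact: measurable_fun_expRM.
  - by apply/measurable_EFinP; exact: measurable_int (mean_occup s0).1.
  - exact: measurable_fun_expRM.
  - exact: sub.
  - move=> r /andP[r0 rs]; rewrite ger0_norm ?mulr_ge0 ?expR_ge0//.
    by rewrite (@le_trans _ _ (c * expR (c * s)))// ?lerDl// ler_wpM2l// ler_expR ler_wpM2l.
  - move=> r /andP[r0 rs]; have /andP[h1 h2] := prob_diag_bound r0; rewrite ger0_norm//.
    by apply: le_trans h2 _; rewrite lerDr mulr_ge0// expR_ge0.
  - by move=> r /andP[r0 _]; rewrite mulr0 expR0 -Rintegral_expR.
  - by move=> r /andP[r0 _]; rewrite mo0 add0r /mocc (mean_occup r0).2.
have iz := rintegrableZl mL c (integrable_exp_mocc sT).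
have e1 : \int[leb]_(r in `]0, s]) (c * (expR (c * r) * mocc r) + expR (c * r) * prob_diag r) =
    c * (\int[leb]_(r in `]0, s]) (expR (c * r) * mocc r)) +
    \int[leb]_(r in `]0, s]) (expR (c * r) * prob_diag r).
  rewrite RintegralD//; last exact: integrable_exp_diag.
  by rewrite RintegralZl//; exact: integrable_exp_mocc.
have e2 : \int[leb]_(r in `]0, s]) (c ^+ n.+1 * kappa * (expR (c * r) * mocc r) + pair_expectation n.+1 true r) =
    c ^+ n.+1 * kappa * (\int[leb]_(r in `]0, s]) (expR (c * r) * mocc r)) +
    \int[leb]_(r in `]0, s]) pair_expectation n.+1 true r.
  rewrite RintegralD//; last exact: pair_expectation_true_integrable.
  by rewrite RintegralZl//; exact: integrable_exp_mocc.
rewrite prod e1 e2 exprS.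
move: (\int[leb]_(r in `]0, s]) (expR (c * r) * mocc r)) => u1.
move: (\int[leb]_(r in `]0, s]) (expR (c * r) * prob_diag r)) => u2.
move: (\int[leb]_(r in `]0, s]) pair_expectation n.+1 true r) => u3.
by ring.
Qed.

Lemma linear_expectation_bound n s : 0 <= s <= T0 ->
  `|linear_expectation n s| <= (kappa * (expR (c * T0) * T0) + expR ((`|lam| + c) * T0)) * Cn ^+ n.
Proof.
move=> sT; have /andP[s0 sT'] := sT.
have cC : c <= Cn.
  by rewrite /system_bound; have := normr_ge0 lam; have := K0; have := kappa0; lra.
have /andP[h1 h2] := pair_expectation_bound n true sT.
have /andP[h3 h4] := mocc_bound sT.
rewrite /linear_expectation -/(mocc s) ger0_norm; last first.
  by rewrite addr_ge0// !mulr_ge0 ?exprn_ge0 ?expR_ge0// ltW.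
rewrite mulrDl lerD// -mulrA [leRHS]mulrC ler_pM ?exprn_ge0//.
- by rewrite !mulr_ge0 ?expR_ge0// ltW.
- by rewrite lerXn2r ?nnegrE// (le_trans c0).
rewrite ler_wpM2l//; first exact: ltW.
by rewrite ler_pM ?expR_ge0// ler_expR ler_wpM2l.
Qed.

End zero_correlation.

Lemma affine_expectation_bound rho n s : 0 <= s <= T0 ->
  `|affine_expectation rho n s| <=
  (`|1 - rho^-1| * expR (c * T0) + `|rho^-1| * expR ((`|lam| + c) * T0)) * Cn ^+ n.
Proof.
move=> sT; have /andP[s0 sT'] := sT.
have cC : c <= Cn.
  by rewrite /system_bound; have := normr_ge0 lam; have := K0; have := kappa0; lra.
have /andP[h1 h2] := pair_expectation_bound n false sT.
rewrite /affine_expectation; apply: le_trans (ler_normD _ _) _; rewrite [leRHS]mulrDl !normrM lerD//.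
  rewrite -mulrA ler_wpM2l// mulrC !ger0_norm ?exprn_ge0 ?expR_ge0//.
  rewrite ler_pM ?exprn_ge0 ?expR_ge0//; first by rewrite ler_expR ler_wpM2l.
  by rewrite lerXn2r ?nnegrE// (le_trans c0).
by rewrite -mulrA ler_wpM2l// ger0_norm.
Qed.

End ChainComparison.

(** The family [m] enters through its equation and bounds alone, so moments and chains may live on
    different probability spaces. Each comparison sequence has as its member at [n = 0] the claimed
    formula times e^(c T0). *)
Lemma moment_feynman_kac {R : realType} {d : nat} (a : lattice d -> lattice d -> R)
    (om : lattice d -> R) (K kappa rho T0 E0 : R) (m : bool -> R -> lattice d * lattice d -> R)
    {dT : measure_display} {T : measurableType dT} (P : probability T R)
    (X1 X2 : R -> T -> lattice d) (k : lattice d) :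
  is_rates a -> is_weight a om -> 0 <= K ->
  (forall j, (\esum_(i in [set: lattice d]) (om i * a i j)%:E <= (K * om j)%:E)%E) ->
  0 < kappa -> 0 <= T0 ->
  (forall b s x, 0 <= s -> 0 <= m b s x) ->
  (forall b s, 0 <= s <= T0 ->
    (\esum_(x in [set: lattice d * lattice d]) (pair_weight om x * m b s x)%:E <= E0%:E)%E) ->
  (forall b x, measurable_fun `]0, T0] (m b ^~ x)) ->
  (forall b s x, 0 <= s <= T0 ->
    let g r := gen_op (pair_rate a) (m b r) x - 2 * m b r x +
      (if b then kappa else kappa * rho) * (diagonal x)%:R * m false r x in
    lebesgue_measure.-integrable `]0, s] (EFin \o g) /\
    m b s x = 1 + \int[lebesgue_measure]_(r in `]0, s]) g r) ->
  is_markov_chain P a X1 -> is_markov_chain P a X2 -> indep_processes P X1 X2 ->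
  {ae P, forall w, X1 0 w = X2 0 w} ->
  let L := occup (pair_chain X1 X2) diagonal T0 in
  m false T0 (k, k) = \int[P]_w expR (kappa * rho * L w) /\
  m true T0 (k, k) = if rho == 0 then 1 + kappa * \int[P]_w L w
    else 1 - rho^-1 + rho^-1 * \int[P]_w expR (kappa * rho * L w).
Proof.
move=> ha hom K0 hK kappa0 T00 m0 mN mm me hX1 hX2 hX12 hX0 L.
pose lam := kappa * rho; pose c := 2 + `|lam|.
have c2 : 2 + `|lam| <= c by [].
have T0T : 0 <= T0 <= T0 by rewrite T00 lexx.
pose pe := pair_expectation a kappa lam c P X1 X2.
have mL := measurable_oc 0 T0.
have pe0 := pair_expectation0 kappa c2 T00 hX1 hX2.
split.
  rewrite (moment_unique (M' := expR ((`|lam| + c) * T0)) ha hom K0 hK kappa0 c2 T00 m0 mN mm me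
    (z := fun n => pe n false)).
  - exact: pe0.
  - by move=> n; exact: (pair_expectation_measurable ha K0 kappa0 c2 T00 hX1 hX2 hX12 hX0 k).
  - move=> n s sT; have /andP[h1 h2] := pair_expectation_bound ha K0 kappa0 c2 hX1 hX2 n false sT.
    by rewrite ger0_norm.
  - move=> n s sT; split.
      exact: (pair_expectation_time_integrable ha K0 kappa0 c2 T00 hX1 hX2 hX12 hX0 k).
    exact: (pair_expectation_equation ha K0 kappa0 c2 hX1 hX2 hX12 hX0 k n sT).2.
have [r0|r0] := eqVneq rho 0.
  have lam0 : lam = 0 by rewrite /lam r0 mulr0.
  have eq n s (sT : 0 <= s <= T0) := linear_expectation_equation ha K0 kappa0 c2 T00 hX1 hX2 hX12 hX0 k lam0 n sT.
  rewrite (moment_unique (M' := kappa * (expR (c * T0) * T0) + expR ((`|lam| + c) * T0))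
    ha hom K0 hK kappa0 c2 T00 m0 mN mm me (z := linear_expectation a kappa lam c P X1 X2)).
  - rewrite /linear_expectation expr0 mul1r mulrDr addrC; congr (_ + _).
      rewrite [LHS]pe0 -[RHS](Rintegral_prob_cst P); apply: eq_Rintegral => w _.
      by rewrite lam0 mul0r expR0.
    by rewrite mulrCA; congr (_ * _); rewrite mulrA -expRD addrC subrr expR0 mul1r.
  - by move=> n; apply/measurable_EFinP; exact: measurable_int (eq n T0 T0T).1.
  - move=> n s sT; exact: (linear_expectation_bound ha K0 kappa0 c2 hX1 hX2).
  - exact: eq.
have eq n s (sT : 0 <= s <= T0) := affine_expectation_equation ha K0 kappa0 c2 T00 hX1 hX2 hX12 hX0 k n r0 (erefl lam) sT.
rewrite (moment_unique (M' := `|1 - rho^-1| * expR (c * T0) + `|rho^-1| * expR ((`|lam| + c) * T0))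
  ha hom K0 hK kappa0 c2 T00 m0 mN mm me (z := affine_expectation a kappa lam c P X1 X2 rho)).
- rewrite /affine_expectation expr0 mul1r mulrDr mulrCA -expRD addNr expR0 mulr1.
  by congr (_ + _); rewrite mulrCA pe0.
- by move=> n; apply/measurable_EFinP; exact: measurable_int (eq n T0 T0T).1.
- move=> n s sT; exact: (affine_expectation_bound ha K0 kappa0 c2 hX1 hX2).
- exact: eq.
Qed.

(** * Zero means from symmetric laws *)

Section SymmetricLaws.
Context {R : realType}.

(** The density is even and Lebesgue measure is invariant under reflection. *)
Lemma normal_prob_symmetric (sigma : R) (B : set R) : sigma != 0 -> measurable B ->
  normal_prob 0 sigma ((-%R) @^-1` B) = normal_prob 0 sigma B.
Proof.
move=> s0 mB; rewrite /normal_prob.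
have even (y : R) : normal_pdf 0 sigma (- y) = normal_pdf 0 sigma y.
  by rewrite !normal_pdfE// /normal_fun !subr0 sqrrN.
transitivity (\int[pushforward lebesgue_measure (-%R : R -> measurableTypeR R)]_(y in B)
    (normal_pdf 0 sigma y)%:E)%E.
  rewrite ge0_integral_pushforward; first by apply: eq_integral => y _ /=; rewrite even.
  - exact: oppr_measurable.
  - exact: mB.
  - by apply/measurable_EFinP; apply: measurable_funTS; exact: measurable_normal_pdf.
  - by move=> y _; rewrite lee_fin normal_pdf_ge0.
by apply: eq_measure_integral => A mA _; exact: lebesgue_measureN.
Qed.

Context {d : measure_display} {T : measurableType d}.
Variable P : probability T R.

Lemma symmetric_law_mean (X : T -> R) : P.-integrable setT (EFin \o X) ->
  (forall B : set R, measurable B -> P (X @^-1` ((-%R) @^-1` B)) = P (X @^-1` B)) ->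
  (\int[P]_w (X w)%:E = 0)%E.
Proof.
move=> iX sX; have mX : measurable_fun setT X by apply/measurable_EFinP; exact: measurable_int iX.
have mN : measurable_fun setT (fun w => - X w) by exact: measurableT_comp.
have iN : P.-integrable setT (EFin \o (fun w => - X w)).
  by apply: eq_integrable (integrableN iX).
have e1 := @integral_pushforward _ _ T (measurableTypeR R) R X mX P setT (@EFin R)
  (@EFin_measurable R setT) iX measurableT.
have e2 := @integral_pushforward _ _ T (measurableTypeR R) R (fun w => - X w) mN P setT (@EFin R)
  (@EFin_measurable R setT) iN measurableT.
have e : (\int[P]_w (X w)%:E = \int[P]_w (- X w)%:E)%E.
  rewrite -[LHS]e1 -[RHS]e2; apply: eq_measure_integral => A mA _.
  exact: (esym (sX A mA)).
move: e; rewrite -!EFin_Rintegral//.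
have -> : \int[P]_w (- X w) = - \int[P]_w X w.
  rewrite -mulN1r -RintegralZl//; by apply: eq_Rintegral => w _; rewrite mulN1r.
by move=> -[h]; congr (_%:E); lra.
Qed.

(** Multiplying [D] by the indicator of [A] only adds mass at 0, which reflection fixes, so the
    symmetry of [D] on [A] passes to the product. *)
Lemma symmetric_increment_mean (D : T -> R) (A : set T) : P.-integrable setT (EFin \o D) ->
  measurable A ->
  (forall B : set R, measurable B -> P (A `&` D @^-1` ((-%R) @^-1` B)) = P (A `&` D @^-1` B)) ->
  (\int[P]_(w in A) (D w)%:E = 0)%E.
Proof.
move=> iD mA sD; have mD : measurable_fun setT D by apply/measurable_EFinP; exact: measurable_int iD.
have mDB B : measurable B -> measurable (D @^-1` B) by move=> mB; rewrite -[_ @^-1` _]setTI; exact: mD.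
pose X w := \1_A w * D w.
have iX : P.-integrable setT (EFin \o X).
  apply: le_integrable iD => //.
    by apply/measurable_EFinP; apply: measurable_funM => //; exact: measurable_indic.
  by move=> w _; rewrite lee_fin /X indicE normrM; case: (_ \in _); rewrite ?normr1 ?mul1r// normr0 mul0r.
have -> : (\int[P]_(w in A) (D w)%:E = \int[P]_w (X w)%:E)%E.
  rewrite integral_mkcond; apply: eq_integral => w _.
  by rewrite patchE /X indicE; case: (_ \in _); rewrite ?mul1r// mul0r.
apply: symmetric_law_mean => // B mB.
have mNB : measurable ((-%R) @^-1` B : set R).
  by rewrite -[_ @^-1` _]setTI; exact: oppr_measurable.
have XE C : X @^-1` C = (A `&` D @^-1` C) `|` (~` A `&` [set _ | C 0]).
  apply/seteqP; split=> w; rewrite /preimage/= /X indicE.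
    by case: (pselect (A w)) => Aw; [rewrite mem_set// mul1r; left|rewrite memNset// mul0r; right].
  by case=> -[Aw]; [rewrite mem_set// mul1r|rewrite memNset// mul0r].
have mC0 C : measurable (~` A `&` [set _ : T | C 0] : set T).
  apply: measurableI; first exact: measurableC.
  have [h|h] := pselect (C 0); [rewrite (_ : [set _ | _] = setT)|rewrite (_ : [set _ | _] = set0)] => //.
    by apply/seteqP; split.
  by apply/seteqP; split.
have dj C : A `&` D @^-1` C `&` (~` A `&` [set _ | C 0]) = set0.
  by apply/seteqP; split=> // w [[? _] []].
rewrite !XE !measureU// ?sD//; last 2 first.
- by apply: measurableI => //; exact: mDB.
- by apply: measurableI => //; exact: mDB.
congr (_ + _)%E; first exact: sD.
by congr (P (_ `&` _)); apply/seteqP; split=> w; rewrite /preimage/= oppr0.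
Qed.

End SymmetricLaws.

(** * Moments of a regular solution *)

Section NiceSolution.
Context {R : realType} {d : nat}.
Local Notation I := (lattice d).
Local Notation J := ('I_2 * I)%type.
Variables (a : I -> I -> R) (om : I -> R) (K kappa rho : R).
Hypotheses (ha : is_rates a) (hom : is_weight a om).
Hypothesis K0 : 0 <= K.
Hypothesis hK : forall j, (\esum_(i in [set: I]) (om i * a i j)%:E <= (K * om j)%:E)%E.
Hypothesis kappa0 : 0 < kappa.
Context {dT : measure_display} {T : measurableType dT}.
Variables (P : probability T R) (F : R -> set (set T)).
Variable W : J -> R -> T -> R.
Variable x : 'I_2 -> R -> I -> T -> R.
Local Notation leb := (@lebesgue_measure R).
Local Notation norm := (wsum om).

Definition pair_cov (p q : J) : R := noise_cov rho p.1 q.1 p.2 q.2.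

(** Independence of the type [j.1] matters: correlated noises sit at a common site, so they have the
    same integrand, as [ito_covariance] asks. *)
Definition diffusion (j : J) (s : R) (w : T) : R :=
  Num.sqrt (kappa * x 0 s j.2 w * x 1 s j.2 w).

(** The stochastic integral, read off from the equation as an explicit functional of the path; this
    gives it continuous paths for every outcome. *)
Definition noise_part (j : J) (t : R) (w : T) : R :=
  x j.1 t j.2 w - 1 - \int[leb]_(s in `]0, t]) (avg a (x j.1 s ^~ w) j.2 - x j.1 s j.2 w).

Hypothesis hW : is_noise P F W pair_cov.
Hypothesis xad : forall n i t, 0 <= t -> measurable_wrt (F t) (x n t i).
Hypothesis xE : forall n w, E_path om (fun t i => x n t i w).
Hypothesis x0 : forall n i w, x n 0 i w = 1.
Hypothesis xito : forall j t, 0 <= t ->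
  is_ito_integral P F (W j) (diffusion j) t (noise_part j t).

Lemma pair_cov1 j : pair_cov j j = 1.
Proof. by rewrite /pair_cov /noise_cov !eqxx. Qed.

Let om0 i : 0 <= om i. Proof. exact: (weight_ge0 hom). Qed.

Lemma path_summable n t w : 0 <= t -> summable om (x n t ^~ w).
Proof. by move=> t0; exact: (E_path_summable (xE n w)). Qed.

Lemma path_ge0 n t i w : 0 <= t -> 0 <= x n t i w.
Proof. by move=> t0; have [] := path_summable n w t0. Qed.

Lemma norm_adapted n t : 0 <= t -> measurable_wrt (F t) (fun w => norm (x n t ^~ w)).
Proof.
move=> t0; apply/(measurable_wrtP (noise_sigma hW t0)).
have m : measurable_fun setT ((fun w => \esum_(i in [set: I]) (om i * x n t i w)%:E)%E
    : g_sigma_algebraType (F t) -> \bar R).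
  apply: measurable_fun_esum => // [i w _|i].
    by rewrite lee_fin mulr_ge0// path_ge0.
  apply/measurable_EFinP; apply: measurable_funM => //.
  exact/(measurable_wrtP (noise_sigma hW t0))/xad.
exact: (measurableT_comp (fine_measurable measurableT) m).
Qed.

Lemma avg_adapted n i t : 0 <= t -> measurable_wrt (F t) (fun w => avg a (x n t ^~ w) i).
Proof.
move=> t0; apply/(measurable_wrtP (noise_sigma hW t0)).
have m : measurable_fun setT ((fun w => \esum_(j in [set: I]) (a i j * x n t j w)%:E)%E
    : g_sigma_algebraType (F t) -> \bar R).
  apply: measurable_fun_esum => // [j w _|j].
    by rewrite lee_fin mulr_ge0// ?path_ge0// (rates_ge0 ha).
  apply/measurable_EFinP; apply: measurable_funM => //.
  exact/(measurable_wrtP (noise_sigma hW t0))/xad.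
exact: (measurableT_comp (fine_measurable measurableT) m).
Qed.

Definition total_norm s w := norm (x 0 s ^~ w) + norm (x 1 s ^~ w).

Lemma norm_continuous_path n w : half_continuous (fun s => norm (x n s ^~ w)).
Proof. exact: (E_path_norm_continuous hom (xE n w)). Qed.

Lemma avg_continuous_path n i w : half_continuous (fun s => avg a (x n s ^~ w) i).
Proof. exact: (E_path_avg_continuous ha hom K0 hK (xE n w)). Qed.

Lemma continuous_path n i w : half_continuous (fun s => x n s i w).
Proof. exact: (E_path_continuous hom (xE n w)). Qed.

Lemma diffusion_continuous_path j w : half_continuous (diffusion j ^~ w).
Proof.
apply: (half_continuous_comp (k := Num.sqrt)); first exact: sqrt_continuous.
apply: half_continuousM; last exact: continuous_path.
by apply: half_continuousM; [exact: half_continuous_cst|exact: continuous_path].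
Qed.

Lemma total_norm_continuous w : half_continuous (total_norm ^~ w).
Proof. by apply: half_continuousD; exact: norm_continuous_path. Qed.

Lemma path_norm_ge0 n s w : 0 <= s -> 0 <= norm (x n s ^~ w).
Proof. by move=> s0; apply: (norm_ge0 hom); exact: path_summable. Qed.

Lemma total_norm_ge0 s w : 0 <= s -> 0 <= total_norm s w.
Proof. by move=> s0; rewrite addr_ge0// path_norm_ge0. Qed.

Lemma norm_le_total n s w : 0 <= s -> norm (x n s ^~ w) <= total_norm s w.
Proof.
move=> s0; rewrite /total_norm; have [->|->] : n = 0 \/ n = 1.
- by case: n => [[|[|//]] h]; [left|right]; exact: val_inj.
- by rewrite lerDl path_norm_ge0.
- by rewrite lerDr path_norm_ge0.
Qed.

Lemma total_norm_adapted s : 0 <= s -> measurable_wrt (F s) (total_norm s).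
Proof. by move=> s0; apply: (adaptedD hW s0); exact: norm_adapted. Qed.

Lemma diffusion_adapted j s : 0 <= s -> measurable_wrt (F s) (diffusion j s).
Proof.
move=> s0; apply: (adapted_comp hW s0 (h := Num.sqrt)).
  exact: continuous_measurable_fun (@sqrt_continuous R).
by apply: (adaptedM hW s0); [apply: (adaptedM hW s0); [exact: (adapted_cst hW s0)|exact: xad]|exact: xad].
Qed.

Lemma diffusion_sqr j s w : 0 <= s -> diffusion j s w ^+ 2 = kappa * (x 0 s j.2 w * x 1 s j.2 w).
Proof.
move=> s0; rewrite sqr_sqrtr ?mulrA//.
by rewrite !mulr_ge0 ?path_ge0// ltW.
Qed.

(** A decreasing family of events in the role of a stopping time. Its indicator is adapted and left
    continuous in [s], so multiplying by it keeps integrands that left-endpoint sums can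
    approximate. *)
Definition bounded_until (N : nat) (s : R) : set T :=
  [set w | forall r, 0 <= r <= s -> total_norm r w <= N%:R].

Lemma bounded_until_mono N s t : s <= t -> bounded_until N t `<=` bounded_until N s.
Proof. by move=> st w h r /andP[r0 rs]; apply: h; rewrite r0 (le_trans rs). Qed.

(** By path continuity it is enough to test the countably many times s k / (m + 1) in [[0, s]]. *)
Lemma bounded_until_F N s : 0 <= s -> F s (bounded_until N s).
Proof.
move=> s0; have sig := noise_sigma hW s0.
pose g m k := s * ((minn k m.+1)%:R / m.+1%:R).
have g01 m k : 0 <= g m k <= s.
  rewrite mulr_ge0 ?divr_ge0//= ler_piMr// ler_pdivrMr// mul1r ler_nat.
  exact: geq_minr.
have e : bounded_until N s = \bigcap_(m in setT) \bigcap_(k in setT) [set w | total_norm (g m k) w <= N%:R].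
  apply/seteqP; split=> [w h m _ k _|w h r /andP[r0 rs]] /=; first exact: h.
  have /half_continuousP cw := @total_norm_continuous w.
  apply/ler_addgt0Pr => e e0; have [dl dl0 hdl] := cw r r0 e e0.
  have [m hm] : exists m : nat, s / m.+1%:R < dl.
    by have [n _ hn] := near_invn_lt s0 dl0; exists n; exact: hn (leqnn n).
  have [k hk] : exists k, `|g m k - r| < dl.
    move: s0; rewrite le_eqVlt => /predU1P[s0|s_gt0].
      exists 0%N; rewrite /g -s0 mul0r; have -> : r = 0.
        by apply/eqP; rewrite eq_le r0 {1}s0 rs.
      by rewrite subrr normr0.
    have m0 : 0 < m.+1%:R :> R by [].
    pose y := r / s * m.+1%:R; have y0 : 0 <= y by rewrite mulr_ge0// divr_ge0// ltW.
    have y1 : y <= m.+1%:R by rewrite ler_piMl// ler_pdivrMr// mul1r.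
    exists (Num.truncn y); have /andP[h1 h2] := truncn_itv y0.
    have hmin : (minn (Num.truncn y) m.+1) = Num.truncn y.
      by apply/minn_idPl; rewrite -(ler_nat R) (le_trans h1).
    rewrite /g hmin.
    have er : r = s * (y / m.+1%:R) by rewrite /y; field; rewrite !gt_eqF//= addr_gt0.
    rewrite [X in _ - X]er -mulrBr -mulrBl normrM (gtr0_norm s_gt0).
    apply: le_lt_trans hm; rewrite ler_pM2l// normrM (gtr0_norm (x := m.+1%:R^-1)) ?invr_gt0//.
    rewrite -[leRHS]mul1r ler_wpM2r ?invr_ge0// distrC ger0_norm ?subr_ge0//.
    by rewrite lerBlDl natr1 ltW.
  have /andP[gm0 _] := g01 m k.
  have := h m Logic.I k Logic.I; have := hdl _ gm0 hk; rewrite /= distrC => /(le_trans (ler_norm _)).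
  rewrite lerBlDl => /le_trans h1 h2; apply: h1.
  by rewrite lerD2r.
rewrite e; have h m k : F s [set w | total_norm (g m k) w <= N%:R].
  have /andP[gm0 gms] := g01 m k.
  apply: (noise_filtration hW gm0 gms).
  have := total_norm_adapted gm0 (measurable_itv `]-oo, N%:R]).
  by congr (F _ _); apply/seteqP; split=> w /=; rewrite in_itv.
have [_ _ _] := sig.
pose G := g_sigma_algebraType (F s).
have mh m k : @measurable _ G [set w | total_norm (g m k) w <= N%:R].
  by rewrite g_sigma_algebraTypeE.
have : @measurable _ G (\bigcap_(m in setT) \bigcap_(k in setT) [set w | total_norm (g m k) w <= N%:R]).
  by apply: bigcapT_measurable => m; apply: bigcapT_measurable => k.
exact: (measurable_g_sigma_algebraType sig).
Qed.

(** If the bound has held up to [s], the indicator is 1 to the left of [s]. Otherwise continuity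
    gives a violation strictly before [s], and the indicator vanishes on a left neighbourhood. *)
Lemma left_cont_localized N (g : R -> T -> R) w s : half_continuous (g ^~ w) -> 0 < s ->
  left_cont (fun r => \1_(bounded_until N r) w * g r w) s.
Proof.
move=> cg s0 e e0; have [ws|ws] := pselect (bounded_until N s w).
  have [dl dl0 h] := half_continuous_left cg s0 e0; exists dl => // r r0 r1 r2.
  rewrite !indicE !mem_set//; last exact: bounded_until_mono (ltW r2) _ ws.
  by rewrite !mul1r h.
have [r0 /andP[r00 r0s] hr0] : exists2 r, 0 <= r < s & N%:R < total_norm r w.
  move/existsNP: ws => [r /not_implyP[/andP[r0 rs] /negP]]; rewrite -ltNge => hr.
  move: rs; rewrite le_eqVlt => /predU1P[rs|rs]; last by exists r => //; rewrite r0.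
  have d0 : 0 < total_norm r w - N%:R by rewrite subr_gt0.
  rewrite -rs in s0 *.
  have [dl dl0 h] := half_continuous_left (@total_norm_continuous w) s0 d0.
  (* The violation occurs at [s] itself and left continuity moves it to this earlier time, which
     lies within [dl] of [s] and is nonnegative. *)
  pose r' := Num.max (r / 2) (r - dl / 2).
  have r'0 : 0 <= r' by rewrite le_max divr_ge0.
  have r'1 : r - dl < r' by rewrite lt_max; apply/orP; right; rewrite ltrD2l ltrN2 ltr_pdivrMr// ltr_pMr// ltrDl.
  have r'2 : r' < r by rewrite gt_max ltr_pdivrMr// ltr_pMr// ltrDl ltr01/= ltrBlDr ltrDl divr_gt0.
  exists r'; first by rewrite r'0.
  have := h r' r'0 r'1 r'2; rewrite ltr_norml => /andP[h1 _].
  by move: h1; rewrite opprB ltrBrDr subrK.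
exists (s - r0) => //; first by rewrite subr_gt0.
move=> r rr0; rewrite opprB addrC subrK => r1 r2.
have nr : ~ bounded_until N r w.
  move=> h; have := h r0; rewrite r00 (ltW r1) => /(_ isT).
  by rewrite leNgt hr0.
by rewrite !indicE !memNset// !mul0r subrr normr0.
Qed.

Definition localized_diffusion N (j : J) s w := \1_(bounded_until N s) w * diffusion j s w.

Lemma localized_adapted N (g : R -> T -> R) s : 0 <= s -> measurable_wrt (F s) (g s) ->
  measurable_wrt (F s) (fun w => \1_(bounded_until N s) w * g s w).
Proof.
move=> s0 mg; apply: (adaptedM hW s0) mg; apply: (adapted_indic hW s0).
exact: bounded_until_F.
Qed.

Lemma path_le n s i w : 0 <= s -> x n s i w <= total_norm s w / om i.
Proof.
move=> s0; apply: le_trans (summable_le hom i (path_summable n w s0)) _.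
by rewrite ler_wpM2r ?invr_ge0// norm_le_total.
Qed.

Lemma localized_diffusion_bound N j s w : 0 <= s ->
  `|localized_diffusion N j s w| <= Num.sqrt (kappa * (N%:R / om j.2) * (N%:R / om j.2)).
Proof.
move=> s0; rewrite /localized_diffusion indicE; have [ws|_] := boolP (w \in _); last first.
  by rewrite mul0r normr0 sqrtr_ge0.
rewrite mul1r ger0_norm ?sqrtr_ge0// ler_wsqrtr//.
have nN : total_norm s w <= N%:R by apply: (set_mem ws); rewrite s0 lexx.
have h n : x n s j.2 w <= N%:R / om j.2.
  by apply: le_trans (path_le n j.2 w s0) _; rewrite ler_wpM2r ?invr_ge0.
rewrite ler_pM ?mulr_ge0 ?path_ge0// ?(ltW kappa0)//.
by rewrite ler_wpM2l// ltW.
Qed.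

(** * The a priori L^2 bound *)

Section apriori.
Variable N : nat.
Local Notation B := (bounded_until N).

Definition localized_energy s w := \1_(B s) w * total_norm s w ^+ 2.

Lemma localized_energy_ge0 s w : 0 <= localized_energy s w.
Proof. by rewrite mulr_ge0 ?sqr_ge0// indicE. Qed.

Lemma localized_energy_le s w : 0 <= s -> localized_energy s w <= N%:R ^+ 2.
Proof.
move=> s0; rewrite /localized_energy indicE; have [ws|_] := boolP (w \in _); last first.
  by rewrite mul0r sqr_ge0.
rewrite mul1r lerXn2r ?nnegrE ?total_norm_ge0//.
by apply: (set_mem ws); rewrite s0 lexx.
Qed.

Lemma localized_energy_norm s w : 0 <= s -> `|localized_energy s w| <= N%:R ^+ 2.
Proof. by move=> s0; rewrite ger0_norm ?localized_energy_ge0// localized_energy_le. Qed.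

Lemma localized_energy_joint t : 0 <= t -> jointly_measurable t localized_energy.
Proof.
move=> t0; apply: measurable_left_cont => // [s /andP[s0 _]|w s /andP[s0 _]].
  apply: (adapted_measurable hW s0); apply: (localized_adapted N (g := fun s w => total_norm s w ^+ 2)) => //.
  by apply: (adaptedM hW s0); exact: total_norm_adapted.
apply: (left_cont_localized N (g := fun s w => total_norm s w ^+ 2)) => //.
by apply: half_continuousM; exact: total_norm_continuous.
Qed.

Definition mean_energy s := \int[P]_w localized_energy s w.

Let mB s : 0 <= s -> measurable (B s).
Proof. by move=> s0; apply: (noise_measurable hW s0); exact: bounded_until_F. Qed.

Let int_energy s : 0 <= s -> P.-integrable setT (EFin \o localized_energy s).
Proof.
move=> s0; apply: (@bounded_integrable _ _ _ _ _ (N%:R ^+ 2)); last first.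
  by move=> w; exact: localized_energy_norm.
apply: (adapted_measurable hW s0); apply: (localized_adapted N (g := fun s w => total_norm s w ^+ 2)) => //.
by apply: (adaptedM hW s0); exact: total_norm_adapted.
Qed.

Lemma mean_energy_bound s : 0 <= s -> 0 <= mean_energy s <= N%:R ^+ 2.
Proof.
move=> s0; apply/andP; split.
  by apply: fine_ge0; apply: integral_ge0 => w _; rewrite lee_fin localized_energy_ge0.
rewrite -[leRHS](Rintegral_prob_cst P); apply: le_Rintegral => //; first exact: int_energy.
  by apply: (@bounded_integrable _ _ _ _ _ `|(N%:R ^+ 2 : R)|).
by move=> w _; exact: localized_energy_le.
Qed.

Lemma bounded_strip (t C : R) (f : R -> T -> R) : 0 <= t -> jointly_measurable t f ->
  (forall s w, 0 <= s <= t -> 0 <= f s w <= C) -> (forall s, 0 <= s <= t -> measurable_fun setT (f s)) ->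
  [/\ P.-integrable setT (EFin \o (fun w => \int[leb]_(s in `]0, t]) f s w)),
    leb.-integrable `]0, t] (EFin \o (fun s => \int[P]_w f s w)) &
    \int[P]_w (\int[leb]_(s in `]0, t]) f s w) = \int[leb]_(s in `]0, t]) (\int[P]_w f s w)].
Proof.
move=> t0 jf fC mf.
have oc s : 0 < s <= t -> 0 <= s <= t by move=> /andP[/ltW -> ->].
have fn s w : 0 <= s <= t -> `|f s w| <= C.
  by move=> /(fC _ w)/andP[h1 h2]; rewrite ger0_norm.
apply: (strip_fubini_ge0 (P := P) (C := C) jf).
- by move=> s w /oc/(fC _ w)/andP[].
- move=> w; apply: (bounded_integrable_oc (M := C)); first exact: jointly_measurable_section.
  by move=> s /oc; exact: fn.
- move=> s /oc st; apply: (@bounded_integrable _ _ _ _ _ C); first exact: mf.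
  by move=> w; exact: fn.
- move=> s /oc st; rewrite -[leRHS](Rintegral_prob_cst P); apply: le_Rintegral => //.
  + by apply: (@bounded_integrable _ _ _ _ _ C); [exact: mf|move=> w; exact: fn].
  + by apply: (@bounded_integrable _ _ _ _ _ `|C|).
  + by move=> w _; have /andP[] := fC s w st.
Qed.

Let strip_energy t : 0 <= t ->
  [/\ P.-integrable setT (EFin \o (fun w => \int[leb]_(s in `]0, t]) localized_energy s w)),
    leb.-integrable `]0, t] (EFin \o mean_energy) &
    \int[P]_w (\int[leb]_(s in `]0, t]) localized_energy s w) = \int[leb]_(s in `]0, t]) mean_energy s].
Proof.
move=> t0; apply: (bounded_strip (C := N%:R ^+ 2)) => //; first exact: localized_energy_joint.
- by move=> s w /andP[s0 _]; rewrite localized_energy_ge0 localized_energy_le.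
- by move=> s /andP[s0 _]; apply/measurable_EFinP; exact: measurable_int (int_energy s0).
Qed.

Lemma localized_diffusion_left j w s : 0 < s -> left_cont (localized_diffusion N j ^~ w) s.
Proof. by move=> s0; apply: left_cont_localized => //; exact: diffusion_continuous_path. Qed.

Lemma localized_diffusion_adapted j s : 0 <= s -> measurable_wrt (F s) (localized_diffusion N j s).
Proof. by move=> s0; apply: localized_adapted => //; exact: diffusion_adapted. Qed.

Lemma localized_diffusion_joint j t : 0 <= t -> jointly_measurable t (localized_diffusion N j).
Proof.
move=> t0; apply: measurable_left_cont => // [s /andP[s0 _]|w s /andP[s0 _]].
  exact: (adapted_measurable hW s0 (@localized_diffusion_adapted j s s0)).
exact: localized_diffusion_left.
Qed.

(** Since om_i v_i is at most the norm of v, the sum of om_i^2 u_i v_i is at most |u| |v|, hence at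
    most (|u| + |v|)^2. *)
Lemma sites_energy_le n m s w : 0 <= s ->
  \sum_(i <- sites m) om i ^+ 2 * (localized_diffusion N (n, i) s w) ^+ 2 <=
  kappa * localized_energy s w.
Proof.
move=> s0; rewrite /localized_diffusion /localized_energy.
under eq_bigr do rewrite exprMn diffusion_sqr//=.
have -> : \1_(B s) w ^+ 2 = \1_(B s) w :> R.
  by rewrite indicE; case: (_ \in _); rewrite ?expr1n ?expr0n.
rewrite (eq_bigr (fun i => (kappa * \1_(B s) w) * (om i * x 0 s i w * (om i * x 1 s i w)))); last first.
  by move=> i _; ring.
rewrite -mulr_sumr -mulrA ler_pM2l// ler_wpM2l//.
have s1 := path_summable 1 w s0; have sm0 := path_summable 0 w s0.
apply: (@le_trans _ _ (\sum_(i <- sites m) om i * x 0 s i w * norm (x 1 s ^~ w))).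
  apply: ler_sum => i _; rewrite ler_wpM2l ?mulr_ge0 ?path_ge0//.
  by have := summable_le hom i s1; rewrite ler_pdivlMr ?(weight_gt0 hom)// mulrC.
rewrite -mulr_suml expr2; apply: ler_pM.
- by rewrite sumr_ge0// => i _; rewrite mulr_ge0// path_ge0.
- exact: path_norm_ge0.
- apply: le_trans (norm_le_total 0 w s0).
  rewrite -lee_fin -(dominated_esum om0 om0 ler01 (L := 1) _ sm0); last by move=> i; rewrite mul1r.
  rewrite -sumEFin; apply: (sum_sites_le_esum (f := fun i => (om i * x 0 s i w)%:E)) => i.
  by rewrite lee_fin mulr_ge0// path_ge0.
- exact: norm_le_total.
Qed.

Lemma sum_energy_le n m t : 0 <= t ->
  \sum_(i <- sites m) om i ^+ 2 * fine (energy P t (localized_diffusion N (n, i))) <=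
  kappa * \int[leb]_(s in `]0, t]) mean_energy s.
Proof.
move=> t0; have [iY _ <-] := strip_energy t0.
pose Z i s w := localized_diffusion N (n, i) s w ^+ 2.
pose C i := Num.sqrt (kappa * (N%:R / om i) * (N%:R / om i)) ^+ 2.
have ZC i s w : 0 <= s <= t -> 0 <= Z i s w <= C i.
  move=> /andP[s0 _]; rewrite sqr_ge0/= /Z /C -[leLHS]real_normK ?num_real//.
  by rewrite lerXn2r ?nnegrE ?sqrtr_ge0//; exact: (localized_diffusion_bound N (n, i) w s0).
have jZ i : jointly_measurable t (Z i).
  by apply: measurable_funX; exact: localized_diffusion_joint.
have mZ i s : 0 <= s <= t -> measurable_fun setT (Z i s).
  move=> /andP[s0 _]; apply: measurable_funX.
  exact: (adapted_measurable hW s0 (@localized_diffusion_adapted (n, i) s s0)).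
have bs i := bounded_strip t0 (jZ i) (ZC i) (mZ i).
have iZ i w : leb.-integrable `]0, t] (EFin \o (Z i ^~ w)).
  apply: (bounded_integrable_oc (M := C i)); first exact: jointly_measurable_section.
  move=> s /andP[s0 st]; have /andP[h1 h2] : 0 <= Z i s w <= C i by apply: ZC; rewrite (ltW s0).
  by rewrite ger0_norm.
have eE i : fine (energy P t (localized_diffusion N (n, i))) = \int[P]_w (\int[leb]_(s in `]0, t]) Z i s w).
  rewrite /energy /Rintegral; congr fine; apply: eq_integral => w _.
  by rewrite fineK//; exact: integrable_fin_num (iZ i w).
under eq_bigr do rewrite eE.
have iw i : P.-integrable setT (EFin \o (fun w => om i ^+ 2 * \int[leb]_(s in `]0, t]) Z i s w)).
  by have [h _ _] := bs i; apply: eq_integrable (integrableZl measurableT (om i ^+ 2) h).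
rewrite (eq_bigr (fun i => \int[P]_w (om i ^+ 2 * \int[leb]_(s in `]0, t]) Z i s w))); last first.
  by move=> i _; have [h _ _] := bs i; rewrite RintegralZl.
have [is_ <-] := Rintegral_sum (sites m) measurableT iw.
rewrite -RintegralZl//; apply: le_Rintegral => //.
  exact: rintegrableZl.
move=> w _.
have iwZ i := rintegrableZl (measurable_oc 0 t) (om i ^+ 2) (iZ i w).
rewrite (eq_bigr (fun i => \int[leb]_(s in `]0, t]) (om i ^+ 2 * Z i s w))); last first.
  by move=> i _; rewrite RintegralZl.
have mL := measurable_oc 0 t.
have [isZ <-] := Rintegral_sum (sites m) mL iwZ.
have iE : leb.-integrable `]0, t] (EFin \o (localized_energy ^~ w)).
  apply: (bounded_integrable_oc (M := N%:R ^+ 2)).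
    exact: jointly_measurable_section (localized_energy_joint t0).
  by move=> s /andP[s0 _]; apply: localized_energy_norm; exact: ltW.
rewrite -RintegralZl//; apply: le_Rintegral => //.
  exact: rintegrableZl.
move=> s; rewrite /= in_itv/= => /andP[s0 _].
by apply: sites_energy_le; exact: ltW.
Qed.

Lemma path_integral_joint n i t : 0 <= t ->
  jointly_measurable t (fun s w => avg a (x n s ^~ w) i) /\
  jointly_measurable t (fun s w => x n s i w).
Proof.
move=> t0; split; apply: measurable_left_cont => //.
- by move=> s /andP[s0 _]; apply: (adapted_measurable hW s0); exact: avg_adapted.
- by move=> w s /andP[s0 _]; apply: half_continuous_left => //; exact: avg_continuous_path.
- by move=> s /andP[s0 _]; apply: (adapted_measurable hW s0); exact: xad.
- by move=> w s /andP[s0 _]; apply: half_continuous_left => //; exact: continuous_path.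
Qed.

Lemma avg_path_integrable n i t w : 0 <= t ->
  leb.-integrable `]0, t] (EFin \o (fun s => avg a (x n s ^~ w) i)).
Proof.
by move=> t0; apply: half_continuous_integrable => //; exact: avg_continuous_path.
Qed.

Lemma path_integrable n i t w : 0 <= t ->
  leb.-integrable `]0, t] (EFin \o (fun s => x n s i w)).
Proof.
by move=> t0; apply: half_continuous_integrable => //; exact: continuous_path.
Qed.

Lemma norm_path_joint n t : 0 <= t -> jointly_measurable t (fun s w => norm (x n s ^~ w)).
Proof.
move=> t0; apply: measurable_left_cont => // [s /andP[s0 _]|w s /andP[s0 _]].
  by apply: (adapted_measurable hW s0); exact: norm_adapted.
by apply: half_continuous_left => //; exact: norm_continuous_path.
Qed.

Lemma norm_path_integrable n t w : 0 <= t ->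
  leb.-integrable `]0, t] (EFin \o (fun s => norm (x n s ^~ w))).
Proof.
by move=> t0; apply: half_continuous_integrable => //; exact: norm_continuous_path.
Qed.

Lemma measurable_path_integral t (f : R -> T -> R) : jointly_measurable t f ->
  (forall s w, 0 < s <= t -> 0 <= f s w) ->
  measurable_fun setT (fun w => \int[leb]_(s in `]0, t]) f s w).
Proof.
move=> jf f0; rewrite /Rintegral.
apply: (measurableT_comp (fine_measurable measurableT)).
have mD : measurable (`]0, t]%classic : set R) by exact: measurable_itv.
have := @measurable_tonelli_strip2 _ T R `]0%R, t]%classic mD (fun z => (f z.1 z.2)%:E).
apply; first exact/measurable_EFinP.
by move=> z [/=]; rewrite in_itv/= => zt _; rewrite lee_fin f0.
Qed.

Lemma noise_partE j t w : 0 <= t -> noise_part j t w =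
  x j.1 t j.2 w - 1 - ((\int[leb]_(s in `]0, t]) avg a (x j.1 s ^~ w) j.2) -
    \int[leb]_(s in `]0, t]) x j.1 s j.2 w).
Proof.
move=> t0; rewrite /noise_part RintegralB//; first exact: avg_path_integrable.
exact: path_integrable.
Qed.

Lemma noise_part_measurable j t : 0 <= t -> measurable_fun setT (noise_part j t).
Proof.
move=> t0; have [j1 j2] := path_integral_joint j.1 j.2 t0.
have -> : noise_part j t = fun w => x j.1 t j.2 w - 1 -
    ((\int[leb]_(s in `]0, t]) avg a (x j.1 s ^~ w) j.2) - \int[leb]_(s in `]0, t]) x j.1 s j.2 w).
  by apply/funext => w; exact: noise_partE.
apply: measurable_funB.
  apply: measurable_funB => //; exact: (adapted_measurable hW t0 (@xad _ _ _ t0)).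
apply: measurable_funB; apply: measurable_path_integral => //.
- by move=> s w /andP[s0 _]; apply: (avg_ge0 ha); apply: path_summable; exact: ltW.
- by move=> s w /andP[s0 _]; apply: path_ge0; exact: ltW.
Qed.

Definition one_norm : R := norm (fun=> 1).

Lemma summable_one : summable om (fun=> 1).
Proof.
split=> //; rewrite (eq_esum (b := fun i => (om i)%:E)); last by move=> i _; rewrite mulr1.
exact: (weight_summable hom).
Qed.

Let om1 i : om i <= 1 * om i. Proof. by rewrite mul1r. Qed.

Lemma sites_wsum_le (f : I -> R) m : summable om f ->
  \sum_(i <- sites m) om i * f i <= norm f.
Proof.
move=> sf; rewrite -lee_fin -(dominated_esum om0 om0 ler01 om1 sf) -sumEFin.
apply: (sum_sites_le_esum (f := fun i => (om i * f i)%:E)) => i.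
by rewrite lee_fin mulr_ge0//; have [] := sf.
Qed.

Lemma sites_avg_le (f : I -> R) m : summable om f ->
  \sum_(i <- sites m) om i * avg a f i <= K * norm f.
Proof.
move=> sf; rewrite -lee_fin; apply: le_trans (sum_avg_le ha hom K0 hK sf).
rewrite -sumEFin; apply: (sum_sites_le_esum (f := fun i => (om i * avg a f i)%:E)) => i.
by rewrite lee_fin mulr_ge0// (avg_ge0 ha i sf).
Qed.

(** The outflow term integrates to something nonpositive and is dropped; the inflow is summed by
    [sites_avg_le]. *)
Lemma partial_norm_le n m t w : 0 <= t ->
  \sum_(i <- sites m) om i * x n t i w <= one_norm + K * (\int[leb]_(s in `]0, t]) norm (x n s ^~ w))
    + \sum_(i <- sites m) om i * noise_part (n, i) t w.
Proof.
move=> t0.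
have mL := measurable_oc 0 t.
have e i : x n t i w = 1 + (\int[leb]_(s in `]0, t]) avg a (x n s ^~ w) i) -
    (\int[leb]_(s in `]0, t]) x n s i w) + noise_part (n, i) t w.
  by rewrite noise_partE//=; ring.
have le1 i : om i * x n t i w <= om i * 1 + om i * (\int[leb]_(s in `]0, t]) avg a (x n s ^~ w) i) +
    om i * noise_part (n, i) t w.
  rewrite -!mulrDr ler_wpM2l// {1}e lerD2r gerBl.
  apply: fine_ge0; apply: integral_ge0 => s; rewrite /= in_itv/= => /andP[s0 _].
  by rewrite lee_fin path_ge0// ltW.
apply: (le_trans (ler_sum _ (fun i _ => le1 i))).
rewrite !big_split/= lerD2r; apply: lerD; first exact: sites_wsum_le summable_one.
have iav i := rintegrableZl mL (om i) (avg_path_integrable n i w t0).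
rewrite (eq_bigr (fun i => \int[leb]_(s in `]0, t]) (om i * avg a (x n s ^~ w) i))); last first.
  by move=> i _; rewrite RintegralZl//; exact: avg_path_integrable.
have [is_ <-] := Rintegral_sum (sites m) mL iav.
have iK := rintegrableZl mL K (norm_path_integrable n w t0).
rewrite -RintegralZl//; last exact: norm_path_integrable.
apply: le_Rintegral => // s; rewrite /= in_itv/= => /andP[s0 _].
by apply: sites_avg_le; apply: path_summable; exact: ltW.
Qed.

Lemma bounded_until_measurable t : 0 <= t -> measurable (B t).
Proof. by move=> t0; apply: (noise_measurable hW t0); exact: bounded_until_F. Qed.

(** Noises of one type at distinct sites are uncorrelated, so [ito_combo_le] applies with the
    weights [om]; on [B t] the localized integrand is the true one. *)
Lemma sites_noise_le n m t : 0 <= t ->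
  (\int[P]_(w in B t) ((\sum_(i <- sites m) om i * noise_part (n, i) t w) ^+ 2)%:E <=
   (4 * (kappa * \int[leb]_(s in `]0, t]) mean_energy s))%:E)%E.
Proof.
move=> t0; pose js : seq J := [seq (n, i) | i <- sites m].
pose e j := fine (energy P t (localized_diffusion N j)).
have Kj j s w : 0 <= s -> s <= t -> `|localized_diffusion N j s w| <=
    Num.sqrt (kappa * (N%:R / om j.2) * (N%:R / om j.2)).
  by move=> s0 _; exact: localized_diffusion_bound.
have ld j w r : 0 < r <= t -> left_cont (localized_diffusion N j ^~ w) r.
  by move=> /andP[r0 _]; exact: localized_diffusion_left.
have la j r : 0 <= r -> r <= t -> measurable_wrt (F r) (localized_diffusion N j r).
  by move=> r0 _; exact: localized_diffusion_adapted.
have := @ito_combo_le _ _ _ P F J W pair_cov hW pair_cov1 t (B t)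
  (fun m' => grid2 t t m') (fun m' => (m'.+1 + m'.+1)%N) t0 (bounded_until_measurable t0)
  (fun m' => grid2_homo m' t0 (lexx t)) (fun m' => grid2_partition m' t0 (lexx t))
  js (fun j => om j.2) diffusion (localized_diffusion N) (fun j => noise_part j t)
  (fun m' j k => localized_diffusion N j (grid2 t t m' k)) e.
have -> : \sum_(j <- js) om j.2 ^+ 2 * e j =
    \sum_(i <- sites m) om i ^+ 2 * fine (energy P t (localized_diffusion N (n, i))).
  by rewrite big_map.
under eq_integral do rewrite big_map/=.
move=> h; apply: le_trans (h _ _ _ _ _ _ _ _ _) _.
- by rewrite map_inj_uniq ?uniq_sites// => i j [].
- move=> j k /mapP[i _ ->] /mapP[i' _ ->] ii; rewrite /pair_cov /noise_cov/=.
  by rewrite ifN//; apply: contraNneq ii => ->.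
- by move=> j; exact: xito.
- by move=> j; exact: noise_part_measurable.
- by move=> j; exact: localized_diffusion_joint.
- move=> j s w Bw /andP[_ st]; rewrite /localized_diffusion indicE mem_set ?mul1r//.
  exact: bounded_until_mono st _ Bw.
- by move=> m' j k kn; exact: (left_cont_coefs t0 (lexx t) (la j) (Kj j) kn).
- by move=> j; exact: (left_cont_energy hW t0 (lexx t) (la j) (Kj j) (ld j)).
- move=> j; rewrite /e fineK// ge0_fin_numE; last exact: energy_ge0.
  apply: (@le_lt_trans _ _ (\int[P]_w (Num.sqrt (kappa * (N%:R / om j.2) * (N%:R / om j.2)) ^+ 2 * t)%:E)%E).
    apply: ge0_le_integral => //.
    + by move=> w _; apply: integral_ge0 => s _; rewrite lee_fin sqr_ge0.
    + by apply: measurable_path_energy; exact: localized_diffusion_joint.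
    + move=> w _.
      apply: (@le_trans _ _ (\int[leb]_(s in `]0%R, t]) (Num.sqrt (kappa * (N%:R / om j.2) * (N%:R / om j.2)) ^+ 2)%:E)%E).
        apply: ge0_le_integral => //.
        * by move=> s _; rewrite lee_fin sqr_ge0.
        * apply/measurable_EFinP; apply: measurable_funX.
          exact: (jointly_measurable_section w (localized_diffusion_joint j t0)).
        * move=> s; rewrite /= in_itv/= => /andP[s0 st]; rewrite lee_fin.
          rewrite -[leLHS]real_normK ?num_real// lerXn2r ?nnegrE ?sqrtr_ge0//.
          by apply: Kj => //; exact: ltW.
      set c' := _ ^+ 2; have ic : leb.-integrable `]0, t] (EFin \o (fun=> c')).
        by apply: (bounded_integrable_oc (M := `|c'|)).
      have mL := measurable_oc 0 t.
      rewrite -[leLHS](fineK (integrable_fin_num mL ic)) lee_fin.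
      by have := Rintegral_cst_oc c' t0; rewrite /Rintegral subr0 => ->.
  by rewrite integral_cst//; have /= -> := @probability_setT _ _ _ P; rewrite mule1 ltry.
rewrite lee_fin ler_pM2l//; exact: sum_energy_le.
Qed.

(** The three terms of [partial_norm_le] are squared with a factor 3 each. The time integral brings
    [t] by [Rintegral_sqr_le], and the noise term brings 12 as 3 times the 4 of [sites_noise_le]. *)
Lemma localized_norm_le n m t : 0 <= t ->
  (\int[P]_(w in B t) ((\sum_(i <- sites m) om i * x n t i w) ^+ 2)%:E <=
   (3 * one_norm ^+ 2 + (3 * K ^+ 2 * t + 12 * kappa) * \int[leb]_(s in `]0, t]) mean_energy s)%:E)%E.
Proof.
move=> t0; have [iY _ eY] := strip_energy t0.
have mG := bounded_until_measurable t0.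
pose S w := \sum_(i <- sites m) om i * x n t i w.
pose M w := \sum_(i <- sites m) om i * noise_part (n, i) t w.
pose Y w := \int[leb]_(s in `]0, t]) localized_energy s w.
have mS : measurable_fun setT S.
  apply: measurable_sum => i; apply: measurable_funM => //.
  exact: (adapted_measurable hW t0 (@xad _ _ _ t0)).
have mM : measurable_fun setT M.
  by apply: measurable_sum => i; apply: measurable_funM => //; exact: noise_part_measurable.
have mY : measurable_fun setT Y by apply/measurable_EFinP; exact: measurable_int iY.
have Y0 w : 0 <= Y w.
  by apply: fine_ge0; apply: integral_ge0 => s _; rewrite lee_fin localized_energy_ge0.
have c0 : 0 <= one_norm by exact: norm_ge0 hom _ summable_one.
pose c1 := 3 * one_norm ^+ 2; pose c2 := 3 * K ^+ 2 * t.
have c10 : 0 <= c1 by rewrite mulr_ge0// sqr_ge0.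
have c20 : 0 <= c2 by rewrite !mulr_ge0// sqr_ge0.
have key w : B t w -> S w ^+ 2 <= c1 + c2 * Y w + 3 * M w ^+ 2.
  move=> Bw; pose A := \int[leb]_(s in `]0, t]) norm (x n s ^~ w).
  have S0 : 0 <= S w by rewrite sumr_ge0// => i _; rewrite mulr_ge0// path_ge0.
  have SM : S w <= one_norm + K * A + M w by exact: partial_norm_le.
  have jn := jointly_measurable_section w (norm_path_joint n t0).
  have iE : leb.-integrable `]0, t] (EFin \o (localized_energy ^~ w)).
    apply: (bounded_integrable_oc (M := N%:R ^+ 2)).
      exact: (jointly_measurable_section w (localized_energy_joint t0)).
    by move=> s /andP[s0 _]; apply: localized_energy_norm; exact: ltW.
  have nb s : 0 < s <= t -> `|norm (x n s ^~ w)| <= N%:R.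
    move=> /andP[s0 st]; rewrite ger0_norm ?path_norm_ge0 ?(ltW s0)//.
    apply: le_trans (norm_le_total n w (ltW s0)) _; apply: Bw.
    by rewrite (ltW s0).
  have A2 : A ^+ 2 <= t * Y w.
    apply: le_trans (Rintegral_sqr_le t0 jn nb) _; rewrite ler_wpM2l//.
    apply: le_Rintegral => //.
      apply: (bounded_integrable_oc (M := N%:R ^+ 2)); first exact: measurable_funX.
      by move=> s st; rewrite normrX lerXn2r ?nnegrE//; exact: nb.
    move=> s; rewrite /= in_itv/= => /andP[s0 st].
    rewrite /localized_energy indicE mem_set ?mul1r; last exact: bounded_until_mono st _ Bw.
    have s0' := ltW s0.
    by rewrite lerXn2r ?nnegrE ?path_norm_ge0 ?total_norm_ge0// norm_le_total.
  have h1 : S w ^+ 2 <= (one_norm + K * A + M w) ^+ 2.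
    by rewrite lerXn2r ?nnegrE// (le_trans S0 SM).
  apply: (le_trans h1); rewrite /c1 /c2.
  have : (one_norm + K * A + M w) ^+ 2 <= 3 * one_norm ^+ 2 + 3 * (K * A) ^+ 2 + 3 * M w ^+ 2.
    rewrite -subr_ge0.
    rewrite (_ : _ - _ = (one_norm - K * A) ^+ 2 + (one_norm - M w) ^+ 2 + (K * A - M w) ^+ 2); last by ring.
    by rewrite !addr_ge0// sqr_ge0.
  move=> /le_trans; apply; rewrite lerD2r lerD2l exprMn.
  rewrite (_ : 3 * K ^+ 2 * t * Y w = 3 * (K ^+ 2 * (t * Y w))); last by ring.
  by rewrite ler_pM2l// ler_wpM2l ?sqr_ge0.
have mEY : measurable_fun setT (EFin \o Y) by exact/measurable_EFinP.
have mM2 : measurable_fun setT (fun w => (M w ^+ 2)%:E).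
  by apply/measurable_EFinP; exact: measurable_funX.
apply: (@le_trans _ _ (\int[P]_(w in B t) (c1%:E + c2%:E * (Y w)%:E + 3%:E * (M w ^+ 2)%:E))%E).
  apply: ge0_le_integral => //.
  - by move=> w _; rewrite lee_fin sqr_ge0.
  - by apply/measurable_EFinP; apply: measurable_funTS; exact: measurable_funX.
  - apply: measurable_funTS; apply: emeasurable_funD; last exact: measurable_funeM.
    by apply: emeasurable_funD => //; exact: measurable_funeM.
have g1 w : (0 <= c1%:E + c2%:E * (Y w)%:E)%E.
  by rewrite -EFinM -EFinD lee_fin addr_ge0// mulr_ge0.
have g2 w : (0 <= 3%:E * (M w ^+ 2)%:E)%E.
  by rewrite -EFinM lee_fin mulr_ge0// sqr_ge0.
have m1 : measurable_fun setT (fun w => c1%:E + c2%:E * (Y w)%:E)%E.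
  by apply: emeasurable_funD => //; exact: measurable_funeM.
have m2 : measurable_fun setT (fun w => 3%:E * (M w ^+ 2)%:E)%E by exact: measurable_funeM.
rewrite ge0_integralD//; [|exact: measurable_funTS|exact: measurable_funTS].
rewrite [leRHS](_ : _ = (c1 + c2 * \int[leb]_(s in `]0, t]) mean_energy s)%:E +
    3%:E * (4 * (kappa * \int[leb]_(s in `]0, t]) mean_energy s))%:E)%E; last first.
  by rewrite -EFinM -EFinD /c1 /c2; congr (_%:E); ring.
apply: leeD.
  apply: (@le_trans _ _ (\int[P]_w (c1%:E + c2%:E * (Y w)%:E))%E).
    by apply: ge0_subset_integral.
  rewrite ge0_integralD; [|exact: measurableT|by move=> w _; rewrite lee_fin
    |exact: measurable_cst|by move=> w _; rewrite -EFinM lee_fin mulr_ge0|exact: measurable_funeM].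
  rewrite integral_cst//; have /= -> := @probability_setT _ _ _ P; rewrite mule1 EFinD leeD2l//.
  rewrite ge0_integralZl_EFin//; last by move=> w _; rewrite lee_fin.
  have -> : (\int[P]_w (Y w)%:E)%E = (\int[leb]_(s in `]0, t]) mean_energy s)%:E.
    by rewrite -eY -[LHS]fineK//; exact: (integrable_fin_num measurableT iY).
  by rewrite -EFinM.
rewrite ge0_integralZl_EFin//.
- by rewrite lee_pmul2l//; exact: sites_noise_le.
- by move=> w _; rewrite lee_fin sqr_ge0.
- exact: measurable_funTS.
Qed.

Lemma sites_wsum_cvg (f : I -> R) : summable om f ->
  (\sum_(i <- sites m) om i * f i) @[m --> \oo] --> norm f.
Proof.
move=> sf; have [f0 _] := sf.
have h0 i : (0 <= (om i * f i)%:E)%E by rewrite lee_fin mulr_ge0.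
have := cvg_sum_sites h0; rewrite (dominated_esum om0 om0 ler01 om1 sf) => h.
move/fine_cvgP : h => [_]; apply: cvg_trans; apply: near_eq_cvg; apply: nearW => m /=.
by rewrite sumEFin.
Qed.

Lemma localized_norm_sqr_le n t : 0 <= t ->
  (\int[P]_(w in B t) ((norm (x n t ^~ w)) ^+ 2)%:E <=
   (3 * one_norm ^+ 2 + (3 * K ^+ 2 * t + 12 * kappa) * \int[leb]_(s in `]0, t]) mean_energy s)%:E)%E.
Proof.
move=> t0; have mG := bounded_until_measurable t0.
apply: (@integral_le_nondecreasing_limit _ _ _ P (B t)
  (fun m w => ((\sum_(i <- sites m) om i * x n t i w) ^+ 2)%:E)) => //.
- move=> m; apply/measurable_EFinP; apply: measurable_funTS; apply: measurable_funX.
  apply: measurable_sum => i; apply: measurable_funM => //.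
  exact: (adapted_measurable hW t0 (@xad _ _ _ t0)).
- by move=> m w _; rewrite lee_fin sqr_ge0.
- move=> w _ m m' mm; have s0 l : 0 <= \sum_(i <- sites l) om i * x n t i w.
    by rewrite sumr_ge0// => i _; rewrite mulr_ge0// path_ge0.
  rewrite lee_fin lerXn2r ?nnegrE//.
  have := @nondecreasing_sum_sites _ _ (fun i => (om i * x n t i w)%:E) _ m m' mm.
  by rewrite !sumEFin lee_fin; apply => i; rewrite lee_fin mulr_ge0// path_ge0.
- move=> w _; apply: cvg_EFin; first exact: nearW.
  have c := sites_wsum_cvg (path_summable n w t0).
  exact: (cvgM c c).
- by move=> m; exact: localized_norm_le.
Qed.

(** The inequality (|u| + |v|)^2 <= 2 |u|^2 + 2 |v|^2 multiplies the previous constants by 4. *)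
Lemma mean_energy_le t : 0 <= t -> mean_energy t <=
  12 * one_norm ^+ 2 + (12 * K ^+ 2 * t + 48 * kappa) * \int[leb]_(s in `]0, t]) mean_energy s.
Proof.
move=> t0; have mG := bounded_until_measurable t0.
have mn n : measurable_fun setT (fun w => norm (x n t ^~ w) ^+ 2).
  by apply: measurable_funX; exact: (adapted_measurable hW t0 (norm_adapted n t0)).
have E : (mean_energy t)%:E = (\int[P]_(w in B t) (total_norm t w ^+ 2)%:E)%E.
  rewrite /mean_energy /Rintegral fineK; last exact: (integrable_fin_num measurableT (int_energy t0)).
  rewrite [RHS]integral_mkcond; apply: eq_integral => w _.
  rewrite patchE /localized_energy indicE; case: (w \in _); first by rewrite mul1r.
  by rewrite mul0r.
rewrite -lee_fin E.
pose b := 3 * one_norm ^+ 2 + (3 * K ^+ 2 * t + 12 * kappa) * \int[leb]_(s in `]0, t]) mean_energy s.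
apply: (@le_trans _ _ (2%:E * \int[P]_(w in B t) (norm (x 0 t ^~ w) ^+ 2)%:E +
    2%:E * \int[P]_(w in B t) (norm (x 1 t ^~ w) ^+ 2)%:E)%E).
  have mE n : measurable_fun (B t) (fun w => (norm (x n t ^~ w) ^+ 2)%:E).
    by apply/measurable_EFinP; exact: measurable_funTS.
  have n0 n w : (0 <= (norm (x n t ^~ w) ^+ 2)%:E)%E by rewrite lee_fin sqr_ge0.
  rewrite -!ge0_integralZl_EFin// -ge0_integralD//; last 4 first.
  - by move=> w _; rewrite mule_ge0.
  - exact: measurable_funeM.
  - by move=> w _; rewrite mule_ge0.
  - exact: measurable_funeM.
  apply: ge0_le_integral => //.
  - by move=> w _; rewrite lee_fin sqr_ge0.
  - apply/measurable_EFinP; apply: measurable_funTS; apply: measurable_funX.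
    exact: (adapted_measurable hW t0 (total_norm_adapted t0)).
  - by apply: emeasurable_funD; exact: measurable_funeM.
  - move=> w _; rewrite -!EFinM -EFinD lee_fin /total_norm.
    have := sqrB_le (norm (x 0 t ^~ w)) (- norm (x 1 t ^~ w)).
    by rewrite opprK sqrrN.
apply: (le_trans (lee_twice (localized_norm_sqr_le 0 t0) (localized_norm_sqr_le 1 t0))).
by rewrite lee_fin le_eqVlt; apply/orP; left; apply/eqP; ring.
Qed.

(** The result is uniform in [N]; the crude bound by the square of [N] serves to make Gronwall's
    inequality applicable. *)
Lemma mean_energy_gronwall T0 t : 0 <= t <= T0 -> mean_energy t <=
  2 * (12 * one_norm ^+ 2) * expR (2 * (12 * K ^+ 2 * T0 + 48 * kappa) * T0).
Proof.
move=> /andP[t0 tT]; have T00 := le_trans t0 tT.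
have c0 : 0 <= 12 * one_norm ^+ 2 by rewrite mulr_ge0// sqr_ge0.
have c2 : 0 < 12 * K ^+ 2 * T0 + 48 * kappa.
  by rewrite ltr_wpDl// ?mulr_gt0// !mulr_ge0// sqr_ge0.
have [_ iM _] := strip_energy T00.
have := @gronwall R T0 (N%:R ^+ 2) (12 * one_norm ^+ 2) (12 * K ^+ 2 * T0 + 48 * kappa) mean_energy
  T00 c0 c2 _ _ _ t.
rewrite t0 tT => /(_ _ _ _ isT) h.
apply: (@le_trans _ _ (2 * (12 * one_norm ^+ 2) * expR (2 * (12 * K ^+ 2 * T0 + 48 * kappa) * t))).
  apply: h.
  - by apply/measurable_EFinP; exact: measurable_int iM.
  - by move=> s /andP[s0 _]; exact: mean_energy_bound.
  - move=> s /andP[s0 sT]; apply: le_trans (mean_energy_le s0) _.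
    rewrite lerD2l ler_wpM2r//.
      apply: fine_ge0; apply: integral_ge0 => r; rewrite /= in_itv/= => /andP[r0 _].
      by rewrite lee_fin; have /andP[] := mean_energy_bound (ltW r0).
    by rewrite lerD2r ler_wpM2l// mulr_ge0// sqr_ge0.
apply: ler_wpM2l; first by rewrite mulr_ge0.
by rewrite ler_expR ler_wpM2l// mulr_ge0// ltW.
Qed.

End apriori.

Definition energy_bound T0 : R :=
  2 * (12 * one_norm ^+ 2) * expR (2 * (12 * K ^+ 2 * T0 + 48 * kappa) * T0).

(** Monotone convergence in [N]: every path is bounded on [[0, t]], so the localization eventually
    has no effect on it. *)
Lemma total_norm_moment T0 t : 0 <= t <= T0 ->
  (\int[P]_w (total_norm t w ^+ 2)%:E <= (energy_bound T0)%:E)%E.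
Proof.
move=> tT; have /andP[t0 _] := tT.
apply: (@integral_le_nondecreasing_limit _ _ _ P setT
  (fun N w => (localized_energy N t w)%:E)) => //.
- move=> N; apply/measurable_EFinP; apply: (adapted_measurable hW t0).
  apply: (localized_adapted N (g := fun s w => total_norm s w ^+ 2)) => //.
  by apply: (adaptedM hW t0); exact: total_norm_adapted.
- by move=> N w _; rewrite lee_fin localized_energy_ge0.
- move=> w _ N N' NN; rewrite lee_fin /localized_energy ler_wpM2r ?sqr_ge0//.
  rewrite !indicE; have [h|_] := boolP (w \in bounded_until N t); last exact: ler0n.
  rewrite mem_set// => r rt; apply: le_trans (set_mem h r rt) _.
  by rewrite ler_nat.
- move=> w _; apply: cvg_near_cst.
  have [C hC] := half_continuous_bounded (@total_norm_continuous w) t0.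
  exists (Num.truncn C).+1 => // N /= hN.
  rewrite /localized_energy indicE mem_set ?mul1r// => r rt.
  apply: le_trans (ler_norm _) _; apply: le_trans (hC r rt) _.
  by apply: ltW; apply: lt_le_trans (truncnS_gt _) _; rewrite ler_nat.
- move=> N; have := @mean_energy_gronwall N T0 t tT.
  rewrite -lee_fin; apply: le_trans; rewrite /mean_energy /Rintegral fineK//.
  have := @bounded_integrable _ _ _ P (localized_energy N t) (N%:R ^+ 2) _ (fun w => localized_energy_norm N w t0).
  move=> h; apply: (integrable_fin_num measurableT); apply: h.
  apply: (adapted_measurable hW t0).
  apply: (localized_adapted N (g := fun s w => total_norm s w ^+ 2)) => //.
  by apply: (adaptedM hW t0); exact: total_norm_adapted.
Qed.

Lemma total_norm_sqint t : 0 <= t -> sqint P setT (total_norm t).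
Proof.
move=> t0; have mt : measurable_fun setT (total_norm t).
  exact: (adapted_measurable hW t0 (total_norm_adapted t0)).
split=> //; apply/integrableP; split.
  by apply/measurable_EFinP; exact: measurable_funX.
under eq_integral do rewrite /= ger0_norm ?sqr_ge0//.
have := @total_norm_moment t t; rewrite t0 lexx => /(_ isT) h.
exact: le_lt_trans h (ltry _).
Qed.

Lemma total_norm_sqr_moment T0 t : 0 <= t <= T0 ->
  \int[P]_w (total_norm t w ^+ 2) <= energy_bound T0.
Proof.
move=> tT; have /andP[t0 _] := tT.
rewrite -lee_fin /Rintegral fineK; first exact: total_norm_moment.
exact: (integrable_fin_num measurableT (total_norm_sqint t0).2).
Qed.

Lemma dominated_sqint t (f : T -> R) L : 0 <= t -> 0 <= L -> measurable_fun setT f ->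
  (forall w, `|f w| <= L * total_norm t w) -> sqint P setT f.
Proof.
move=> t0 L0 mf fL; apply: (@le_sqint _ _ _ _ _ measurableT f (fun w => L * total_norm t w) mf _ (sqintZ measurableT L (total_norm_sqint t0))).
by move=> w _; rewrite (le_trans (fL w))// ler_norm.
Qed.

Lemma dominated_moment T0 t (f : T -> R) L : 0 <= t <= T0 -> 0 <= L -> measurable_fun setT f ->
  (forall w, `|f w| <= L * total_norm t w) -> \int[P]_w (f w ^+ 2) <= L ^+ 2 * energy_bound T0.
Proof.
move=> tT L0 mf fL; have /andP[t0 _] := tT.
apply: (@le_trans _ _ (L ^+ 2 * \int[P]_w (total_norm t w ^+ 2))); last first.
  by rewrite ler_wpM2l ?sqr_ge0//; exact: total_norm_sqr_moment.
have i2 := (total_norm_sqint t0).2.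
rewrite -RintegralZl//; apply: le_Rintegral => //.
- exact: (dominated_sqint t0 L0 mf fL).2.
- exact: rintegrableZl.
- move=> w _; rewrite -exprMn -[leLHS]real_normK ?num_real// lerXn2r ?nnegrE//.
  by rewrite mulr_ge0// total_norm_ge0.
Qed.

Lemma path_dominated n i t w : 0 <= t -> `|x n t i w| <= (om i)^-1 * total_norm t w.
Proof. by move=> t0; rewrite ger0_norm ?path_ge0// mulrC path_le. Qed.

Lemma avg_dominated n i t w : 0 <= t -> `|avg a (x n t ^~ w) i| <= K / om i * total_norm t w.
Proof.
move=> t0; have sf := path_summable n w t0; rewrite ger0_norm ?(avg_ge0 ha i sf)//.
apply: le_trans (avg_le ha hom K0 hK i sf) _.
by rewrite ler_wpM2l ?norm_le_total//; apply: divr_ge0; rewrite ?K0//; exact: om0.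
Qed.

Lemma diffusion_joint j t : 0 <= t -> jointly_measurable t (diffusion j).
Proof.
move=> t0; apply: measurable_left_cont => // [s /andP[s0 _]|w s /andP[s0 _]].
  by apply: (adapted_measurable hW s0); exact: diffusion_adapted.
by apply: half_continuous_left => //; exact: diffusion_continuous_path.
Qed.

Lemma pair_moment_le T0 t i : 0 <= t <= T0 ->
  P.-integrable setT (EFin \o (fun w => x 0 t i w * x 1 t i w)) /\
  \int[P]_w (x 0 t i w * x 1 t i w) <= (om i)^-1 ^+ 2 * energy_bound T0.
Proof.
move=> tT; have /andP[t0 _] := tT.
have oi : 0 <= (om i)^-1 by rewrite invr_ge0; exact: om0.
have mx n : measurable_fun setT (x n t i) by exact: (adapted_measurable hW t0 (@xad n i _ t0)).
have sx n := dominated_sqint t0 oi (mx n) (fun w => path_dominated n i w t0).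
have ip := sqint_mul measurableT (sx 0) (sx 1).
split=> //; apply: (@le_trans _ _ (\int[P]_w (((om i)^-1 * total_norm t w) ^+ 2))).
  apply: le_Rintegral => //; first exact: (sqintZ measurableT _ (total_norm_sqint t0)).2.
  move=> w _; rewrite expr2 ler_pM ?path_ge0//.
    by apply: le_trans (ler_norm _) (path_dominated 0 i w t0).
  by apply: le_trans (ler_norm _) (path_dominated 1 i w t0).
have i2 := (total_norm_sqint t0).2.
rewrite (_ : \int[P]_w _ = \int[P]_w ((om i)^-1 ^+ 2 * total_norm t w ^+ 2)); last first.
  by apply: eq_Rintegral => w _; rewrite exprMn.
rewrite RintegralZl// ler_wpM2l ?sqr_ge0//; exact: total_norm_sqr_moment.
Qed.

Lemma diffusion_energy j t : 0 <= t ->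
  P.-integrable setT (EFin \o (fun w => \int[leb]_(s in `]0, t]) (diffusion j s w ^+ 2))) /\
  leb.-integrable `]0, t] (EFin \o (fun s => \int[P]_w (x 0 s j.2 w * x 1 s j.2 w))) /\
  energy P t (diffusion j) = (kappa * \int[leb]_(s in `]0, t]) \int[P]_w (x 0 s j.2 w * x 1 s j.2 w))%:E.
Proof.
move=> t0.
have mL := measurable_oc 0 t.
have jd : jointly_measurable t (fun s w => diffusion j s w ^+ 2).
  by apply: measurable_funX; exact: diffusion_joint.
have iw w : leb.-integrable `]0, t] (EFin \o (fun s => diffusion j s w ^+ 2)).
  apply: (@half_continuous_integrable _ (fun s => diffusion j s w ^+ 2)) => //.
  by apply: half_continuousM; exact: diffusion_continuous_path.
have jp : jointly_measurable t (fun s w => x 0 s j.2 w * x 1 s j.2 w).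
  have [_ h0] := @path_integral_joint 0 j.2 t t0; have [_ h1] := @path_integral_joint 1 j.2 t t0.
  exact: measurable_funM.
have iwp w : leb.-integrable `]0, t] (EFin \o (fun s => x 0 s j.2 w * x 1 s j.2 w)).
  apply: (@half_continuous_integrable _ (fun s => x 0 s j.2 w * x 1 s j.2 w)) => //.
  by apply: half_continuousM; exact: continuous_path.
have oc s : 0 < s <= t -> 0 <= s <= t by move=> /andP[/ltW -> ->].
have [i1 i2 e] := strip_fubini_ge0 (P := P) (C := (om j.2)^-1 ^+ 2 * energy_bound t) jp
  (fun s w st => mulr_ge0 (path_ge0 0 j.2 w (proj1 (andP (oc s st)))) (path_ge0 1 j.2 w (proj1 (andP (oc s st)))))
  iwp (fun s st => (pair_moment_le j.2 (oc s st)).1) (fun s st => (pair_moment_le j.2 (oc s st)).2).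
have ed w : \int[leb]_(s in `]0, t]) (diffusion j s w ^+ 2) =
    kappa * \int[leb]_(s in `]0, t]) (x 0 s j.2 w * x 1 s j.2 w).
  rewrite -RintegralZl//; apply: eq_Rintegral => s; rewrite inE/= in_itv/= => /andP[s0 _].
  by rewrite diffusion_sqr// ltW.
have i1k : P.-integrable setT (EFin \o (fun w => \int[leb]_(s in `]0, t]) (diffusion j s w ^+ 2))).
  by apply: eq_integrable (integrableZl measurableT kappa i1) => // w _ /=; rewrite ed.
split=> //; split=> //.
rewrite -e -RintegralZl// /energy.
rewrite (eq_integral (fun w => (\int[leb]_(s in `]0, t]) (diffusion j s w ^+ 2))%R%:E)); last first.
  by move=> w _; rewrite /Rintegral fineK//; exact: (integrable_fin_num mL (iw w)).
rewrite -[LHS]fineK; last exact: (integrable_fin_num measurableT i1k).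
by congr (_%:E); apply: eq_Rintegral => w _; rewrite ed.
Qed.

Lemma bounded_until_eventually t w : 0 <= t -> \forall N \near \oo, bounded_until N t w.
Proof.
move=> t0; have [C hC] := half_continuous_bounded (@total_norm_continuous w) t0.
exists (Num.truncn C).+1 => // N /= hN r rt.
apply: le_trans (ler_norm _) _; apply: le_trans (hC r rt) _.
by apply: ltW; apply: lt_le_trans (truncnS_gt _) _; rewrite ler_nat.
Qed.

(** Along each path the localized integrand equals the full one for large [N], and the squared
    difference is always dominated by the square of the full integrand, whose energy is finite. *)
Lemma localized_diffusion_cvg j t : 0 <= t ->
  energy P t (fun s w => localized_diffusion N j s w - diffusion j s w) @[N --> \oo] --> 0%E.
Proof.
move=> t0; have [id [_ _]] := diffusion_energy j t0.
have mL := measurable_oc 0 t.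
have jD N : jointly_measurable t (fun s w => localized_diffusion N j s w - diffusion j s w).
  apply: jointly_measurableB; [exact: localized_diffusion_joint|exact: diffusion_joint].
have Dle N s w : (localized_diffusion N j s w - diffusion j s w) ^+ 2 <= diffusion j s w ^+ 2.
  rewrite /localized_diffusion indicE; case: (_ \in _); rewrite ?mul1r ?subrr ?expr0n ?sqr_ge0//.
  by rewrite mul0r sub0r sqrrN.
have iw w : leb.-integrable `]0, t] (EFin \o (fun s => diffusion j s w ^+ 2)).
  apply: (@half_continuous_integrable _ (fun s => diffusion j s w ^+ 2)) => //.
  by apply: half_continuousM; exact: diffusion_continuous_path.
have iN N w : leb.-integrable `]0, t] (EFin \o (fun s => (localized_diffusion N j s w - diffusion j s w) ^+ 2)).
  apply: le_integrable (iw w) => //.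
    apply/measurable_EFinP; apply: measurable_funX; exact: (jointly_measurable_section w (jD N)).
  by move=> s _ /=; rewrite lee_fin !ger0_norm ?sqr_ge0.
pose e N w := \int[leb]_(s in `]0, t]) ((localized_diffusion N j s w - diffusion j s w) ^+ 2).
have eE N w : (\int[leb]_(s in `]0%R, t]) ((localized_diffusion N j s w - diffusion j s w) ^+ 2)%:E)%E = (e N w)%:E.
  by rewrite /e /Rintegral fineK//; exact: (integrable_fin_num mL (iN N w)).
have me N : measurable_fun setT (e N).
  apply/measurable_EFinP; apply: eq_measurable_fun (measurable_path_energy (jD N)) => w _.
  exact: eE.
have e0 N w : 0 <= e N w.
  by rewrite -lee_fin -eE; apply: integral_ge0 => s _; rewrite lee_fin sqr_ge0.
have ele N w : `|e N w| <= \int[leb]_(s in `]0, t]) (diffusion j s w ^+ 2).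
  by rewrite ger0_norm//; apply: le_Rintegral => // s _; exact: Dle.
have ecv w : e N w @[N --> \oo] --> (0 : R).
  apply: cvg_near_cst; apply: filterS (bounded_until_eventually w t0) => N Bw.
  rewrite /e (_ : \int[leb]_(s in `]0, t]) _ = \int[leb]_(s in `]0, t]) 0).
    by rewrite Rintegral_cst_oc// mul0r.
  apply: eq_Rintegral => s; rewrite inE/= in_itv/= => /andP[_ st].
  rewrite /localized_diffusion indicE mem_set ?mul1r ?subrr ?expr0n//.
  exact: bounded_until_mono st _ Bw.
have [_ ce] := @Rintegral_dominated_cvg _ _ _ P setT e (fun=> 0) _ measurableT me (fun w _ => ecv w) id (fun N w _ => ele N w).
move: ce; rewrite (Rintegral_prob_cst P) => ce.
have ie N : P.-integrable setT (EFin \o e N).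
  apply: le_integrable id => //; first exact/measurable_EFinP.
  move=> w _ /=; rewrite lee_fin (le_trans (ele N w))//; exact: ler_norm.
have -> : (fun N => energy P t (fun s w => localized_diffusion N j s w - diffusion j s w)) = EFin \o (fun N => \int[P]_w e N w).
  apply/funext => N; rewrite /energy /= /Rintegral fineK; last exact: (integrable_fin_num measurableT (ie N)).
  by apply: eq_integral => w _; rewrite eE.
by apply/(fine_cvgP _ (0 : R)); split; [exact: nearW|exact: ce].
Qed.

Lemma noise_approx j k s t : 0 <= s -> s <= t -> exists mm : nat -> nat,
  forall l, l \in [:: j; k] ->
    ito_approx P F W t l (diffusion l) (noise_part l t) (fun N => grid2 s t (mm N))
      (fun N => (mm N).+1 + (mm N).+1)%N (fun N i => localized_diffusion N l (grid2 s t (mm N) i)).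
Proof.
move=> s0 st; have t0 := le_trans s0 st.
apply: (@approx_pair_exists _ _ _ P F J W pair_cov hW s t j k diffusion (fun l => noise_part l t)
  localized_diffusion (fun=> 0)) => //.
- by move=> l; exact: xito.
- by move=> l; exact: noise_part_measurable.
- by move=> l; exact: diffusion_joint.
- by move=> N l r r0 _; exact: localized_diffusion_adapted.
- move=> N l; exists (Num.sqrt (kappa * (N%:R / om l.2) * (N%:R / om l.2))) => r w r0 _.
  exact: localized_diffusion_bound.
- by move=> N l w r /andP[r0 _]; exact: localized_diffusion_left.
- by move=> l; exact: localized_diffusion_cvg.
Qed.

Lemma noise_part_sqint j t : 0 <= t -> sqint P setT (noise_part j t).
Proof.
move=> t0; have [mm h] := noise_approx j j t0 (lexx t).
have A := h j (mem_head _ _).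
exact: (ito_approx_sqint hW pair_cov1 t0 (fun m => grid2_homo (mm m) t0 (lexx t))
  (fun m => grid2_partition (mm m) t0 (lexx t)) A).
Qed.

(** Noises at different sites are uncorrelated; at a common site the integrands and their
    approximations coincide, which is the second alternative in [ito_covariance]. *)
Lemma noise_part_covariance j k t : 0 <= t ->
  \int[P]_w (noise_part j t w * noise_part k t w) =
  pair_cov j k * (kappa * \int[leb]_(s in `]0, t]) \int[P]_w (x 0 s j.2 w * x 1 s j.2 w)).
Proof.
move=> t0; have [mm h] := noise_approx j k t0 (lexx t).
have A := h j (mem_head _ _); have A' : _ := h k _.
have {}A' := A' (mem_last j [:: k]).
have [_ [_ eE]] := diffusion_energy j t0.
rewrite (ito_covariance hW pair_cov1 t0 (fun m => grid2_homo (mm m) t0 (lexx t))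
  (fun m => grid2_partition (mm m) t0 (lexx t)) A A').
  by rewrite eE.
rewrite /pair_cov /noise_cov; case: ifPn => [/eqP jk|_]; [right|by left].
have ed : diffusion j = diffusion k.
  by apply/funext => s; apply/funext => w; rewrite /diffusion jk.
by split=> //; apply/funext => N; apply/funext => i; rewrite /localized_diffusion ed.
Qed.

Lemma noise_part_increment j s t (Z : T -> R) : 0 <= s -> s <= t ->
  measurable_wrt (F s) Z -> sqint P setT Z ->
  \int[P]_w (Z w * (noise_part j t w - noise_part j s w)) = 0.
Proof.
move=> s0 st mZ sZ; have [mm h] := noise_approx j j s0 st.
have A := h j (mem_head _ _).
exact: (ito_increment_mart hW pair_cov1 s0 st A (xito j s0) (noise_part_measurable j s0) mZ sZ).
Qed.

Lemma noise_part0 j w : noise_part j 0 w = 0.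
Proof. by rewrite /noise_part x0 Rintegral_oc_set0 subrr subr0. Qed.

(** Coordinates and averages are bounded by multiples of [total_norm], whose second moment is
    controlled, so one criterion covers both. *)
Lemma regular_dominated (f : R -> T -> R) L : 0 <= L -> (forall w, half_continuous (f ^~ w)) ->
  (forall s, 0 <= s -> measurable_wrt (F s) (f s)) ->
  (forall s w, 0 <= s -> `|f s w| <= L * total_norm s w) -> regular P f.
Proof.
move=> L0 cf af fL; split=> // T0 T00; exists (L ^+ 2 * energy_bound T0) => s sT.
have /andP[s0 _] := sT; have mf := adapted_measurable hW s0 (af s s0).
split; first exact: (dominated_sqint s0 L0 mf (fun w => fL s w s0)).
exact: (dominated_moment sT L0 mf (fun w => fL s w s0)).
Qed.

Lemma path_regular n i : regular P (fun s w => x n s i w).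
Proof.
apply: (@regular_dominated _ (om i)^-1).
- by rewrite invr_ge0; exact: om0.
- by move=> w; exact: continuous_path.
- by move=> s s0; exact: xad.
- by move=> s w s0; exact: path_dominated.
Qed.

Lemma avg_regular n i : regular P (fun s w => avg a (x n s ^~ w) i).
Proof.
apply: (@regular_dominated _ (K / om i)).
- by apply: divr_ge0 => //; exact: om0.
- by move=> w; exact: avg_continuous_path.
- by move=> s s0; exact: avg_adapted.
- by move=> s w s0; exact: avg_dominated.
Qed.

Definition path_drift (j : J) s w := avg a (x j.1 s ^~ w) j.2 - x j.1 s j.2 w.

Lemma path_drift_regular j : regular P (path_drift j).
Proof. exact: regularB (avg_regular j.1 j.2) (path_regular j.1 j.2). Qed.

Lemma noise_part_path j s w :
  x j.1 s j.2 w = 1 + (\int[leb]_(r in `]0, s]) path_drift j r w) + noise_part j s w.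
Proof. by rewrite /noise_part /path_drift; ring. Qed.

Lemma primitive_half_continuous (f : R -> T -> R) w : regular P f ->
  half_continuous (fun s => \int[leb]_(r in `]0, s]) f r w).
Proof.
move=> rf; apply/half_continuousP => s s0 e e0.
have s10 : 0 <= s + 1 by rewrite addr_ge0.
have [C hC] := half_continuous_bounded (rf.1 w) s10.
have mf : measurable_fun `]0, s + 1] (f ^~ w) by exact: (jointly_measurable_section w (regular_joint s10 rf)).
have C0 : 0 <= C by rewrite (le_trans _ (hC 0 _)) ?lexx.
have inc p q : 0 <= p -> p <= q -> q <= s + 1 ->
    `|(\int[leb]_(r in `]0, q]) f r w) - \int[leb]_(r in `]0, p]) f r w| <= C * (q - p).
  move=> p0 pq q1; have sub (u v : R) : 0 <= u -> v <= s + 1 -> `]u, v]%classic `<=` `]0, s + 1]%classic.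
    move=> u0 v1 r /=; rewrite !in_itv/= => /andP[ur rv].
    by rewrite (le_lt_trans u0 ur) (le_trans rv v1).
  have iq : leb.-integrable `]0, q] (EFin \o (f ^~ w)).
    apply: (bounded_integrable_oc (M := C)) => [|r /andP[/ltW r0 rq]].
      by apply: measurable_funS mf => //; exact: sub.
    by apply: hC; rewrite r0 (le_trans rq).
  rewrite (Rintegral_cat p0 pq iq) addrC addKr; apply: le_normr_Rintegral_oc => //.
    by apply: measurable_funS mf => //; exact: sub.
  by move=> r /andP[pr rq]; apply: hC; rewrite (le_trans p0 (ltW pr)) (le_trans rq).
exists (Num.min 1 (e / (C + 1))) => [|r r0]; first by rewrite lt_min ltr01 divr_gt0// ltr_wpDl.
rewrite lt_min => /andP[r1 re].
have {}re : C * `|r - s| <= e.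
  apply: (@le_trans _ _ ((C + 1) * (e / (C + 1)))); last by rewrite mulrCA divff ?mulr1// gt_eqF// ltr_wpDl.
  by rewrite ler_pM ?lerDl// ltW.
have [rs|/ltW sr] := leP r s.
  rewrite distrC; apply: le_trans (inc r s r0 rs _) _; first by rewrite lerDl.
  by move: re; rewrite distrC ger0_norm// subr_ge0.
apply: le_trans (inc s r s0 sr _) _; last by move: re; rewrite ger0_norm// subr_ge0.
by move: r1; rewrite ltr_norml => /andP[_]; rewrite ltrBlDl addrC => /ltW; rewrite addrC.
Qed.

(** The second moment is the covariance with itself, [kappa] times the time integral of a bounded
    mixed moment. *)
Lemma noise_part_regular j : regular P (noise_part j).
Proof.
split=> [w|T0 T00].
  have h1 := @continuous_path j.1 j.2 w.
  have h3 := @primitive_half_continuous (path_drift j) w (path_drift_regular j).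
  exact: (@half_continuousB _ _ _ (@half_continuousB _ _ _ h1 (@half_continuous_cst _ 1)) h3).
pose b := (om j.2)^-1 ^+ 2 * energy_bound T0.
have om1' : 0 <= (om j.2)^-1 by rewrite invr_ge0; exact: om0.
have b0 : 0 <= b.
  have T0T : 0 <= T0 <= T0 by rewrite T00 lexx.
  apply: le_trans (pair_moment_le j.2 T0T).2; apply: Rintegral_ge0 => w _.
  by rewrite mulr_ge0// path_ge0.
exists (kappa * (b * T0)) => s /andP[s0 sT]; split; first exact: noise_part_sqint.
rewrite (_ : \int[P]_w _ = \int[P]_w (noise_part j s w * noise_part j s w)); last first.
  by apply: eq_Rintegral => w _; rewrite expr2.
rewrite noise_part_covariance// pair_cov1 mul1r ler_pM2l//.
have [_ [i1 _]] := diffusion_energy j s0.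
apply: le_trans (ler_norm _) _.
apply: (@le_trans _ _ (b * (s - 0))); last by rewrite subr0 ler_wpM2l.
apply: le_normr_Rintegral_oc => //; first by apply/measurable_EFinP; exact: measurable_int i1.
move=> r /andP[/ltW r0 rs]; have rT : 0 <= r <= T0 by rewrite r0 (le_trans rs).
rewrite ger0_norm; first exact: (pair_moment_le j.2 rT).2.
by apply: Rintegral_ge0 => w _; rewrite mulr_ge0// path_ge0.
Qed.

(** * The moment equations *)

Definition moment n m t i j := \int[P]_w (x n t i w * x m t j w).

Lemma moment_ge0 n m t i j : 0 <= t -> 0 <= moment n m t i j.
Proof. by move=> t0; apply: Rintegral_ge0 => w _; rewrite mulr_ge0// path_ge0. Qed.

Lemma momentC n m t i j : moment n m t i j = moment m n t j i.
Proof. by apply: eq_Rintegral => w _; rewrite mulrC. Qed.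

Lemma moment_integrable n m t i j : 0 <= t ->
  P.-integrable setT (EFin \o (fun w => x n t i w * x m t j w)).
Proof. by move=> t0; exact: regular_mul_integrable (path_regular n i) (path_regular m j). Qed.

Lemma moment_time_integrable n m t i j : 0 <= t ->
  leb.-integrable `]0, t] (EFin \o (fun s => moment n m s i j)).
Proof. by move=> t0; have [] := regular_fubini t0 (path_regular n i) (path_regular m j). Qed.

Lemma avg_moment n m t i j : 0 <= t ->
  (\esum_(k in [set: I]) (a i k * moment n m t k j)%:E =
   (\int[P]_w (avg a (x n t ^~ w) i * x m t j w))%:E)%E.
Proof.
move=> t0; have ia := regular_mul_integrable t0 (avg_regular n i) (path_regular m j).
have mx n' k : measurable_fun setT (x n' t k) by exact: (adapted_measurable hW t0 (@xad n' k _ t0)).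
have a0 k : 0 <= a i k := rates_ge0 ha i k.
rewrite /Rintegral fineK; last exact: (integrable_fin_num measurableT ia).
transitivity (\int[P]_w (\esum_(k in [set: I]) (a i k * (x n t k w * x m t j w))%:E))%E.
  rewrite ge0_integral_esum//.
  - apply: eq_esum => k _; rewrite /moment /Rintegral EFinM fineK; last first.
      exact: (integrable_fin_num measurableT (moment_integrable n m k j t0)).
    rewrite -ge0_integralZl//; last by rewrite lee_fin.
      by apply: measurableT_comp => //; exact: measurable_funM.
    by move=> w _; rewrite lee_fin mulr_ge0// path_ge0.
  - by move=> k w _; rewrite lee_fin mulr_ge0// mulr_ge0// path_ge0.
  - by move=> k; apply/measurable_EFinP; apply: measurable_funM => //; exact: measurable_funM.
apply: eq_integral => w _; rewrite EFinM -(avgE ha hom K0 hK i (path_summable n w t0)).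
rewrite -esumZr ?path_ge0//; first by apply: eq_esum => k _; rewrite -EFinM mulrA.
by move=> k; rewrite lee_fin mulr_ge0// path_ge0.
Qed.

Lemma avg_momentE n m t i j : 0 <= t ->
  \int[P]_w (avg a (x n t ^~ w) i * x m t j w) = avg a (fun k => moment n m t k j) i.
Proof. by move=> t0; rewrite /avg /wsum avg_moment. Qed.

Lemma noise_part_drift j k s t : 0 <= s -> s <= t ->
  \int[P]_w (path_drift j s w * (noise_part k t w - noise_part k s w)) = 0.
Proof.
move=> s0 st; apply: noise_part_increment => //.
  by apply: (adaptedB hW) => //; [exact: avg_adapted|exact: xad].
exact: regular_sqint s0 (path_drift_regular j).
Qed.

Lemma noise_part_mean j t : 0 <= t -> \int[P]_w noise_part j t w = 0.
Proof.
move=> t0; rewrite -[RHS](@noise_part_increment j 0 t (fun=> 1))//.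
- by apply: eq_Rintegral => w _; rewrite noise_part0 subr0 mul1r.
- exact: (adapted_cst hW).
- exact: sqint_cst.
Qed.

Lemma moment_equation n m i j t : 0 <= t ->
  let g s := (avg a (fun k => moment n m s k j) i - moment n m s i j) +
    (avg a (fun k => moment n m s i k) j - moment n m s i j) +
    pair_cov (n, i) (m, j) * kappa * moment 0 1 s i i in
  leb.-integrable `]0, t] (EFin \o g) /\
  moment n m t i j = 1 + \int[leb]_(s in `]0, t]) g s.
Proof.
move=> t0 g.
have mL := measurable_oc 0 t.
have [i1 [i2 e]] := semimartingale_product t0 (path_drift_regular (n, i)) (path_drift_regular (m, j))
  (noise_part_regular (n, i)) (noise_part_regular (m, j)) (path_regular n i) (path_regular m j)
  (fun s w _ => noise_part_path (n, i) s w) (fun s w _ => noise_part_path (m, j) s w)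
  (fun s st => noise_part_drift (n, i) (m, j) (proj1 (andP st)) (proj2 (andP st)))
  (fun s st => noise_part_drift (m, j) (n, i) (proj1 (andP st)) (proj2 (andP st)))
  (noise_part_mean (n, i) t0) (noise_part_mean (m, j) t0).
have i3 := moment_time_integrable 0 1 i i t0.
pose k : R := pair_cov (n, i) (m, j) * kappa.
have i3k := rintegrableZl mL k i3.
have e1 s : 0 <= s -> \int[P]_w (path_drift (n, i) s w * x m s j w) =
    avg a (fun k => moment n m s k j) i - moment n m s i j.
  move=> s0; rewrite -avg_momentE// /moment -RintegralB//.
  - by apply: eq_Rintegral => w _; rewrite /path_drift /= mulrBl.
  - exact: regular_mul_integrable (avg_regular n i) (path_regular m j).
  - exact: moment_integrable.
have e2 s : 0 <= s -> \int[P]_w (x n s i w * path_drift (m, j) s w) =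
    avg a (fun k => moment n m s i k) j - moment n m s i j.
  move=> s0.
  have -> : (fun k => moment n m s i k) = (fun k => moment m n s k i) by apply/funext => k'; exact: momentC.
  rewrite -avg_momentE// momentC /moment -RintegralB//.
  - by apply: eq_Rintegral => w _; rewrite /path_drift /= mulrC mulrBl.
  - exact: regular_mul_integrable (avg_regular m j) (path_regular n i).
  - exact: moment_integrable.
have eg s : 0 <= s -> g s = \int[P]_w (path_drift (n, i) s w * x m s j w) +
    \int[P]_w (x n s i w * path_drift (m, j) s w) + k * moment 0 1 s i i.
  by move=> s0; rewrite e1// e2.
have i12 := rintegrableD mL i1 i2.
split.
  apply: eq_integrable (integrableD mL i12 i3k) => // s; rewrite inE/= in_itv/= => /andP[/ltW s0 _].
  by rewrite eg.
rewrite {1}/moment e noise_part_covariance//= -!addrA; congr (_ + _).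
rewrite (_ : \int[leb]_(s in `]0, t]) g s = \int[leb]_(s in `]0, t])
    (\int[P]_w (path_drift (n, i) s w * x m s j w) +
    \int[P]_w (x n s i w * path_drift (m, j) s w) + k * moment 0 1 s i i)); last first.
  by apply: eq_Rintegral => s; rewrite inE/= in_itv/= => /andP[/ltW s0 _]; rewrite eg.
by rewrite RintegralD// RintegralD// addrA RintegralZl// mulrA.
Qed.

(** The weighted double sum is the expectation of a product of two weighted norms; this places the
    moments in the space where the kernel acts. *)
Lemma moment_norm_le n m T0 t : 0 <= t <= T0 ->
  (\esum_(i in [set: I]) \esum_(j in [set: I]) (om i * om j * moment n m t i j)%:E <=
   (energy_bound T0)%:E)%E.
Proof.
move=> tT; have /andP[t0 _] := tT.
have mx n' k : measurable_fun setT (x n' t k) by exact: (adapted_measurable hW t0 (@xad n' k _ t0)).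
have mE i j : measurable_fun setT (fun w => (om i * om j * (x n t i w * x m t j w))%:E).
  by apply/measurable_EFinP; apply: measurable_funM => //; exact: measurable_funM.
have E0 i j w : (0 <= (om i * om j * (x n t i w * x m t j w))%:E)%E.
  by rewrite lee_fin !mulr_ge0// ?path_ge0//; exact: om0.
apply: le_trans (total_norm_moment tT).
rewrite (_ : (\esum_(i in [set: I]) _ = \int[P]_w
    \esum_(i in [set: I]) \esum_(j in [set: I]) (om i * om j * (x n t i w * x m t j w))%:E)%E); last first.
  rewrite ge0_integral_esum//; last 2 first.
    by move=> i w _; apply: esum_ge0 => j _.
    by move=> i; apply: measurable_fun_esum.
  apply: eq_esum => i _; rewrite ge0_integral_esum//; apply: eq_esum => j _.
  rewrite /moment /Rintegral EFinM fineK; last first.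
    exact: (integrable_fin_num measurableT (moment_integrable n m i j t0)).
  rewrite -ge0_integralZl//.
  - by apply/measurable_EFinP; exact: measurable_funM.
  - by move=> w _; rewrite lee_fin mulr_ge0// path_ge0.
  - by rewrite lee_fin mulr_ge0//; exact: om0.
apply: ge0_le_integral => //.
- by move=> w _; apply: esum_ge0 => i _; apply: esum_ge0.
- by apply: measurable_fun_esum => // [i w _|i]; [exact: esum_ge0|exact: measurable_fun_esum].
- by apply/measurable_EFinP; apply: measurable_funX; exact: (adapted_measurable hW t0 (total_norm_adapted t0)).
move=> w _.
have eN n' : (\esum_(i in [set: I]) (om i * x n' t i w)%:E = (norm (x n' t ^~ w))%:E)%E.
  apply: esum_wsum => //; last exact: (path_summable n' w t0).2.
  by move=> i; apply: mulr_ge0; [exact: om0|exact: path_ge0].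
rewrite (_ : (\esum_(i in [set: I]) _ = \esum_(i in [set: I]) ((om i * x n t i w)%:E * (norm (x m t ^~ w))%:E))%E); last first.
  apply: eq_esum => i _; rewrite -eN -esumZl.
  - by apply: eq_esum => j _; rewrite -EFinM; congr (_%:E); ring.
  - by apply: mulr_ge0; [exact: om0|exact: path_ge0].
  - by move=> j; rewrite lee_fin; apply: mulr_ge0; [exact: om0|exact: path_ge0].
rewrite esumZr ?path_norm_ge0//; last first.
  by move=> i; rewrite lee_fin; apply: mulr_ge0; [exact: om0|exact: path_ge0].
by rewrite eN -EFinM lee_fin expr2 ler_pM ?path_norm_ge0// norm_le_total.
Qed.

Lemma gen_op_moment n m s i j : 0 <= s ->
  gen_op (pair_rate a) (fun y => moment n m s y.1 y.2) (i, j) =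
  avg a (fun k => moment n m s k j) i + avg a (fun k => moment n m s i k) j.
Proof.
move=> s0; rewrite /gen_op.
rewrite (eq_esum (b := fun y => ((pair_rate a (i, j) y)%:E * (moment n m s y.1 y.2)%:E)%E))//.
rewrite (esum_pair_rate ha); last by move=> y; rewrite lee_fin moment_ge0.
have -> : (fun k => moment n m s i k) = (fun k => moment m n s k i) by apply/funext => k; exact: momentC.
rewrite -!avg_momentE// -[RHS]/(fine (_ + _)%:E) EFinD -!avg_moment//=.
by congr (fine (_ + _)); apply: eq_esum => k _; rewrite EFinM//= momentC.
Qed.

Section chain.
Context {dT' : measure_display} {T' : measurableType dT'}.
Variable P' : probability T' R.
Variables X1 X2 : R -> T' -> I.
Hypotheses (hX1 : is_markov_chain P' a X1) (hX2 : is_markov_chain P' a X2).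
Hypothesis hX12 : indep_processes P' X1 X2.
Hypothesis hX0 : {ae P', forall w, X1 0 w = X2 0 w}.

Lemma moment_chain n k t : 0 <= t ->
  let L := occup (pair_chain X1 X2) diagonal t in
  moment 0 1 t k k = \int[P']_w expR (kappa * rho * L w) /\
  moment n n t k k = if rho == 0 then 1 + kappa * \int[P']_w L w
    else 1 - rho^-1 + rho^-1 * \int[P']_w expR (kappa * rho * L w).
Proof.
move=> t0.
pose m (b : bool) s (y : I * I) := if b then moment n n s y.1 y.2 else moment 0 1 s y.1 y.2.
apply: (@moment_feynman_kac R d a om K kappa rho t (energy_bound t) m _ _ P' X1 X2 k ha hom K0 hK kappa0 t0) => //.
- by move=> [] s y s0; exact: moment_ge0.
- move=> b s st; rewrite esum_pair; last first.
    move=> y; rewrite lee_fin mulr_ge0//; first exact/ltW/(pair_weight_gt0 hom).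
    by case: b; apply: moment_ge0; have /andP[] := st.
  by case: b; exact: moment_norm_le.
- move=> [] y; apply/measurable_EFinP.
    exact: measurable_int (moment_time_integrable n n y.1 y.2 t0).
  exact: measurable_int (moment_time_integrable 0 1 y.1 y.2 t0).
move=> b s [i j] /andP[s0 _] g.
have key p q r : 0 <= r -> gen_op (pair_rate a) (fun y => moment p q r y.1 y.2) (i, j) -
    2 * moment p q r i j + pair_cov (p, i) (q, j) * kappa * moment 0 1 r i i =
    (avg a (fun k => moment p q r k j) i - moment p q r i j) +
    (avg a (fun k => moment p q r i k) j - moment p q r i j) +
    pair_cov (p, i) (q, j) * kappa * moment 0 1 r i i.
  by move=> r0; rewrite gen_op_moment//; ring.
have eqg p q : (forall r, 0 <= r -> g r = gen_op (pair_rate a) (fun y => moment p q r y.1 y.2) (i, j) -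
    2 * moment p q r i j + pair_cov (p, i) (q, j) * kappa * moment 0 1 r i i) ->
    leb.-integrable `]0, s] (EFin \o g) /\
    moment p q s i j = 1 + \int[leb]_(r in `]0, s]) g r.
  move=> hg; have [h1 h2] := moment_equation p q i j s0; split.
    apply: eq_integrable h1 => // r; rewrite inE/= in_itv/= => /andP[/ltW r0 _].
    by rewrite hg// key.
  rewrite h2; congr (_ + _); apply: eq_Rintegral => r; rewrite inE/= in_itv/= => /andP[/ltW r0 _].
  by rewrite hg// key.
(* Off the diagonal both sides vanish; on it the moment at (i, j) is the one at (i, i). *)
have diagE (u : R) r : u * (diagonal (i, j))%:R * moment 0 1 r i j =
    (if i == j then u else 0) * moment 0 1 r i i.
  by rewrite /diagonal/=; case: eqVneq => [->|_]; rewrite ?mulr1// mulr0 !mul0r.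
case: b @g eqg => g eqg.
  apply: (eqg n n) => r r0; rewrite /g/= diagE /pair_cov /noise_cov/= eqxx; congr (_ + _ * _).
  by case: eqP; rewrite ?mul1r ?mul0r.
apply: (eqg 0 1) => r r0; rewrite /g/= diagE /pair_cov /noise_cov/=; congr (_ + _ * _).
by case: eqP; rewrite ?mul0r// mulrC.
Qed.

End chain.
End NiceSolution.

(** * Reduction to regular paths *)

Section Reduction.
Context {R : realType} {d : nat}.
Local Notation I := (lattice d).
Local Notation J := ('I_2 * I)%type.
Local Notation leb := (@lebesgue_measure R).
Variables (a : I -> I -> R) (om : I -> R) (kappa rho : R).
Hypotheses (ha : is_rates a) (hom : is_weight a om) (kappa0 : 0 < kappa).
Context {dT : measure_display} {T : measurableType dT}.
Variables (P : probability T R) (F : R -> set (set T)).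
Variables (W : 'I_2 -> I -> R -> T -> R) (u v : R -> I -> T -> R).
Hypothesis hsol : is_sbm_solution P F a om kappa rho W u v.
Variable N0 : set T.
Hypotheses (mN0 : measurable N0) (PN0 : P N0 = 0%E).
Hypothesis good : forall w, ~ N0 w ->
  [/\ E_path om (fun t i => u t i w), E_path om (fun t i => v t i w) &
    forall i, u 0 i w = 1 /\ v 0 i w = 1].

(* Modifying the paths on the null set N0 preserves adaptedness only for the
   completed filtration. *)
Definition completed (t : R) : set (set T) :=
  [set A | measurable A /\ exists2 B, F t B & forall w, ~ N0 w -> (A w <-> B w)].

Definition noise (j : J) : R -> T -> R := W j.1 j.2.

(** The constant path 1 replaces the solution on the null event: it has the right start value and
    stays in the state space because the weight is summable. *)
Definition regularized (n : 'I_2) (t : R) (i : I) (w : T) : R :=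
  if w \in N0 then 1 else if n == 0 then u t i w else v t i w.

Let sF t : 0 <= t -> sigma_algebra setT (F t).
Proof. by have [h _ _] := sbm_filtration hsol; exact: h. Qed.
Let Fm t : 0 <= t -> F t `<=` measurable.
Proof. by have [_ h _] := sbm_filtration hsol; exact: h. Qed.
Let FM s t : 0 <= s -> s <= t -> F s `<=` F t.
Proof. by have [_ _ h] := sbm_filtration hsol; exact: h. Qed.

Lemma sub_completed t : 0 <= t -> F t `<=` completed t.
Proof. by move=> t0 A FA; split; [exact: Fm FA|exists A]. Qed.

Lemma completed_sigma t : 0 <= t -> sigma_algebra setT (completed t).
Proof.
move=> t0; have [F0 FC FU] := sF t0; split.
- by split=> //; exists set0.
- move=> A [mA [B FB AB]]; split; first by rewrite setTD; exact: measurableC.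
  exists (setT `\` B); first exact: FC.
  by move=> w /AB; rewrite /setD/=; tauto.
- move=> A cA; split; first by apply: bigcup_measurable => k _; exact: (cA k).1.
  have /choice[B hB] : forall k, exists B, F t B /\ forall w, ~ N0 w -> (A k w <-> B w).
    by move=> k; have [_ [B FB AB]] := cA k; exists B.
  exists (\bigcup_k B k); first by apply: FU => k; exact: (hB k).1.
  by move=> w Nw; split=> -[k _] h; exists k => //; have := (hB k).2 w Nw; tauto.
Qed.

Lemma completed_measurable t : completed t `<=` measurable.
Proof. by move=> A []. Qed.

Lemma completed_mono s t : 0 <= s -> s <= t -> completed s `<=` completed t.
Proof. by move=> s0 st A [mA [B FB AB]]; split=> //; exists B => //; exact: FM FB. Qed.

Lemma completed_integral t A (f : T -> R) : 0 <= t -> completed t A ->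
  P.-integrable setT (EFin \o f) ->
  exists2 B, F t B & (\int[P]_(w in A) (f w)%:E = \int[P]_(w in B) (f w)%:E)%E.
Proof.
move=> t0 [mA [B FB AB]] fi; exists B => //.
have mB := Fm t0 FB.
have iA : P.-integrable A (EFin \o f) by apply: integrableS fi.
have iB : P.-integrable B (EFin \o f) by apply: integrableS fi.
rewrite (negligible_integral mN0 mA iA PN0) (negligible_integral mN0 mB iB PN0).
congr (integral _ _ _); apply/seteqP; split=> w [h Nw]; split=> //; have := AB w Nw; tauto.
Qed.

Let W_adapted j t : 0 <= t -> measurable_wrt (F t) (noise j t).
Proof. by move=> t0; exact: (brownian_adapted (sbm_brownian hsol j.1 j.2)). Qed.

Let W_measurable j t : 0 <= t -> measurable_fun setT (noise j t).
Proof. by move=> t0; apply: measurable_wrt_fun (W_adapted j t0); exact: Fm. Qed.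

Let W_sqint j t : 0 <= t -> sqint P setT (noise j t).
Proof.
move=> t0; split; first exact: W_measurable.
have i1 := martingale_integrable (sbm_bracket hsol j.1 j.1 j.2 j.2) t0.
have i2 : P.-integrable setT (EFin \o (fun=> noise_cov rho j.1 j.1 j.2 j.2 * t)).
  exact: finite_measure_integrable_cst.
apply: eq_integrable (integrableD measurableT i1 i2) => // w _ /=.
by rewrite -EFinD subrK expr2.
Qed.

Let W_integrable j t : 0 <= t -> P.-integrable setT (EFin \o noise j t).
Proof.
move=> t0; apply: eq_integrable (sqint_mul measurableT (W_sqint j t0) (sqint_cst P 1)) => // w _ /=.
by rewrite mulr1.
Qed.

(** Independence of the past factors the law of the increment on a past event, and the normal law is
    symmetric. *)
Lemma brownian_increment_mean j s t A : 0 <= s -> s <= t -> F s A ->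
  (\int[P]_(w in A) (noise j t w - noise j s w)%:E = 0)%E.
Proof.
move=> s0 st FA; have t0 := le_trans s0 st.
move: st; rewrite le_eqVlt => /predU1P[->|st].
  by under eq_integral do rewrite subrr; rewrite integral0.
have hB := sbm_brownian hsol j.1 j.2.
have iD := rintegrableB measurableT (W_integrable j t0) (W_integrable j s0).
apply: (symmetric_increment_mean iD); first exact: Fm FA.
move=> B mB.
have mNB : measurable ((-%R) @^-1` B : set R).
  by rewrite -[_ @^-1` _]setTI; exact: oppr_measurable.
have sg : Num.sqrt (t - s) != 0 by rewrite gt_eqF// sqrtr_gt0 subr_gt0.
rewrite (brownian_indep hB s0 st FA); last by exists ((-%R) @^-1` B).
rewrite (brownian_indep hB s0 st FA); last by exists B.
have e1 := brownian_normal hB s0 st mNB; have e2 := brownian_normal hB s0 st mB.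
by rewrite [X in (_ * X)%E]e1 [X in _ = (_ * X)%E]e2 normal_prob_symmetric.
Qed.

Lemma bracket_increment j k s t A : 0 <= s -> s <= t -> F s A ->
  (\int[P]_(w in A) (noise j t w * noise k t w - noise j s w * noise k s w -
    pair_cov rho j k * (t - s))%:E = 0)%E.
Proof.
move=> s0 st FA; have t0 := le_trans s0 st.
have mart := sbm_bracket hsol j.1 k.1 j.2 k.2.
have mA := Fm s0 FA.
have it := integrableS measurableT mA (@subsetT _ A) (martingale_integrable mart t0).
have is_ := integrableS measurableT mA (@subsetT _ A) (martingale_integrable mart s0).
have e := martingale_condexp mart s0 st FA.
transitivity (\int[P]_(w in A) ((noise j t w * noise k t w - pair_cov rho j k * t)%:E -
    (noise j s w * noise k s w - pair_cov rho j k * s)%:E))%E.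
  by apply: eq_integral => w _; rewrite -EFinB; congr (_%:E); ring.
rewrite integralB// e subee//; exact: integrable_fin_num.
Qed.

Lemma completed_noise : is_noise P completed noise (pair_cov rho).
Proof.
split.
- exact: completed_sigma.
- by move=> t _; exact: completed_measurable.
- exact: completed_mono.
- by move=> j t t0 B mB; apply: sub_completed => //; exact: W_adapted.
- exact: W_sqint.
- move=> j s t A s0 st cA; have t0 := le_trans s0 st.
  have iD := rintegrableB measurableT (W_integrable j t0) (W_integrable j s0).
  have [B FB ->] := completed_integral s0 cA iD.
  exact: brownian_increment_mean.
- move=> j k s t A s0 st cA; have t0 := le_trans s0 st.
  have ip r : 0 <= r -> P.-integrable setT (EFin \o (fun w => noise j r w * noise k r w)).
    by move=> r0; exact: sqint_mul (W_sqint j r0) (W_sqint k r0).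
  have ic : P.-integrable setT (EFin \o (fun _ : T => pair_cov rho j k * (t - s))).
    exact: finite_measure_integrable_cst.
  have iD := rintegrableB measurableT (rintegrableB measurableT (ip t t0) (ip s s0)) ic.
  have [B FB ->] := completed_integral s0 cA iD.
  exact: bracket_increment.
Qed.

Lemma regularized_adapted n i t : 0 <= t -> measurable_wrt (completed t) (regularized n t i).
Proof.
move=> t0 B mB.
pose y w := if n == 0 then u t i w else v t i w.
have Fy : F t (y @^-1` B).
  by rewrite /y; case: (n == 0); [exact: (sbm_adapted_u hsol)|exact: (sbm_adapted_v hsol)].
split; last first.
  exists (y @^-1` B) => // w Nw; rewrite /preimage/= /regularized memNset//.
rewrite (_ : _ @^-1` _ = (y @^-1` B `\` N0) `|` (N0 `&` [set _ | B 1])); last first.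
  apply/seteqP; split=> w; rewrite /preimage/= /regularized.
    by case: (pselect (N0 w)) => Nw; [rewrite mem_set//; right|rewrite memNset//; left].
  by case=> -[h1 h2]; [rewrite memNset|rewrite mem_set].
apply: measurableU; first by apply: measurableD => //; exact: Fm Fy.
apply: measurableI => //; have [h|h] := pselect (B 1).
  by rewrite (_ : [set _ | _] = setT)//; apply/seteqP; split.
by rewrite (_ : [set _ | _] = set0)//; apply/seteqP; split.
Qed.

Lemma regularized_path n w : E_path om (fun t i => regularized n t i w).
Proof.
case: (pselect (N0 w)) => Nw; last first.
  have [hu hv _] := good Nw; rewrite /regularized memNset//.
  by case: (n == 0).
rewrite /regularized mem_set//; split=> t t0.
  split=> //; under eq_esum do rewrite mul1r.
  exact: (weight_summable hom).
rewrite (_ : (fun s => _) = fun=> 0%E); first exact: cvg_cst.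
by apply/funext => s; rewrite esum1// => j _; rewrite subrr normr0 mul0r.
Qed.

Lemma regularized_start n i w : regularized n 0 i w = 1.
Proof.
rewrite /regularized; case: ifPn => // /negP Nw.
have [_ _ h] := good (fun h => Nw (mem_set h)).
by case: ifP => _; have [] := h i.
Qed.

Lemma step_time_ge0 (S : @step_process dT T R) t k : itv_partition 0 t (step_pts S) ->
  (k <= size (step_pts S))%N -> 0 <= step_time S k.
Proof. by move=> /step_process_partition[e0 _ mono] kn; rewrite -e0; exact: mono. Qed.

(** The same step processes serve: the null event joins every exceptional event, and adaptedness
    passes to the larger filtration. *)
Lemma ito_modification (X H H' : R -> T -> R) t (A A' : T -> R) :
  (forall w, ~ N0 w -> (forall s, 0 <= s <= t -> H s w = H' s w) /\ A w = A' w) ->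
  is_ito_integral P F X H t A -> is_ito_integral P completed X H' t A'.
Proof.
move=> e [S [ad cH cI]]; exists S; split.
- move=> n; have [part hS] := ad n; split=> // k kn; have [mS bS] := hS k kn; split=> //.
  by move=> B mB; apply: sub_completed; [exact: (step_time_ge0 part (ltnW kn))|exact: mS].
- move=> eps delta e0 d0; apply: filterS (cH eps delta e0 d0) => n [B [mB PB hB]].
  exists (B `|` N0); split; first exact: measurableU.
    by rewrite measureU0.
  move=> w h; have Nw : ~ N0 w by move=> ?; apply: h; right.
  have Bw : ~ B w by move=> ?; apply: h; left.
  rewrite (_ : (\int[_]_(s in _) _ = \int[leb]_(s in `[0%R, t]) ((step_val (S n) s w - H s w) ^+ 2)%:E)%E).
    exact: hB.
  apply: eq_integral => s; rewrite inE/= in_itv/= => st.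
  by rewrite (e w Nw).1.
- move=> eps delta e0 d0; apply: filterS (cI eps delta e0 d0) => n [B [mB PB hB]].
  exists (B `|` N0); split; first exact: measurableU.
    by rewrite measureU0.
  move=> w h; have Nw : ~ N0 w by move=> ?; apply: h; right.
  have Bw : ~ B w by move=> ?; apply: h; left.
  by rewrite -(e w Nw).2; exact: hB.
Qed.

Variable K : R.
Hypothesis K0 : 0 <= K.
Hypothesis hK : forall j, (\esum_(i in [set: I]) (om i * a i j)%:E <= (K * om j)%:E)%E.

(** Off the null event the equation is rewritten with start value 1, with [drift] as average minus
    value, and over the half-open time interval. *)
Lemma regularized_ito j t : 0 <= t ->
  is_ito_integral P completed (noise j) (diffusion kappa regularized j) t
    (noise_part a regularized j t).
Proof.
move=> t0; pose y := if j.1 == 0 then u else v.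
have comp : is_ito_integral P F (noise j) (fun s w => Num.sqrt (kappa * u s j.2 w * v s j.2 w)) t
    (fun w => y t j.2 w - y 0 j.2 w - \int[leb]_(s in `[0, t]) drift a (y s ^~ w) j.2).
  rewrite /y /noise; case: eqVneq => [->|j1]; first exact: (sbm_eq_u hsol).
  have -> : j.1 = 1.
    by apply/val_inj => /=; move: j1; case: (j.1) => -[|[|]]//= m; rewrite -val_eqE.
  exact: (sbm_eq_v hsol).
apply: (ito_modification _ comp) => w Nw; have [hu hv h0] := good Nw.
have yE s i : regularized j.1 s i w = y s i w.
  by rewrite /regularized memNset// /y; case: ifP.
split=> [s _|].
  by rewrite /diffusion /regularized memNset.
have y0 : y 0 j.2 w = 1 by rewrite /y; case: ifP => _; have [] := h0 j.2.
have Ey : E_path om (fun s i => y s i w) by rewrite /y; case: ifP.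
rewrite /noise_part y0 yE; congr (_ - _).
pose g s := avg a (y s ^~ w) j.2 - y s j.2 w.
have cg : half_continuous g.
  have h1 := @E_path_avg_continuous R d a om K ha hom K0 hK _ Ey j.2.
  have h2 := @E_path_continuous R d a om hom _ Ey j.2.
  exact: (@half_continuousB _ _ _ h1 h2).
transitivity (\int[leb]_(s in `[0, t]) g s).
  apply: eq_Rintegral => s; rewrite inE/= in_itv/= => /andP[s0 _].
  by rewrite /g (drift_avg ha hom K0 hK)//; exact: (E_path_summable Ey).
transitivity (\int[leb]_(s in `]0, t]) g s).
  rewrite /Rintegral integral_itv_obnd_cbnd//.
  by apply/measurable_EFinP; exact: half_continuous_measurable.
apply: eq_Rintegral => s _.
have eA : regularized j.1 s ^~ w = y s ^~ w by apply/funext => i; exact: yE.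
by rewrite yE eA.
Qed.

Section chain.
Context {dT' : measure_display} {T' : measurableType dT'}.
Variable P' : probability T' R.
Variables X1 X2 : R -> T' -> I.
Hypotheses (hX1 : is_markov_chain P' a X1) (hX2 : is_markov_chain P' a X2).
Hypothesis hX12 : indep_processes P' X1 X2.
Hypothesis hX0 : {ae P', forall w, X1 0 w = X2 0 w}.

(** [moment_chain] is applied to the regularized solution, type 0 being [u] and type 1 being [v];
    expectations do not see the null event. *)
Lemma solution_moments k t : 0 <= t ->
  let L := occup (pair_chain X1 X2) diagonal t in
  let second := if rho == 0 then 1 + kappa * \int[P']_w L w
    else 1 - rho^-1 + rho^-1 * \int[P']_w expR (kappa * rho * L w) in
  [/\ (\int[P]_w (u t k w * v t k w)%:E = (\int[P']_w expR (kappa * rho * L w))%:E)%E,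
    (\int[P]_w (u t k w ^+ 2)%:E = second%:E)%E &
    (\int[P]_w (v t k w ^+ 2)%:E = second%:E)%E].
Proof.
move=> t0 L second.
have key n := moment_chain ha hom K0 hK kappa0 completed_noise regularized_adapted
  regularized_path regularized_start regularized_ito hX1 hX2 hX12 hX0 n k t0.
have mu : measurable_fun setT (u t k).
  by apply: measurable_wrt_fun (sbm_adapted_u hsol k t0); exact: Fm.
have mv : measurable_fun setT (v t k).
  by apply: measurable_wrt_fun (sbm_adapted_v hsol k t0); exact: Fm.
have aeN : {ae P, forall w, ~ N0 w}.
  by exists N0; split=> // w /=; exact: contrapT.
have mr n : measurable_fun setT (regularized n t k).
  have := @regularized_adapted n k t t0.
  by move=> h; apply: measurable_wrt_fun h; exact: completed_measurable.
have E (f : T -> R) n m : measurable_fun setT f ->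
    (forall w, ~ N0 w -> f w = regularized n t k w * regularized m t k w) ->
    (\int[P]_w (f w)%:E = (moment P regularized n m t k k)%:E)%E.
  move=> mf fE; rewrite /moment EFin_Rintegral; last first.
    exact: (moment_integrable ha hom K0 hK kappa0 completed_noise regularized_adapted
      regularized_path regularized_ito n m k k t0).
  apply: ae_eq_integral => //.
  - exact/measurable_EFinP.
  - by apply/measurable_EFinP; exact: measurable_funM.
  - by apply: filterS aeN => w Nw _ /=; rewrite fE.
split.
- rewrite -(key 0).1; apply: E; first exact: measurable_funM.
  by move=> w Nw; rewrite /regularized memNset.
- rewrite /second -(key 0).2; apply: E; first exact: measurable_funX.
  by move=> w Nw; rewrite /regularized memNset// expr2.
- rewrite /second -(key 1).2; apply: E; first exact: measurable_funX.
  by move=> w Nw; rewrite /regularized memNset// expr2.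
Qed.

End chain.
End Reduction.

Lemma expectationE {dT : measure_display} {T : measurableType dT} {R : realType}
    (P : probability T R) (X : T -> R) : ('E_P[X] = \int[P]_w (X w)%:E)%E.
Proof. by rewrite unlock. Qed.

(** The difference of the chains is 0 exactly when the pair is on the diagonal, and the endpoint 0
    carries no Lebesgue measure. *)
Lemma local_time0_occup {R : realType} {d : nat} (a : lattice d -> lattice d -> R)
    {dT : measure_display} {T : measurableType dT} (P : probability T R)
    (X1 X2 : R -> T -> lattice d) t w :
  is_markov_chain P a X1 -> is_markov_chain P a X2 -> 0 <= t ->
  local_time0 (symmetrization X1 X2) t w = occup (pair_chain X1 X2) diagonal t w.
Proof.
move=> hX1 hX2 t0; rewrite /local_time0 /occup.
transitivity (\int[lebesgue_measure]_(s in `[0, t]) (diagonal (pair_chain X1 X2 s w))%:R).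
  by apply: eq_Rintegral => s _; rewrite /symmetrization subr_eq0.
rewrite /Rintegral integral_itv_obnd_cbnd//; apply/measurable_EFinP.
have i := @occup_integrable _ _ _ _ _ _ (@pair_past_sigma R d dT T X1 X2)
  (fun r r0 => @pair_past_measurable R d a dT T P X1 X2 hX1 hX2 r r0)
  (fun r x r0 => @pair_past_event R d dT T X1 X2 r x r0)
  (fun w r r0 => @pair_chain_rc R d a dT T P X1 X2 hX1 hX2 w r r0) diagonal 0 t w (lexx 0) t0.
by apply/measurable_EFinP; exact: measurable_int i.
Qed.

Theorem lemma3p2 (R : realType) (d : nat) (hd : (1 <= d)%N)
  (a : lattice d -> lattice d -> R) (ha : is_rates a)
  (om : lattice d -> R) (hom : is_weight a om)
  (kappa rho : R) (hkappa : 0 < kappa) (hrho : -1 <= rho <= 1)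
  (* the solution, with its filtered probability space and its noise *)
  (dT : measure_display) (T : measurableType dT) (P : probability T R)
  (F : R -> set (set T)) (W : 'I_2 -> lattice d -> R -> T -> R)
  (u v : R -> lattice d -> T -> R)
  (hsol : is_sbm_solution P F a om kappa rho W u v)
  (hinit : {ae P, forall w, forall i, u 0 i w = 1 /\ v 0 i w = 1})
  (* the Markov chains, on a possibly different probability space *)
  (dT' : measure_display) (T' : measurableType dT') (P' : probability T' R)
  (X1 X2 : R -> T' -> lattice d)
  (hX1 : is_markov_chain P' a X1) (hX2 : is_markov_chain P' a X2)
  (hX12 : indep_processes P' X1 X2)
  (hX0 : {ae P', forall w, symmetrization X1 X2 0 w = 0})
  (k : lattice d) (t : R) (ht : 0 <= t) :
  let L := local_time0 (symmetrization X1 X2) in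
  let second_moment : \bar R :=
    (if rho == 0%R then 1 + kappa%:E * 'E_P'[L t]
     else (1 - rho^-1)%:E
          + (rho^-1)%:E * 'E_P'[fun w => expR (kappa * rho * L t w)])%E in
  ('E_P[fun w => (u t k w * v t k w)%R]
     = 'E_P'[fun w => expR (kappa * rho * L t w)])%E /\
  ('E_P[fun w => (u t k w ^+ 2)%R])%E = second_moment /\
  ('E_P[fun w => (v t k w ^+ 2)%R])%E = second_moment.
Proof.
move=> L second_moment.
have [K hK] := weight_rates hom.
(* The weight condition provides some [K] of unspecified sign; the nonnegative column sum at site 0
   settles it. *)
have K0 : 0 <= K.
  have w0 := weight_gt0 hom (0 : lattice d).
  rewrite -(pmulr_lge0 _ w0) -lee_fin; apply: le_trans (hK 0); apply: esum_ge0 => i _.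
  by rewrite lee_fin mulr_ge0 ?(rates_ge0 ha)// ltW// (weight_gt0 hom).
have [N1 [mN1 PN1 sub1]] := sbm_paths hsol; have [N2 [mN2 PN2 sub2]] := hinit.
(* Off this single null event the paths of both types are continuous in the weighted space and start
   at 1 at every site. *)
pose N0 := N1 `|` N2.
have mN0 : measurable N0 by exact: measurableU.
have PN0 : P N0 = 0%E by rewrite measureU0.
have good w : ~ N0 w -> [/\ E_path om (fun t i => u t i w), E_path om (fun t i => v t i w) &
    forall i, u 0 i w = 1 /\ v 0 i w = 1].
  move=> Nw.
  have [h1 h2] : E_path om (fun t i => u t i w) /\ E_path om (fun t i => v t i w).
    by apply: contrapT => h; apply: Nw; left; apply: sub1.
  by split=> //; apply: contrapT => h; apply: Nw; right; apply: sub2.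
have hX0' : {ae P', forall w, X1 0 w = X2 0 w}.
  by apply: filterS hX0 => w; rewrite /symmetrization => /eqP; rewrite subr_eq0 => /eqP.
have [e1 e2 e3] := solution_moments ha hom hkappa hsol mN0 PN0 good K0 hK hX1 hX2 hX12 hX0' k ht.
have LE w : L t w = occup (pair_chain X1 X2) diagonal t w.
  exact: (local_time0_occup w hX1 hX2 ht).
have mo := measurable_pair_occup hX1 hX2 ht.
have bo w : 0 <= occup (pair_chain X1 X2) diagonal t w <= t.
  exact: (@occup_bound _ _ _ _ _ _ (@pair_past_sigma R d dT' T' X1 X2)
    (fun r r0 => @pair_past_measurable R d a dT' T' P' X1 X2 hX1 hX2 r r0)
    (fun r x r0 => @pair_past_event R d dT' T' X1 X2 r x r0)
    (fun w r r0 => @pair_chain_rc R d a dT' T' P' X1 X2 hX1 hX2 w r r0) diagonal t w ht).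
have io : P'.-integrable setT (EFin \o occup (pair_chain X1 X2) diagonal t).
  apply: (@bounded_integrable _ _ _ P' _ t) => // w.
  by have /andP[h1 h2] := bo w; rewrite ger0_norm.
have ie : P'.-integrable setT (EFin \o (fun w => expR (kappa * rho * occup (pair_chain X1 X2) diagonal t w))).
  apply: (@bounded_integrable _ _ _ P' _ (expR (`|kappa * rho| * t))).
    by apply: measurableT_comp => //; exact: measurable_funM.
  move=> w; have /andP[h1 h2] := bo w; rewrite ger0_norm ?expR_ge0// ler_expR.
  by apply: le_trans (ler_norm _) _; rewrite normrM (ger0_norm h1) ler_wpM2l.
have Eexp : ('E_P'[fun w => expR (kappa * rho * L t w)] =
    (\int[P']_w expR (kappa * rho * occup (pair_chain X1 X2) diagonal t w))%:E)%E.
  rewrite expectationE (EFin_Rintegral ie).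
  by apply: eq_integral => w _; rewrite LE.
have EL : ('E_P'[L t] = (\int[P']_w occup (pair_chain X1 X2) diagonal t w)%:E)%E.
  rewrite expectationE (EFin_Rintegral io).
  by apply: eq_integral => w _; rewrite LE.
have sE : second_moment = (if rho == 0 then 1 + kappa * \int[P']_w occup (pair_chain X1 X2) diagonal t w
    else 1 - rho^-1 + rho^-1 * \int[P']_w expR (kappa * rho * occup (pair_chain X1 X2) diagonal t w))%:E.
  by rewrite /second_moment Eexp EL; case: ifP => _; rewrite !EFinD EFinM.
by rewrite sE Eexp !expectationE e1 e2 e3.
Qed.
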